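(* Let $n\in\mathbb{N}$ and let $(x_i)_{1\le i\le n}\in(0,1)^n$ be a solution of the algebraic system $E^n_{8,9,12}$, i.e. \[ \frac{8}{x_i}+\frac{9}{x_i-1}+\sum_{j\neq i}\frac{12}{x_j-x_i}=0,\qquad 1\le i\le n . \] Let $w_i\in\mathfrak{H}$ with $J(w_i)=x_i$, and set \[ f_n=\frac{\eta^{20}}{E_4^2\,(J-1)\prod_{i=1}^n (J-x_i)^2}. \] Then $f_n$ is a weight $2$ meromorphic modular form for $\mathrm{SL}_2(\mathbb{Z})$ (with a character) which does not vanish on $\mathfrak{H}$, whose poles in $\mathfrak{H}$ are double poles located at $i$, at $\rho=e^{2\pi i/3}$ and at each $w_i$ (and their $\mathrm{SL}_2(\mathbb{Z})$-translates), all with zero residue. Moreover, if $h_n$ is a primitive of $f_n$ on $\mathfrak{H}$ (i.e. $h_n'=f_n$), then \[ \{h_n,\tau\}=2\pi^2\,\frac{(12n+11)^2}{6^2}\,E_4(\tau). \]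
   Context: $\mathfrak{H}$ is the upper half-plane, $q=e^{2\pi i\tau}$, $\eta(\tau)=q^{1/24}\prod_{n\ge1}(1-q^n)$, $E_4=1+240\sum_{n\ge1}\sigma_3(n)q^n$, $E_6=1-504\sum_{n\ge1}\sigma_5(n)q^n$ with $\sigma_k(n)=\sum_{d\mid n}d^k$, $\Delta=\eta^{24}$, and $J=E_4^3/(1728\Delta)$. For a meromorphic function $h$ on $\mathfrak{H}$, the Schwarz derivative is $\{h,\tau\}=\left(\frac{h''}{h'}\right)'-\frac12\left(\frac{h''}{h'}\right)^2$. *)

(* Defs.v *)
From Stdlib Require Import Reals ZArith Arith List Lra Lia.
From Coquelicot Require Import Coquelicot.

Open Scope R_scope.
Open Scope C_scope.

(** ** Complex analysis *)

Definition Cexp (z : C) : C :=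
  RtoC (exp (Re z)) * (cos (Im z), sin (Im z)).

(* Total operators in the style of [Lim_seq] and [Series], taken on real and
   imaginary parts; they give the limit and the sum whenever these exist. *)
Definition CLim_seq (u : nat -> C) : C :=
  (real (Lim_seq (fun n => Re (u n))), real (Lim_seq (fun n => Im (u n)))).

Definition CSeries (a : nat -> C) : C :=
  (Series (fun n => Re (a n)), Series (fun n => Im (a n))).

Definition Csum (l : list nat) (F : nat -> C) : C :=
  fold_right Cplus (RtoC 0) (map F l).

Definition Cprod (l : list nat) (F : nat -> C) : C :=
  fold_right Cmult (RtoC 1) (map F l).

Definition Rsum (l : list nat) (F : nat -> R) : R :=
  fold_right Rplus 0%R (map F l).

(* The module is [C_AbsRing] over itself, as in [is_derive_mult] and
   [is_derive_comp], rather than [C_NormedModule]. *)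
Definition is_Cderive (f : C -> C) (z l : C) : Prop :=
  @is_derive C_AbsRing (AbsRing_NormedModule C_AbsRing) f z l.

Definition near (z : C) (P : C -> Prop) : Prop :=
  exists r : R, (0 < r)%R /\ forall u : C, (Cmod (u - z) < r)%R -> P u.

Definition near_punctured (z : C) (P : C -> Prop) : Prop :=
  near z (fun u => u <> z -> P u).

Definition holomorphic_at (f : C -> C) (z : C) : Prop :=
  near z (fun u => exists l : C, is_Cderive f u l).

(* Meromorphic functions are represented by total functions whose values at
   the poles are irrelevant (for a quotient, [/ 0 = 0] there). *)
Definition meromorphic_at (f : C -> C) (z : C) : Prop :=
  exists (m : nat) (g : C -> C), holomorphic_at g z /\
    near_punctured z (fun u => f u = g u / (u - z) ^ m).

Definition pole_of_order (m : nat) (f : C -> C) (z : C) : Prop :=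
  (1 <= m)%nat /\
  exists g : C -> C, holomorphic_at g z /\ g z <> 0 /\
    near_punctured z (fun u => f u = g u / (u - z) ^ m).

(* Coefficient of [1 / (u - z)] in the Laurent expansion at [z], for [f]
   meromorphic at [z]; [c k] is the coefficient of [1 / (u - z) ^ k]. *)
Definition is_residue (f : C -> C) (z r : C) : Prop :=
  exists (m : nat) (c : nat -> C) (g : C -> C),
    holomorphic_at g z /\
    near_punctured z (fun u =>
      f u = Csum (seq 1 (S m)) (fun k => c k / (u - z) ^ k) + g u) /\
    c 1%nat = r.

(* [h1], [h2], [h3] are the first three derivatives involved: the relation
   includes their existence and [h' <> 0]. *)
Definition is_schwarzian (h : C -> C) (z s : C) : Prop :=
  exists (h1 h2 : C -> C) (h3 : C),
    near z (fun u => is_Cderive h u (h1 u)) /\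
    near z (fun u => is_Cderive h1 u (h2 u)) /\
    h1 z <> 0 /\
    is_Cderive (fun u => h2 u / h1 u) z h3 /\
    s = h3 - / RtoC 2 * (h2 z / h1 z) ^ 2.

(** ** Upper half-plane and modular group *)

Definition upper (t : C) : Prop := (0 < Im t)%R.

Record SL2Z : Type := mkSL2Z {
  ma : Z; mb : Z; mc : Z; md : Z;
  mdet : (ma * md - mb * mc = 1)%Z
}.

Lemma SL2Z_mul_det (g h : SL2Z) :
  ((ma g * ma h + mb g * mc h) * (mc g * mb h + md g * md h)
   - (ma g * mb h + mb g * md h) * (mc g * ma h + md g * mc h) = 1)%Z.
Proof.
transitivity ((ma g * md g - mb g * mc g) * (ma h * md h - mb h * mc h))%Z.
- ring.
- now rewrite !mdet.
Qed.

Definition SL2Z_mul (g h : SL2Z) : SL2Z :=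
  mkSL2Z _ _ _ _ (SL2Z_mul_det g h).

Definition autf (g : SL2Z) (t : C) : C :=
  RtoC (IZR (mc g)) * t + RtoC (IZR (md g)).

Definition act (g : SL2Z) (t : C) : C :=
  (RtoC (IZR (ma g)) * t + RtoC (IZR (mb g))) / autf g t.

Definition in_orbit (z t : C) : Prop := exists g : SL2Z, t = act g z.

Definition is_character (chi : SL2Z -> C) : Prop :=
  (forall g, chi g <> 0) /\
  (forall g h, chi (SL2Z_mul g h) = chi g * chi h).

Definition meromorphic_on_H (f : C -> C) : Prop :=
  forall t, upper t -> meromorphic_at f t.

(* A nontrivial character (of finite order on SL_2(Z)) makes [f] periodic only
   under some translation by [N], hence the local parameter
   exp (2 pi i t / N) at the cusp. *)
Definition meromorphic_at_cusp (f : C -> C) : Prop :=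
  exists (N m : nat) (g : C -> C) (r : R),
    (1 <= N)%nat /\ (0 < r)%R /\
    (forall u, (Cmod u < r)%R -> exists l, is_Cderive g u l) /\
    (forall t, upper t ->
       let u := Cexp (RtoC (2 * PI / INR N) * Ci * t) in
       (Cmod u < r)%R -> f t = g u / u ^ m).

Definition meromorphic_modular_form (k : nat) (chi : SL2Z -> C) (f : C -> C)
  : Prop :=
  meromorphic_on_H f /\
  (forall (g : SL2Z) (t : C), upper t -> holomorphic_at f t ->
     f (act g t) = chi g * autf g t ^ k * f t) /\
  meromorphic_at_cusp f.

(* [f] is meromorphic on the half-plane, so is a primitive of [f], and
   [h' = f] is an identity of meromorphic functions. *)
Definition is_primitive_on_H (f h : C -> C) : Prop :=
  meromorphic_on_H h /\
  (forall t, upper t -> holomorphic_at f t -> is_Cderive h t (f t)).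

(** ** Classical modular functions *)

Definition sigma (k n : nat) : nat :=
  list_sum (map (fun d => d ^ k)%nat
                (filter (fun d => Nat.eqb (n mod d) 0) (seq 1 n))).

Definition qpar (t : C) : C := Cexp (RtoC (2 * PI) * Ci * t).

Definition eta (t : C) : C :=
  Cexp (RtoC (2 * PI / 24) * Ci * t) *
  CLim_seq (fun N => Cprod (seq 1 N) (fun n => RtoC 1 - qpar t ^ n)).

Definition E4 (t : C) : C :=
  RtoC 1 + RtoC 240 *
    CSeries (fun n => RtoC (INR (sigma 3 (S n))) * qpar t ^ (S n)).

Definition Delta (t : C) : C := eta t ^ 24.

Definition J (t : C) : C := E4 t ^ 3 / (RtoC 1728 * Delta t).

Definition rho : C := Cexp (RtoC (2 * PI / 3) * Ci).

(** ** The algebraic system and the form f_n *)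

(* Families indexed by 1..n are functions on [nat] used on indices [i < n].
   Distinctness of the [x i] is what makes the fractions meaningful. *)
Definition E_system (a b c : R) (n : nat) (x : nat -> R) : Prop :=
  (forall i j, (i < n)%nat -> (j < n)%nat -> i <> j -> x i <> x j) /\
  (forall i, (i < n)%nat -> x i <> 0%R /\ x i <> 1%R) /\
  (forall i, (i < n)%nat ->
     (a / x i + b / (x i - 1)
      + Rsum (filter (fun j => negb (Nat.eqb j i)) (seq 0 n))
             (fun j => c / (x j - x i)) = 0)%R).

(* With the sign convention [12 / (x j - x i)] the system has no solution in
   (0,1)^n for n >= 2: the largest x would be < 8/17 and the smallest > 8/17.
   The residues of [f_form] vanish under the opposite convention
   [12 / (x i - x j)], i.e. c = -12 here, which is the (solvable) Stieltjes
   system for zeros of Jacobi polynomials. Both conventions are admitted; they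
   agree for n <= 1. *)
Definition E_8_9_12 (n : nat) (x : nat -> R) : Prop :=
  E_system 8 9 12 n x \/ E_system 8 9 (-12) n x.

Definition f_form (n : nat) (x : nat -> R) (t : C) : C :=
  eta t ^ 20 /
  (E4 t ^ 2 * (J t - RtoC 1)
   * Cprod (seq 0 n) (fun i => (J t - RtoC (x i)) ^ 2)).

Definition pole_locus (n : nat) (w : nat -> C) (t : C) : Prop :=
  in_orbit Ci t \/ in_orbit rho t \/
  exists i, (i < n)%nat /\ in_orbit (w i) t.

(* Main.v *)
(* Write f_n = N / D^2 with N = 1728 eta^44 and D = E4 E6 prod (J - x_i), so that the
   poles are the zeros of D; they are simple zeros because J' vanishes only where E4 E6
   does, and J separates the orbits above real values. Ramanujan's differential
   equations turn the logarithmic derivative Phi = N'/N - 2 D'/D of f_n into a rational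
   function of J times E6/E4 plus a multiple of E2, and the algebraic system for the x_i
   is exactly what makes Phi' - Phi^2/2 = 2 pi^2 (12n+11)^2/36 E4. Clearing denominators,
   2 (D'' - (N'/N) D') is a multiple of D, so N D'' = N' D' at the zeros of D: this is
   the vanishing of the residues.

   The inversion formulas for E2 and E4 come from the partial fractions of 1/sin^2,
   obtained by repeated bisection, and that for eta from eta'/eta = 2 pi i E2/24. A form
   of negative weight that is holomorphic and bounded at the cusp vanishes, since a
   maximum of |g|^2 / y^k would contradict strict subharmonicity; this gives Ramanujan's
   equations and the discriminant. For J, two inequivalent points above a real x can be
   moved along the line x + i s until J is injective because it is close to its pole at
   the cusp. *)
From Stdlib Require Import Reals ZArith Arith List Permutation Lra Lia Psatz Classical ClassicalEpsilon.
From Coquelicot Require Import Coquelicot.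
Require Import Defs.

Local Open Scope R_scope.
Local Open Scope C_scope.

Lemma Cmod_RtoC_pos (r : R) : (0 <= r)%R -> Cmod (RtoC r) = r.
Proof. intros H; rewrite Cmod_R; apply Rabs_pos_eq; exact H. Qed.

Lemma Cmod_minus_sym (a b : C) : Cmod (a - b) = Cmod (b - a).
Proof. rewrite <- Cmod_opp; f_equal; ring. Qed.

Lemma Cmod_sub_triangle (a b : C) : (Cmod (a - b) <= Cmod a + Cmod b)%R.
Proof. unfold Cminus; rewrite <- (Cmod_opp b); apply Cmod_triangle. Qed.

Lemma Cmod_triangle_rev (a b : C) : (Cmod a - Cmod b <= Cmod (a - b))%R.
Proof.
pose proof (Cmod_triangle (a - b) b) as H.
replace (a - b + b) with a in H by ring; lra.
Qed.

Lemma Cmod_dist_triangle (a b c : C) : (Cmod (a - c) <= Cmod (a - b) + Cmod (b - c))%R.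
Proof. replace (a - c) with ((a - b) + (b - c)) by ring; apply Cmod_triangle. Qed.

Lemma im_le_Cmod (c : C) : (Rabs (Im c) <= Cmod c)%R.
Proof. eapply Rle_trans; [apply Rmax_r | apply Rmax_Cmod]. Qed.

Lemma Cmod_le_Re_Im (c : C) : (Cmod c <= Rabs (Re c) + Rabs (Im c))%R.
Proof.
replace c with (RtoC (Re c) + Ci * RtoC (Im c)) at 1.
- eapply Rle_trans; [apply Cmod_triangle|].
  rewrite Cmod_mult, Cmod_Ci, !Cmod_R; lra.
- destruct c as [a b]; unfold RtoC, Ci, Cplus, Cmult; simpl; f_equal; ring.
Qed.

Lemma Ceq (a b : C) : Re a = Re b -> Im a = Im b -> a = b.
Proof. destruct a, b; simpl; intros; subst; reflexivity. Qed.

Lemma Re_minus (a b : C) : Re (a - b) = (Re a - Re b)%R.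
Proof. destruct a, b; reflexivity. Qed.

Lemma Im_minus (a b : C) : Im (a - b) = (Im a - Im b)%R.
Proof. destruct a, b; reflexivity. Qed.

Lemma Cminus_neq_0 (a b : C) : a <> b -> a - b <> 0.
Proof. intros H E; apply H; replace a with (a - b + b) by ring; rewrite E; ring. Qed.

Lemma Cinv_0 : / RtoC 0 = 0.
Proof. unfold Cinv, RtoC; simpl; f_equal; unfold Rdiv; ring. Qed.

Lemma Cmult_neq_0_l (a b : C) : a * b <> 0 -> a <> 0.
Proof. intros H E; apply H; rewrite E; ring. Qed.

Lemma Cmult_neq_0_r (a b : C) : a * b <> 0 -> b <> 0.
Proof. intros H E; apply H; rewrite E; ring. Qed.

Lemma Cmult_integral (a b : C) : a * b = 0 -> a = 0 \/ b = 0.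
Proof.
intros H; destruct (classic (a = 0)) as [E | E]; [now left | right].
replace b with (/ a * (a * b)) by (field; exact E); rewrite H; ring.
Qed.

Lemma Cpow_neq_0_inv (a : C) (n : nat) : a ^ S n <> 0 -> a <> 0.
Proof. intros H E; apply H; rewrite E, Cpow_S; ring. Qed.

Definition Ccont (f : C -> C) (z : C) : Prop :=
  forall eps : R, (0 < eps)%R -> exists d : R, (0 < d)%R /\
    forall u, (Cmod (u - z) < d)%R -> (Cmod (f u - f z) < eps)%R.

Lemma is_Cderive_eps (f : C -> C) (z l : C) :
  is_Cderive f z l <->
  forall eps : R, (0 < eps)%R -> exists d : R, (0 < d)%R /\
    forall u, (Cmod (u - z) < d)%R ->
      (Cmod (f u - f z - (u - z) * l) <= eps * Cmod (u - z))%R.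
Proof.
split.
- intros [_ H] eps He.
  destruct (H z (fun P HP => HP) (mkposreal eps He)) as [d Hd].
  exists d; split; [apply cond_pos|].
  intros u Hu; exact (Hd u Hu).
- intros H; split; [apply is_linear_scal_l|].
  intros x Hx eps.
  assert (E : x = z) by (symmetry; exact (@is_filter_lim_locally_unique C_AbsRing (AbsRing_NormedModule C_AbsRing) z x Hx)).
  subst x.
  destruct (H eps (cond_pos eps)) as [d [Hd Hu]].
  exists (mkposreal d Hd); intros u Hdu; exact (Hu u Hdu).
Qed.

Lemma near_and (z : C) (P Q : C -> Prop) :
  near z P -> near z Q -> near z (fun u => P u /\ Q u).
Proof.
intros [r [Hr HP]] [s [Hs HQ]].
exists (Rmin r s); split; [now apply Rmin_glb_lt|].
intros u Hu; split.
- apply HP; eapply Rlt_le_trans; [exact Hu | apply Rmin_l].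
- apply HQ; eapply Rlt_le_trans; [exact Hu | apply Rmin_r].
Qed.

Lemma near_imp (z : C) (P Q : C -> Prop) :
  (forall u, P u -> Q u) -> near z P -> near z Q.
Proof. intros H [r [Hr HP]]; exists r; split; auto. Qed.

Lemma near_self (z : C) (P : C -> Prop) : near z P -> P z.
Proof.
intros [r [Hr HP]]; apply HP.
replace (z - z) with (RtoC 0) by ring; rewrite Cmod_0; exact Hr.
Qed.

Lemma is_Cderive_ext_near (f g : C -> C) (z l : C) :
  near z (fun u => f u = g u) -> is_Cderive f z l -> is_Cderive g z l.
Proof.
intros Hn H; pose proof (near_self _ _ Hn) as E; simpl in E.
destruct Hn as [r [Hr Hn]].
rewrite is_Cderive_eps in *; intros eps He.
destruct (H eps He) as [d [Hd Hf]].
exists (Rmin r d); split; [now apply Rmin_glb_lt|].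
intros u Hu; rewrite <- E, <- Hn.
- apply Hf; eapply Rlt_le_trans; [exact Hu | apply Rmin_r].
- eapply Rlt_le_trans; [exact Hu | apply Rmin_l].
Qed.

Lemma is_Cderive_ext (f g : C -> C) (z l : C) :
  (forall u, f u = g u) -> is_Cderive f z l -> is_Cderive g z l.
Proof. intros H; apply is_Cderive_ext_near; exists 1%R; split; [lra | auto]. Qed.

Lemma is_Cderive_const (c z : C) : is_Cderive (fun _ => c) z 0.
Proof. exact (@is_derive_const C_AbsRing (AbsRing_NormedModule C_AbsRing) c z). Qed.

Lemma is_Cderive_id (z : C) : is_Cderive (fun u => u) z 1.
Proof. exact (is_derive_id z). Qed.

Lemma is_Cderive_plus (f g : C -> C) (z a b : C) :
  is_Cderive f z a -> is_Cderive g z b -> is_Cderive (fun u => f u + g u) z (a + b).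
Proof. intros Hf Hg; exact (@is_derive_plus C_AbsRing (AbsRing_NormedModule C_AbsRing) f g z a b Hf Hg). Qed.

Lemma is_Cderive_minus (f g : C -> C) (z a b : C) :
  is_Cderive f z a -> is_Cderive g z b -> is_Cderive (fun u => f u - g u) z (a - b).
Proof. intros Hf Hg; exact (@is_derive_minus C_AbsRing (AbsRing_NormedModule C_AbsRing) f g z a b Hf Hg). Qed.

Lemma is_Cderive_mult (f g : C -> C) (z a b : C) :
  is_Cderive f z a -> is_Cderive g z b ->
  is_Cderive (fun u => f u * g u) z (a * g z + f z * b).
Proof. intros Hf Hg; exact (is_derive_mult f g z a b Hf Hg Cmult_comm). Qed.

Lemma is_Cderive_scal (k : C) (f : C -> C) (z a : C) :
  is_Cderive f z a -> is_Cderive (fun u => k * f u) z (k * a).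
Proof.
intros Hf; replace (k * a) with (0 * f z + k * a) by ring.
exact (is_Cderive_mult _ _ z _ _ (is_Cderive_const k z) Hf).
Qed.

Lemma is_Cderive_comp (f g : C -> C) (z a b : C) :
  is_Cderive f (g z) a -> is_Cderive g z b -> is_Cderive (fun u => f (g u)) z (b * a).
Proof. intros Hf Hg; exact (@is_derive_comp C_AbsRing (AbsRing_NormedModule C_AbsRing) f g z a b Hf Hg). Qed.

Lemma is_Cderive_cont (f : C -> C) (z l : C) : is_Cderive f z l -> Ccont f z.
Proof.
intros H eps He; rewrite is_Cderive_eps in H.
destruct (H 1%R Rlt_0_1) as [d [Hd Hf]].
pose proof (Cmod_ge_0 l) as Hl.
assert (Hk : (0 < eps / (Cmod l + 2))%R) by (apply Rdiv_lt_0_compat; lra).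
exists (Rmin d (eps / (Cmod l + 2))); split; [now apply Rmin_glb_lt|].
intros u Hu.
assert (Hu1 : (Cmod (u - z) < d)%R) by (eapply Rlt_le_trans; [exact Hu | apply Rmin_l]).
assert (Hu2 : (Cmod (u - z) < eps / (Cmod l + 2))%R)
  by (eapply Rlt_le_trans; [exact Hu | apply Rmin_r]).
specialize (Hf u Hu1).
replace (f u - f z) with ((f u - f z - (u - z) * l) + (u - z) * l) by ring.
eapply Rle_lt_trans; [apply Cmod_triangle|].
rewrite Cmod_mult.
assert (Hq : (Cmod (u - z) * (Cmod l + 2) < eps)%R).
{ apply (Rmult_lt_compat_r (Cmod l + 2)) in Hu2; [|lra].
  replace (eps / (Cmod l + 2) * (Cmod l + 2))%R with eps in Hu2 by (field; lra); exact Hu2. }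
pose proof (Cmod_ge_0 (u - z)); nra.
Qed.

Lemma Ccont_neq (f : C -> C) (z : C) (c : C) :
  Ccont f z -> f z <> c -> near z (fun u => f u <> c).
Proof.
intros H Hz.
assert (Hp : (0 < Cmod (f z - c))%R) by (apply Cmod_gt_0, Cminus_neq_0, Hz).
destruct (H _ Hp) as [d [Hd Hf]].
exists d; split; [exact Hd|]; intros u Hu E.
specialize (Hf u Hu); rewrite E, Cmod_minus_sym in Hf; lra.
Qed.

Lemma Ccont_ge_half (f : C -> C) (z : C) :
  Ccont f z -> f z <> 0 -> near z (fun u => (Cmod (f z) / 2 <= Cmod (f u))%R).
Proof.
intros H Hz.
assert (Hp : (0 < Cmod (f z) / 2)%R) by (apply Cmod_gt_0 in Hz; lra).
destruct (H _ Hp) as [d [Hd Hf]].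
exists d; split; [exact Hd|]; intros u Hu.
specialize (Hf u Hu); pose proof (Cmod_triangle_rev (f z) (f u)).
rewrite Cmod_minus_sym in Hf; lra.
Qed.

Lemma Ccont_id (z : C) : Ccont (fun u => u) z.
Proof. exact (is_Cderive_cont _ _ _ (is_Cderive_id z)). Qed.

Lemma is_Cderive_Cinv (z : C) : z <> 0 -> is_Cderive Cinv z (- / z ^ 2).
Proof.
intros Hz; apply is_Cderive_eps; intros eps He.
assert (Hp : (0 < Cmod z)%R) by now apply Cmod_gt_0.
destruct (Ccont_ge_half (fun u => u) z (Ccont_id z) Hz) as [r [Hr Hh]].
set (k := (Cmod z ^ 3 / 2)%R).
assert (Hk : (0 < k)%R) by (unfold k; apply Rdiv_lt_0_compat; [apply pow_lt; exact Hp | lra]).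
exists (Rmin r (eps * k)); split.
{ apply Rmin_glb_lt; [exact Hr | apply Rmult_lt_0_compat; lra]. }
intros u Hu.
assert (Hu1 : (Cmod (u - z) < r)%R) by (eapply Rlt_le_trans; [exact Hu | apply Rmin_l]).
assert (Hu2 : (Cmod (u - z) < eps * k)%R) by (eapply Rlt_le_trans; [exact Hu | apply Rmin_r]).
specialize (Hh u Hu1); simpl in Hh.
assert (Hu0 : u <> 0) by (apply Cmod_gt_0; lra).
replace (/ u - / z - (u - z) * - / z ^ 2) with ((u - z) * ((u - z) / (u * z ^ 2))).
2:{ field; auto. }
rewrite Cmod_mult, Rmult_comm; apply Rmult_le_compat_r; [apply Cmod_ge_0|].
rewrite Cmod_div by (apply Cmult_neq_0; [exact Hu0 | now apply Cpow_nz]).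
assert (Hb : (k <= Cmod (u * z ^ 2))%R).
{ rewrite Cmod_mult, Cmod_pow; unfold k; nra. }
apply (Rmult_le_reg_r (Cmod (u * z ^ 2))); [lra|].
unfold Rdiv; rewrite Rmult_assoc, Rinv_l, Rmult_1_r by lra; nra.
Qed.

Lemma is_Cderive_inv (f : C -> C) (z a : C) :
  f z <> 0 -> is_Cderive f z a -> is_Cderive (fun u => / f u) z (- a / f z ^ 2).
Proof.
intros Hz Hf; replace (- a / f z ^ 2) with (a * - / f z ^ 2) by (field; exact Hz).
exact (is_Cderive_comp Cinv f z _ _ (is_Cderive_Cinv _ Hz) Hf).
Qed.

Lemma is_Cderive_div (f g : C -> C) (z a b : C) :
  g z <> 0 -> is_Cderive f z a -> is_Cderive g z b ->
  is_Cderive (fun u => f u / g u) z ((a * g z - f z * b) / g z ^ 2).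
Proof.
intros Hz Hf Hg.
replace ((a * g z - f z * b) / g z ^ 2) with (a * / g z + f z * (- b / g z ^ 2))
  by (field; exact Hz).
exact (is_Cderive_mult f (fun u => / g u) z _ _ Hf (is_Cderive_inv g z b Hz Hg)).
Qed.

Lemma is_Cderive_pow (f : C -> C) (z a : C) (n : nat) :
  is_Cderive f z a ->
  is_Cderive (fun u => f u ^ n) z (RtoC (INR n) * f z ^ pred n * a).
Proof.
intros Hf; induction n as [|n IH].
- simpl; replace (0 * 1 * a) with (RtoC 0) by ring; apply is_Cderive_const.
- apply (is_Cderive_ext (fun u => f u * f u ^ n)); [intros; now rewrite Cpow_S|].
  replace (RtoC (INR (S n)) * f z ^ pred (S n) * a)
    with (a * f z ^ n + f z * (RtoC (INR n) * f z ^ pred n * a)).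
  + now apply is_Cderive_mult.
  + rewrite S_INR, RtoC_plus; destruct n; simpl; ring.
Qed.

Lemma is_Cderive_unique (f : C -> C) (z a b : C) :
  is_Cderive f z a -> is_Cderive f z b -> a = b.
Proof.
intros Ha Hb; rewrite is_Cderive_eps in Ha, Hb.
destruct (classic (a = b)) as [E | E]; [exact E | exfalso].
assert (Hp : (0 < Cmod (a - b))%R) by (apply Cmod_gt_0, Cminus_neq_0, E).
destruct (Ha (Cmod (a - b) / 4)%R) as [d [Hd Hf]]; [lra|].
destruct (Hb (Cmod (a - b) / 4)%R) as [e [He Hg]]; [lra|].
set (s := (Rmin d e / 2)%R).
assert (Hm : (0 < Rmin d e)%R) by now apply Rmin_glb_lt.
assert (Hs : Cmod (z + RtoC s - z) = s).
{ replace (z + RtoC s - z) with (RtoC s) by ring; apply Cmod_RtoC_pos; unfold s; lra. }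
pose proof (Rmin_l d e); pose proof (Rmin_r d e).
specialize (Hf (z + RtoC s)); specialize (Hg (z + RtoC s)); rewrite Hs in Hf, Hg.
assert (H1 := Hf ltac:(unfold s; lra)); assert (H2 := Hg ltac:(unfold s; lra)).
pose proof (Cmod_sub_triangle (f (z + RtoC s) - f z - (z + RtoC s - z) * b)
              (f (z + RtoC s) - f z - (z + RtoC s - z) * a)) as H3.
replace (f (z + RtoC s) - f z - (z + RtoC s - z) * b -
    (f (z + RtoC s) - f z - (z + RtoC s - z) * a)) with (RtoC s * (a - b)) in H3 by ring.
rewrite Cmod_mult, Cmod_RtoC_pos in H3 by (unfold s; lra).
assert (0 < s)%R by (unfold s; lra); nra.
Qed.

Lemma Ccont_ext_near (f g : C -> C) (z : C) :
  near z (fun u => f u = g u) -> Ccont f z -> Ccont g z.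
Proof.
intros Hn H eps He; pose proof (near_self _ _ Hn) as E; simpl in E.
destruct Hn as [r [Hr Hn]]; destruct (H eps He) as [d [Hd Hf]].
exists (Rmin r d); split; [now apply Rmin_glb_lt|].
intros u Hu; rewrite <- E, <- Hn.
- apply Hf; eapply Rlt_le_trans; [exact Hu | apply Rmin_r].
- eapply Rlt_le_trans; [exact Hu | apply Rmin_l].
Qed.

Lemma Ccont_plus (f g : C -> C) (z : C) :
  Ccont f z -> Ccont g z -> Ccont (fun u => f u + g u) z.
Proof.
intros Hf Hg eps He.
destruct (Hf (eps / 2)%R) as [d [Hd H1]]; [lra|].
destruct (Hg (eps / 2)%R) as [e [He' H2]]; [lra|].
exists (Rmin d e); split; [now apply Rmin_glb_lt|]; intros u Hu.
replace (f u + g u - (f z + g z)) with ((f u - f z) + (g u - g z)) by ring.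
eapply Rle_lt_trans; [apply Cmod_triangle|].
specialize (H1 u ltac:(eapply Rlt_le_trans; [exact Hu | apply Rmin_l])).
specialize (H2 u ltac:(eapply Rlt_le_trans; [exact Hu | apply Rmin_r])); lra.
Qed.

Lemma Ccont_mult (f g : C -> C) (z : C) :
  Ccont f z -> Ccont g z -> Ccont (fun u => f u * g u) z.
Proof.
intros Hf Hg eps He.
pose proof (Cmod_ge_0 (f z)) as Pf; pose proof (Cmod_ge_0 (g z)) as Pg.
set (k := Rmin 1 (eps / (Cmod (f z) + Cmod (g z) + 2))).
assert (Hq : (0 < eps / (Cmod (f z) + Cmod (g z) + 2))%R)
  by (apply Rdiv_lt_0_compat; lra).
assert (Hk : (0 < k)%R) by (apply Rmin_glb_lt; lra).
assert (Hk1 : (k <= 1)%R) by apply Rmin_l.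
assert (Hk2 : (k * (Cmod (f z) + Cmod (g z) + 2) <= eps)%R).
{ assert (H : (k <= eps / (Cmod (f z) + Cmod (g z) + 2))%R) by apply Rmin_r.
  apply (Rmult_le_compat_r (Cmod (f z) + Cmod (g z) + 2)) in H; [|lra].
  replace (eps / (Cmod (f z) + Cmod (g z) + 2) * (Cmod (f z) + Cmod (g z) + 2))%R
    with eps in H by (field; lra); exact H. }
destruct (Hf k Hk) as [d [Hd H1]]; destruct (Hg k Hk) as [e [He' H2]].
exists (Rmin d e); split; [now apply Rmin_glb_lt|]; intros u Hu.
specialize (H1 u ltac:(eapply Rlt_le_trans; [exact Hu | apply Rmin_l])).
specialize (H2 u ltac:(eapply Rlt_le_trans; [exact Hu | apply Rmin_r])).
replace (f u * g u - f z * g z)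
  with ((f u - f z) * (g u - g z) + f z * (g u - g z) + g z * (f u - f z)) by ring.
eapply Rle_lt_trans; [apply Cmod_triangle|].
eapply Rle_lt_trans; [apply Rplus_le_compat_r, Cmod_triangle|].
rewrite !Cmod_mult.
pose proof (Cmod_ge_0 (f u - f z)); pose proof (Cmod_ge_0 (g u - g z)); nra.
Qed.

Lemma Ccont_inv (f : C -> C) (z : C) :
  f z <> 0 -> Ccont f z -> Ccont (fun u => / f u) z.
Proof.
intros Hz Hf eps He.
destruct (is_Cderive_cont _ _ _ (is_Cderive_Cinv _ Hz) eps He) as [d [Hd H1]].
destruct (Hf d Hd) as [e [He' H2]].
exists e; split; auto.
Qed.

(** * Mean value inequality and Taylor expansions *)

Lemma Re_mult_le (a b : C) : (Re (a * b) <= Cmod a * Cmod b)%R.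
Proof.
rewrite <- Cmod_mult; eapply Rle_trans; [apply Rle_abs | apply re_le_Cmod].
Qed.

Lemma mean_value_ineq (f df : C -> C) (a b : C) (M : R) :
  (forall s : R, (0 <= s <= 1)%R ->
     is_Cderive f (a + RtoC s * (b - a)) (df (a + RtoC s * (b - a))) /\
     (Cmod (df (a + RtoC s * (b - a))%C) <= M)%R) ->
  (Cmod (f b - f a) <= M * Cmod (b - a))%R.
Proof.
intros H.
set (w := f b - f a).
set (p := fun s : R => a + RtoC s * (b - a)).
set (g := fun s : R => Re (Cconj w * f (p s))).
set (dg := fun s : R => Re (Cconj w * (df (p s) * (b - a)))).
assert (Hd : forall s, (0 <= s <= 1)%R -> is_derive g s (dg s)).
{ intros s Hs; apply is_derive_Reals; intros eps He.
  destruct (H s Hs) as [Hf _]; rewrite is_Cderive_eps in Hf.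
  set (k := (Cmod w * Cmod (b - a) + 1)%R).
  assert (Hk : (0 < k)%R)
    by (unfold k; pose proof (Cmod_ge_0 w); pose proof (Cmod_ge_0 (b - a)); nra).
  destruct (Hf (eps / k / 2)%R) as [d [Hd Hu]].
  { apply Rdiv_lt_0_compat; [apply Rdiv_lt_0_compat; lra | lra]. }
  assert (Hd' : (0 < d / (Cmod (b - a) + 1))%R)
    by (apply Rdiv_lt_0_compat; [lra | pose proof (Cmod_ge_0 (b - a)); lra]).
  exists (mkposreal _ Hd'); simpl; intros h Hh Hhd.
  assert (E : p (s + h)%R - p s = RtoC h * (b - a))
    by (unfold p; rewrite RtoC_plus; ring).
  assert (Hm : Cmod (p (s + h)%R - p s) = (Rabs h * Cmod (b - a))%R)
    by (rewrite E, Cmod_mult, Cmod_R; reflexivity).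
  specialize (Hu (p (s + h)%R)); fold (p s) in Hu; rewrite Hm in Hu.
  assert (Hlt : (Rabs h * Cmod (b - a) < d)%R).
  { apply (Rmult_lt_compat_r (Cmod (b - a) + 1)) in Hhd;
      [|pose proof (Cmod_ge_0 (b - a)); lra].
    replace (d / (Cmod (b - a) + 1) * (Cmod (b - a) + 1))%R with d in Hhd
      by (field; pose proof (Cmod_ge_0 (b - a)); lra).
    pose proof (Rabs_pos h); lra. }
  specialize (Hu Hlt).
  assert (E2 : ((g (s + h) - g s) / h - dg s =
    Re (Cconj w * (f (p (s + h)%R) - f (p s) - (p (s + h)%R - p s) * df (p s))) / h)%R).
  { rewrite E; unfold g, dg.
    replace (Cconj w * (f (p (s + h)%R) - f (p s) - RtoC h * (b - a) * df (p s)))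
      with (Cconj w * f (p (s + h)%R) - Cconj w * f (p s)
            - RtoC h * (Cconj w * (df (p s) * (b - a)))) by ring.
    rewrite !Re_minus, re_scal_l; field; exact Hh. }
  rewrite E2; unfold Rdiv; rewrite Rabs_mult, Rabs_inv.
  assert (Hah : (0 < Rabs h)%R) by now apply Rabs_pos_lt.
  apply (Rmult_lt_reg_r (Rabs h)); [exact Hah|].
  rewrite Rmult_assoc, Rinv_l, Rmult_1_r by lra.
  eapply Rle_lt_trans; [apply re_le_Cmod|].
  rewrite Cmod_mult, Cmod_conj.
  eapply Rle_lt_trans; [apply Rmult_le_compat_l; [apply Cmod_ge_0 | exact Hu]|].
  replace (Cmod w * (eps / k / 2 * (Rabs h * Cmod (b - a))))%R
    with (eps * Rabs h * ((k - 1) / k / 2))%R by (unfold k; field; fold k; lra).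
  rewrite <- (Rmult_1_r (eps * Rabs h)) at 2.
  apply Rmult_lt_compat_l; [nra|].
  apply (Rmult_lt_reg_r (k * 2)); [lra|]; field_simplify; lra. }
destruct (MVT_gen g 0 1 dg) as [c [Hc Ec]].
{ intros s Hs; apply Hd; rewrite Rmin_left, Rmax_right in Hs; lra. }
{ intros s Hs; rewrite Rmin_left, Rmax_right in Hs by lra.
  apply continuity_pt_filterlim, @ex_derive_continuous; exists (dg s); auto. }
rewrite Rmin_left, Rmax_right in Hc by lra.
assert (E0 : (g 1 - g 0 = Cmod w ^ 2)%R).
{ unfold g, p.
  replace (a + RtoC 1 * (b - a)) with b by ring.
  replace (a + RtoC 0 * (b - a)) with a by ring.
  rewrite <- Re_minus.
  replace (Cconj w * f b - Cconj w * f a) with (w * Cconj w) by (unfold w; ring).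
  rewrite <- Cmod2_conj; reflexivity. }
assert (Hle : (dg c <= Cmod w * (M * Cmod (b - a)))%R).
{ unfold dg; eapply Rle_trans; [apply Re_mult_le|].
  rewrite Cmod_conj, Cmod_mult; apply Rmult_le_compat_l; [apply Cmod_ge_0|].
  apply Rmult_le_compat_r; [apply Cmod_ge_0 | apply H; exact Hc]. }
rewrite E0 in Ec.
destruct (Rle_lt_or_eq_dec 0 (Cmod w) (Cmod_ge_0 w)) as [Hw | Hw].
- apply (Rmult_le_reg_l (Cmod w)); [exact Hw|]; nra.
- rewrite <- Hw; destruct (H 0%R ltac:(lra)) as [_ HM].
  pose proof (Cmod_ge_0 (df (a + RtoC 0 * (b - a))%C)); pose proof (Cmod_ge_0 (b - a)); nra.
Qed.

Lemma segment_ball (z a b : C) (r : R) (s : R) :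
  (Cmod (a - z) < r)%R -> (Cmod (b - z) < r)%R -> (0 <= s <= 1)%R ->
  (Cmod (a + RtoC s * (b - a) - z) < r)%R.
Proof.
intros Ha Hb Hs.
replace (a + RtoC s * (b - a) - z)
  with (RtoC (1 - s) * (a - z) + RtoC s * (b - z)) by (rewrite RtoC_minus; ring).
eapply Rle_lt_trans; [apply Cmod_triangle|].
rewrite !Cmod_mult, !Cmod_RtoC_pos by lra.
destruct (Rle_lt_or_eq_dec 0 s) as [H | H]; [lra | |subst s; lra].
destruct (Rle_lt_or_eq_dec s 1) as [H' | H']; [lra | nra | subst s; lra].
Qed.

Lemma segment_dist (z b : C) (s : R) :
  (0 <= s <= 1)%R -> (Cmod (z + RtoC s * (b - z) - z) <= Cmod (b - z))%R.
Proof.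
intros Hs; replace (z + RtoC s * (b - z) - z) with (RtoC s * (b - z)) by ring.
rewrite Cmod_mult, Cmod_RtoC_pos by lra; pose proof (Cmod_ge_0 (b - z)); nra.
Qed.

Lemma strict_derive (f df : C -> C) (z : C) :
  near z (fun u => is_Cderive f u (df u)) -> Ccont df z ->
  forall eps : R, (0 < eps)%R -> exists d : R, (0 < d)%R /\
    forall u v, (Cmod (u - z) < d)%R -> (Cmod (v - z) < d)%R ->
      (Cmod (f u - f v - (u - v) * df z) <= eps * Cmod (u - v))%R.
Proof.
intros [r [Hr Hf]] Hc eps He.
destruct (Hc eps He) as [d [Hd Hdf]].
exists (Rmin r d); split; [now apply Rmin_glb_lt|].
intros u v Hu Hv.
replace (f u - f v - (u - v) * df z)
  with ((f u - u * df z) - (f v - v * df z)) by ring.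
apply (mean_value_ineq (fun x => f x - x * df z) (fun x => df x - df z)).
intros s Hs.
pose proof (segment_ball z v u (Rmin r d) s Hv Hu Hs) as Hin.
set (x := v + RtoC s * (u - v)) in *; split.
- apply is_Cderive_minus.
  + apply Hf; eapply Rlt_le_trans; [exact Hin | apply Rmin_l].
  + pose proof (is_Cderive_mult _ _ x _ _ (is_Cderive_id x) (is_Cderive_const (df z) x)) as E.
    cbv beta in E; replace (1 * df z + x * 0) with (df z) in E by ring; exact E.
- apply Rlt_le, Hdf; eapply Rlt_le_trans; [exact Hin | apply Rmin_r].
Qed.

Lemma locally_injective (f df : C -> C) (z : C) :
  near z (fun u => is_Cderive f u (df u)) -> Ccont df z -> df z <> 0 ->
  exists d : R, (0 < d)%R /\ forall u v,
    (Cmod (u - z) < d)%R -> (Cmod (v - z) < d)%R -> f u = f v -> u = v.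
Proof.
intros Hf Hc Hz; apply Cmod_gt_0 in Hz.
destruct (strict_derive f df z Hf Hc (Cmod (df z) / 2)) as [d [Hd H]]; [lra|].
exists d; split; [exact Hd|]; intros u v Hu Hv E.
specialize (H u v Hu Hv); rewrite E in H.
replace (f v - f v - (u - v) * df z) with (- ((u - v) * df z)) in H by ring.
rewrite Cmod_opp, Cmod_mult in H.
pose proof (Cmod_ge_0 (u - v)).
assert (E0 : Cmod (u - v) = 0%R) by nra.
apply Cmod_eq_0 in E0; replace u with (u - v + v) by ring; rewrite E0; ring.
Qed.

Fixpoint psum (a : nat -> C) (n : nat) : C :=
  match n with O => RtoC 0 | S k => psum a k + a k end.

Definition peano (n : nat) (f : C -> C) (z : C) (c : nat -> C) : Prop :=
  forall eps : R, (0 < eps)%R -> exists d : R, (0 < d)%R /\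
    forall u, (Cmod (u - z) < d)%R ->
      (Cmod (f u - psum (fun k => c k * (u - z) ^ k)%C (S n)) <= eps * Cmod (u - z) ^ n)%R.

Definition antider_coef (c0 : C) (c : nat -> C) (k : nat) : C :=
  match k with O => c0 | S j => c j / RtoC (INR (S j)) end.

Lemma psum_antider_coef_derive (c0 : C) (c : nat -> C) (z u : C) (n : nat) :
  is_Cderive (fun u => psum (fun k => antider_coef c0 c k * (u - z) ^ k) (S n)) u
    (psum (fun k => c k * (u - z) ^ k) n).
Proof.
induction n as [|n IH].
- apply (is_Cderive_ext (fun _ => c0)); [intros; simpl; ring | apply is_Cderive_const].
- change (psum (fun k => c k * (u - z) ^ k) (S n))
    with (psum (fun k => c k * (u - z) ^ k) n + c n * (u - z) ^ n).
  apply (is_Cderive_ext (fun u => psum (fun k => antider_coef c0 c k * (u - z) ^ k) (S n)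
           + antider_coef c0 c (S n) * (u - z) ^ S n)); [reflexivity|].
  apply is_Cderive_plus; [exact IH|].
  replace (c n * (u - z) ^ n)
    with (antider_coef c0 c (S n) * (RtoC (INR (S n)) * (u - z) ^ pred (S n) * (1 - 0))).
  + apply (is_Cderive_scal _ (fun v => (v - z) ^ S n)).
    exact (is_Cderive_pow (fun v => v - z) u _ (S n)
      (is_Cderive_minus (fun v => v) (fun _ => z) u _ _ (is_Cderive_id u) (is_Cderive_const z u))).
  + unfold antider_coef; simpl pred; field.
    intros E; apply (not_0_INR (S n)); [lia|]; apply RtoC_inj; exact E.
Qed.

Lemma psum_at_center (c : nat -> C) (z : C) (n : nat) :
  psum (fun k => c k * (z - z) ^ k) (S n) = c O.
Proof.
replace (z - z) with (RtoC 0) by ring.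
induction n as [|n IH]; [simpl; ring|].
change (psum (fun k => c k * 0 ^ k) (S n) + c (S n) * 0 ^ S n = c O).
rewrite IH, Cpow_S; ring.
Qed.

Lemma peano_antider (n : nat) (f df : C -> C) (z : C) (c : nat -> C) :
  near z (fun u => is_Cderive f u (df u)) -> peano n df z c ->
  peano (S n) f z (antider_coef (f z) c).
Proof.
intros [r [Hr Hf]] Hp eps He.
destruct (Hp eps He) as [d [Hd Hc]].
exists (Rmin r d); split; [now apply Rmin_glb_lt|]; intros u Hu.
set (P := fun u => psum (fun k => antider_coef (f z) c k * (u - z) ^ k) (S (S n))).
change (Cmod (f u - P u) <= eps * Cmod (u - z) ^ S n)%R.
assert (E : f z - P z = 0).
{ unfold P; rewrite psum_at_center; simpl; ring. }
replace (f u - P u) with ((f u - P u) - (f z - P z)) by (rewrite E; ring).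
replace (eps * Cmod (u - z) ^ S n)%R with (eps * Cmod (u - z) ^ n * Cmod (u - z))%R
  by (simpl; ring).
apply (mean_value_ineq (fun x => f x - P x)
         (fun x => df x - psum (fun k => c k * (x - z) ^ k) (S n))).
intros s Hs.
assert (Hzz : (Cmod (z - z) < Rmin r d)%R).
{ replace (z - z) with (RtoC 0) by ring; rewrite Cmod_0; now apply Rmin_glb_lt. }
pose proof (segment_ball z z u _ s Hzz Hu Hs) as Hin.
pose proof (segment_dist z u s Hs) as Hle.
set (x := z + RtoC s * (u - z)) in *; split.
- apply is_Cderive_minus; [|apply psum_antider_coef_derive].
  apply Hf; eapply Rlt_le_trans; [exact Hin | apply Rmin_l].
- eapply Rle_trans; [apply Hc; eapply Rlt_le_trans; [exact Hin | apply Rmin_r]|].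
  apply Rmult_le_compat_l; [lra|]; apply pow_incr; split; [apply Cmod_ge_0 | exact Hle].
Qed.

Lemma peano_0 (f : C -> C) (z : C) (c : nat -> C) : Ccont f z -> c O = f z -> peano 0 f z c.
Proof.
intros H E eps He; destruct (H eps He) as [d [Hd Hf]].
exists d; split; [exact Hd|]; intros u Hu; simpl.
replace (f u - (0 + c 0%nat * 1)) with (f u - f z) by (rewrite E; ring).
rewrite Rmult_1_r; apply Rlt_le; auto.
Qed.

(** * Functions with iterated complex derivatives *)

Definition Copen (U : C -> Prop) : Prop := forall z, U z -> near z U.

Fixpoint smooth (U : C -> Prop) (n : nat) (f : C -> C) : Prop :=
  match n with
  | O => forall u, U u -> Ccont f u
  | S k => exists df, (forall u, U u -> is_Cderive f u (df u)) /\ smooth U k df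
  end.

Section Smooth.
Context (U : C -> Prop) (HU : Copen U).

Lemma smooth_le (n : nat) : forall f, smooth U (S n) f -> smooth U n f.
Proof using HU.
induction n as [|n IH]; intros f [df [Hd Hs]].
- intros u Hu; exact (is_Cderive_cont _ _ _ (Hd u Hu)).
- exists df; auto.
Qed.

Lemma smooth_ext (n : nat) (f g : C -> C) :
  (forall u, U u -> f u = g u) -> smooth U n f -> smooth U n g.
Proof using HU.
intros E; assert (En : forall u, U u -> near u (fun v => f v = g v)).
{ intros u Hu; destruct (HU u Hu) as [r [Hr Hv]]; exists r; split; auto. }
destruct n as [|n].
- intros H u Hu; apply (Ccont_ext_near f); auto.
- intros [df [Hd Hs]]; exists df; split; [|exact Hs].
  intros u Hu; apply (is_Cderive_ext_near f); auto.
Qed.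

Lemma smooth_const (n : nat) : forall c, smooth U n (fun _ => c).
Proof using HU.
induction n as [|n IH]; intros c.
- intros u _; exact (is_Cderive_cont _ _ _ (is_Cderive_const c u)).
- exists (fun _ => RtoC 0); split; [intros; apply is_Cderive_const | apply IH].
Qed.

Lemma smooth_id (n : nat) : smooth U n (fun u => u).
Proof using HU.
destruct n as [|n].
- intros u _; apply Ccont_id.
- exists (fun _ => RtoC 1); split; [intros; apply is_Cderive_id | apply smooth_const].
Qed.

Lemma smooth_plus (n : nat) : forall f g,
  smooth U n f -> smooth U n g -> smooth U n (fun u => f u + g u).
Proof using HU.
induction n as [|n IH]; intros f g Hf Hg.
- intros u Hu; apply Ccont_plus; auto.
- destruct Hf as [df [Hf Sf]], Hg as [dg [Hg Sg]].
  exists (fun u => df u + dg u); split; [|auto].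
  intros u Hu; apply is_Cderive_plus; auto.
Qed.

Lemma smooth_mult (n : nat) : forall f g,
  smooth U n f -> smooth U n g -> smooth U n (fun u => f u * g u).
Proof using HU.
induction n as [|n IH]; intros f g Hf Hg.
- intros u Hu; apply Ccont_mult; auto.
- pose proof (smooth_le _ _ Hf) as Hf'; pose proof (smooth_le _ _ Hg) as Hg'.
  destruct Hf as [df [Hf Sf]], Hg as [dg [Hg Sg]].
  exists (fun u => df u * g u + f u * dg u); split; [|apply smooth_plus; auto].
  intros u Hu; apply is_Cderive_mult; auto.
Qed.

Lemma smooth_scal (n : nat) (c : C) (f : C -> C) :
  smooth U n f -> smooth U n (fun u => c * f u).
Proof using HU. intros H; apply smooth_mult; [apply smooth_const | exact H]. Qed.

Lemma smooth_minus (n : nat) (f g : C -> C) :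
  smooth U n f -> smooth U n g -> smooth U n (fun u => f u - g u).
Proof using HU.
intros Hf Hg; apply (smooth_ext n (fun u => f u + (- (1)) * g u)).
- intros; ring.
- apply smooth_plus; [exact Hf | apply smooth_scal, Hg].
Qed.

Lemma smooth_pow (n k : nat) (f : C -> C) : smooth U n f -> smooth U n (fun u => f u ^ k).
Proof using HU.
intros H; induction k as [|k IH]; [apply (smooth_const n 1)|].
apply (smooth_ext n (fun u => f u * f u ^ k)); [reflexivity|].
apply smooth_mult; auto.
Qed.

Lemma smooth_inv (n : nat) : forall f : C -> C,
  (forall u, U u -> f u <> 0) -> smooth U n f -> smooth U n (fun u => / f u).
Proof using HU.
induction n as [|n IH]; intros f Hz Hf.
- intros u Hu; apply Ccont_inv; auto.
- pose proof (smooth_le _ _ Hf) as Hf'.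
  destruct Hf as [df [Hf Sf]].
  exists (fun u => - df u / f u ^ 2); split.
  + intros u Hu; apply is_Cderive_inv; auto.
  + apply (smooth_ext n (fun u => (- (1)) * (df u * (/ f u * / f u)))).
    * intros u Hu; field; auto.
    * apply smooth_scal, smooth_mult; [exact Sf | apply smooth_mult; auto].
Qed.

Lemma smooth_peano (n : nat) : forall f z, U z -> smooth U n f -> exists c, peano n f z c.
Proof using HU.
induction n as [|n IH]; intros f z Hz Hf.
- exists (fun _ => f z); apply peano_0; auto.
- destruct Hf as [df [Hf Sf]]; destruct (IH df z Hz Sf) as [c Hc].
  exists (antider_coef (f z) c); apply (peano_antider n f df z c); [|exact Hc].
  apply (near_imp z U); [exact Hf | apply HU; exact Hz].
Qed.

Lemma smooth_all_derive (f : C -> C) :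
  (forall n, smooth U n f) -> exists df, (forall u, U u -> is_Cderive f u (df u)) /\
    forall n, smooth U n df.
Proof using HU.
intros H; destruct (H 1%nat) as [df [Hd Hs]].
exists df; split; [exact Hd|]; intros n.
destruct (H (S n)) as [dg [Hd' Hs']].
apply (smooth_ext n dg); [|exact Hs'].
intros u Hu; apply (is_Cderive_unique f u); auto.
Qed.

End Smooth.

(** * Absolutely convergent complex series *)

Definition Ccvg (u : nat -> C) (l : C) : Prop :=
  forall eps : R, (0 < eps)%R -> exists N : nat, forall n, (N <= n)%nat ->
    (Cmod (u n - l) < eps)%R.

Definition Cabs (a : nat -> C) : Prop := ex_series (fun n => Cmod (a n)).

Lemma Ccvg_ext (u v : nat -> C) (l : C) : (forall n, u n = v n) -> Ccvg u l -> Ccvg v l.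
Proof. intros E H eps He; destruct (H eps He) as [N HN]; exists N; intros; rewrite <- E; auto. Qed.

Lemma Ccvg_const (c : C) : Ccvg (fun _ => c) c.
Proof.
intros eps He; exists O; intros n _.
replace (c - c) with (RtoC 0) by ring; rewrite Cmod_0; exact He.
Qed.

Lemma Ccvg_unique (u : nat -> C) (a b : C) : Ccvg u a -> Ccvg u b -> a = b.
Proof.
intros Ha Hb; destruct (classic (a = b)) as [E | E]; [exact E | exfalso].
assert (Hp : (0 < Cmod (a - b))%R) by (apply Cmod_gt_0, Cminus_neq_0, E).
destruct (Ha (Cmod (a - b) / 2)%R) as [N HN]; [lra|].
destruct (Hb (Cmod (a - b) / 2)%R) as [M HM]; [lra|].
specialize (HN (N + M)%nat ltac:(lia)); specialize (HM (N + M)%nat ltac:(lia)).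
pose proof (Cmod_dist_triangle a (u (N + M)%nat) b) as H.
rewrite (Cmod_minus_sym a (u (N + M)%nat)) in H; lra.
Qed.

Lemma Ccvg_comp (f : C -> C) (u : nat -> C) (l : C) :
  Ccont f l -> Ccvg u l -> Ccvg (fun n => f (u n)) (f l).
Proof.
intros Hf Hu eps He; destruct (Hf eps He) as [d [Hd H]]; destruct (Hu d Hd) as [N HN].
exists N; auto.
Qed.

Lemma Ccvg_plus (u v : nat -> C) (a b : C) :
  Ccvg u a -> Ccvg v b -> Ccvg (fun n => u n + v n) (a + b).
Proof.
intros Hu Hv eps He.
destruct (Hu (eps / 2)%R) as [N HN]; [lra|]; destruct (Hv (eps / 2)%R) as [M HM]; [lra|].
exists (N + M)%nat; intros n Hn.
replace (u n + v n - (a + b)) with ((u n - a) + (v n - b)) by ring.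
eapply Rle_lt_trans; [apply Cmod_triangle|].
specialize (HN n ltac:(lia)); specialize (HM n ltac:(lia)); lra.
Qed.

Lemma Ccvg_scal (k : C) (u : nat -> C) (a : C) :
  Ccvg u a -> Ccvg (fun n => k * u n) (k * a).
Proof.
apply (Ccvg_comp (fun z => k * z)).
apply (is_Cderive_cont _ _ (k * 1)), is_Cderive_scal, is_Cderive_id.
Qed.

Lemma Ccvg_minus (u v : nat -> C) (a b : C) :
  Ccvg u a -> Ccvg v b -> Ccvg (fun n => u n - v n) (a - b).
Proof.
intros Hu Hv; apply (Ccvg_ext (fun n => u n + (- (1)) * v n)); [intros; ring|].
replace (a - b) with (a + (- (1)) * b) by ring.
apply Ccvg_plus; [exact Hu | apply (Ccvg_scal (- (1))), Hv].
Qed.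

Lemma Ccvg_0_le (u : nat -> C) (b : nat -> R) :
  (forall n, (Cmod (u n) <= b n)%R) -> is_lim_seq b 0 -> Ccvg u 0.
Proof.
intros Hb Hl eps He; apply is_lim_seq_spec in Hl.
destruct (Hl (mkposreal eps He)) as [N HN]; exists N; intros n Hn.
specialize (HN n Hn); simpl in HN.
replace (u n - 0) with (u n) by ring.
eapply Rle_lt_trans; [apply Hb|].
eapply Rle_lt_trans; [apply Rle_abs|]; rewrite Rminus_0_r in HN; exact HN.
Qed.

Lemma Ccvg_Cmod_le (u : nat -> C) (l : C) (B : R) :
  Ccvg u l -> (forall n, (Cmod (u n) <= B)%R) -> (Cmod l <= B)%R.
Proof.
intros H HB; destruct (Rle_lt_dec (Cmod l) B) as [H0 | H0]; [exact H0 | exfalso].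
destruct (H (Cmod l - B)%R) as [N HN]; [lra|].
specialize (HN N (le_n N)); specialize (HB N).
pose proof (Cmod_triangle_rev l (u N)); rewrite Cmod_minus_sym in HN; lra.
Qed.

Lemma Ccvg_shift (u : nat -> C) (l : C) (k : nat) :
  Ccvg u l -> Ccvg (fun n => u (n + k)%nat) l.
Proof. intros H eps He; destruct (H eps He) as [N HN]; exists N; intros; apply HN; lia. Qed.

Lemma Ccvg_S_inv (u : nat -> C) (l : C) : Ccvg (fun n => u (S n)) l -> Ccvg u l.
Proof.
intros H eps He; destruct (H eps He) as [N HN]; exists (S N); intros n Hn.
destruct n as [|n]; [lia | apply HN; lia].
Qed.

Lemma is_lim_seq_Re (u : nat -> C) (l : C) :
  is_lim_seq (fun n => Re (u n)) (Re l) -> is_lim_seq (fun n => Im (u n)) (Im l) -> Ccvg u l.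
Proof.
intros H1 H2 eps He; apply is_lim_seq_spec in H1; apply is_lim_seq_spec in H2.
assert (He2 : (0 < eps / 2)%R) by lra.
destruct (H1 (mkposreal _ He2)) as [N HN]; destruct (H2 (mkposreal _ He2)) as [M HM].
exists (N + M)%nat; intros n Hn.
specialize (HN n ltac:(lia)); specialize (HM n ltac:(lia)); simpl in HN, HM.
eapply Rle_lt_trans; [apply Cmod_le_Re_Im|]; rewrite Re_minus, Im_minus; lra.
Qed.

Lemma Ccvg_Re (u : nat -> C) (l : C) : Ccvg u l -> is_lim_seq (fun n => Re (u n)) (Re l).
Proof.
intros H; apply is_lim_seq_spec; intros eps.
destruct (H eps (cond_pos eps)) as [N HN]; exists N; intros n Hn.
rewrite <- Re_minus; eapply Rle_lt_trans; [apply re_le_Cmod | auto].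
Qed.

Lemma Ccvg_Im (u : nat -> C) (l : C) : Ccvg u l -> is_lim_seq (fun n => Im (u n)) (Im l).
Proof.
intros H; apply is_lim_seq_spec; intros eps.
destruct (H eps (cond_pos eps)) as [N HN]; exists N; intros n Hn.
rewrite <- Im_minus; eapply Rle_lt_trans; [apply im_le_Cmod | auto].
Qed.

Lemma CLim_seq_unique (u : nat -> C) (l : C) : Ccvg u l -> CLim_seq u = l.
Proof.
intros H; unfold CLim_seq.
rewrite (is_lim_seq_unique _ _ (Ccvg_Re u l H)), (is_lim_seq_unique _ _ (Ccvg_Im u l H)).
destruct l; reflexivity.
Qed.

Lemma psum_S (a : nat -> C) (n : nat) : psum a (S n) = psum a n + a n.
Proof. reflexivity. Qed.

Lemma psum_ext (a b : nat -> C) (n : nat) :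
  (forall k, (k < n)%nat -> a k = b k) -> psum a n = psum b n.
Proof. induction n as [|n IH]; intros H; simpl; [reflexivity|]; rewrite IH, H; auto. Qed.

Lemma psum_shift (a : nat -> C) (n : nat) : psum a (S n) = a O + psum (fun k => a (S k)) n.
Proof.
induction n as [|n IH]; [simpl; ring|].
rewrite psum_S, IH, psum_S; ring.
Qed.

Lemma psum_plus (a b : nat -> C) (n : nat) :
  psum (fun k => a k + b k) n = psum a n + psum b n.
Proof. induction n as [|n IH]; simpl; [ring | rewrite IH; ring]. Qed.

Lemma psum_scal (c : C) (a : nat -> C) (n : nat) :
  psum (fun k => c * a k) n = c * psum a n.
Proof. induction n as [|n IH]; simpl; [ring | rewrite IH; ring]. Qed.

Lemma psum_0 (n : nat) : psum (fun _ => RtoC 0) n = 0.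
Proof. induction n as [|n IH]; simpl; [reflexivity | rewrite IH; ring]. Qed.

Lemma psum_Re (a : nat -> C) (n : nat) : Re (psum a (S n)) = sum_n (fun k => Re (a k)) n.
Proof.
induction n as [|n IH].
- unfold psum; rewrite sum_O, Cplus_0_l; reflexivity.
- rewrite psum_S, sum_Sn, <- IH; destruct (psum a (S n)), (a (S n)); reflexivity.
Qed.

Lemma psum_Im (a : nat -> C) (n : nat) : Im (psum a (S n)) = sum_n (fun k => Im (a k)) n.
Proof.
induction n as [|n IH].
- unfold psum; rewrite sum_O, Cplus_0_l; reflexivity.
- rewrite psum_S, sum_Sn, <- IH; destruct (psum a (S n)), (a (S n)); reflexivity.
Qed.

Lemma Cabs_Re (a : nat -> C) : Cabs a -> ex_series (fun n => Re (a n)).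
Proof.
intros H; apply (@ex_series_le R_AbsRing R_CompleteNormedModule _ (fun n => Cmod (a n)));
  [|exact H]; intros n; apply re_le_Cmod.
Qed.

Lemma Cabs_Im (a : nat -> C) : Cabs a -> ex_series (fun n => Im (a n)).
Proof.
intros H; apply (@ex_series_le R_AbsRing R_CompleteNormedModule _ (fun n => Cmod (a n)));
  [|exact H]; intros n; apply im_le_Cmod.
Qed.

Lemma CSeries_cvg (a : nat -> C) : Cabs a -> Ccvg (psum a) (CSeries a).
Proof.
intros H; apply Ccvg_S_inv, is_lim_seq_Re.
- apply (is_lim_seq_ext (sum_n (fun k => Re (a k)))); [intros; now rewrite psum_Re|].
  exact (Series_correct _ (Cabs_Re a H)).
- apply (is_lim_seq_ext (sum_n (fun k => Im (a k)))); [intros; now rewrite psum_Im|].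
  exact (Series_correct _ (Cabs_Im a H)).
Qed.

Lemma CSeries_unique (a : nat -> C) (l : C) : Cabs a -> Ccvg (psum a) l -> CSeries a = l.
Proof. intros Ha H; exact (Ccvg_unique _ _ _ (CSeries_cvg a Ha) H). Qed.

Lemma CSeries_ext (a b : nat -> C) : (forall n, a n = b n) -> CSeries a = CSeries b.
Proof. intros H; unfold CSeries; f_equal; apply Series_ext; intros; now rewrite H. Qed.

Lemma Cabs_ext (a b : nat -> C) : (forall n, a n = b n) -> Cabs a -> Cabs b.
Proof. intros H; apply ex_series_ext; intros; now rewrite H. Qed.

Lemma Cabs_le (a : nat -> C) (b : nat -> R) :
  (forall n, (Cmod (a n) <= b n)%R) -> ex_series b -> Cabs a.
Proof.
intros H; apply (@ex_series_le R_AbsRing R_CompleteNormedModule).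
intros n; change (Rabs (Cmod (a n)) <= b n)%R.
rewrite Rabs_pos_eq; [apply H | apply Cmod_ge_0].
Qed.

Lemma Cabs_plus (a b : nat -> C) : Cabs a -> Cabs b -> Cabs (fun n => a n + b n).
Proof.
intros Ha Hb; apply (Cabs_le _ (fun n => (Cmod (a n) + Cmod (b n))%R)).
- intros; apply Cmod_triangle.
- exact (ex_series_plus (fun n => Cmod (a n)) (fun n => Cmod (b n)) Ha Hb).
Qed.

Lemma ex_series_scal_R (c : R) (a : nat -> R) :
  ex_series a -> ex_series (fun n => (c * a n)%R).
Proof. intros H; exact (@ex_series_scal R_AbsRing R_NormedModule c a H). Qed.

Lemma Cabs_scal (c : C) (a : nat -> C) : Cabs a -> Cabs (fun n => c * a n).
Proof.
intros Ha; apply (Cabs_le _ (fun n => (Cmod c * Cmod (a n))%R)).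
- intros; rewrite Cmod_mult; lra.
- now apply ex_series_scal_R.
Qed.

Lemma Cabs_S (a : nat -> C) : Cabs a <-> Cabs (fun n => a (S n)).
Proof. exact (ex_series_incr_1 (fun n => Cmod (a n))). Qed.

Lemma CSeries_plus (a b : nat -> C) :
  Cabs a -> Cabs b -> CSeries (fun n => a n + b n) = CSeries a + CSeries b.
Proof.
intros Ha Hb; apply CSeries_unique; [now apply Cabs_plus|].
apply (Ccvg_ext (fun n => psum a n + psum b n)); [intros; now rewrite psum_plus|].
apply Ccvg_plus; now apply CSeries_cvg.
Qed.

Lemma CSeries_scal (c : C) (a : nat -> C) :
  Cabs a -> CSeries (fun n => c * a n) = c * CSeries a.
Proof.
intros Ha; apply CSeries_unique; [now apply Cabs_scal|].
apply (Ccvg_ext (fun n => c * psum a n)); [intros; now rewrite psum_scal|].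
apply Ccvg_scal; now apply CSeries_cvg.
Qed.

Lemma Cabs_minus (a b : nat -> C) : Cabs a -> Cabs b -> Cabs (fun n => a n - b n).
Proof.
intros Ha Hb; apply (Cabs_ext (fun n => a n + (- (1)) * b n)); [intros; ring|].
apply Cabs_plus; [exact Ha | now apply Cabs_scal].
Qed.

Lemma CSeries_minus (a b : nat -> C) :
  Cabs a -> Cabs b -> CSeries (fun n => a n - b n) = CSeries a - CSeries b.
Proof.
intros Ha Hb; rewrite (CSeries_ext _ (fun n => a n + (- (1)) * b n)) by (intros; ring).
rewrite CSeries_plus, CSeries_scal; [ring | exact Hb | exact Ha | now apply Cabs_scal].
Qed.

Lemma CSeries_incr (a : nat -> C) : Cabs a -> CSeries a = a O + CSeries (fun n => a (S n)).
Proof.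
intros Ha; apply CSeries_unique; [exact Ha|]; apply Ccvg_S_inv.
apply (Ccvg_ext (fun n => a O + psum (fun k => a (S k)) n)); [intros; now rewrite psum_shift|].
apply Ccvg_plus; [apply Ccvg_const | apply CSeries_cvg; now apply (Cabs_S a)].
Qed.

Lemma CSeries_split (a : nat -> C) (n : nat) :
  Cabs a -> CSeries a = psum a n + CSeries (fun k => a (n + k)%nat).
Proof.
intros Ha; induction n as [|n IH].
- simpl; rewrite Cplus_0_l; reflexivity.
- assert (Hn : Cabs (fun k => a (n + k)%nat)).
  { exact (proj1 (ex_series_incr_n (fun k => Cmod (a k)) n) Ha). }
  rewrite IH, (CSeries_incr _ Hn), psum_S, Nat.add_0_r.
  rewrite (CSeries_ext (fun k => a (n + S k)%nat) (fun k => a (S n + k)%nat));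
    [ring | intros k; f_equal; lia].
Qed.

Lemma psum_Cmod_le (a : nat -> C) (b : nat -> R) (n : nat) :
  (forall k, (Cmod (a k) <= b k)%R) -> (Cmod (psum a (S n)) <= sum_n b n)%R.
Proof.
intros H; induction n as [|n IH].
- rewrite psum_S, sum_O; simpl; rewrite Cplus_0_l; apply H.
- rewrite psum_S, sum_Sn; eapply Rle_trans; [apply Cmod_triangle|].
  apply Rplus_le_compat; auto.
Qed.

Lemma psum_Cmod_le_Series (a : nat -> C) (b : nat -> R) (n : nat) :
  (forall k, (Cmod (a k) <= b k)%R) -> ex_series b -> (Cmod (psum a n) <= Series b)%R.
Proof.
intros H Hb.
assert (Hp : forall k, (0 <= b k)%R) by (intros; eapply Rle_trans; [apply Cmod_ge_0 | apply H]).
assert (Hs : forall k, (sum_n b k <= Series b)%R).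
{ apply (is_lim_seq_incr_compare (sum_n b)); [exact (Series_correct b Hb)|].
  intros k; rewrite sum_Sn; unfold plus; simpl; specialize (Hp (S k)); lra. }
destruct n as [|n].
- simpl; rewrite Cmod_0; specialize (Hs O); rewrite sum_O in Hs; specialize (Hp O); lra.
- eapply Rle_trans; [now apply psum_Cmod_le | apply Hs].
Qed.

Lemma CSeries_Cmod_le (a : nat -> C) (b : nat -> R) :
  (forall n, (Cmod (a n) <= b n)%R) -> ex_series b -> (Cmod (CSeries a) <= Series b)%R.
Proof.
intros H Hb; apply (Ccvg_Cmod_le (psum a)); [exact (CSeries_cvg a (Cabs_le a b H Hb))|].
intros n; now apply psum_Cmod_le_Series.
Qed.

Lemma CSeries_0 (a : nat -> C) : (forall n, a n = 0) -> CSeries a = 0.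
Proof.
intros H; assert (E : forall n, Cmod (a n) = 0%R) by (intros; rewrite H; apply Cmod_0).
apply CSeries_unique.
- exists 0%R; apply (is_series_ext (fun _ => 0%R)); [intros; now rewrite E|].
  apply filterlim_ext with (fun _ => 0%R); [|apply filterlim_const].
  intros n; rewrite sum_n_const; ring.
- apply (Ccvg_ext (fun _ => RtoC 0)); [|apply Ccvg_const].
  intros n; rewrite (psum_ext a (fun _ => RtoC 0)) by auto; now rewrite psum_0.
Qed.

Lemma Series_tail_lim (b : nat -> R) :
  ex_series b -> forall eps, (0 < eps)%R -> exists N,
    (Rabs (Series (fun k => b (N + k)%nat)) < eps)%R.
Proof.
intros Hb eps He; pose proof (Series_correct b Hb) as Hc.
change (is_lim_seq (sum_n b) (Series b)) in Hc; apply is_lim_seq_spec in Hc.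
destruct (Hc (mkposreal eps He)) as [N HN]; simpl in HN.
exists (S N); specialize (HN N (le_n N)).
rewrite (Series_incr_n b (S N)) in HN by (auto; lia); simpl pred in HN.
rewrite sum_n_Reals in HN.
match type of HN with (Rabs (?s - (?s + ?t)) < _)%R =>
  replace (s - (s + t))%R with (- t)%R in HN by ring end.
rewrite Rabs_Ropp in HN; exact HN.
Qed.

Lemma psum_cvg (T : nat -> nat -> C) (L : nat -> C) (n : nat) :
  (forall j, Ccvg (fun k => T k j) (L j)) -> Ccvg (fun k => psum (T k) n) (psum L n).
Proof.
intros H; induction n as [|n IH]; [exact (Ccvg_const 0)|].
apply (Ccvg_plus (fun k => psum (T k) n) (fun k => T k n)); auto.
Qed.

Lemma CSeries_dominated_cvg (T : nat -> nat -> C) (L : nat -> C) (b : nat -> R) :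
  (forall k j, (Cmod (T k j) <= b j)%R) -> ex_series b ->
  (forall j, Ccvg (fun k => T k j) (L j)) ->
  Ccvg (fun k => CSeries (T k)) (CSeries L).
Proof.
intros HT Hb HL eps He.
assert (HLb : forall j, (Cmod (L j) <= b j)%R)
  by (intros j; apply (Ccvg_Cmod_le (fun k => T k j)); auto).
destruct (Series_tail_lim b Hb (eps / 3)) as [N HN]; [lra|].
destruct (psum_cvg T L N HL (eps / 3)%R) as [K HK]; [lra|].
assert (Hbn : ex_series (fun k => b (N + k)%nat)) by now apply (ex_series_incr_n b N).
exists K; intros k Hk.
rewrite (CSeries_split (T k) N), (CSeries_split L N); try (eapply Cabs_le; eauto; fail).
specialize (HK k Hk); pose proof (Rle_abs (Series (fun k => b (N + k)%nat))) as Hab.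
assert (H1 := CSeries_Cmod_le (fun j => T k (N + j)%nat) _ (fun j => HT k (N + j)%nat) Hbn).
assert (H2 := CSeries_Cmod_le (fun j => L (N + j)%nat) _ (fun j => HLb (N + j)%nat) Hbn).
simpl in H1, H2.
replace (psum (T k) N + CSeries (fun j => T k (N + j)%nat) -
   (psum L N + CSeries (fun j => L (N + j)%nat)))
  with ((psum (T k) N - psum L N) +
        (CSeries (fun j => T k (N + j)%nat) - CSeries (fun j => L (N + j)%nat))) by ring.
eapply Rle_lt_trans; [apply Cmod_triangle|].
pose proof (Cmod_sub_triangle (CSeries (fun j => T k (N + j)%nat))
              (CSeries (fun j => L (N + j)%nat))); lra.
Qed.

Lemma Cabs_iterated (r : nat -> nat -> C) (A B : nat -> R) :
  (forall m n, (Cmod (r m n) <= A m * B n)%R) -> ex_series A -> ex_series B ->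
  Cabs (fun m => CSeries (r m)).
Proof.
intros H HA HB; apply (Cabs_le _ (fun m => (Series B * A m)%R)); [|now apply ex_series_scal_R].
intros m; rewrite Rmult_comm, <- Series_scal_l.
apply CSeries_Cmod_le; [apply H | now apply ex_series_scal_R].
Qed.

Lemma CSeries_fubini (r : nat -> nat -> C) (A B : nat -> R) :
  (forall m n, (Cmod (r m n) <= A m * B n)%R) -> (forall n, (0 <= B n)%R) ->
  ex_series A -> ex_series B ->
  CSeries (fun m => CSeries (r m)) = CSeries (fun n => CSeries (fun m => r m n)).
Proof.
intros H HB0 HA HB.
assert (Hr : forall m, Cabs (r m)).
{ intros m; apply (Cabs_le _ (fun n => (A m * B n)%R)); [apply H | now apply ex_series_scal_R]. }
assert (HcB : forall n m, (Cmod (r m n) <= B n * A m)%R)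
  by (intros; rewrite Rmult_comm; apply H).
assert (Hc : forall n, Cabs (fun m => r m n)).
{ intros n; apply (Cabs_le _ (fun m => (B n * A m)%R)); [apply HcB | now apply ex_series_scal_R]. }
apply CSeries_unique; [now apply (Cabs_iterated r A B)|].
apply (Ccvg_ext (fun M => CSeries (fun n => psum (fun m => r m n) M))).
{ intros M; induction M as [|M IH]; [simpl; now apply CSeries_0|].
  rewrite psum_S, <- IH; rewrite <- CSeries_plus; [now apply CSeries_ext | | apply Hr].
  clear IH; induction M as [|M IH]; simpl.
  - apply (Cabs_ext (fun k => 0 * r O k)); [intros; ring | now apply Cabs_scal].
  - apply Cabs_plus; auto. }
apply (CSeries_dominated_cvg _ _ (fun n => (Series A * B n)%R)).
- intros M n; rewrite Rmult_comm, <- Series_scal_l.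
  apply (psum_Cmod_le_Series (fun m => r m n)); [apply HcB | now apply ex_series_scal_R].
- now apply ex_series_scal_R.
- intros n; apply CSeries_cvg, Hc.
Qed.

Lemma ex_series_geom_scal (M r : R) : (Rabs r < 1)%R -> ex_series (fun n => (M * r ^ n)%R).
Proof. intros H; apply ex_series_scal_R, ex_series_geom, H. Qed.

Lemma ex_series_inv_sq : ex_series (fun n => (/ INR (S n) ^ 2)%R).
Proof.
apply ex_series_incr_1.
apply (@ex_series_le R_AbsRing R_CompleteNormedModule _
         (fun n => (/ INR (S n) - / INR (S (S n)))%R)).
- intros n; change (Rabs (/ INR (S (S n)) ^ 2) <= / INR (S n) - / INR (S (S n)))%R.
  rewrite (S_INR (S n)), S_INR; pose proof (pos_INR n).
  rewrite Rabs_pos_eq by (apply Rlt_le, Rinv_0_lt_compat, pow_lt; lra).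
  apply (Rmult_le_reg_r ((INR n + 1 + 1) ^ 2 * (INR n + 1))); [nra|].
  field_simplify; nra.
- exists 1%R.
  change (is_lim_seq (sum_n (fun n => (/ INR (S n) - / INR (S (S n)))%R)) (Finite 1)).
  apply (is_lim_seq_ext (fun n => (1 - / INR (S (S n)))%R)).
  + intros n; induction n as [|n IH].
    * rewrite sum_O; simpl; field.
    * rewrite sum_Sn, <- IH; unfold plus; simpl; ring.
  + replace (Finite 1) with (Finite (1 - 0)) by (f_equal; ring).
    apply is_lim_seq_minus'; [apply is_lim_seq_const|].
    apply (is_lim_seq_incr_1 (fun n => (/ INR (S n))%R)).
    apply (is_lim_seq_incr_1 (fun n => (/ INR n)%R)).
    replace (Finite 0) with (Rbar_inv p_infty) by reflexivity.
    apply is_lim_seq_inv; [apply is_lim_seq_INR | discriminate].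
Qed.

(* Newton iteration with frozen slope is a contraction. *)
Lemma locally_surjective (f df : C -> C) (z : C) :
  near z (fun u => is_Cderive f u (df u)) -> Ccont df z -> df z <> 0 ->
  forall eps : R, (0 < eps)%R -> exists d : R, (0 < d)%R /\ forall c,
    (Cmod (c - f z) < d)%R -> exists u, (Cmod (u - z) < eps)%R /\ f u = c.
Proof.
intros Hf Hc Hz eps He; pose proof Hz as Hz'; apply Cmod_gt_0 in Hz'.
set (l := df z) in *.
destruct (strict_derive f df z Hf Hc (Cmod l / 2)) as [r [Hr H]]; [lra|].
set (e := Rmin r eps); assert (He' : (0 < e)%R) by now apply Rmin_glb_lt.
assert (Her : (e <= r)%R) by apply Rmin_l; assert (Hee : (e <= eps)%R) by apply Rmin_r.
exists (Cmod l * (e / 4))%R; split; [nra|]; intros c Hcd.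
set (T := fun u => u - (f u - c) / l).
set (u := fix u n := match n with O => z | S k => T (u k) end).
set (d0 := (e / 4)%R).
assert (Hd1 : (Cmod (u 1%nat - u O) <= d0)%R).
{ change (Cmod (z - (f z - c) / l - z) <= d0)%R.
  replace (z - (f z - c) / l - z) with ((c - f z) / l) by (field; exact Hz).
  rewrite Cmod_div by exact Hz; unfold d0.
  apply (Rmult_le_reg_r (Cmod l)); [exact Hz'|]; unfold Rdiv at 1.
  rewrite Rmult_assoc, Rinv_l, Rmult_1_r by lra; lra. }
assert (HT : forall a b, (Cmod (a - z) < r)%R -> (Cmod (b - z) < r)%R ->
  (Cmod (T a - T b) <= / 2 * Cmod (a - b))%R).
{ intros a b Ha Hb; unfold T.
  replace (a - (f a - c) / l - (b - (f b - c) / l))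
    with (- (f a - f b - (a - b) * l) / l) by (field; exact Hz).
  rewrite Cmod_div, Cmod_opp by exact Hz.
  specialize (H a b Ha Hb); fold l in H.
  apply (Rmult_le_reg_r (Cmod l)); [exact Hz'|]; unfold Rdiv at 1.
  rewrite Rmult_assoc, Rinv_l, Rmult_1_r by lra; lra. }
assert (Hin : forall n, (Cmod (u (S n) - u n) <= d0 * (/ 2) ^ n)%R /\ (Cmod (u n - z) <= 2 * d0 * (1 - (/ 2) ^ n))%R).
{ induction n as [|n [IH1 IH2]].
  - split; [simpl pow; lra|].
    change (Cmod (z - z) <= 2 * d0 * (1 - 1))%R.
    replace (z - z) with (RtoC 0) by ring; rewrite Cmod_0; lra.
  - assert (Hp : (0 < (/ 2) ^ n)%R) by (apply pow_lt; lra).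
    assert (Hn : (Cmod (u (S n) - z) <= 2 * d0 * (1 - (/ 2) ^ S n))%R).
    { eapply Rle_trans; [apply (Cmod_dist_triangle _ (u n))|]; simpl pow; lra. }
    split; [|exact Hn].
    change (Cmod (T (u (S n)) - T (u n)) <= d0 * (/ 2) ^ S n)%R.
    eapply Rle_trans; [apply HT|].
    + eapply Rle_lt_trans; [exact Hn|]; simpl pow; unfold d0 in *; nra.
    + eapply Rle_lt_trans; [exact IH2|]; unfold d0 in *; nra.
    + simpl pow; lra. }
set (a := fun n => u (S n) - u n).
assert (Ha : Cabs a).
{ apply (Cabs_le _ (fun n => (d0 * (/ 2) ^ n)%R)); [intros; apply Hin|].
  apply ex_series_geom_scal; rewrite Rabs_pos_eq; lra. }
set (w := z + CSeries a).
assert (Hw : Ccvg u w).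
{ apply (Ccvg_ext (fun n => z + psum a n)).
  - induction n as [|n IH]; [simpl; ring|].
    rewrite psum_S; transitivity ((z + psum a n) + a n); [ring|].
    rewrite IH; unfold a; ring.
  - apply Ccvg_plus; [apply Ccvg_const | now apply CSeries_cvg]. }
assert (Hwz : (Cmod (w - z) <= 2 * d0)%R).
{ apply (Ccvg_Cmod_le (fun n => u n - z)).
  - apply Ccvg_minus; [exact Hw | apply Ccvg_const].
  - intros n; destruct (Hin n) as [_ Hn]; assert (Hp : (0 < (/ 2) ^ n)%R) by (apply pow_lt; lra).
    unfold d0 in *; nra. }
exists w; split; [unfold d0 in *; lra|].
assert (Hfw : Ccont f w).
{ intros e1 He1.
  assert (Hlt : (Cmod (w - z) < r)%R) by (unfold d0 in *; lra).
  exists (Rmin (r - Cmod (w - z)) (e1 / (2 * Cmod l))); split.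
  { apply Rmin_glb_lt; [lra | apply Rdiv_lt_0_compat; lra]. }
  intros v Hv.
  assert (Hv1 : (Cmod (v - w) < r - Cmod (w - z))%R)
    by (eapply Rlt_le_trans; [exact Hv | apply Rmin_l]).
  assert (Hv2 : (Cmod (v - w) < e1 / (2 * Cmod l))%R)
    by (eapply Rlt_le_trans; [exact Hv | apply Rmin_r]).
  assert (Hvz : (Cmod (v - z) < r)%R).
  { eapply Rle_lt_trans; [apply (Cmod_dist_triangle v w z)|]; lra. }
  specialize (H v w Hvz Hlt); fold l in H.
  pose proof (Cmod_triangle (f v - f w - (v - w) * l) ((v - w) * l)) as H1.
  replace (f v - f w - (v - w) * l + (v - w) * l) with (f v - f w) in H1 by ring.
  rewrite Cmod_mult in H1.
  apply (Rmult_lt_compat_r (2 * Cmod l)) in Hv2; [|lra].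
  replace (e1 / (2 * Cmod l) * (2 * Cmod l))%R with e1 in Hv2 by (field; lra).
  pose proof (Cmod_ge_0 (v - w)); nra. }
assert (E : T w = w).
{ apply (Ccvg_unique (fun n => u (S n))).
  - change (Ccvg (fun n => T (u n)) (T w)); apply (Ccvg_comp T); [|exact Hw].
    unfold T, Cdiv.
    intros e1 He1.
    destruct (Ccont_plus (fun u => u) (fun u => (- / l) * (f u + - c)) w) with (eps := e1)
      as [d1 [Hd1' Hd2]]; [apply Ccont_id | | exact He1 |].
    + apply Ccont_mult; [exact (is_Cderive_cont _ _ _ (is_Cderive_const _ w))|].
      apply Ccont_plus; [exact Hfw | exact (is_Cderive_cont _ _ _ (is_Cderive_const _ w))].
    + exists d1; split; [exact Hd1'|]; intros v Hv; specialize (Hd2 v Hv).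
      replace (v - (f v - c) * / l - (w - (f w - c) * / l))
        with (v + - / l * (f v + - c) - (w + - / l * (f w + - c))) by ring.
      exact Hd2.
  - apply (Ccvg_ext (fun n => u (n + 1)%nat)); [|exact (Ccvg_shift u w 1 Hw)].
    intros n; now rewrite Nat.add_1_r. }
unfold T in E.
replace (f w) with (c + (w - (w - (f w - c) / l)) * l) by (field; exact Hz).
rewrite E; ring.
Qed.

(** * The complex exponential *)

Lemma Cexp_plus (a b : C) : Cexp (a + b) = Cexp a * Cexp b.
Proof.
destruct a as [x y], b as [x' y']; unfold Cexp, Cmult, Cplus, RtoC; simpl.
rewrite exp_plus, cos_plus, sin_plus; f_equal; ring.
Qed.

Lemma Cexp_0 : Cexp 0 = 1.
Proof.
unfold Cexp, Cmult, RtoC; simpl; rewrite exp_0, cos_0, sin_0; f_equal; ring.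
Qed.

Lemma Cexp_neq_0 (a : C) : Cexp a <> 0.
Proof.
intros E; assert (H : Cexp (a + - a) = 1) by (replace (a + - a) with (RtoC 0) by ring; apply Cexp_0).
rewrite Cexp_plus, E, Cmult_0_l in H; apply C1_nz; symmetry; exact H.
Qed.

Lemma Cexp_pow (a : C) (n : nat) : Cexp a ^ n = Cexp (RtoC (INR n) * a).
Proof.
induction n as [|n IH].
- simpl; rewrite Cmult_0_l; symmetry; exact Cexp_0.
- rewrite Cpow_S, IH, <- Cexp_plus, S_INR, RtoC_plus; f_equal; ring.
Qed.

Lemma Cmod_Cexp (a : C) : Cmod (Cexp a) = exp (Re a).
Proof.
destruct a as [x y]; unfold Cexp; simpl.
rewrite Cmod_mult, Cmod_R, Rabs_pos_eq by (apply Rlt_le, exp_pos).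
assert (E : Cmod (cos y, sin y) = 1%R).
{ unfold Cmod; replace (fst (cos y, sin y) ^ 2 + snd (cos y, sin y) ^ 2)%R with 1%R.
  - apply sqrt_1.
  - pose proof (sin2_cos2 y) as H; unfold Rsqr in H; simpl; lra. }
rewrite E; ring.
Qed.

Lemma Cexp_imag (r : R) : Cexp (RtoC r * Ci) = (cos r, sin r).
Proof.
unfold Cexp, Cmult, RtoC, Ci; simpl.
replace (r * 0 - 0 * 1)%R with 0%R by ring; replace (r * 1 + 0 * 0)%R with r by ring.
rewrite exp_0; f_equal; ring.
Qed.

Lemma sin_abs_le (t : R) : (Rabs (sin t) <= Rabs t)%R.
Proof.
destruct (MVT_gen sin 0 t cos) as [c [_ E]].
- intros x _; apply is_derive_Reals, derivable_pt_lim_sin.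
- intros x _; apply continuity_pt_filterlim, @ex_derive_continuous; exists (cos x).
  apply is_derive_Reals, derivable_pt_lim_sin.
- rewrite sin_0, !Rminus_0_r in E; rewrite E, Rabs_mult.
  pose proof (COS_bound c); pose proof (Rabs_pos t).
  assert (Rabs (cos c) <= 1)%R by (apply Rabs_le; lra); nra.
Qed.

Lemma cos_1_abs_le (t : R) : (Rabs (cos t - 1) <= t ^ 2 / 2)%R.
Proof.
replace t with (2 * (t / 2))%R at 1 by field.
rewrite cos_2a_sin; pose proof (sin_abs_le (t / 2)) as H.
replace (1 - 2 * sin (t / 2) * sin (t / 2) - 1)%R with (- (2 * sin (t / 2) ^ 2))%R by ring.
rewrite Rabs_Ropp, Rabs_pos_eq by (pose proof (pow2_ge_0 (sin (t / 2))); lra).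
pose proof (pow_incr _ _ 2 (conj (Rabs_pos _) H)) as H2.
rewrite !pow2_abs in H2; lra.
Qed.

Lemma sin_id_abs_le (t : R) : (Rabs (sin t - t) <= Rabs t * (t ^ 2 / 2))%R.
Proof.
destruct (MVT_gen (fun x => sin x - x)%R 0 t (fun x => cos x - 1)%R) as [c [Hc E]].
- intros x _; auto_derive; [trivial | ring].
- intros x _; apply (continuity_pt_minus sin (fun x => x)); [apply continuity_sin|].
  apply derivable_continuous_pt, derivable_pt_id.
- simpl in E; rewrite sin_0, !Rminus_0_r in E; rewrite E, Rabs_mult, Rmult_comm.
  apply Rmult_le_compat_l; [apply Rabs_pos|].
  eapply Rle_trans; [apply cos_1_abs_le|].
  assert (Rabs c <= Rabs t)%R.
  { destruct (Rle_lt_dec 0 t) as [Ht | Ht].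
    - rewrite Rmin_left, Rmax_right in Hc by lra; rewrite !Rabs_pos_eq; lra.
    - rewrite Rmin_right, Rmax_left in Hc by lra; rewrite !Rabs_left1; lra. }
  pose proof (pow_incr _ _ 2 (conj (Rabs_pos _) H)) as H2.
  rewrite !pow2_abs in H2; lra.
Qed.

Lemma exp_1_abs_le (x : R) : (Rabs x <= / 2)%R -> (Rabs (exp x - 1 - x) <= 2 * x ^ 2)%R.
Proof.
intros H; apply Rabs_le_between in H.
pose proof (exp_ineq1_le x) as H1; pose proof (exp_ineq1_le (- x)) as H2.
rewrite exp_Ropp in H2; pose proof (exp_pos x) as Hp.
rewrite Rabs_pos_eq by lra.
assert (H3 : (exp x * (1 - x) <= 1)%R).
{ apply (Rmult_le_compat_l (exp x)) in H2; [|lra]; rewrite Rinv_r in H2; lra. }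
nra.
Qed.

Lemma is_Cderive_Cexp (z : C) : is_Cderive Cexp z (Cexp z).
Proof.
assert (Hq : forall h, (Cmod h <= / 2)%R -> (Cmod (Cexp h - 1 - h) <= 12 * Cmod h ^ 2)%R).
{ intros [x y] Hh; set (m := Cmod (x, y)) in *.
  assert (Hx : (Rabs x <= m)%R) by apply (re_le_Cmod (x, y)).
  assert (Hy : (Rabs y <= m)%R) by apply (im_le_Cmod (x, y)).
  pose proof (Rabs_pos x); pose proof (Rabs_pos y).
  assert (He := exp_1_abs_le x ltac:(lra)).
  pose proof (cos_1_abs_le y) as Hc; pose proof (sin_id_abs_le y) as Hs.
  rewrite <- (pow2_abs x) in He; rewrite <- (pow2_abs y) in Hc, Hs.
  eapply Rle_trans; [apply Cmod_le_Re_Im|].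
  assert (E1 : Re (Cexp (x, y) - 1 - (x, y)) =
    ((exp x - 1 - x) * cos y + (1 + x) * (cos y - 1))%R)
    by (unfold Cexp, RtoC; simpl; ring).
  assert (E2 : Im (Cexp (x, y) - 1 - (x, y)) =
    ((1 + (exp x - 1)) * (sin y - y) + ((exp x - 1 - x) + x) * y)%R)
    by (unfold Cexp, RtoC; simpl; ring).
  rewrite E1, E2; clear E1 E2.
  pose proof (COS_bound y).
  assert (Hc1 : (Rabs (cos y) <= 1)%R) by (apply Rabs_le; lra).
  assert (Hx1 : (Rabs (1 + x) <= 2)%R)
    by (eapply Rle_trans; [apply Rabs_triang|]; rewrite Rabs_R1; lra).
  assert (He1 : (Rabs (exp x - 1) <= 1)%R).
  { replace (exp x - 1)%R with ((exp x - 1 - x) + x)%R by ring.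
    eapply Rle_trans; [apply Rabs_triang|]; nra. }
  assert (He2 : (Rabs (1 + (exp x - 1)) <= 2)%R)
    by (eapply Rle_trans; [apply Rabs_triang|]; rewrite Rabs_R1; lra).
  assert (He3 : (Rabs (exp x - 1 - x + x) <= 2 * Rabs x)%R)
    by (eapply Rle_trans; [apply Rabs_triang|]; nra).
  assert (B1 : (Rabs ((exp x - 1 - x) * cos y + (1 + x) * (cos y - 1)) <= 2 * m ^ 2 + m ^ 2)%R).
  { eapply Rle_trans; [apply Rabs_triang|]; rewrite !Rabs_mult.
    apply Rplus_le_compat.
    - pose proof (Rabs_pos (exp x - 1 - x)); pose proof (Rabs_pos (cos y)); nra.
    - pose proof (Rabs_pos (cos y - 1)); pose proof (Rabs_pos (1 + x)); nra. }
  assert (B2 : (Rabs ((1 + (exp x - 1)) * (sin y - y) + (exp x - 1 - x + x) * y)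
           <= m ^ 2 + 2 * m ^ 2)%R).
  { eapply Rle_trans; [apply Rabs_triang|]; rewrite !Rabs_mult.
    apply Rplus_le_compat.
    - assert (Rabs (sin y - y) <= m ^ 2 / 2)%R by nra.
      pose proof (Rabs_pos (sin y - y)); pose proof (Rabs_pos (1 + (exp x - 1))); nra.
    - pose proof (Rabs_pos (exp x - 1 - x + x)); nra. }
  nra. }
apply is_Cderive_eps; intros eps He.
assert (Hz : (0 < Cmod (Cexp z))%R) by apply Cmod_gt_0, Cexp_neq_0.
exists (Rmin (/ 2) (eps / (12 * Cmod (Cexp z)))); split.
{ apply Rmin_glb_lt; [lra | apply Rdiv_lt_0_compat; lra]. }
intros u Hu.
assert (Hu1 : (Cmod (u - z) < / 2)%R) by (eapply Rlt_le_trans; [exact Hu | apply Rmin_l]).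
assert (Hu2 : (Cmod (u - z) < eps / (12 * Cmod (Cexp z)))%R)
  by (eapply Rlt_le_trans; [exact Hu | apply Rmin_r]).
replace u with (z + (u - z)) at 1 by ring; rewrite Cexp_plus.
replace (Cexp z * Cexp (u - z) - Cexp z - (u - z) * Cexp z)
  with (Cexp z * (Cexp (u - z) - 1 - (u - z))) by ring.
rewrite Cmod_mult; specialize (Hq (u - z) ltac:(lra)).
apply (Rmult_lt_compat_r (12 * Cmod (Cexp z))) in Hu2; [|lra].
replace (eps / (12 * Cmod (Cexp z)) * (12 * Cmod (Cexp z)))%R with eps in Hu2 by (field; lra).
pose proof (Cmod_ge_0 (u - z)).
apply Rle_trans with (Cmod (Cexp z) * (12 * Cmod (u - z) ^ 2))%R;
  [apply Rmult_le_compat_l; lra | nra].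
Qed.

Lemma qpar_Cmod (t : C) : Cmod (qpar t) = exp (- (2 * PI * Im t)).
Proof.
unfold qpar; rewrite Cmod_Cexp; f_equal; destruct t; unfold Ci, RtoC; simpl; ring.
Qed.

Lemma PI_pos : (0 < PI)%R.
Proof. exact PI_RGT_0. Qed.

Lemma qpar_lt_1 (t : C) : upper t -> (Cmod (qpar t) < 1)%R.
Proof.
intros H; rewrite qpar_Cmod, <- exp_0; apply exp_increasing.
pose proof PI_pos; unfold upper in H; nra.
Qed.

Definition twopii : C := RtoC (2 * PI) * Ci.

Lemma twopii_neq_0 : twopii <> 0.
Proof.
apply Cmod_gt_0; unfold twopii; rewrite Cmod_mult, Cmod_Ci, Cmod_R.
pose proof PI_pos; rewrite Rabs_pos_eq; lra.
Qed.

Lemma is_Cderive_Cexp_scal (k z : C) :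
  is_Cderive (fun t => Cexp (k * t)) z (k * Cexp (k * z)).
Proof.
apply (is_Cderive_comp Cexp (fun t => k * t)); [apply is_Cderive_Cexp|].
pose proof (is_Cderive_scal k _ z _ (is_Cderive_id z)) as H.
now rewrite Cmult_1_r in H.
Qed.

Lemma is_Cderive_qpar (t : C) : is_Cderive qpar t (twopii * qpar t).
Proof. exact (is_Cderive_Cexp_scal twopii t). Qed.

Lemma qpar_neq_0 (t : C) : qpar t <> 0.
Proof. apply Cexp_neq_0. Qed.

Lemma qpar_plus (a b : C) : qpar (a + b) = qpar a * qpar b.
Proof. unfold qpar; rewrite <- Cexp_plus; f_equal; ring. Qed.

Lemma qpar_1 : qpar 1 = 1.
Proof.
unfold qpar; rewrite Cmult_1_r, Cexp_imag, cos_2PI, sin_2PI; reflexivity.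
Qed.

Lemma qpar_scal (t : C) (n : nat) : qpar (RtoC (INR n) * t) = qpar t ^ n.
Proof. unfold qpar; rewrite Cexp_pow; f_equal; ring. Qed.

Lemma Copen_upper : Copen upper.
Proof.
intros z Hz; exists (Im z); split; [exact Hz|]; intros u Hu.
pose proof (im_le_Cmod (u - z)) as H; rewrite Im_minus in H.
assert (H1 : (Rabs (Im u - Im z) < Im z)%R) by lra.
apply Rabs_lt_between in H1; unfold upper; lra.
Qed.

Definition disk (z : C) : Prop := (Cmod z < 1)%R.

Lemma Copen_disk : Copen disk.
Proof.
intros z Hz; exists (1 - Cmod z)%R; unfold disk in *; split; [lra|]; intros u Hu.
pose proof (Cmod_triangle_rev u z); pose proof (Cmod_triangle (u - z) z) as H1.
replace (u - z + z) with u in H1 by ring; lra.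
Qed.

(** * Power series on the unit disk *)

Definition subexp (a : nat -> C) : Prop :=
  forall r : R, (0 < r < 1)%R -> exists M : R, forall n, (Cmod (a n) * r ^ n <= M)%R.

Definition PS (a : nat -> C) (z : C) : C := CSeries (fun n => a n * z ^ n).

Lemma subexp_le (a b : nat -> C) :
  (forall n, (Cmod (a n) <= Cmod (b n))%R) -> subexp b -> subexp a.
Proof.
intros H Hb r Hr; destruct (Hb r Hr) as [M HM]; exists M; intros n.
eapply Rle_trans; [apply Rmult_le_compat_r; [apply pow_le; lra | apply H] | apply HM].
Qed.

Lemma subexp_const (c : C) : subexp (fun _ => c).
Proof.
intros r Hr; exists (Cmod c); intros n.
assert (r ^ n <= 1)%R.
{ rewrite <- (pow1 n); apply pow_incr; lra. }
pose proof (Cmod_ge_0 c); nra.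
Qed.

Lemma subexp_scal (c : C) (a : nat -> C) : subexp a -> subexp (fun n => c * a n).
Proof.
intros H r Hr; destruct (H r Hr) as [M HM]; exists (Cmod c * M)%R; intros n.
rewrite Cmod_mult, Rmult_assoc; apply Rmult_le_compat_l; [apply Cmod_ge_0 | apply HM].
Qed.

Lemma INR_geom_bounded (r : R) : (0 < r < 1)%R ->
  exists M : R, forall n, (INR n * r ^ n <= M)%R.
Proof.
intros Hr; exists (/ (/ r - 1))%R; intros n.
assert (Hi : (1 < / r)%R).
{ rewrite <- Rinv_1; apply Rinv_lt_contravar; lra. }
pose proof (poly n (/ r - 1) ltac:(lra)) as H.
replace (1 + (/ r - 1))%R with (/ r)%R in H by ring; rewrite pow_inv in H.
assert (Hp : (0 < r ^ n)%R) by (apply pow_lt; lra).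
apply (Rmult_le_reg_r (/ r - 1)); [lra|]; rewrite Rinv_l by lra.
apply (Rmult_le_compat_r (r ^ n)) in H; [|lra]; rewrite Rinv_l in H by lra.
pose proof (pos_INR n); nra.
Qed.

Lemma subexp_INR_mult (a : nat -> C) : subexp a -> subexp (fun n => RtoC (INR n) * a n).
Proof.
intros H r Hr.
assert (Hs : (0 < sqrt r < 1)%R).
{ split; [apply sqrt_lt_R0; lra | rewrite <- sqrt_1; apply sqrt_lt_1; lra]. }
destruct (H (sqrt r) Hs) as [M HM]; destruct (INR_geom_bounded _ Hs) as [K HK].
exists (K * M)%R; intros n.
rewrite Cmod_mult, Cmod_RtoC_pos by apply pos_INR.
replace (INR n * Cmod (a n) * r ^ n)%R
  with ((INR n * sqrt r ^ n) * (Cmod (a n) * sqrt r ^ n))%R.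
- apply Rmult_le_compat; auto.
  + apply Rmult_le_pos; [apply pos_INR | apply pow_le; lra].
  + apply Rmult_le_pos; [apply Cmod_ge_0 | apply pow_le; lra].
- rewrite <- (sqrt_sqrt r) at 3 by lra; rewrite Rpow_mult_distr; ring.
Qed.

Lemma subexp_S (a : nat -> C) : subexp a -> subexp (fun n => a (S n)).
Proof.
intros H r Hr; destruct (H r Hr) as [M HM]; exists (M / r)%R; intros n.
specialize (HM (S n)); simpl in HM.
apply (Rmult_le_reg_r r); [lra|]; unfold Rdiv; rewrite (Rmult_assoc M), Rinv_l by lra; lra.
Qed.

Lemma subexp_pow (k : nat) : subexp (fun n => RtoC (INR n ^ k)).
Proof.
induction k as [|k IH]; [exact (subexp_const 1)|].
apply (subexp_le _ (fun n => RtoC (INR n) * RtoC (INR n ^ k))); [|now apply subexp_INR_mult].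
intros n; rewrite <- RtoC_mult; apply Rle_refl.
Qed.

Lemma subexp_summable (a : nat -> C) (r : R) :
  subexp a -> (0 <= r < 1)%R -> ex_series (fun n => (Cmod (a n) * r ^ n)%R).
Proof.
intros H Hr; set (p := ((1 + r) / 2)%R).
destruct (H p) as [M HM]; [unfold p; lra|].
apply (@ex_series_le R_AbsRing R_CompleteNormedModule _ (fun n => (M * (r / p) ^ n)%R)).
- intros n; change (Rabs (Cmod (a n) * r ^ n) <= M * (r / p) ^ n)%R.
  rewrite Rabs_pos_eq by (apply Rmult_le_pos; [apply Cmod_ge_0 | apply pow_le; lra]).
  replace (r ^ n)%R with (p ^ n * (r / p) ^ n)%R
    by (rewrite <- Rpow_mult_distr; f_equal; unfold p; field; lra).
  rewrite <- Rmult_assoc; apply Rmult_le_compat_r; [|apply HM].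
  apply pow_le; unfold p; apply Rmult_le_pos; [lra | apply Rlt_le, Rinv_0_lt_compat; lra].
- apply ex_series_geom_scal; rewrite Rabs_pos_eq.
  + apply (Rmult_lt_reg_r p); [unfold p; lra|]; unfold Rdiv; rewrite Rmult_assoc, Rinv_l;
      unfold p; lra.
  + apply Rmult_le_pos; [lra | apply Rlt_le, Rinv_0_lt_compat; unfold p; lra].
Qed.

Lemma PS_Cabs (a : nat -> C) (z : C) : subexp a -> disk z -> Cabs (fun n => a n * z ^ n).
Proof.
intros Ha Hz; apply (Cabs_le _ (fun n => (Cmod (a n) * Cmod z ^ n)%R)).
- intros n; rewrite Cmod_mult, Cmod_pow; lra.
- apply subexp_summable; [exact Ha | split; [apply Cmod_ge_0 | exact Hz]].
Qed.

Lemma PS_ext (a b : nat -> C) (z : C) : (forall n, a n = b n) -> PS a z = PS b z.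
Proof. intros H; apply CSeries_ext; intros; now rewrite H. Qed.

Lemma pow_taylor_bound (z u : C) (R0 : R) (n : nat) :
  (Cmod z <= R0)%R -> (Cmod u <= R0)%R ->
  (Cmod (u ^ n - z ^ n - (u - z) * (RtoC (INR n) * z ^ pred n)) * R0 ^ 2
     <= INR n ^ 2 * R0 ^ n * Cmod (u - z) ^ 2)%R.
Proof.
intros Hz Hu; pose proof (Cmod_ge_0 z) as Pz; pose proof (Cmod_ge_0 u) as Pu.
assert (HR : (0 <= R0)%R) by lra.
induction n as [|n IH].
- simpl (INR 0); replace (u ^ 0 - z ^ 0 - (u - z) * (0 * z ^ pred 0)) with (RtoC 0)
    by (simpl; ring); rewrite Cmod_0; lra.
- set (e := u ^ n - z ^ n - (u - z) * (RtoC (INR n) * z ^ pred n)) in *.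
  replace (u ^ S n - z ^ S n - (u - z) * (RtoC (INR (S n)) * z ^ pred (S n)))
    with (u * e + (u - z) ^ 2 * (RtoC (INR n) * z ^ pred n)).
  2:{ rewrite S_INR, RtoC_plus; unfold e; destruct n; simpl; ring. }
  eapply Rle_trans; [apply Rmult_le_compat_r; [apply pow_le, HR | apply Cmod_triangle]|].
  rewrite !Cmod_mult, !Cmod_pow, (Cmod_RtoC_pos (INR n)) by apply pos_INR.
  assert (H1 : (INR n * Cmod z ^ pred n * R0 ^ 2 <= INR n * (R0 * R0 ^ n))%R).
  { destruct n as [|n]; [simpl; lra|].
    replace (R0 * R0 ^ S n)%R with (R0 ^ n * R0 ^ 2)%R by (simpl; ring).
    rewrite Rmult_assoc; apply Rmult_le_compat_l; [apply pos_INR|].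
    apply Rmult_le_compat_r; [apply pow_le, HR | simpl; apply pow_incr; lra]. }
  assert (H2 : (Cmod u * (Cmod e * R0 ^ 2) <=
     R0 * (INR n ^ 2 * R0 ^ n * Cmod (u - z) ^ 2))%R).
  { apply Rmult_le_compat; auto.
    apply Rmult_le_pos; [apply Cmod_ge_0 | apply pow_le, HR]. }
  apply (Rmult_le_compat_l (Cmod (u - z) ^ 2)) in H1; [|apply pow_le, Cmod_ge_0].
  apply Rle_trans with (R0 * (INR n ^ 2 * R0 ^ n * Cmod (u - z) ^ 2) +
     Cmod (u - z) ^ 2 * (INR n * (R0 * R0 ^ n)))%R; [nra|].
  rewrite S_INR.
  replace ((INR n + 1) ^ 2 * R0 ^ S n * Cmod (u - z) ^ 2)%R
    with (R0 * R0 ^ n * Cmod (u - z) ^ 2 * (INR n ^ 2 + INR n + (INR n + 1)))%R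
    by (simpl; ring).
  replace (R0 * (INR n ^ 2 * R0 ^ n * Cmod (u - z) ^ 2) +
     Cmod (u - z) ^ 2 * (INR n * (R0 * R0 ^ n)))%R
    with (R0 * R0 ^ n * Cmod (u - z) ^ 2 * (INR n ^ 2 + INR n))%R by ring.
  apply Rmult_le_compat_l; [|pose proof (pos_INR n); lra].
  apply Rmult_le_pos; [apply Rmult_le_pos; [lra | apply pow_le, HR] | apply pow_le, Cmod_ge_0].
Qed.

Definition dcoef (a : nat -> C) (n : nat) : C := RtoC (INR (S n)) * a (S n).

Definition ncoef (a : nat -> C) (n : nat) : C := RtoC (INR n) * a n.

Lemma subexp_ncoef (a : nat -> C) : subexp a -> subexp (ncoef a).
Proof. exact (subexp_INR_mult a). Qed.

Lemma subexp_dcoef (a : nat -> C) : subexp a -> subexp (dcoef a).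
Proof. intros H; exact (subexp_S _ (subexp_ncoef a H)). Qed.

Lemma is_Cderive_PS (a : nat -> C) (z : C) :
  subexp a -> disk z -> is_Cderive (PS a) z (PS (dcoef a) z).
Proof.
intros Ha Hz; apply is_Cderive_eps; intros eps He.
set (R0 := ((1 + Cmod z) / 2)%R).
assert (HR : (Cmod z < R0 < 1)%R) by (unfold disk, R0 in *; lra).
pose proof (Cmod_ge_0 z) as Pz.
assert (Hn2 : subexp (fun n => RtoC (INR n) * (RtoC (INR n) * a n)))
  by (apply subexp_INR_mult, subexp_INR_mult, Ha).
pose proof (subexp_summable _ R0 Hn2 ltac:(lra)) as Hs.
set (b := fun n => (Cmod (RtoC (INR n) * (RtoC (INR n) * a n)) * R0 ^ n)%R) in *.
set (K := (Rabs (Series b) / R0 ^ 2 + 1)%R).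
assert (HK : (0 < K)%R).
{ unfold K; assert (0 <= Rabs (Series b) / R0 ^ 2)%R; [|lra].
  apply Rmult_le_pos; [apply Rabs_pos | apply Rlt_le, Rinv_0_lt_compat, pow_lt; lra]. }
exists (Rmin (R0 - Cmod z) (eps / K)); split.
{ apply Rmin_glb_lt; [lra | apply Rdiv_lt_0_compat; lra]. }
intros u Hu.
assert (Hu1 : (Cmod (u - z) < R0 - Cmod z)%R) by (eapply Rlt_le_trans; [exact Hu | apply Rmin_l]).
assert (Hu2 : (Cmod (u - z) < eps / K)%R) by (eapply Rlt_le_trans; [exact Hu | apply Rmin_r]).
assert (HuR : (Cmod u < R0)%R) by (pose proof (Cmod_triangle_rev u z); lra).
assert (Hdu : disk u) by (unfold disk; lra).
assert (Ed : CSeries (fun n => a n * (RtoC (INR n) * z ^ pred n)) = PS (dcoef a) z).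
{ rewrite CSeries_incr.
  - simpl (INR 0); unfold PS; rewrite (CSeries_ext _ (fun n => dcoef a n * z ^ n)); [ring|].
    intros n; unfold dcoef; simpl pred; ring.
  - apply Cabs_S; apply (Cabs_ext (fun n => dcoef a n * z ^ n)).
    + intros n; unfold dcoef; simpl pred; ring.
    + apply PS_Cabs; [now apply subexp_dcoef | exact Hz]. }
assert (Hd : Cabs (fun n => a n * (RtoC (INR n) * z ^ pred n))).
{ apply Cabs_S; apply (Cabs_ext (fun n => dcoef a n * z ^ n)).
  + intros n; unfold dcoef; simpl pred; ring.
  + apply PS_Cabs; [now apply subexp_dcoef | exact Hz]. }
pose proof (PS_Cabs a u Ha Hdu) as Cu; pose proof (PS_Cabs a z Ha Hz) as Cz.
rewrite <- Ed; unfold PS.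
rewrite <- CSeries_scal, <- CSeries_minus, <- CSeries_minus;
  auto using Cabs_minus, Cabs_scal.
rewrite (CSeries_ext _ (fun n =>
  a n * (u ^ n - z ^ n - (u - z) * (RtoC (INR n) * z ^ pred n)))) by (intros; ring).
assert (HR2 : (0 < R0 ^ 2)%R) by (apply pow_lt; lra).
eapply Rle_trans; [apply (CSeries_Cmod_le _ (fun n => (Cmod (u - z) ^ 2 / R0 ^ 2 * b n)%R))|].
- intros n; rewrite Cmod_mult; apply (Rmult_le_reg_r (R0 ^ 2)); [exact HR2|].
  replace (Cmod (u - z) ^ 2 / R0 ^ 2 * b n * R0 ^ 2)%R with (Cmod (u - z) ^ 2 * b n)%R
    by (field; lra).
  rewrite Rmult_assoc.
  eapply Rle_trans; [apply Rmult_le_compat_l; [apply Cmod_ge_0|];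
    apply (pow_taylor_bound z u R0 n); lra|].
  unfold b; rewrite !Cmod_mult, Cmod_RtoC_pos by apply pos_INR; apply Req_le; ring.
- now apply ex_series_scal_R.
- rewrite Series_scal_l.
  apply (Rmult_lt_compat_r K) in Hu2; [|exact HK].
  replace (eps / K * K)%R with eps in Hu2 by (field; lra).
  pose proof (Rle_abs (Series b)) as Hb; pose proof (Cmod_ge_0 (u - z)) as Pu.
  apply Rle_trans with (Cmod (u - z) ^ 2 * K)%R; [|nra].
  unfold K, Rdiv; rewrite Rmult_assoc; apply Rmult_le_compat_l; [apply pow_le; lra|].
  assert (Hi : (0 < / R0 ^ 2)%R) by (apply Rinv_0_lt_compat; lra); nra.
Qed.

Lemma smooth_PS (n : nat) : forall a, subexp a -> smooth disk n (PS a).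
Proof.
induction n as [|n IH]; intros a Ha.
- intros u Hu; exact (is_Cderive_cont _ _ _ (is_Cderive_PS a u Ha Hu)).
- exists (PS (dcoef a)); split; [intros; now apply is_Cderive_PS | apply IH, subexp_dcoef, Ha].
Qed.

Lemma PS_incr (a : nat -> C) (z : C) :
  subexp a -> disk z -> PS a z = a O + z * PS (fun n => a (S n)) z.
Proof.
intros Ha Hz; unfold PS; rewrite CSeries_incr by now apply PS_Cabs.
rewrite <- CSeries_scal by (apply (PS_Cabs (fun n => a (S n))); [now apply subexp_S | exact Hz]).
rewrite (CSeries_ext (fun n => z * (a (S n) * z ^ n)) (fun n => a (S n) * z ^ S n));
  [simpl; ring | intros; rewrite Cpow_S; ring].
Qed.

Lemma PS_ncoef (a : nat -> C) (z : C) :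
  subexp a -> disk z -> PS (ncoef a) z = z * PS (dcoef a) z.
Proof.
intros Ha Hz; rewrite PS_incr; [|now apply subexp_ncoef | exact Hz].
unfold ncoef at 1; simpl (INR 0).
rewrite (PS_ext (fun n => ncoef a (S n)) (dcoef a)) by reflexivity; ring.
Qed.

Lemma PS_at_0 (a : nat -> C) : subexp a -> PS a 0 = a O.
Proof.
intros Ha; rewrite PS_incr; [ring | exact Ha |].
unfold disk; rewrite Cmod_0; lra.
Qed.

Definition QS (a : nat -> C) (t : C) : C := PS a (qpar t).

Lemma is_Cderive_QS (a : nat -> C) (t : C) :
  subexp a -> upper t -> is_Cderive (QS a) t (twopii * QS (ncoef a) t).
Proof.
intros Ha Ht; unfold QS.
rewrite PS_ncoef; [|exact Ha | now apply qpar_lt_1].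
replace (twopii * (qpar t * PS (dcoef a) (qpar t)))
  with (twopii * qpar t * PS (dcoef a) (qpar t)) by ring.
apply (is_Cderive_comp (PS a) qpar); [|apply is_Cderive_qpar].
apply is_Cderive_PS; [exact Ha | now apply qpar_lt_1].
Qed.

Lemma smooth_QS (n : nat) : forall a, subexp a -> smooth upper n (QS a).
Proof.
induction n as [|n IH]; intros a Ha.
- intros u Hu; exact (is_Cderive_cont _ _ _ (is_Cderive_QS a u Ha Hu)).
- exists (fun t => twopii * QS (ncoef a) t); split; [intros; now apply is_Cderive_QS|].
  apply (smooth_scal upper Copen_upper), IH, subexp_ncoef, Ha.
Qed.

(** * Lambert series *)

Lemma CSeries_of_cvg (a : nat -> C) (l : C) : Ccvg (psum a) l -> CSeries a = l.
Proof.
intros H.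
assert (H1 : Ccvg (fun n => psum a (S n)) l).
{ apply (Ccvg_ext (fun n => psum a (n + 1)%nat)); [intros; now rewrite Nat.add_1_r|].
  exact (Ccvg_shift _ _ 1 H). }
apply Ceq; simpl; apply is_series_unique.
- change (is_lim_seq (sum_n (fun n => Re (a n))) (Re l)).
  apply (is_lim_seq_ext (fun n => Re (psum a (S n)))); [intros; apply psum_Re|].
  exact (Ccvg_Re _ _ H1).
- change (is_lim_seq (sum_n (fun n => Im (a n))) (Im l)).
  apply (is_lim_seq_ext (fun n => Im (psum a (S n)))); [intros; apply psum_Im|].
  exact (Ccvg_Im _ _ H1).
Qed.

Definition divs (N : nat) : list nat := filter (fun d => Nat.eqb (N mod d) 0) (seq 1 N).

Lemma Csum_ext (l : list nat) (f g : nat -> C) :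
  (forall d, In d l -> f d = g d) -> Csum l f = Csum l g.
Proof.
unfold Csum; induction l as [|d l IH]; intros H; [reflexivity|].
simpl; rewrite H, IH; auto with datatypes.
Qed.

Lemma Csum_app (l l' : list nat) (f : nat -> C) : Csum (l ++ l') f = Csum l f + Csum l' f.
Proof.
unfold Csum; induction l as [|d l IH]; [simpl; ring|].
simpl; rewrite IH; ring.
Qed.

Lemma Csum_scal (k : C) (l : list nat) (f : nat -> C) :
  Csum l (fun d => k * f d) = k * Csum l f.
Proof. unfold Csum; induction l as [|d l IH]; simpl; [ring | rewrite IH; ring]. Qed.

Lemma Csum_perm (l l' : list nat) (f : nat -> C) : Permutation l l' -> Csum l f = Csum l' f.
Proof.
unfold Csum; induction 1; simpl; [reflexivity | now rewrite IHPermutation | ring | congruence].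
Qed.

Lemma Csum_map (l : list nat) (p : nat -> nat) (f : nat -> C) :
  Csum (map p l) f = Csum l (fun d => f (p d)).
Proof. unfold Csum; now rewrite map_map. Qed.

Lemma psum_filter (p : nat -> bool) (g : nat -> C) (M : nat) :
  psum (fun n => if p (S n) then g (S n) else 0) M = Csum (filter p (seq 1 M)) g.
Proof.
induction M as [|M IH]; [reflexivity|].
rewrite seq_S, filter_app, Csum_app, psum_S, IH; f_equal; simpl.
destruct (p (S M)); unfold Csum; simpl; ring.
Qed.

Lemma divs_spec (N d : nat) : In d (divs N) <-> (1 <= d <= N)%nat /\ Nat.divide d N.
Proof.
unfold divs; rewrite filter_In, in_seq, Nat.eqb_eq; split.
- intros [H E]; split; [lia|]; now apply Nat.Lcm0.mod_divide.
- intros [H E]; split; [lia|]; now apply Nat.Lcm0.mod_divide.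
Qed.

Lemma divs_reverse (N : nat) (g : nat -> C) :
  Csum (divs N) (fun d => g (N / d)%nat) = Csum (divs N) g.
Proof.
rewrite <- (Csum_map (divs N) (fun d => (N / d)%nat)); apply Csum_perm.
assert (Hdiv : forall d, In d (divs N) -> (N / d * d = N)%nat).
{ intros d Hd; apply divs_spec in Hd; destruct Hd as [Hd [k Hk]].
  rewrite Hk at 1; rewrite Nat.div_mul by lia; now symmetry. }
assert (Hin : forall d, In d (divs N) -> In (N / d)%nat (divs N)).
{ intros d Hd; pose proof (Hdiv d Hd) as E; apply divs_spec in Hd; apply divs_spec.
  split; [|exists d; lia].
  destruct (N / d)%nat; nia. }
assert (Hinv : forall d, In d (divs N) -> (N / (N / d) = d)%nat).
{ intros d Hd; pose proof (Hdiv d Hd) as E; pose proof (Hin d Hd) as Hi.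
  apply divs_spec in Hi; rewrite <- E at 1; rewrite Nat.mul_comm, Nat.div_mul; lia. }
assert (Hnd : NoDup (divs N)) by (apply NoDup_filter, seq_NoDup).
apply NoDup_Permutation; [|exact Hnd|].
- apply NoDup_map_NoDup_ForallPairs; [|exact Hnd].
  intros a b Ha Hb E; rewrite <- (Hinv a Ha), E; now apply Hinv.
- intros d; rewrite in_map_iff; split.
  + intros [e [E He]]; subst d; auto.
  + intros Hd; exists (N / d)%nat; split; auto.
Qed.

Lemma RtoC_INR_sigma (k N : nat) :
  RtoC (INR (sigma k N)) = Csum (divs N) (fun d => RtoC (INR d ^ k)).
Proof.
unfold sigma; fold (divs N); unfold Csum; induction (divs N) as [|d l IH]; [reflexivity|].
simpl; rewrite plus_INR, RtoC_plus, IH, pow_INR; reflexivity.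
Qed.

Lemma sigma_le (k N : nat) : (sigma k N <= N * N ^ k)%nat.
Proof.
unfold sigma; fold (divs N).
assert (Hl : (length (divs N) <= N)%nat).
{ unfold divs; eapply Nat.le_trans; [apply filter_length_le|]; now rewrite length_seq. }
assert (H : forall l, (forall d, In d l -> (d <= N)%nat) ->
  (list_sum (map (fun d => d ^ k) l) <= length l * N ^ k)%nat).
{ induction l as [|d l IH]; intros Hd; [simpl; lia|].
  simpl; apply Nat.add_le_mono.
  - apply Nat.pow_le_mono_l; auto with datatypes.
  - apply IH; auto with datatypes. }
eapply Nat.le_trans; [apply H; intros d Hd; apply divs_spec in Hd; lia|].
now apply Nat.mul_le_mono_r.
Qed.

Lemma subexp_sigma (k : nat) : subexp (fun n => RtoC (INR (sigma k n))).
Proof.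
apply (subexp_le _ (fun n => RtoC (INR n ^ S k))); [|apply subexp_pow].
intros n; rewrite !Cmod_RtoC_pos by (auto using pos_INR, pow_le).
simpl; rewrite <- pow_INR, <- mult_INR; apply le_INR, sigma_le.
Qed.

Lemma pow_le_1_antitone (s : R) (n m : nat) :
  (0 <= s <= 1)%R -> (n <= m)%nat -> (s ^ m <= s ^ n)%R.
Proof.
intros Hs H; induction H as [|m H IH]; [lra|].
simpl; assert (0 <= s ^ m)%R by (apply pow_le; lra); nra.
Qed.

Lemma CSeries_multiples (g : nat -> C) (n : nat) :
  Cabs (fun N => if andb (1 <=? N)%nat (N mod S n =? 0)%nat then g N else 0) ->
  CSeries (fun k => g (S n * S k)%nat) =
  CSeries (fun N => if andb (1 <=? N)%nat (N mod S n =? 0)%nat then g N else 0).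
Proof.
set (a := fun N => if andb (1 <=? N)%nat (N mod S n =? 0)%nat then g N else 0).
intros Ha; apply CSeries_of_cvg.
assert (Hb : forall K i, (i <= n)%nat ->
  psum a (S (S n * K) + i) = psum a (S (S n * K))).
{ intros K; induction i as [|i IH]; intros Hi; [now rewrite Nat.add_0_r|].
  rewrite Nat.add_succ_r, psum_S, IH by lia.
  replace (a (S (S n * K) + i)%nat) with (RtoC 0); [ring|].
  unfold a.
  replace ((S (S n * K) + i) mod S n)%nat with (S i).
  - now destruct (1 <=? S (S n * K) + i)%nat.
  - replace (S (S n * K) + i)%nat with (S i + K * S n)%nat by lia.
    rewrite Nat.Div0.mod_add, Nat.mod_small; lia. }
assert (E : forall K, psum (fun k => g (S n * S k)%nat) K = psum a (S (S n * K))).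
{ induction K as [|K IH].
  - rewrite Nat.mul_0_r; simpl; unfold a; simpl; ring.
  - rewrite psum_S, IH, <- (Hb K n (le_n n)).
    replace (S (S n * S K)) with (S (S (S n * K) + n))%nat by lia.
    rewrite (psum_S a); f_equal; unfold a.
    replace (S (S n * K) + n)%nat with (S K * S n)%nat by lia.
    rewrite Nat.Div0.mod_mul, (Nat.mul_comm (S n)); reflexivity. }
intros eps He; destruct (CSeries_cvg a Ha eps He) as [N HN].
exists N; intros K HK; rewrite E; apply HN; nia.
Qed.

Section Lambert.
Context (h : nat -> nat -> C) (c : nat -> C) (q : C).
Hypothesis h_le : forall n N, (1 <= n <= N)%nat -> (Cmod (h n N) <= Cmod (c N))%R.
Hypothesis c_subexp : subexp c.
Hypothesis q_disk : disk q.

Let r (n N : nat) : C :=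
  if andb (1 <=? N)%nat (N mod S n =? 0)%nat then h (S n) N * q ^ N else 0.

Lemma lambert_r_le (n N : nat) :
  (Cmod (r n N) <= sqrt (Cmod q) ^ n * (Cmod (c N) * sqrt (Cmod q) ^ N))%R.
Proof using h_le q_disk.
set (s := sqrt (Cmod q)).
assert (Hs : (0 <= s <= 1)%R).
{ split; [apply sqrt_pos|]; rewrite <- sqrt_1; apply sqrt_le_1_alt, Rlt_le, q_disk. }
assert (Hp : forall k, (0 <= s ^ k)%R) by (intros; apply pow_le; lra).
unfold r; destruct (1 <=? N)%nat eqn:E1; destruct (N mod S n =? 0)%nat eqn:E2; simpl;
  try (rewrite Cmod_0; apply Rmult_le_pos; auto; apply Rmult_le_pos; auto using Cmod_ge_0; fail).
apply Nat.leb_le in E1; apply Nat.eqb_eq in E2.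
assert (Hn : (S n <= N)%nat).
{ apply Nat.Lcm0.mod_divide in E2; destruct E2 as [k Hk]; destruct k; nia. }
rewrite Cmod_mult, Cmod_pow.
replace (Cmod q) with (s * s)%R by (apply sqrt_sqrt, Cmod_ge_0).
rewrite Rpow_mult_distr.
assert (H1 : (s ^ N <= s ^ n)%R) by (apply pow_le_1_antitone; [exact Hs | lia]).
assert (H2 : (Cmod (h (S n) N) <= Cmod (c N))%R) by (apply h_le; lia).
pose proof (Cmod_ge_0 (h (S n) N)); pose proof (Hp N).
apply Rle_trans with (Cmod (c N) * (s ^ N * s ^ n))%R; [|apply Req_le; ring].
apply Rmult_le_compat; auto; [apply Rmult_le_pos; auto | now apply Rmult_le_compat_l].
Qed.

Lemma lambert_sqrt : (0 <= sqrt (Cmod q) < 1)%R.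
Proof using q_disk.
split; [apply sqrt_pos|]; rewrite <- sqrt_1; apply sqrt_lt_1_alt.
split; [apply Cmod_ge_0 | exact q_disk].
Qed.

Lemma lambert_exA : ex_series (fun n => (sqrt (Cmod q) ^ n)%R).
Proof using q_disk.
apply ex_series_geom; rewrite Rabs_pos_eq; apply lambert_sqrt.
Qed.

Lemma lambert_exB : ex_series (fun N => (Cmod (c N) * sqrt (Cmod q) ^ N)%R).
Proof using c_subexp q_disk. apply subexp_summable; [exact c_subexp | apply lambert_sqrt]. Qed.

Lemma lambert_row (n : nat) :
  CSeries (fun k => h (S n) (S n * S k)%nat * q ^ (S n * S k)) = CSeries (r n).
Proof using h_le c_subexp q_disk.
apply (CSeries_multiples (fun N => h (S n) N * q ^ N)).
apply (Cabs_le (r n) (fun N => (sqrt (Cmod q) ^ n * (Cmod (c N) * sqrt (Cmod q) ^ N))%R)).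
- apply lambert_r_le.
- apply ex_series_scal_R, lambert_exB.
Qed.

Lemma lambert_Cabs :
  Cabs (fun n => CSeries (fun k => h (S n) (S n * S k)%nat * q ^ (S n * S k))).
Proof using h_le c_subexp q_disk.
apply (Cabs_ext (fun n => CSeries (r n))); [intros; now rewrite lambert_row|].
exact (Cabs_iterated r _ _ lambert_r_le lambert_exA lambert_exB).
Qed.

Lemma lambert_sum :
  CSeries (fun n => CSeries (fun k => h (S n) (S n * S k)%nat * q ^ (S n * S k))) =
  PS (fun N => Csum (divs N) (fun d => h d N)) q.
Proof using h_le c_subexp q_disk.
rewrite (CSeries_ext _ (fun n => CSeries (r n))) by (intros; apply lambert_row).
rewrite (CSeries_fubini r _ _ lambert_r_le); [| |exact lambert_exA | exact lambert_exB].
2:{ intros n; apply Rmult_le_pos; [apply Cmod_ge_0 | apply pow_le, lambert_sqrt]. }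
apply CSeries_ext; intros N; apply CSeries_of_cvg.
assert (E : forall M, (N <= M)%nat -> psum (fun n => r n N) M =
  Csum (divs N) (fun d => h d N) * q ^ N).
{ intros M HM; induction HM as [|M HM IH].
  - unfold divs; rewrite <- (psum_filter (fun d => Nat.eqb (N mod d) 0)).
    rewrite Cmult_comm, <- psum_scal; apply psum_ext; intros k Hk; unfold r.
    replace (1 <=? N)%nat with true by (symmetry; apply Nat.leb_le; lia).
    rewrite Bool.andb_true_l; destruct (N mod S k =? 0)%nat; ring.
  - rewrite psum_S, IH.
    replace (r M N) with (RtoC 0); [ring|]; unfold r.
    destruct (1 <=? N)%nat eqn:E1; [|reflexivity]; apply Nat.leb_le in E1.
    rewrite Nat.mod_small by lia; destruct N; [lia | reflexivity]. }
intros eps He; exists N; intros M HM; rewrite E by exact HM.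
replace (Csum (divs N) (fun d => h d N) * q ^ N - Csum (divs N) (fun d => h d N) * q ^ N)
  with (RtoC 0) by ring.
rewrite Cmod_0; exact He.
Qed.

End Lambert.

(** * Power series of rational functions and of the logarithm *)

Lemma disk_1_minus (z : C) : disk z -> 1 - z <> 0.
Proof.
intros H E; assert (Ez : z = 1) by (replace z with (1 - (1 - z)) by ring; rewrite E; ring).
unfold disk in H; rewrite Ez, Cmod_1 in H; lra.
Qed.

Lemma disk_pow (q : C) (n : nat) : disk q -> disk (q ^ S n).
Proof.
unfold disk; intros H; rewrite Cmod_pow; simpl.
assert (Cmod q ^ n <= 1)%R.
{ rewrite <- (pow1 n); apply pow_incr; split; [apply Cmod_ge_0 | lra]. }
pose proof (Cmod_ge_0 q); assert (0 <= Cmod q ^ n)%R by (apply pow_le; lra); nra.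
Qed.

Lemma PS_geom (z : C) : disk z -> PS (fun _ => RtoC 1) z = / (1 - z).
Proof.
intros H; pose proof (PS_incr (fun _ => RtoC 1) z (subexp_const 1) H) as E.
simpl in E; pose proof (disk_1_minus z H) as Hz.
replace (PS (fun _ => RtoC 1) z)
  with ((PS (fun _ => RtoC 1) z - z * PS (fun _ => RtoC 1) z) / (1 - z)) by (field; exact Hz).
rewrite E at 1; field; exact Hz.
Qed.

Lemma PS_ncoef_closed (a : nat -> C) (F : C -> C) (z d : C) :
  subexp a -> (forall u, disk u -> PS a u = F u) -> disk z -> is_Cderive F z d ->
  PS (ncoef a) z = z * d.
Proof.
intros Ha HF Hz Hd; rewrite PS_ncoef by assumption; f_equal.
apply (is_Cderive_unique F z); [|exact Hd].
apply (is_Cderive_ext_near (PS a)); [|now apply is_Cderive_PS].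
exact (near_imp z disk _ HF (Copen_disk z Hz)).
Qed.

Definition vrat (z : C) : C := z / (1 - z) ^ 2.

Lemma is_Cderive_1_minus (z : C) : is_Cderive (fun u => 1 - u) z (- (1)).
Proof.
replace (- (1)) with (0 - 1) by ring.
exact (is_Cderive_minus _ _ z _ _ (is_Cderive_const 1 z) (is_Cderive_id z)).
Qed.

Lemma PS_id (z : C) : disk z -> PS (fun n => RtoC (INR n ^ 1)) z = vrat z.
Proof.
intros H; pose proof (disk_1_minus z H) as Hz.
rewrite (PS_ext _ (ncoef (fun _ => RtoC 1))).
2:{ intros n; unfold ncoef; rewrite pow_1; ring. }
rewrite (PS_ncoef_closed _ (fun u => / (1 - u)) z (- - (1) / (1 - z) ^ 2)); auto.
- unfold vrat; field; exact Hz.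
- apply subexp_const.
- exact PS_geom.
- apply (is_Cderive_inv (fun u => 1 - u)); [exact Hz | apply is_Cderive_1_minus].
Qed.

Lemma is_Cderive_div_1_minus_pow (F : C -> C) (z d : C) (n : nat) :
  1 - z <> 0 -> is_Cderive F z d ->
  is_Cderive (fun u => F u / (1 - u) ^ S n) z
    ((d * (1 - z) + RtoC (INR (S n)) * F z) / (1 - z) ^ S (S n)).
Proof.
intros Hz HF.
pose proof (is_Cderive_pow _ z _ (S n) (is_Cderive_1_minus z)) as Hp; simpl pred in Hp.
pose proof (is_Cderive_div F _ z d _ (Cpow_nz _ (S n) Hz) HF Hp) as H.
cbv beta in H.
replace ((d * (1 - z) ^ S n - F z * (RtoC (INR (S n)) * (1 - z) ^ n * - (1))) /
  ((1 - z) ^ S n) ^ 2)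
  with ((d * (1 - z) + RtoC (INR (S n)) * F z) / (1 - z) ^ S (S n)) in H; [exact H|].
rewrite !Cpow_S; field; repeat split; auto using Cpow_nz.
Qed.

Lemma PS_sq (z : C) : disk z -> PS (fun n => RtoC (INR n ^ 2)) z = z * (1 + z) / (1 - z) ^ 3.
Proof.
intros H; pose proof (disk_1_minus z H) as Hz.
rewrite (PS_ext _ (ncoef (fun n => RtoC (INR n ^ 1)))).
2:{ intros n; unfold ncoef; rewrite <- RtoC_mult; f_equal; simpl; ring. }
rewrite (PS_ncoef_closed _ (fun u => u / (1 - u) ^ 2) z
  ((1 * (1 - z) + RtoC (INR 2) * z) / (1 - z) ^ 3)); auto.
- simpl (INR 2); rewrite RtoC_plus; field; exact Hz.
- apply subexp_pow.
- exact PS_id.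
- exact (is_Cderive_div_1_minus_pow (fun u => u) z 1 1 Hz (is_Cderive_id z)).
Qed.

Lemma PS_cube (z : C) : disk z ->
  PS (fun n => RtoC (INR n ^ 3)) z = vrat z + RtoC 6 * vrat z ^ 2.
Proof.
intros H; pose proof (disk_1_minus z H) as Hz.
rewrite (PS_ext _ (ncoef (fun n => RtoC (INR n ^ 2)))).
2:{ intros n; unfold ncoef; rewrite <- RtoC_mult; f_equal; simpl; ring. }
rewrite (PS_ncoef_closed _ (fun u => u * (1 + u) / (1 - u) ^ 3) z
  (((1 * (1 + z) + z * (0 + 1)) * (1 - z) + RtoC (INR 3) * (z * (1 + z))) / (1 - z) ^ 4)); auto.
- unfold vrat; replace (INR 3) with 3%R by (simpl; ring); field; exact Hz.
- apply subexp_pow.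
- exact PS_sq.
- apply (is_Cderive_div_1_minus_pow (fun u => u * (1 + u)) z _ 2 Hz).
  apply (is_Cderive_mult (fun u => u) (fun u => 1 + u)); [apply is_Cderive_id|].
  apply (is_Cderive_plus (fun _ => RtoC 1)); [apply is_Cderive_const | apply is_Cderive_id].
Qed.

Definition log1m_coef (n : nat) : C := match n with O => 0 | S _ => RtoC (- / INR n) end.

Lemma subexp_log1m : subexp log1m_coef.
Proof.
apply (subexp_le _ (fun _ => RtoC 1)); [|apply subexp_const].
intros [|n]; rewrite Cmod_1; unfold log1m_coef; [rewrite Cmod_0; lra|].
rewrite Cmod_R, Rabs_Ropp, Rabs_pos_eq.
- rewrite <- Rinv_1; apply Rinv_le_contravar; [lra|].
  rewrite S_INR; pose proof (pos_INR n); lra.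
- apply Rlt_le, Rinv_0_lt_compat, lt_0_INR; lia.
Qed.

Lemma derive_0_const_disk (F : C -> C) :
  (forall u, disk u -> is_Cderive F u 0) -> forall z, disk z -> F z = F 0.
Proof.
intros H z Hz.
assert (H0 : (Cmod (F z - F 0) <= 0 * Cmod (z - 0))%R).
{ apply (mean_value_ineq F (fun _ => RtoC 0)); intros s Hs; split; [|rewrite Cmod_0; lra].
  apply H; unfold disk.
  pose proof (segment_ball 0 0 z 1 s) as Hb.
  replace (0 + RtoC s * (z - 0) - 0) with (0 + RtoC s * (z - 0)) in Hb by ring.
  apply Hb; [|replace (z - 0) with z by ring; exact Hz | exact Hs].
  replace (0 - 0) with (RtoC 0) by ring; rewrite Cmod_0; lra. }
rewrite Rmult_0_l in H0; pose proof (Cmod_ge_0 (F z - F 0)).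
assert (E : F z - F 0 = 0) by (apply Cmod_eq_0; lra).
replace (F z) with (F z - F 0 + F 0) by ring; rewrite E; ring.
Qed.

Lemma disk_0 : disk 0.
Proof. unfold disk; rewrite Cmod_0; lra. Qed.

Lemma Cexp_log1m (z : C) : disk z -> Cexp (PS log1m_coef z) = 1 - z.
Proof.
intros Hz.
set (F := fun u => Cexp (PS log1m_coef u) / (1 - u)).
assert (HF : F z = F 0).
{ apply derive_0_const_disk; [|exact Hz]; intros u Hu.
  pose proof (disk_1_minus u Hu) as Hu1.
  pose proof (is_Cderive_PS log1m_coef u subexp_log1m Hu) as Hd.
  assert (E : PS (dcoef log1m_coef) u = - / (1 - u)).
  { rewrite <- PS_geom by exact Hu; unfold PS.
    rewrite (CSeries_ext _ (fun n => (- (1)) * (1 * u ^ n))).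
    - rewrite CSeries_scal; [ring | exact (PS_Cabs (fun _ => RtoC 1) u (subexp_const 1) Hu)].
    - intros n; unfold dcoef, log1m_coef; rewrite <- RtoC_mult.
      replace (INR (S n) * - / INR (S n))%R with (-1)%R
        by (field; apply not_0_INR; lia); ring. }
  rewrite E in Hd.
  pose proof (is_Cderive_div _ _ u _ _ Hu1
    (is_Cderive_comp Cexp _ u _ _ (is_Cderive_Cexp _) Hd) (is_Cderive_1_minus u)) as H.
  cbv beta in H.
  match type of H with is_Cderive _ _ ?d => replace d with (RtoC 0) in H end; [exact H|].
  field; exact Hu1. }
unfold F in HF; rewrite PS_at_0 in HF by exact subexp_log1m; simpl in HF.
rewrite Cexp_0 in HF; pose proof (disk_1_minus z Hz) as Hz1.
replace (Cexp (PS log1m_coef z)) with (Cexp (PS log1m_coef z) / (1 - z) * (1 - z))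
  by (field; exact Hz1).
rewrite HF; field.
Qed.

(** * Fourier expansions of [eta] and of the Eisenstein series *)

Definition e2_coef (n : nat) : C :=
  match n with O => 1 | S _ => RtoC (- (24)) * RtoC (INR (sigma 1 n)) end.

Definition e4_coef (n : nat) : C :=
  match n with O => 1 | S _ => RtoC 240 * RtoC (INR (sigma 3 n)) end.

Definition E2 (t : C) : C := QS e2_coef t.

Lemma subexp_cons (x : C) (a : nat -> C) :
  subexp a -> subexp (fun n => match n with O => x | S _ => a n end).
Proof.
intros H r Hr; destruct (H r Hr) as [M HM]; exists (Rmax (Cmod x) M); intros [|n].
- simpl; rewrite Rmult_1_r; apply Rmax_l.
- eapply Rle_trans; [apply (HM (S n)) | apply Rmax_r].
Qed.

Lemma subexp_e2 : subexp e2_coef.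
Proof. exact (subexp_cons 1 _ (subexp_scal _ _ (subexp_sigma 1))). Qed.

Lemma subexp_e4 : subexp e4_coef.
Proof. exact (subexp_cons 1 _ (subexp_scal _ _ (subexp_sigma 3))). Qed.

Lemma PS_S_part (a : nat -> C) (z : C) :
  subexp a -> disk z -> PS a z = a O + CSeries (fun n => a (S n) * z ^ S n).
Proof.
intros Ha Hz; unfold PS; rewrite CSeries_incr by now apply PS_Cabs.
simpl (z ^ 0); ring.
Qed.

Lemma PS_sigma_S (k : nat) (z : C) : disk z ->
  PS (fun n => RtoC (INR (sigma k n))) z =
  CSeries (fun n => RtoC (INR (sigma k (S n))) * z ^ S n).
Proof.
intros Hz; rewrite PS_S_part; [|apply subexp_sigma | exact Hz].
change (sigma k 0) with O; simpl (INR 0); ring.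
Qed.

Lemma E4_QS (t : C) : upper t -> E4 t = QS e4_coef t.
Proof.
intros Ht; pose proof (qpar_lt_1 t Ht) as Hq; unfold E4, QS.
rewrite PS_S_part; [|exact subexp_e4 | exact Hq].
rewrite <- CSeries_scal.
- f_equal; apply CSeries_ext; intros n; unfold e4_coef; ring.
- apply (Cabs_S (fun n => RtoC (INR (sigma 3 n)) * qpar t ^ n)).
  apply (PS_Cabs (fun n => RtoC (INR (sigma 3 n)))); [apply subexp_sigma | exact Hq].
Qed.

Lemma lambert_pow (k : nat) (q : C) : disk q ->
  Cabs (fun n => PS (fun j => RtoC (INR j ^ S k)) (q ^ S n)) /\
  CSeries (fun n => PS (fun j => RtoC (INR j ^ S k)) (q ^ S n)) =
  PS (fun n => RtoC (INR (sigma (S k) n))) q.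
Proof.
intros Hq.
set (h := fun d N => RtoC (INR (N / d) ^ S k)).
assert (Hh : forall n N, (1 <= n <= N)%nat -> (Cmod (h n N) <= Cmod (RtoC (INR N ^ S k)))%R).
{ intros n N Hn; unfold h; rewrite !Cmod_RtoC_pos by (apply pow_le, pos_INR).
  apply pow_incr; split; [apply pos_INR | apply le_INR, Nat.Div0.div_le_upper_bound; nia]. }
assert (E : forall n, CSeries (fun j => h (S n) (S n * S j)%nat * q ^ (S n * S j)) =
  PS (fun j => RtoC (INR j ^ S k)) (q ^ S n)).
{ intros n; rewrite PS_S_part; [|apply subexp_pow | now apply disk_pow].
  simpl (INR 0); rewrite pow_i, Cplus_0_l by lia.
  apply CSeries_ext; intros j; unfold h.
  replace (S n * S j / S n)%nat with (S j)
    by (rewrite Nat.mul_comm, Nat.div_mul; lia).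
  now rewrite <- Cpow_mult_r. }
split.
- apply (Cabs_ext _ _ E).
  exact (lambert_Cabs h (fun N => RtoC (INR N ^ S k)) q Hh (subexp_pow (S k)) Hq).
- rewrite <- (CSeries_ext _ _ E).
  rewrite (lambert_sum h (fun N => RtoC (INR N ^ S k)) q Hh (subexp_pow (S k)) Hq).
  apply PS_ext; intros N; rewrite RtoC_INR_sigma; unfold h.
  exact (divs_reverse N (fun d => RtoC (INR d ^ S k))).
Qed.

Lemma E2_lambert (t : C) : upper t ->
  Cabs (fun n => vrat (qpar t ^ S n)) /\
  E2 t = 1 - RtoC 24 * CSeries (fun n => vrat (qpar t ^ S n)).
Proof.
intros Ht; pose proof (qpar_lt_1 t Ht) as Hq.
destruct (lambert_pow 0 (qpar t) Hq) as [H1 H2].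
assert (E : forall n, PS (fun j => RtoC (INR j ^ 1)) (qpar t ^ S n) = vrat (qpar t ^ S n))
  by (intros; apply PS_id; now apply disk_pow).
split; [exact (Cabs_ext _ _ E H1)|].
rewrite <- (CSeries_ext _ _ E), H2, PS_sigma_S by exact Hq.
unfold E2, QS; rewrite PS_S_part; [|exact subexp_e2 | exact Hq].
rewrite (CSeries_ext (fun n => e2_coef (S n) * qpar t ^ S n)
  (fun n => (- RtoC 24) * (RtoC (INR (sigma 1 (S n))) * qpar t ^ S n))).
- rewrite CSeries_scal; [unfold e2_coef; ring|].
  apply (Cabs_S (fun n => RtoC (INR (sigma 1 n)) * qpar t ^ n)).
  apply (PS_Cabs (fun n => RtoC (INR (sigma 1 n)))); [apply subexp_sigma | exact Hq].
- intros n; unfold e2_coef; rewrite RtoC_opp; ring.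
Qed.

Lemma E4_lambert (t : C) : upper t ->
  Cabs (fun n => vrat (qpar t ^ S n) + RtoC 6 * vrat (qpar t ^ S n) ^ 2) /\
  E4 t = 1 + RtoC 240 * CSeries (fun n =>
           vrat (qpar t ^ S n) + RtoC 6 * vrat (qpar t ^ S n) ^ 2).
Proof.
intros Ht; pose proof (qpar_lt_1 t Ht) as Hq.
destruct (lambert_pow 2 (qpar t) Hq) as [H1 H2].
assert (E : forall n, PS (fun j => RtoC (INR j ^ 3)) (qpar t ^ S n) =
   vrat (qpar t ^ S n) + RtoC 6 * vrat (qpar t ^ S n) ^ 2)
  by (intros; apply PS_cube; now apply disk_pow).
split; [exact (Cabs_ext _ _ E H1)|].
rewrite <- (CSeries_ext _ _ E), H2, PS_sigma_S by exact Hq; reflexivity.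
Qed.

Definition logeta_coef (n : nat) : C := RtoC (- (INR (sigma 1 n) / INR n)).

Lemma subexp_logeta : subexp logeta_coef.
Proof.
apply (subexp_le _ (fun n => RtoC (INR (sigma 1 n)))); [|apply subexp_sigma].
intros n; unfold logeta_coef; rewrite RtoC_opp, Cmod_opp.
destruct n as [|n]; [change (sigma 1 0) with O; unfold Rdiv; simpl; rewrite Rmult_0_l; lra|].
assert (H : (1 <= INR (S n))%R) by (rewrite S_INR; pose proof (pos_INR n); lra).
assert (Hi : (0 < / INR (S n) <= 1)%R).
{ split; [apply Rinv_0_lt_compat; lra | rewrite <- Rinv_1; apply Rinv_le_contravar; lra]. }
pose proof (pos_INR (sigma 1 (S n))).
rewrite !Cmod_RtoC_pos; [unfold Rdiv; nra | lra | unfold Rdiv; nra].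
Qed.

Lemma euler_product (q : C) : disk q ->
  Ccvg (fun N => Cprod (seq 1 N) (fun n => RtoC 1 - q ^ n)) (Cexp (PS logeta_coef q)).
Proof.
intros Hq.
set (h := fun d N => RtoC (- (INR d / INR N))).
assert (Hh : forall n N, (1 <= n <= N)%nat -> (Cmod (h n N) <= Cmod (RtoC 1))%R).
{ intros n N Hn; unfold h; rewrite Cmod_1, RtoC_opp, Cmod_opp, Cmod_RtoC_pos.
  - assert (0 < INR N)%R by (apply lt_0_INR; lia).
    apply (Rmult_le_reg_r (INR N)); [lra|]; unfold Rdiv.
    rewrite Rmult_assoc, Rinv_l, Rmult_1_l, Rmult_1_r by lra; apply le_INR; lia.
  - apply Rmult_le_pos; [apply pos_INR | apply Rlt_le, Rinv_0_lt_compat, lt_0_INR; lia]. }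
assert (E : forall n, CSeries (fun j => h (S n) (S n * S j)%nat * q ^ (S n * S j)) =
  PS log1m_coef (q ^ S n)).
{ intros n; rewrite PS_S_part; [|apply subexp_log1m | now apply disk_pow].
  unfold log1m_coef at 1; rewrite Cplus_0_l.
  apply CSeries_ext; intros j; rewrite Cpow_mult_r; f_equal; unfold h, log1m_coef.
  f_equal; rewrite mult_INR; field; split; apply not_0_INR; lia. }
assert (Hc : Ccvg (psum (fun n => PS log1m_coef (q ^ S n))) (PS logeta_coef q)).
{ replace (PS logeta_coef q) with (CSeries (fun n => PS log1m_coef (q ^ S n))).
  - apply CSeries_cvg, (Cabs_ext _ _ E).
    exact (lambert_Cabs h (fun _ => RtoC 1) q Hh (subexp_const 1) Hq).
  - rewrite <- (CSeries_ext _ _ E).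
    rewrite (lambert_sum h (fun _ => RtoC 1) q Hh (subexp_const 1) Hq).
    apply PS_ext; intros N; unfold logeta_coef, h.
    rewrite (Csum_ext _ _ (fun d => RtoC (- / INR N) * RtoC (INR d ^ 1))).
    + rewrite Csum_scal, <- RtoC_INR_sigma, <- RtoC_mult; f_equal; unfold Rdiv; ring.
    + intros d _; rewrite <- RtoC_mult; f_equal; unfold Rdiv; ring. }
apply (Ccvg_ext (fun N => Cexp (psum (fun n => PS log1m_coef (q ^ S n)) N))).
- induction n as [|n IH]; [exact Cexp_0|].
  rewrite psum_S, Cexp_plus, IH, Cexp_log1m by now apply disk_pow.
  rewrite seq_S; unfold Cprod; rewrite map_app, fold_right_app; simpl map.
  generalize (map (fun n => RtoC 1 - q ^ n) (seq 1 n)); intros l.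
  induction l as [|x l IHl]; simpl in *; [ring | rewrite <- IHl; ring].
- apply (Ccvg_comp Cexp); [|exact Hc].
  exact (is_Cderive_cont _ _ _ (is_Cderive_Cexp _)).
Qed.

Definition eta_log (t : C) : C := twopii / RtoC 24 * t + QS logeta_coef t.

Lemma eta_exp (t : C) : upper t -> eta t = Cexp (eta_log t).
Proof.
intros Ht; unfold eta, eta_log, QS.
rewrite (CLim_seq_unique _ _ (euler_product (qpar t) (qpar_lt_1 t Ht))), Cexp_plus.
do 2 f_equal; unfold twopii, Rdiv; rewrite RtoC_mult, RtoC_inv by lra; field.
Qed.

Lemma eta_neq_0 (t : C) : upper t -> eta t <> 0.
Proof. intros Ht; rewrite eta_exp by exact Ht; apply Cexp_neq_0. Qed.

Lemma E2_logeta (t : C) : upper t -> E2 t = 1 + RtoC 24 * QS (ncoef logeta_coef) t.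
Proof.
intros Ht; pose proof (qpar_lt_1 t Ht) as Hq; unfold E2, QS.
assert (Hs : subexp (ncoef logeta_coef)) by (apply subexp_ncoef, subexp_logeta).
rewrite !PS_S_part; try exact Hq; [|exact Hs | exact subexp_e2].
rewrite (CSeries_ext (fun n => e2_coef (S n) * qpar t ^ S n)
  (fun n => RtoC 24 * (ncoef logeta_coef (S n) * qpar t ^ S n))).
- rewrite CSeries_scal.
  + change (e2_coef 0) with (RtoC 1).
    change (ncoef logeta_coef 0) with (RtoC (INR 0) * logeta_coef 0); simpl (INR 0); ring.
  + apply (Cabs_S (fun n => ncoef logeta_coef n * qpar t ^ n)); now apply PS_Cabs.
- intros n; unfold e2_coef, ncoef, logeta_coef.
  replace (- (INR (sigma 1 (S n)) / INR (S n)))%R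
    with (/ INR (S n) * - INR (sigma 1 (S n)))%R by (unfold Rdiv; ring).
  rewrite RtoC_mult, RtoC_inv, !RtoC_opp by (apply not_0_INR; lia).
  field; intros E; apply (not_0_INR (S n)); [lia | now apply RtoC_inj].
Qed.

Lemma is_Cderive_eta (t : C) : upper t ->
  is_Cderive eta t (twopii / RtoC 24 * E2 t * eta t).
Proof.
intros Ht.
apply (is_Cderive_ext_near (fun u => Cexp (eta_log u))).
{ apply (near_imp t upper); [intros u Hu; symmetry; now apply eta_exp | now apply Copen_upper]. }
rewrite eta_exp by exact Ht.
apply (is_Cderive_comp Cexp eta_log); [apply is_Cderive_Cexp|].
rewrite E2_logeta by exact Ht.
replace (twopii / RtoC 24 * (1 + RtoC 24 * QS (ncoef logeta_coef) t))
  with (twopii / RtoC 24 * 1 + twopii * QS (ncoef logeta_coef) t) by field.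
apply is_Cderive_plus.
- apply is_Cderive_scal, is_Cderive_id.
- apply is_Cderive_QS; [exact subexp_logeta | exact Ht].
Qed.

(** * Partial fractions by repeated bisection *)

Lemma Ccvg_mult (u v : nat -> C) (a b : C) :
  Ccvg u a -> Ccvg v b -> Ccvg (fun n => u n * v n) (a * b).
Proof.
intros Hu Hv eps He.
pose proof (Cmod_ge_0 a) as Pa; pose proof (Cmod_ge_0 b) as Pb.
set (k := Rmin 1 (eps / (Cmod a + Cmod b + 2))).
assert (Hq : (0 < eps / (Cmod a + Cmod b + 2))%R) by (apply Rdiv_lt_0_compat; lra).
assert (Hk : (0 < k)%R) by (apply Rmin_glb_lt; lra).
assert (Hk1 : (k <= 1)%R) by apply Rmin_l.
assert (Hk2 : (k * (Cmod a + Cmod b + 2) <= eps)%R).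
{ assert (H : (k <= eps / (Cmod a + Cmod b + 2))%R) by apply Rmin_r.
  apply (Rmult_le_compat_r (Cmod a + Cmod b + 2)) in H; [|lra].
  replace (eps / (Cmod a + Cmod b + 2) * (Cmod a + Cmod b + 2))%R
    with eps in H by (field; lra); exact H. }
destruct (Hu k Hk) as [N HN]; destruct (Hv k Hk) as [M HM].
exists (N + M)%nat; intros n Hn.
specialize (HN n ltac:(lia)); specialize (HM n ltac:(lia)).
replace (u n * v n - a * b)
  with ((u n - a) * (v n - b) + a * (v n - b) + b * (u n - a)) by ring.
eapply Rle_lt_trans; [apply Cmod_triangle|].
eapply Rle_lt_trans; [apply Rplus_le_compat_r, Cmod_triangle|].
rewrite !Cmod_mult.
pose proof (Cmod_ge_0 (u n - a)); pose proof (Cmod_ge_0 (v n - b)); nra.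
Qed.

Lemma Ccvg_inv (u : nat -> C) (a : C) : a <> 0 -> Ccvg u a -> Ccvg (fun n => / u n) (/ a).
Proof.
intros Ha; apply (Ccvg_comp Cinv), (is_Cderive_cont _ _ _ (is_Cderive_Cinv a Ha)).
Qed.

Lemma psum_add (a : nat -> C) (n m : nat) :
  psum a (n + m) = psum a n + psum (fun k => a (n + k)%nat) m.
Proof.
induction m as [|m IH].
- rewrite Nat.add_0_r; simpl; ring.
- rewrite Nat.add_succ_r, !psum_S, IH; ring.
Qed.

Lemma psum_rev (h : nat -> C) (M : nat) :
  psum (fun j => h (M - j)%nat) M = psum (fun i => h (S i)) M.
Proof.
induction M as [|M IH]; [reflexivity|].
rewrite psum_shift, psum_S, Nat.sub_0_r.
rewrite (psum_ext _ (fun j => h (M - j)%nat)) by reflexivity.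
rewrite IH; ring.
Qed.

Lemma CSeries_cutoff (a : nat -> C) (M : nat) :
  CSeries (fun j => if (j <? M)%nat then a j else 0) = psum a M.
Proof.
apply CSeries_of_cvg; intros eps He; exists M; intros n Hn.
replace (psum (fun j => if (j <? M)%nat then a j else 0) n) with (psum a M).
- replace (psum a M - psum a M) with (RtoC 0) by ring; rewrite Cmod_0; exact He.
- replace n with (M + (n - M))%nat by lia; rewrite psum_add.
  rewrite (psum_ext (fun k => if (M + k <? M)%nat then a (M + k)%nat else 0)
    (fun _ => RtoC 0)).
  + rewrite psum_0, Cplus_0_r; apply psum_ext; intros k Hk.
    now replace (k <? M)%nat with true by (symmetry; apply Nat.ltb_lt; lia).
  + intros k _; now replace (M + k <? M)%nat with false by (symmetry; apply Nat.ltb_ge; lia).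
Qed.

Definition RN (n : nat) : C := RtoC (INR n).

Lemma RN_S (n : nat) : RN (S n) = RN n + 1.
Proof. unfold RN; rewrite S_INR, RtoC_plus; reflexivity. Qed.

Lemma RN_plus (n m : nat) : RN (n + m) = RN n + RN m.
Proof. unfold RN; rewrite plus_INR, RtoC_plus; reflexivity. Qed.

Lemma RN_S_neq_0 (n : nat) : RN (S n) <> 0.
Proof. intros E; apply RtoC_inj in E; revert E; apply not_0_INR; lia. Qed.

Definition pw (k : nat) : C := RN (2 ^ k).

Lemma pw_S (k : nat) : pw (S k) = 2 * pw k.
Proof.
unfold pw; simpl; rewrite Nat.add_0_r, RN_plus; ring.
Qed.

Lemma pow2_pos (k : nat) : (1 <= INR (2 ^ k))%R.
Proof.
replace 1%R with (INR 1) by reflexivity; apply le_INR.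
pose proof (Nat.pow_nonzero 2 k); lia.
Qed.

Lemma pw_neq_0 (k : nat) : pw k <> 0.
Proof. intros E; apply RtoC_inj in E; pose proof (pow2_pos k); lra. Qed.

Lemma Cmod_pw (k : nat) : Cmod (pw k) = INR (2 ^ k).
Proof. unfold pw, RN; apply Cmod_RtoC_pos, pos_INR. Qed.

Lemma Im_div_pw (z : C) (k : nat) : Im (z / pw k) = (Im z / INR (2 ^ k))%R.
Proof.
unfold pw, RN, Cdiv; rewrite <- RtoC_inv by (pose proof (pow2_pos k); lra).
destruct z; simpl; unfold Rdiv; ring.
Qed.

Lemma qpar_RN (z : C) (j : nat) : qpar (z + RN j) = qpar z.
Proof.
induction j as [|j IH].
- unfold RN; simpl (INR 0); now rewrite Cplus_0_r.
- rewrite RN_S, Cplus_assoc, qpar_plus, IH, qpar_1; ring.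
Qed.

Lemma qpar_RN_minus (z : C) (j : nat) : qpar (z - RN j) = qpar z.
Proof. rewrite <- (qpar_RN (z - RN j) j); f_equal; ring. Qed.

Lemma qpar_0 : qpar 0 = 1.
Proof. unfold qpar; rewrite Cmult_0_r; exact Cexp_0. Qed.

Lemma qpar_half : qpar (RtoC (/ 2)) = - (1).
Proof.
unfold qpar; replace (RtoC (2 * PI) * Ci * RtoC (/ 2)) with (RtoC PI * Ci).
- rewrite Cexp_imag, cos_PI, sin_PI; unfold RtoC, Copp; simpl; f_equal; ring.
- replace PI with (2 * PI * / 2)%R at 1 by field; rewrite RtoC_mult; ring.
Qed.

Definition off_integers (z : C) : Prop := (0 <= Im z)%R /\ qpar z <> 1.

Lemma off_integers_upper (z : C) : upper z -> off_integers z.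
Proof.
intros H; split; [unfold upper in H; lra|].
intros E; apply qpar_lt_1 in H; rewrite E, Cmod_1 in H; lra.
Qed.

Lemma off_integers_plus (z : C) (j : nat) : off_integers z -> off_integers (z + RN j).
Proof.
intros [H1 H2]; split; [|now rewrite qpar_RN].
destruct z; unfold RN, RtoC in *; simpl in *; lra.
Qed.

Lemma off_integers_minus (z : C) (j : nat) : off_integers z -> off_integers (z - RN j).
Proof.
intros [H1 H2]; split; [|now rewrite qpar_RN_minus].
destruct z; unfold RN, RtoC in *; simpl in *; lra.
Qed.

Lemma off_integers_neq_0 (z : C) : off_integers z -> z <> 0.
Proof. intros [_ H] E; apply H; rewrite E; exact qpar_0. Qed.

Lemma qpar_pw (z : C) (k : nat) : qpar (z / pw k) ^ (2 ^ k) = qpar z.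
Proof. rewrite <- qpar_scal; f_equal; fold (RN (2 ^ k)); fold (pw k); field; apply pw_neq_0. Qed.

Lemma off_integers_pw (z : C) (k : nat) : off_integers z -> off_integers (z / pw k).
Proof.
intros [H1 H2]; split.
- rewrite Im_div_pw; apply Rmult_le_pos; [exact H1|].
  apply Rlt_le, Rinv_0_lt_compat; pose proof (pow2_pos k); lra.
- intros E; apply H2; rewrite <- (qpar_pw z k), E, Cpow_1_l; reflexivity.
Qed.

Section Bisection.
Context (f : C -> C) (e : nat) (c : C).
Hypothesis f_period : forall z, f (z + 1) = f z.
Hypothesis f_bisect : forall z, off_integers z ->
  2 ^ e * f z = f (z / 2) + f ((z + 1) / 2).
Hypothesis f_origin : forall z, off_integers z ->
  Ccvg (fun k => f (z / pw k) / pw k ^ e) (c / z ^ e).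

Lemma bisect_iter (z : C) (k : nat) : off_integers z ->
  pw k ^ e * f z = psum (fun j => f ((z + RN j) / pw k)) (2 ^ k).
Proof using f_bisect.
intros Hz; induction k as [|k IH].
- unfold pw; simpl; unfold RN; simpl (INR 1); simpl (INR 0).
  rewrite Cpow_1_l, Cplus_0_r; replace (z / 1) with z by field; ring.
- rewrite pw_S, Cpow_mult_l, <- Cmult_assoc, IH, <- psum_scal.
  replace (2 ^ S k)%nat with (2 ^ k + 2 ^ k)%nat by (simpl; lia).
  rewrite psum_add, <- psum_plus; apply psum_ext; intros j _.
  pose proof (pw_neq_0 k) as Hk.
  rewrite f_bisect by now apply off_integers_pw, off_integers_plus.
  f_equal; f_equal.
  + field; exact Hk.
  + rewrite RN_plus; fold (pw k); field; exact Hk.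
Qed.

Lemma bisect_sym (z : C) (k : nat) : off_integers z ->
  pw (S k) ^ e * f z = f (z / pw (S k))
    + psum (fun j => f ((z + RN (S j)) / pw (S k)) + f ((z - RN (S j)) / pw (S k)))
        (pred (2 ^ k))
    + f ((z - pw k) / pw (S k)).
Proof using f_period f_bisect.
intros Hz; rewrite bisect_iter by exact Hz.
pose proof (pw_neq_0 (S k)) as Hk.
replace (2 ^ S k)%nat with (2 ^ k + 2 ^ k)%nat by (simpl; lia).
rewrite psum_add.
rewrite (psum_ext (fun j => f ((z + RN (2 ^ k + j)) / pw (S k)))
  (fun j => f ((z - RN (2 ^ k - j)) / pw (S k)))).
2:{ intros j Hj; rewrite <- (f_period ((z - RN (2 ^ k - j)) / pw (S k))); f_equal.
    replace (RN (2 ^ k + j)) with (pw (S k) - RN (2 ^ k - j)); [field; exact Hk|].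
    rewrite RN_plus, pw_S; unfold pw, RN; rewrite (minus_INR _ j), RtoC_minus by lia; ring. }
rewrite (psum_rev (fun i => f ((z - RN i) / pw (S k)))).
replace (pw k) with (RN (2 ^ k)) by reflexivity.
assert (E : exists M, (2 ^ k = S M)%nat)
  by (exists (pred (2 ^ k)); pose proof (Nat.pow_nonzero 2 k); lia).
destruct E as [M E]; generalize (pw (S k)); intros w; rewrite E; simpl pred.
rewrite psum_shift, psum_S, psum_plus.
replace (z + RN 0) with z by (unfold RN; simpl (INR 0); ring); ring.
Qed.

Lemma bisect_partial_fractions (z : C) (b : nat -> R) (B : R) (k0 : nat) :
  off_integers z -> (1 <= e)%nat -> ex_series b ->
  (forall k j, (k0 <= k)%nat -> (S j < 2 ^ k)%nat ->
     (Cmod ((f ((z + RN (S j)) / pw (S k)) + f ((z - RN (S j)) / pw (S k))) / pw (S k) ^ e)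
       <= b j)%R) ->
  (forall j, (0 <= b j)%R) ->
  (forall k, (k0 <= k)%nat -> (Cmod (f ((z - pw k)/ pw (S k))) <= B)%R) ->
  Ccvg (psum (fun j => c / (z + RN (S j)) ^ e + c / (z - RN (S j)) ^ e)) (f z - c / z ^ e).
Proof using f_period f_bisect f_origin.
intros Hz He Hb Hdom Hb0 HB.
set (F := fun k j => (f ((z + RN (S j)) / pw (S k)) + f ((z - RN (S j)) / pw (S k)))
                     / pw (S k) ^ e).
set (T := fun k j => if (j <? pred (2 ^ (k + k0)))%nat then F (k + k0)%nat j else 0).
set (L := fun j => c / (z + RN (S j)) ^ e + c / (z - RN (S j)) ^ e).
assert (HT : forall k j, (Cmod (T k j) <= b j)%R).
{ intros k j; unfold T; destruct (j <? pred (2 ^ (k + k0)))%nat eqn:E.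
  - apply Nat.ltb_lt in E; apply Hdom; lia.
  - rewrite Cmod_0; apply Hb0. }
assert (HL : forall j, Ccvg (fun k => T k j) (L j)).
{ intros j.
  assert (H0 : Ccvg (fun k => F (k + k0)%nat j) (L j)).
  { apply (Ccvg_shift (fun k => F k j)); unfold F, L.
    apply (Ccvg_ext (fun k => f ((z + RN (S j)) / pw (S k)) / pw (S k) ^ e
                       + f ((z - RN (S j)) / pw (S k)) / pw (S k) ^ e)).
    { intros k; field; apply Cpow_nz, pw_neq_0. }
    apply Ccvg_plus.
    - apply (Ccvg_ext (fun k => f ((z + RN (S j)) / pw (k + 1)) / pw (k + 1) ^ e)).
      { intros; now rewrite Nat.add_1_r. }
      apply (Ccvg_shift (fun k => f ((z + RN (S j)) / pw k) / pw k ^ e)).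
      apply f_origin; now apply off_integers_plus.
    - apply (Ccvg_ext (fun k => f ((z - RN (S j)) / pw (k + 1)) / pw (k + 1) ^ e)).
      { intros; now rewrite Nat.add_1_r. }
      apply (Ccvg_shift (fun k => f ((z - RN (S j)) / pw k) / pw k ^ e)).
      apply f_origin; now apply off_integers_minus. }
  intros eps Heps; destruct (H0 eps Heps) as [N HN]; exists (N + S (S j))%nat; intros n Hn.
  unfold T; replace (j <? pred (2 ^ (n + k0)))%nat with true; [apply HN; lia|].
  symmetry; apply Nat.ltb_lt.
  pose proof (Nat.pow_gt_lin_r 2 (n + k0)); lia. }
pose proof (CSeries_dominated_cvg T L b HT Hb HL) as Hlim.
assert (HLb : forall j, (Cmod (L j) <= b j)%R)
  by (intros j; apply (Ccvg_Cmod_le (fun k => T k j)); auto).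
pose proof (CSeries_cvg L (Cabs_le L b HLb Hb)) as HcL.
replace (f z - c / z ^ e) with (CSeries L); [exact HcL|].
apply (Ccvg_unique _ _ _ Hlim).
apply (Ccvg_ext (fun k => f z - f (z / pw (S (k + k0))) / pw (S (k + k0)) ^ e
  - f ((z - pw (k + k0)) / pw (S (k + k0))) / pw (S (k + k0)) ^ e)).
{ intros k; unfold T; rewrite (CSeries_cutoff (F (k + k0)%nat)).
  pose proof (Cpow_nz _ e (pw_neq_0 (S (k + k0)))) as Hp.
  unfold F, Cdiv; rewrite (psum_ext _ (fun j => / pw (S (k + k0)) ^ e *
    (f ((z + RN (S j)) / pw (S (k + k0))) + f ((z - RN (S j)) / pw (S (k + k0))))))
    by (intros; unfold Cdiv; ring).
  rewrite psum_scal.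
  pose proof (bisect_sym z (k + k0) Hz) as E.
  replace (f z) with (/ pw (S (k + k0)) ^ e * (pw (S (k + k0)) ^ e * f z)) by (field; exact Hp).
  rewrite E; unfold Cdiv; ring. }
replace (f z - c / z ^ e) with (f z - c / z ^ e - 0) by ring.
apply Ccvg_minus; [apply Ccvg_minus; [apply Ccvg_const|]|].
- apply (Ccvg_ext (fun k => f (z / pw (k + S k0)) / pw (k + S k0) ^ e)).
  { intros; now rewrite Nat.add_succ_r. }
  apply (Ccvg_shift (fun k => f (z / pw k) / pw k ^ e)), f_origin, Hz.
- apply (Ccvg_0_le _ (fun k => (Rabs B * / 2 ^ k)%R)).
  + intros k; rewrite Cmod_div by apply Cpow_nz, pw_neq_0.
    rewrite Cmod_pow, Cmod_pw; unfold Rdiv.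
    apply Rmult_le_compat; [apply Cmod_ge_0 | | | ].
    * apply Rlt_le, Rinv_0_lt_compat, pow_lt; pose proof (pow2_pos (S (k + k0))); lra.
    * eapply Rle_trans; [apply HB; lia | apply Rle_abs].
    * apply Rinv_le_contravar; [apply pow_lt; lra|].
      assert (H2 : (2 ^ k <= INR (2 ^ S (k + k0)))%R).
      { rewrite pow_INR; replace (INR 2) with 2%R by (simpl; ring).
        apply Rle_pow; [lra | lia]. }
      assert (H1 := pow2_pos (S (k + k0))).
      eapply Rle_trans; [exact H2|].
      rewrite <- (pow_1 (INR (2 ^ S (k + k0)))) at 1; apply Rle_pow; [exact H1 | exact He].
  + replace (Finite 0) with (Rbar_mult (Rabs B) 0) by (simpl; f_equal; ring).
    apply is_lim_seq_scal_l.
    apply (is_lim_seq_ext (fun k => (/ 2) ^ k)%R); [intros; now rewrite pow_inv|].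
    apply is_lim_seq_geom; rewrite Rabs_pos_eq; lra.
Qed.

End Bisection.

Lemma sin_sq_lower (t : R) :
  (0 <= t <= 3 * PI / 4)%R -> ((t / 2) ^ 2 * (1 + cos t) ^ 2 <= sin t ^ 2)%R.
Proof.
intros Ht; pose proof PI_pos.
assert (Hc2 : (0 <= cos (t / 2))%R) by (apply cos_ge_0; lra).
assert (Hs : (t / 2 * cos (t / 2) <= sin (t / 2))%R).
{ destruct (MVT_gen sin 0 (t / 2) cos) as [x [Hx E]].
  - intros x _; apply is_derive_Reals, derivable_pt_lim_sin.
  - intros x _; apply continuity_sin.
  - rewrite Rmin_left, Rmax_right in Hx by lra.
    rewrite sin_0, !Rminus_0_r in E; rewrite E, Rmult_comm.
    apply Rmult_le_compat_r; [lra|].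
    apply cos_decr_1; lra. }
assert (E1 : sin t = (2 * sin (t / 2) * cos (t / 2))%R).
{ rewrite <- sin_2a; f_equal; field. }
assert (E2 : cos t = (2 * cos (t / 2) * cos (t / 2) - 1)%R).
{ rewrite <- cos_2a_cos; f_equal; field. }
assert (H0 : (0 <= t / 2 * (1 + cos t))%R).
{ apply Rmult_le_pos; [lra|]; rewrite E2; nra. }
assert (H1 : (t / 2 * (1 + cos t) <= sin t)%R).
{ rewrite E1, E2; replace (1 + (2 * cos (t / 2) * cos (t / 2) - 1))%R
    with (2 * (cos (t / 2) * cos (t / 2)))%R by ring.
  apply (Rmult_le_compat_r (2 * cos (t / 2))) in Hs; [|lra]; lra. }
rewrite <- Rpow_mult_distr; apply pow_incr; lra.
Qed.

Lemma cos_3PI4_lower (t : R) : (0 <= t <= 3 * PI / 4)%R -> (29 / 100 <= 1 + cos t)%R.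
Proof.
intros Ht; pose proof PI_pos.
assert (H1 : (cos (3 * PI / 4) <= cos t)%R) by (apply cos_decr_1; lra).
replace (3 * PI / 4)%R with (PI - PI / 4)%R in H1 by field.
rewrite cos_minus, cos_PI, sin_PI, cos_PI4 in H1.
assert (Hs : (1 / sqrt 2 <= 71 / 100)%R).
{ assert (Hp : (0 < sqrt 2)%R) by (apply sqrt_lt_R0; lra).
  assert (E : (sqrt 2 * sqrt 2 = 2)%R) by (apply sqrt_sqrt; lra).
  apply (Rmult_le_reg_r (sqrt 2)); [exact Hp|]; unfold Rdiv at 1.
  rewrite Rmult_assoc, Rinv_l by lra; nra. }
lra.
Qed.

Definition low_const : R := (exp (- (PI / 2)) / 4)%R.

Lemma low_const_pos : (0 < low_const)%R.
Proof. unfold low_const; pose proof (exp_pos (- (PI / 2))); lra. Qed.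

Lemma qpar_minus_1_lower (w : C) :
  (Rabs (Re w) <= 3 / 4)%R -> (0 <= Im w <= / 4)%R ->
  (low_const * Cmod w <= Cmod (qpar w - 1))%R.
Proof.
destruct w as [x y]; simpl; intros Hx Hy; pose proof PI_pos as HP.
set (r := exp (- (2 * PI * y))); set (ep := exp (- (PI / 2))).
assert (Hr0 : (0 < r)%R) by apply exp_pos.
assert (Hep : (0 < ep)%R) by apply exp_pos.
assert (Hrep : (ep <= r)%R).
{ unfold ep, r; destruct (Req_dec (- (PI / 2)) (- (2 * PI * y))) as [E | E].
  - rewrite E; lra.
  - apply Rlt_le, exp_increasing; assert (2 * PI * y <= PI / 2)%R by nra; lra. }
assert (Hr1 : (r <= 1)%R).
{ pose proof (exp_ineq1_le (2 * PI * y)) as H; unfold r; rewrite exp_Ropp.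
  rewrite <- Rinv_1; apply Rinv_le_contravar; [lra|]; nra. }
assert (H1r : (2 * PI * y * r <= 1 - r)%R).
{ pose proof (exp_ineq1_le (2 * PI * y)) as H.
  apply (Rmult_le_compat_l r) in H; [|lra].
  unfold r at 2 in H; rewrite <- exp_plus in H.
  replace (- (2 * PI * y) + 2 * PI * y)%R with 0%R in H by ring; rewrite exp_0 in H; lra. }
assert (Eq : qpar (x, y) = (r * cos (2 * PI * x), r * sin (2 * PI * x))%R).
{ unfold qpar, Cexp, r.
  replace (Re (RtoC (2 * PI) * Ci * (x, y))) with (- (2 * PI * y))%R
    by (unfold RtoC, Ci; simpl; ring).
  replace (Im (RtoC (2 * PI) * Ci * (x, y))) with (2 * PI * x)%R
    by (unfold RtoC, Ci; simpl; ring).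
  unfold RtoC, Cmult; simpl; f_equal; ring. }
set (t := (PI * Rabs x)%R).
assert (Ht : (0 <= t <= 3 * PI / 4)%R) by (unfold t; pose proof (Rabs_pos x); nra).
assert (Est : (sin (PI * x) ^ 2 = sin t ^ 2)%R).
{ unfold t, Rabs; destruct (Rcase_abs x); [|reflexivity].
  replace (PI * - x)%R with (- (PI * x))%R by ring; rewrite sin_neg; ring. }
assert (E : (Cmod (qpar (x, y) - 1) ^ 2 = (1 - r) ^ 2 + 4 * r * sin t ^ 2)%R).
{ rewrite Cmod2_alt, Eq, <- Est; unfold RtoC; simpl.
  replace (2 * PI * x)%R with (2 * (PI * x))%R by ring.
  rewrite cos_2a_sin, sin_2a.
  pose proof (sin2_cos2 (PI * x)) as Hsc; unfold Rsqr in Hsc.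
  replace (cos (PI * x)) with (cos (PI * x)) by reflexivity.
  set (s := sin (PI * x)) in *; set (k := cos (PI * x)) in *.
  replace (k * k)%R with (1 - s * s)%R by lra.
  ring_simplify.
  replace (k ^ 2)%R with (1 - s ^ 2)%R by (simpl; lra); ring. }
pose proof (sin_sq_lower t Ht) as Hs; pose proof (cos_3PI4_lower t Ht) as Hc.
assert (Hs2 : ((PI * x) ^ 2 * (21 / 1000) <= sin t ^ 2)%R).
{ eapply Rle_trans; [|exact Hs].
  assert (Et : ((PI * x) ^ 2 = t ^ 2)%R).
  { unfold t; rewrite !Rpow_mult_distr, pow2_abs; reflexivity. }
  rewrite Et; assert (21 / 1000 * 4 <= (1 + cos t) ^ 2)%R by nra.
  pose proof (pow2_ge_0 t); nra. }
assert (HPI : (3 < PI)%R) by (pose proof PI2_3_2; lra).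
apply Rsqr_incr_0_var; [|apply Cmod_ge_0]; rewrite !Rsqr_pow2, E, Rpow_mult_distr, Cmod2_alt.
unfold low_const; fold ep; simpl Re; simpl Im.
assert (A1 : (2 * PI * y * ep <= 1 - r)%R).
{ eapply Rle_trans; [|exact H1r]; apply Rmult_le_compat_l; nra. }
assert (A2 : ((2 * PI * y * ep) ^ 2 <= (1 - r) ^ 2)%R) by (apply pow_incr; split; [apply Rmult_le_pos; nra | exact A1]).
assert (A3 : (ep ^ 2 * sin t ^ 2 <= r * sin t ^ 2)%R).
{ apply Rmult_le_compat_r; [apply pow2_ge_0|]; nra. }
assert (A4 : (ep ^ 2 * ((PI * x) ^ 2 * (21 / 1000)) <= ep ^ 2 * sin t ^ 2)%R).
{ apply Rmult_le_compat_l; [apply pow2_ge_0 | exact Hs2]. }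
assert (B1 : (9 * (ep * x) ^ 2 <= (ep * (PI * x)) ^ 2)%R).
{ replace ((ep * (PI * x)) ^ 2)%R with (PI ^ 2 * (ep * x) ^ 2)%R by ring.
  apply Rmult_le_compat_r; [apply pow2_ge_0 | nra]. }
assert (B2 : (9 * (ep * y) ^ 2 <= (ep * (PI * y)) ^ 2)%R).
{ replace ((ep * (PI * y)) ^ 2)%R with (PI ^ 2 * (ep * y) ^ 2)%R by ring.
  apply Rmult_le_compat_r; [apply pow2_ge_0 | nra]. }
pose proof (pow2_ge_0 (ep * x)); pose proof (pow2_ge_0 (ep * y)); nra.
Qed.

Lemma qpar_minus_1_upper (w : C) :
  (0 <= Im w)%R -> (Cmod (qpar w - 1) <= 2 * PI * Cmod w)%R.
Proof.
intros Hw; pose proof PI_pos.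
pose proof (mean_value_ineq qpar (fun u => twopii * qpar u) 0 w (2 * PI)) as H0.
rewrite qpar_0 in H0; replace (w - 0) with w in H0 by ring; apply H0.
intros s Hs; split; [apply is_Cderive_qpar|].
replace (0 + RtoC s * w) with (RtoC s * w) by ring.
rewrite Cmod_mult, qpar_Cmod; unfold twopii.
rewrite Cmod_mult, Cmod_Ci, Cmod_RtoC_pos by lra.
assert (Hi : (0 <= Im (RtoC s * w))%R) by (destruct w; unfold RtoC in *; simpl in *; nra).
assert (He : (exp (- (2 * PI * Im (RtoC s * w))) <= 1)%R).
{ rewrite exp_Ropp, <- Rinv_1; apply Rinv_le_contravar; [lra|].
  pose proof (exp_ineq1_le (2 * PI * Im (RtoC s * w))); nra. }
pose proof (exp_pos (- (2 * PI * Im (RtoC s * w)))); nra.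
Qed.

Lemma qpar_le_1 (w : C) : (0 <= Im w)%R -> (Cmod (qpar w) <= 1)%R.
Proof.
intros H; rewrite qpar_Cmod, exp_Ropp, <- Rinv_1; apply Rinv_le_contravar; [lra|].
pose proof PI_pos; pose proof (exp_ineq1_le (2 * PI * Im w)); nra.
Qed.

Lemma ex_series_eventually_le (a b : nat -> R) (N : nat) :
  (forall n, (N <= n)%nat -> (0 <= a n <= b n)%R) -> ex_series b -> ex_series a.
Proof.
intros H Hb; apply (ex_series_incr_n a N).
apply (@ex_series_le R_AbsRing R_CompleteNormedModule _ (fun k => b (N + k)%nat)).
- intros n; change (Rabs (a (N + n)%nat) <= b (N + n)%nat)%R.
  specialize (H (N + n)%nat ltac:(lia)); rewrite Rabs_pos_eq; lra.
- now apply (ex_series_incr_n b N).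
Qed.

Lemma ex_series_lattice (z : C) (e : nat) : (2 <= e)%nat ->
  ex_series (fun j => (/ Cmod (z + RN (S j)) ^ e)%R).
Proof.
intros He.
set (N := S (Z.to_nat (up (2 * Cmod z + 2)))).
assert (HN : (2 * Cmod z + 2 <= INR N)%R).
{ unfold N; rewrite S_INR, INR_IZR_INZ, Z2Nat.id.
  - destruct (archimed (2 * Cmod z + 2)); lra.
  - apply le_IZR; destruct (archimed (2 * Cmod z + 2)); pose proof (Cmod_ge_0 z); lra. }
apply (ex_series_eventually_le _ (fun j => (4 * / INR (S j) ^ 2)%R) N).
- intros j Hj; apply le_INR in Hj.
  assert (H1 : (INR (S j) / 2 <= Cmod (z + RN (S j)))%R).
  { pose proof (Cmod_triangle_rev (RN (S j)) (- z)) as H.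
    replace (RN (S j) - - z) with (z + RN (S j)) in H by ring.
    rewrite Cmod_opp in H; unfold RN at 1 in H; rewrite Cmod_RtoC_pos in H by apply pos_INR.
    rewrite S_INR in *; pose proof (Cmod_ge_0 z); lra. }
  pose proof (Cmod_ge_0 z).
  assert (H2 : (1 <= Cmod (z + RN (S j)))%R) by (rewrite S_INR in *; lra).
  assert (H3 : (0 < INR (S j))%R) by (rewrite S_INR in *; lra).
  split; [apply Rlt_le, Rinv_0_lt_compat, pow_lt; lra|].
  replace (4 * / INR (S j) ^ 2)%R with (/ (INR (S j) / 2) ^ 2)%R by (field; lra).
  apply Rinv_le_contravar; [apply pow_lt; lra|].
  apply Rle_trans with (Cmod (z + RN (S j)) ^ 2)%R.
  + apply pow_incr; lra.
  + apply Rle_pow; assumption.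
- apply ex_series_scal_R, ex_series_inv_sq.
Qed.

Lemma ex_series_lattice_minus (z : C) (e : nat) : (2 <= e)%nat ->
  ex_series (fun j => (/ Cmod (z - RN (S j)) ^ e)%R).
Proof.
intros He; apply (ex_series_ext (fun j => (/ Cmod (- z + RN (S j)) ^ e)%R)).
- intros j; do 2 f_equal; rewrite <- Cmod_opp; f_equal; ring.
- now apply ex_series_lattice.
Qed.

Lemma exists_pow2_ge (x : R) : exists k0, forall k, (k0 <= k)%nat -> (x <= INR (2 ^ S k))%R.
Proof.
exists (Z.to_nat (up (Rabs x))); intros k Hk.
assert (H : (Rabs x <= INR k)%R).
{ apply Rle_trans with (INR (Z.to_nat (up (Rabs x)))); [|now apply le_INR].
  rewrite INR_IZR_INZ, Z2Nat.id.
  - destruct (archimed (Rabs x)); lra.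
  - apply le_IZR; destruct (archimed (Rabs x)); pose proof (Rabs_pos x); lra. }
pose proof (Nat.pow_gt_lin_r 2 (S k) ltac:(lia)) as H2.
assert (H3 : (k <= 2 ^ S k)%nat) by lia; apply le_INR in H3.
pose proof (Rle_abs x); lra.
Qed.

Section BisectionBounds.
Context (z : C) (k : nat).
Hypothesis z_off : off_integers z.
Hypothesis k_large : (4 * Cmod z <= INR (2 ^ S k))%R.

Lemma bisect_small : (Cmod (z / pw (S k)) <= / 4)%R.
Proof using k_large.
rewrite Cmod_div, Cmod_pw by apply pw_neq_0; pose proof (pow2_pos (S k)).
apply (Rmult_le_reg_r (INR (2 ^ S k))); [lra|]; unfold Rdiv.
rewrite Rmult_assoc, Rinv_l by lra; lra.
Qed.

Lemma bisect_low (s : R) :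
  (Rabs s <= / 2)%R -> off_integers (z / pw (S k) + RtoC s) ->
  (low_const * Cmod (z / pw (S k) + RtoC s) <= Cmod (qpar (z / pw (S k) + RtoC s) - 1))%R.
Proof using k_large.
intros Hs [Hi _]; apply qpar_minus_1_lower.
- pose proof (re_le_Cmod (z / pw (S k))) as H; pose proof bisect_small.
  destruct (z / pw (S k)) as [x y]; unfold RtoC in *; simpl in *.
  eapply Rle_trans; [apply Rabs_triang|]; lra.
- pose proof (im_le_Cmod (z / pw (S k))) as H; pose proof bisect_small.
  destruct (z / pw (S k)) as [x y]; unfold RtoC in *; simpl in *.
  rewrite Rplus_0_r in *; rewrite Rabs_pos_eq in H; lra.
Qed.

Lemma bisect_shift_plus (j : nat) :
  (z + RN j) / pw (S k) = z / pw (S k) + RtoC (INR j / INR (2 ^ S k)).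
Proof using.
unfold Rdiv; rewrite RtoC_mult, RtoC_inv by (pose proof (pow2_pos (S k)); lra).
unfold pw, RN; field; apply pw_neq_0.
Qed.

Lemma bisect_shift_minus (j : nat) :
  (z - RN j) / pw (S k) = z / pw (S k) + RtoC (- (INR j / INR (2 ^ S k))).
Proof using.
unfold Rdiv; rewrite RtoC_opp, RtoC_mult, RtoC_inv by (pose proof (pow2_pos (S k)); lra).
unfold pw, RN; field; apply pw_neq_0.
Qed.

Lemma bisect_frac (j : nat) : (j <= 2 ^ k)%nat -> (Rabs (INR j / INR (2 ^ S k)) <= / 2)%R.
Proof using.
intros Hj; apply le_INR in Hj; pose proof (pow2_pos k); pose proof (pos_INR j).
replace (INR (2 ^ S k)) with (2 * INR (2 ^ k))%R
  by (simpl; rewrite !plus_INR; simpl; ring).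
rewrite Rabs_pos_eq; [|apply Rmult_le_pos; [lra | apply Rlt_le, Rinv_0_lt_compat; lra]].
apply (Rmult_le_reg_r (2 * INR (2 ^ k))); [lra|]; unfold Rdiv.
rewrite Rmult_assoc, Rinv_l by lra; lra.
Qed.

Lemma bisect_low_plus (j : nat) : (j <= 2 ^ k)%nat ->
  (low_const * Cmod ((z + RN j) / pw (S k)) <= Cmod (qpar ((z + RN j) / pw (S k)) - 1))%R.
Proof using k_large z_off.
intros Hj.
assert (Ho : off_integers ((z + RN j) / pw (S k)))
  by (now apply off_integers_pw, off_integers_plus).
rewrite bisect_shift_plus in *; apply bisect_low; [now apply bisect_frac | exact Ho].
Qed.

Lemma bisect_low_minus (j : nat) : (j <= 2 ^ k)%nat ->
  (low_const * Cmod ((z - RN j) / pw (S k)) <= Cmod (qpar ((z - RN j) / pw (S k)) - 1))%R.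
Proof using k_large z_off.
intros Hj.
assert (Ho : off_integers ((z - RN j) / pw (S k)))
  by (now apply off_integers_pw, off_integers_minus).
rewrite bisect_shift_minus in *; apply bisect_low; [|exact Ho].
rewrite Rabs_Ropp; now apply bisect_frac.
Qed.

Lemma bisect_end : (/ 4 <= Cmod ((z - pw k) / pw (S k)))%R.
Proof using k_large.
pose proof bisect_small.
replace ((z - pw k) / pw (S k)) with (z / pw (S k) - RtoC (/ 2)).
- pose proof (Cmod_triangle_rev (RtoC (/ 2)) (z / pw (S k))) as H1.
  rewrite Cmod_minus_sym, Cmod_RtoC_pos in H1 by lra; lra.
- rewrite pw_S, RtoC_inv by lra; field; apply pw_neq_0.
Qed.

End BisectionBounds.

Definition vz (z : C) : C := vrat (qpar z).
Definition cz (z : C) : C := (qpar z + 1) / (qpar z - 1).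
Definition fz (z : C) : C := vz z + RtoC 6 * vz z ^ 2.

Lemma qpar_plus_1 (z : C) : qpar (z + 1) = qpar z.
Proof. rewrite qpar_plus, qpar_1; ring. Qed.

Lemma qpar_half_sq (z : C) : qpar z = qpar (z / 2) ^ 2.
Proof. rewrite <- qpar_scal; f_equal; simpl (INR 2); rewrite RtoC_plus; field. Qed.

Lemma qpar_half_plus (z : C) : qpar ((z + 1) / 2) = - qpar (z / 2).
Proof.
replace ((z + 1) / 2) with (z / 2 + RtoC (/ 2)).
- rewrite qpar_plus, qpar_half; ring.
- rewrite RtoC_inv by lra; field.
Qed.

Lemma off_integers_halves (z : C) : off_integers z ->
  1 - qpar (z / 2) <> 0 /\ 1 + qpar (z / 2) <> 0 /\ 1 - qpar z <> 0.
Proof.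
intros [_ H]; rewrite (qpar_half_sq z) in *; set (q := qpar (z / 2)) in *.
repeat split; intros E; apply H.
- replace (q ^ 2) with (1 - (1 - q) * (1 + q)) by ring; rewrite E; ring.
- replace (q ^ 2) with (1 - (1 - q) * (1 + q)) by ring; rewrite E; ring.
- replace (q ^ 2) with (1 - (1 - q ^ 2)) by ring; rewrite E; ring.
Qed.

Lemma vz_bisect (z : C) : off_integers z -> 2 ^ 2 * vz z = vz (z / 2) + vz ((z + 1) / 2).
Proof.
intros H; destruct (off_integers_halves z H) as [H1 [H2 H3]].
unfold vz, vrat; rewrite qpar_half_plus, (qpar_half_sq z) in *.
set (q := qpar (z / 2)) in *.
replace (1 - - q) with (1 + q) by ring; field; auto.
Qed.

Lemma cz_bisect (z : C) : off_integers z -> 2 ^ 1 * cz z = cz (z / 2) + cz ((z + 1) / 2).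
Proof.
intros H; destruct (off_integers_halves z H) as [H1 [H2 H3]].
unfold cz; rewrite qpar_half_plus, (qpar_half_sq z) in *.
set (q := qpar (z / 2)) in *; field; repeat split.
- intros E; apply H2; replace (1 + q) with (- (- q - 1)) by ring; rewrite E; ring.
- intros E; apply H1; replace (1 - q) with (- (q - 1)) by ring; rewrite E; ring.
- intros E; apply H3; replace (1 - q ^ 2) with (- (q ^ 2 - 1)) by ring; rewrite E; ring.
Qed.

Lemma fz_bisect (z : C) : off_integers z -> 2 ^ 4 * fz z = fz (z / 2) + fz ((z + 1) / 2).
Proof.
intros H; destruct (off_integers_halves z H) as [H1 [H2 H3]].
unfold fz, vz, vrat; rewrite qpar_half_plus, (qpar_half_sq z) in *.
set (q := qpar (z / 2)) in *.
replace (1 - - q) with (1 + q) by ring; field; auto.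
Qed.

Lemma pw_inv_cvg (z : C) : Ccvg (fun k => z / pw k) 0.
Proof.
apply (Ccvg_0_le _ (fun k => (Cmod z * (/ 2) ^ k)%R)).
- intros k; rewrite Cmod_div, Cmod_pw, pow_INR by apply pw_neq_0.
  replace (INR 2) with 2%R by (simpl; ring); rewrite pow_inv; unfold Rdiv; lra.
- replace (Finite 0) with (Rbar_mult (Cmod z) 0) by (simpl; f_equal; ring).
  apply is_lim_seq_scal_l, is_lim_seq_geom; rewrite Rabs_pos_eq; lra.
Qed.

Lemma qpar_pw_cvg (z : C) : Ccvg (fun k => qpar (z / pw k)) 1.
Proof.
rewrite <- qpar_0; apply (Ccvg_comp qpar); [|apply pw_inv_cvg].
exact (is_Cderive_cont _ _ _ (is_Cderive_qpar 0)).
Qed.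

Lemma qpar_quot_cvg (z : C) : z <> 0 ->
  Ccvg (fun k => (qpar (z / pw k) - 1) * pw k) (twopii * z).
Proof.
intros Hz eps He; apply Cmod_gt_0 in Hz.
pose proof (is_Cderive_qpar 0) as Hd; rewrite is_Cderive_eps in Hd.
destruct (Hd (eps / (2 * Cmod z))%R) as [d [Hd0 H]]; [apply Rdiv_lt_0_compat; lra|].
destruct (pw_inv_cvg z d Hd0) as [N HN]; exists N; intros n Hn.
specialize (HN n Hn); specialize (H _ HN); rewrite qpar_0 in H.
replace (z / pw n - 0) with (z / pw n) in H by ring.
replace ((qpar (z / pw n) - 1) * pw n - twopii * z)
  with ((qpar (z / pw n) - 1 - z / pw n * (twopii * 1)) * pw n) by (field; apply pw_neq_0).
rewrite Cmod_mult.
assert (Hp : (0 < Cmod (pw n))%R) by apply Cmod_gt_0, pw_neq_0.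
rewrite Cmod_div in H by apply pw_neq_0.
apply (Rmult_le_compat_r (Cmod (pw n))) in H; [|lra].
replace (eps / (2 * Cmod z) * (Cmod z / Cmod (pw n)) * Cmod (pw n))%R with (eps / 2)%R in H
  by (field; lra); lra.
Qed.

Lemma vz_origin (z : C) : off_integers z ->
  Ccvg (fun k => vz (z / pw k) / pw k ^ 2) (/ twopii ^ 2 / z ^ 2).
Proof.
intros Hz; pose proof (off_integers_neq_0 z Hz) as Hz0.
pose proof (Cmult_neq_0 _ _ twopii_neq_0 Hz0) as Ht.
apply (Ccvg_ext (fun k => qpar (z / pw k) *
  (/ ((qpar (z / pw k) - 1) * pw k) * / ((qpar (z / pw k) - 1) * pw k)))).
{ intros k; unfold vz, vrat; pose proof (pw_neq_0 k).
  assert (Hk : qpar (z / pw k) - 1 <> 0)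
    by (apply Cminus_neq_0; now apply off_integers_pw).
  field; repeat split; auto.
  intros E; apply Hk; replace (qpar (z / pw k) - 1) with (- (1 - qpar (z / pw k))) by ring.
  rewrite E; ring. }
replace (/ twopii ^ 2 / z ^ 2) with (1 * (/ (twopii * z) * / (twopii * z)))
  by (field; auto using twopii_neq_0).
apply Ccvg_mult; [apply qpar_pw_cvg|].
apply Ccvg_mult; apply Ccvg_inv; auto; now apply qpar_quot_cvg.
Qed.

Lemma cz_origin (z : C) : off_integers z ->
  Ccvg (fun k => cz (z / pw k) / pw k ^ 1) (2 / twopii / z ^ 1).
Proof.
intros Hz; pose proof (off_integers_neq_0 z Hz) as Hz0.
pose proof (Cmult_neq_0 _ _ twopii_neq_0 Hz0) as Ht.
apply (Ccvg_ext (fun k => (qpar (z / pw k) + 1) *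
  / ((qpar (z / pw k) - 1) * pw k))).
{ intros k; unfold cz; pose proof (pw_neq_0 k).
  assert (Hk : qpar (z / pw k) - 1 <> 0)
    by (apply Cminus_neq_0; now apply off_integers_pw).
  field; repeat split; auto. }
replace (2 / twopii / z ^ 1) with ((1 + 1) * / (twopii * z))
  by (rewrite Cpow_1_r; field; auto using twopii_neq_0).
apply Ccvg_mult.
- apply Ccvg_plus; [apply qpar_pw_cvg | apply Ccvg_const].
- apply Ccvg_inv; auto; now apply qpar_quot_cvg.
Qed.

Lemma fz_origin (z : C) : off_integers z ->
  Ccvg (fun k => fz (z / pw k) / pw k ^ 4) (RtoC 6 / twopii ^ 4 / z ^ 4).
Proof.
intros Hz; pose proof (off_integers_neq_0 z Hz) as Hz0.
pose proof (vz_origin z Hz) as Hv.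
assert (H2 : Ccvg (fun k => / pw k ^ 2) 0).
{ pose proof (Ccvg_mult _ _ _ _ (pw_inv_cvg 1) (pw_inv_cvg 1)) as H.
  replace (0 * 0) with (RtoC 0) in H by ring; revert H; apply Ccvg_ext.
  intros k; field; apply pw_neq_0. }
apply (Ccvg_ext (fun k => vz (z / pw k) / pw k ^ 2 * / pw k ^ 2
  + RtoC 6 * (vz (z / pw k) / pw k ^ 2 * (vz (z / pw k) / pw k ^ 2)))).
{ intros k; unfold fz; field; apply pw_neq_0. }
replace (RtoC 6 / twopii ^ 4 / z ^ 4)
  with (/ twopii ^ 2 / z ^ 2 * 0 + RtoC 6 * (/ twopii ^ 2 / z ^ 2 * (/ twopii ^ 2 / z ^ 2)))
  by (field; auto using twopii_neq_0).
apply Ccvg_plus; [now apply Ccvg_mult|].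
apply (Ccvg_scal (RtoC 6)); now apply Ccvg_mult.
Qed.

Lemma vrat_bound (q : C) (d : R) :
  (Cmod q <= 1)%R -> (0 < d)%R -> (d <= Cmod (q - 1))%R -> (Cmod (vrat q) <= / d ^ 2)%R.
Proof.
intros Hq Hd H.
assert (Hn : 1 - q <> 0).
{ apply Cmod_gt_0; rewrite Cmod_minus_sym; lra. }
unfold vrat; rewrite Cmod_div, Cmod_pow by now apply Cpow_nz.
rewrite (Cmod_minus_sym 1 q).
assert (H2 : (/ Cmod (q - 1) ^ 2 <= / d ^ 2)%R).
{ apply Rinv_le_contravar; [apply pow_lt; lra | apply pow_incr; lra]. }
assert (H3 : (0 < / Cmod (q - 1) ^ 2)%R) by (apply Rinv_0_lt_compat, pow_lt; lra).
unfold Rdiv; pose proof (Cmod_ge_0 q); nra.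
Qed.

Lemma Cmod_pos_div_pw (z : C) (k : nat) : z <> 0 -> (0 < Cmod (z / pw k))%R.
Proof.
intros H; apply Cmod_gt_0; intros E; apply H.
replace z with (z / pw k * pw k) by (field; apply pw_neq_0); rewrite E; ring.
Qed.

Definition bnd (z : C) (e : nat) (j : nat) : R :=
  (/ Cmod (z + RN (S j)) ^ e + / Cmod (z - RN (S j)) ^ e)%R.

Lemma ex_series_bnd (z : C) (e : nat) : (2 <= e)%nat -> ex_series (bnd z e).
Proof.
intros He.
exact (ex_series_plus (fun j => (/ Cmod (z + RN (S j)) ^ e)%R)
  (fun j => (/ Cmod (z - RN (S j)) ^ e)%R) (ex_series_lattice z e He)
  (ex_series_lattice_minus z e He)).
Qed.

Section VzBounds.
Context (z : C) (k : nat).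
Hypothesis z_off : off_integers z.
Hypothesis k_large : (4 * Cmod z <= INR (2 ^ S k))%R.

Lemma vz_shift_bound (u : C) : off_integers u ->
  (low_const * Cmod (u / pw (S k)) <= Cmod (qpar (u / pw (S k)) - 1))%R ->
  (Cmod (vz (u / pw (S k)) / pw (S k) ^ 2) <= / low_const ^ 2 * / Cmod u ^ 2)%R.
Proof using.
intros Hu Hl; pose proof (off_integers_neq_0 u Hu) as Hu0.
pose proof low_const_pos as Hc; pose proof (Cmod_pos_div_pw u (S k) Hu0) as Hp.
rewrite Cmod_div, Cmod_pow by apply Cpow_nz, pw_neq_0.
assert (Hpw : (0 < Cmod (pw (S k)))%R) by apply Cmod_gt_0, pw_neq_0.
assert (Hpw2 : (0 < Cmod (pw (S k)) ^ 2)%R) by (apply pow_lt; lra).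
assert (Hq : (Cmod (qpar (u / pw (S k))) <= 1)%R)
  by apply qpar_le_1, (proj1 (off_integers_pw u (S k) Hu)).
pose proof (vrat_bound _ (low_const * Cmod (u / pw (S k))) Hq ltac:(nra) Hl) as Hv.
apply (Rmult_le_reg_r (Cmod (pw (S k)) ^ 2)); [exact Hpw2|]; unfold Rdiv.
rewrite Rmult_assoc, Rinv_l, Rmult_1_r by lra.
eapply Rle_trans; [exact Hv|]; apply Req_le.
rewrite Cmod_div by apply pw_neq_0.
assert (0 < Cmod u)%R by now apply Cmod_gt_0.
field; repeat split; lra.
Qed.

Lemma vz_pair_bound (j : nat) : (S j < 2 ^ k)%nat ->
  (Cmod ((vz ((z + RN (S j)) / pw (S k)) + vz ((z - RN (S j)) / pw (S k))) / pw (S k) ^ 2)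
   <= / low_const ^ 2 * bnd z 2 j)%R.
Proof using z_off k_large.
intros Hj.
replace ((vz ((z + RN (S j)) / pw (S k)) + vz ((z - RN (S j)) / pw (S k))) / pw (S k) ^ 2)
  with (vz ((z + RN (S j)) / pw (S k)) / pw (S k) ^ 2
        + vz ((z - RN (S j)) / pw (S k)) / pw (S k) ^ 2)
  by (field; apply pw_neq_0).
eapply Rle_trans; [apply Cmod_triangle|]; unfold bnd; rewrite Rmult_plus_distr_l.
apply Rplus_le_compat; apply vz_shift_bound.
- now apply off_integers_plus.
- apply bisect_low_plus; auto; lia.
- now apply off_integers_minus.
- apply bisect_low_minus; auto; lia.
Qed.

Lemma fz_shift_bound (u : C) : off_integers u ->
  (low_const * Cmod (u / pw (S k)) <= Cmod (qpar (u / pw (S k)) - 1))%R ->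
  (Cmod (fz (u / pw (S k)) / pw (S k) ^ 4)
   <= / low_const ^ 2 * / Cmod u ^ 2 + 6 * (/ low_const ^ 4 * / Cmod u ^ 4))%R.
Proof using.
intros Hu Hl; pose proof (vz_shift_bound u Hu Hl) as Hv.
pose proof (off_integers_neq_0 u Hu) as Hu0; pose proof low_const_pos as Hc.
assert (Hup : (0 < Cmod u)%R) by now apply Cmod_gt_0.
set (V := vz (u / pw (S k)) / pw (S k) ^ 2) in *.
set (X := (/ low_const ^ 2 * / Cmod u ^ 2)%R) in *.
replace (fz (u / pw (S k)) / pw (S k) ^ 4) with (V * / pw (S k) ^ 2 + RtoC 6 * (V * V))
  by (unfold V, fz; field; apply pw_neq_0).
replace (6 * (/ low_const ^ 4 * / Cmod u ^ 4))%R with (6 * (X * X))%R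
  by (unfold X; field; split; lra).
pose proof (Cmod_ge_0 V).
eapply Rle_trans; [apply Cmod_triangle|]; apply Rplus_le_compat.
- rewrite Cmod_mult, Cmod_inv, Cmod_pow, Cmod_pw by apply Cpow_nz, pw_neq_0.
  assert (Hi : (0 < / INR (2 ^ S k) ^ 2 <= 1)%R).
  { pose proof (pow2_pos (S k)); split; [apply Rinv_0_lt_compat, pow_lt; lra|].
    rewrite <- Rinv_1; apply Rinv_le_contravar; [lra|]; nra. }
  nra.
- rewrite !Cmod_mult, Cmod_RtoC_pos by lra; nra.
Qed.

Lemma fz_pair_bound (j : nat) : (S j < 2 ^ k)%nat ->
  (Cmod ((fz ((z + RN (S j)) / pw (S k)) + fz ((z - RN (S j)) / pw (S k))) / pw (S k) ^ 4)
   <= / low_const ^ 2 * bnd z 2 j + 6 * / low_const ^ 4 * bnd z 4 j)%R.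
Proof using z_off k_large.
intros Hj.
replace ((fz ((z + RN (S j)) / pw (S k)) + fz ((z - RN (S j)) / pw (S k))) / pw (S k) ^ 4)
  with (fz ((z + RN (S j)) / pw (S k)) / pw (S k) ^ 4
        + fz ((z - RN (S j)) / pw (S k)) / pw (S k) ^ 4)
  by (field; apply pw_neq_0).
eapply Rle_trans; [apply Cmod_triangle|]; unfold bnd.
assert (H1 := fz_shift_bound (z + RN (S j)) (off_integers_plus z _ z_off)
  (bisect_low_plus z k z_off k_large (S j) ltac:(lia))).
assert (H2 := fz_shift_bound (z - RN (S j)) (off_integers_minus z _ z_off)
  (bisect_low_minus z k z_off k_large (S j) ltac:(lia))).
lra.
Qed.

Lemma cz_pair_bound (j : nat) : (S j < 2 ^ k)%nat ->
  (Cmod ((cz ((z + RN (S j)) / pw (S k)) + cz ((z - RN (S j)) / pw (S k))) / pw (S k) ^ 1)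
   <= 8 * PI * Cmod z / low_const ^ 2 * bnd z 2 j)%R.
Proof using z_off k_large.
intros Hj; pose proof PI_pos as HP; pose proof low_const_pos as Hc.
pose proof (off_integers_plus z (S j) z_off) as Op.
pose proof (off_integers_minus z (S j) z_off) as Om.
pose proof (bisect_low_plus z k z_off k_large (S j) ltac:(lia)) as Lp.
pose proof (bisect_low_minus z k z_off k_large (S j) ltac:(lia)) as Lm.
set (P := z + RN (S j)) in *; set (M := z - RN (S j)) in *.
set (a := qpar (P / pw (S k))) in *; set (b := qpar (M / pw (S k))) in *.
assert (Ha : a - 1 <> 0) by (apply Cminus_neq_0; now apply off_integers_pw).
assert (Hb : b - 1 <> 0) by (apply Cminus_neq_0; now apply off_integers_pw).
pose proof (pw_neq_0 (S k)) as Hw.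
assert (Eab : a * b = qpar (2 * z / pw (S k))).
{ unfold a, b; rewrite <- qpar_plus; f_equal; unfold P, M; field; exact Hw. }
replace ((cz (P / pw (S k)) + cz (M / pw (S k))) / pw (S k) ^ 1)
  with (2 * (qpar (2 * z / pw (S k)) - 1) / ((a - 1) * (b - 1)) / pw (S k)).
2:{ unfold cz; fold a; fold b; rewrite <- Eab, Cpow_1_r; field; auto. }
assert (HPp : (0 < Cmod P)%R) by (apply Cmod_gt_0, off_integers_neq_0, Op).
assert (HMp : (0 < Cmod M)%R) by (apply Cmod_gt_0, off_integers_neq_0, Om).
rewrite !Cmod_div by (auto; now apply Cmult_neq_0).
rewrite !Cmod_mult, (Cmod_RtoC_pos 2) by lra.
assert (Hu : (Cmod (qpar (2 * z / pw (S k)) - 1) <= 2 * PI * (2 * Cmod z / Cmod (pw (S k))))%R).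
{ eapply Rle_trans; [apply qpar_minus_1_upper|].
  - rewrite Im_div_pw; destruct z_off as [Hi _]; pose proof (pow2_pos (S k)).
    apply Rmult_le_pos; [destruct z; unfold RtoC; simpl in *; lra|].
    apply Rlt_le, Rinv_0_lt_compat; lra.
  - rewrite Cmod_div, Cmod_mult, (Cmod_RtoC_pos 2) by (auto; lra); lra. }
rewrite Cmod_div in Lp, Lm by exact Hw.
set (W := Cmod (pw (S k))) in *.
assert (HW : (0 < W)%R) by now apply Cmod_gt_0.
assert (Hden : (low_const ^ 2 * (Cmod P * Cmod M) / W ^ 2 <= Cmod (a - 1) * Cmod (b - 1))%R).
{ replace (low_const ^ 2 * (Cmod P * Cmod M) / W ^ 2)%R
    with ((low_const * (Cmod P / W)) * (low_const * (Cmod M / W)))%R by (field; lra).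
  assert (0 < Cmod P / W)%R by (apply Rdiv_lt_0_compat; lra).
  assert (0 < Cmod M / W)%R by (apply Rdiv_lt_0_compat; lra).
  apply Rmult_le_compat; auto; nra. }
assert (Hdp : (0 < low_const ^ 2 * (Cmod P * Cmod M) / W ^ 2)%R).
{ apply Rdiv_lt_0_compat; [|apply pow_lt; lra].
  apply Rmult_lt_0_compat; [apply pow_lt; lra | nra]. }
assert (Hinv : (/ (Cmod (a - 1) * Cmod (b - 1)) <= / (low_const ^ 2 * (Cmod P * Cmod M) / W ^ 2))%R)
  by (apply Rinv_le_contravar; lra).
assert (Hinv0 : (0 < / (Cmod (a - 1) * Cmod (b - 1)))%R) by (apply Rinv_0_lt_compat; lra).
pose proof (Cmod_ge_0 (qpar (2 * z / pw (S k)) - 1)) as Hq0; pose proof (Cmod_ge_0 z) as Hz0.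
apply Rle_trans with (2 * (2 * PI * (2 * Cmod z / W)) *
   / (low_const ^ 2 * (Cmod P * Cmod M) / W ^ 2) / W)%R.
{ unfold Rdiv at 1 2; apply Rmult_le_compat_r; [apply Rlt_le, Rinv_0_lt_compat; lra|].
  apply Rmult_le_compat; lra. }
replace (2 * (2 * PI * (2 * Cmod z / W)) * / (low_const ^ 2 * (Cmod P * Cmod M) / W ^ 2) / W)%R
  with (8 * PI * Cmod z / low_const ^ 2 * (/ Cmod P * / Cmod M))%R
  by (field; repeat split; lra).
apply Rmult_le_compat_l.
{ apply Rmult_le_pos; [nra | apply Rlt_le, Rinv_0_lt_compat, pow_lt; lra]. }
unfold bnd; fold P; fold M; rewrite <- !pow_inv.
pose proof (pow2_ge_0 (/ Cmod P - / Cmod M)).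
assert (0 < / Cmod P)%R by (apply Rinv_0_lt_compat; lra).
assert (0 < / Cmod M)%R by (apply Rinv_0_lt_compat; lra); nra.
Qed.

Lemma bisect_end_qpar : (low_const / 4 <= Cmod (qpar ((z - pw k) / pw (S k)) - 1))%R.
Proof using z_off k_large.
pose proof (bisect_low_minus z k z_off k_large (2 ^ k) ltac:(lia)) as H.
fold (pw k) in H; pose proof (bisect_end z k k_large); pose proof low_const_pos; nra.
Qed.

Lemma bisect_end_im : (0 <= Im ((z - pw k) / pw (S k)))%R.
Proof using z_off.
exact (proj1 (off_integers_pw _ (S k) (off_integers_minus z (2 ^ k) z_off))).
Qed.

Lemma vz_end_bound : (Cmod (vz ((z - pw k) / pw (S k))) <= / (low_const / 4) ^ 2)%R.
Proof using z_off k_large.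
apply vrat_bound; [apply qpar_le_1, bisect_end_im | | apply bisect_end_qpar].
pose proof low_const_pos; lra.
Qed.

Lemma fz_end_bound : (Cmod (fz ((z - pw k) / pw (S k))) <=
  / (low_const / 4) ^ 2 + 6 * (/ (low_const / 4) ^ 2) ^ 2)%R.
Proof using z_off k_large.
pose proof vz_end_bound as H; unfold fz.
eapply Rle_trans; [apply Cmod_triangle|]; apply Rplus_le_compat; [exact H|].
rewrite Cmod_mult, Cmod_pow, Cmod_RtoC_pos by lra; apply Rmult_le_compat_l; [lra|].
apply pow_incr; split; [apply Cmod_ge_0 | exact H].
Qed.

Lemma cz_end_bound : (Cmod (cz ((z - pw k) / pw (S k))) <= 8 / low_const)%R.
Proof using z_off k_large.
pose proof bisect_end_qpar as H; pose proof low_const_pos as Hc; unfold cz.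
rewrite Cmod_div by (apply Cmod_gt_0; lra).
assert (Hn : (Cmod (qpar ((z - pw k) / pw (S k)) + 1) <= 2)%R).
{ eapply Rle_trans; [apply Cmod_triangle|]; rewrite Cmod_1.
  pose proof (qpar_le_1 _ bisect_end_im); lra. }
replace (8 / low_const)%R with (2 * / (low_const / 4))%R by (field; lra).
apply Rmult_le_compat; [apply Cmod_ge_0 | | exact Hn |].
- apply Rlt_le, Rinv_0_lt_compat; lra.
- apply Rinv_le_contravar; lra.
Qed.

End VzBounds.

Lemma bnd_pos (z : C) (e j : nat) : off_integers z -> (0 <= bnd z e j)%R.
Proof.
intros Hz; unfold bnd.
assert (0 < / Cmod (z + RN (S j)) ^ e)%R
  by (apply Rinv_0_lt_compat, pow_lt, Cmod_gt_0, off_integers_neq_0; now apply off_integers_plus).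
assert (0 < / Cmod (z - RN (S j)) ^ e)%R
  by (apply Rinv_0_lt_compat, pow_lt, Cmod_gt_0, off_integers_neq_0; now apply off_integers_minus).
lra.
Qed.

Lemma vz_partial_fractions (z : C) : off_integers z ->
  Ccvg (psum (fun j => / twopii ^ 2 / (z + RN (S j)) ^ 2 + / twopii ^ 2 / (z - RN (S j)) ^ 2))
    (vz z - / twopii ^ 2 / z ^ 2).
Proof.
intros Hz; destruct (exists_pow2_ge (4 * Cmod z)) as [k0 Hk0].
assert (Hc : (0 < / low_const ^ 2)%R) by (apply Rinv_0_lt_compat, pow_lt, low_const_pos).
apply (bisect_partial_fractions vz 2 (/ twopii ^ 2)) with
  (b := fun j => (/ low_const ^ 2 * bnd z 2 j)%R) (B := (/ (low_const / 4) ^ 2)%R) (k0 := k0).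
- intros u; unfold vz; now rewrite qpar_plus_1.
- exact vz_bisect.
- exact vz_origin.
- exact Hz.
- lia.
- apply ex_series_scal_R, ex_series_bnd; lia.
- intros k j Hk Hj; apply vz_pair_bound; auto.
- intros j; pose proof (bnd_pos z 2 j Hz); nra.
- intros k Hk; apply vz_end_bound; auto.
Qed.

Lemma cz_partial_fractions (z : C) : off_integers z ->
  Ccvg (psum (fun j => 2 / twopii / (z + RN (S j)) ^ 1 + 2 / twopii / (z - RN (S j)) ^ 1))
    (cz z - 2 / twopii / z ^ 1).
Proof.
intros Hz; destruct (exists_pow2_ge (4 * Cmod z)) as [k0 Hk0].
assert (Hc : (0 < / low_const ^ 2)%R) by (apply Rinv_0_lt_compat, pow_lt, low_const_pos).
apply (bisect_partial_fractions cz 1 (2 / twopii)) with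
  (b := fun j => (8 * PI * Cmod z / low_const ^ 2 * bnd z 2 j)%R)
  (B := (8 / low_const)%R) (k0 := k0).
- intros u; unfold cz; now rewrite qpar_plus_1.
- exact cz_bisect.
- exact cz_origin.
- exact Hz.
- lia.
- apply ex_series_scal_R, ex_series_bnd; lia.
- intros k j Hk Hj; apply cz_pair_bound; auto.
- intros j; pose proof (bnd_pos z 2 j Hz); pose proof PI_pos; pose proof (Cmod_ge_0 z).
  apply Rmult_le_pos; [|assumption]; unfold Rdiv; apply Rmult_le_pos; nra.
- intros k Hk; apply cz_end_bound; auto.
Qed.

Lemma fz_partial_fractions (z : C) : off_integers z ->
  Ccvg (psum (fun j => RtoC 6 / twopii ^ 4 / (z + RN (S j)) ^ 4
                 + RtoC 6 / twopii ^ 4 / (z - RN (S j)) ^ 4))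
    (fz z - RtoC 6 / twopii ^ 4 / z ^ 4).
Proof.
intros Hz; destruct (exists_pow2_ge (4 * Cmod z)) as [k0 Hk0].
assert (Hc : (0 < / low_const ^ 2)%R) by (apply Rinv_0_lt_compat, pow_lt, low_const_pos).
assert (Hc4 : (0 < / low_const ^ 4)%R) by (apply Rinv_0_lt_compat, pow_lt, low_const_pos).
apply (bisect_partial_fractions fz 4 (RtoC 6 / twopii ^ 4)) with
  (b := fun j => (/ low_const ^ 2 * bnd z 2 j + 6 * / low_const ^ 4 * bnd z 4 j)%R)
  (B := (/ (low_const / 4) ^ 2 + 6 * (/ (low_const / 4) ^ 2) ^ 2)%R) (k0 := k0).
- intros u; unfold fz, vz; now rewrite qpar_plus_1.
- exact fz_bisect.
- exact fz_origin.
- exact Hz.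
- lia.
- exact (ex_series_plus (fun j => (/ low_const ^ 2 * bnd z 2 j)%R)
    (fun j => (6 * / low_const ^ 4 * bnd z 4 j)%R)
    (ex_series_scal_R _ _ (ex_series_bnd z 2 ltac:(lia)))
    (ex_series_scal_R _ _ (ex_series_bnd z 4 ltac:(lia)))).
- intros k j Hk Hj; apply fz_pair_bound; auto.
- intros j; pose proof (bnd_pos z 2 j Hz); pose proof (bnd_pos z 4 j Hz); nra.
- intros k Hk; apply fz_end_bound; auto.
Qed.

(** * Inversion formulas for the Eisenstein series *)

Definition zsum (e : nat) : C := CSeries (fun n => / RN (S n) ^ e).

Lemma Cabs_inv_pow (z : C) (e : nat) : (2 <= e)%nat -> off_integers z \/ z = 0 ->
  Cabs (fun j => / (z + RN (S j)) ^ e).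
Proof.
intros He Hz; apply (Cabs_ext (fun j => / (z + RN (S j)) ^ e)); [reflexivity|].
apply (Cabs_le _ (fun j => (/ Cmod (z + RN (S j)) ^ e)%R)); [|now apply ex_series_lattice].
intros j; rewrite Cmod_inv, Cmod_pow; [lra|].
apply Cpow_nz; destruct Hz as [Hz | Hz].
- now apply off_integers_neq_0, off_integers_plus.
- rewrite Hz, Cplus_0_l; apply RN_S_neq_0.
Qed.

Lemma Cabs_zsum (e : nat) : (2 <= e)%nat -> Cabs (fun n => / RN (S n) ^ e).
Proof.
intros He; apply (Cabs_ext (fun n => / (0 + RN (S n)) ^ e)).
- intros n; now rewrite Cplus_0_l.
- apply Cabs_inv_pow; auto.
Qed.

Lemma off_integers_half : off_integers (/ 2).
Proof.
rewrite <- RtoC_inv by lra; split; [simpl; lra|].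
rewrite qpar_half; intros E; apply RtoC_inj in E || injection E; lra.
Qed.

Lemma RN_half_neq_0 (n : nat) : RN n + / 2 <> 0.
Proof.
rewrite <- RtoC_inv by lra; unfold RN; rewrite <- RtoC_plus.
intros E; apply RtoC_inj in E; pose proof (pos_INR n); lra.
Qed.

Lemma psum_double (a : nat -> C) (n : nat) :
  psum a (2 * n) = psum (fun j => a (2 * j)%nat) n + psum (fun j => a (S (2 * j))) n.
Proof.
induction n as [|n IH]; [simpl; ring|].
replace (2 * S n)%nat with (S (S (2 * n))) by lia; rewrite !psum_S, IH; ring.
Qed.

Lemma RN_double (j : nat) : RN (2 * j) = 2 * RN j.
Proof. unfold RN; rewrite mult_INR, RtoC_mult; simpl (INR 2); rewrite RtoC_plus; ring. Qed.

Lemma zsum_eval (e : nat) (F c : C) :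
  (2 <= e)%nat -> c <> 0 -> (2 ^ e - 1 <> 0) -> (forall x : C, (- x) ^ e = x ^ e) ->
  Ccvg (psum (fun j => c / (/ 2 + RN (S j)) ^ e + c / (/ 2 - RN (S j)) ^ e))
    (F - c / (/ 2) ^ e) ->
  zsum e = F / c / 2 / (2 ^ e - 1).
Proof.
intros He Hc H2e Hpar Hlim.
set (o := fun j => / (RN j + / 2) ^ e).
assert (Ho : Cabs o).
{ apply Cabs_S; apply (Cabs_ext (fun j => / (/ 2 + RN (S j)) ^ e)).
  - intros j; unfold o; do 2 f_equal; ring.
  - apply Cabs_inv_pow; [exact He | left; exact off_integers_half]. }
pose proof (CSeries_cvg o Ho) as Hco.
assert (E1 : CSeries o + CSeries o = F / c).
{ apply (Ccvg_unique (fun n => psum o n + psum o (n + 1))).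
  - apply Ccvg_plus; [exact Hco | exact (Ccvg_shift _ _ 1 Hco)].
  - apply (Ccvg_ext (fun n => / c *
      psum (fun j => c / (/ 2 + RN (S j)) ^ e + c / (/ 2 - RN (S j)) ^ e) n + o O)).
    + intros n.
      rewrite (psum_ext _ (fun j => c * (o (S j) + o j))).
      * rewrite psum_scal, psum_plus, Nat.add_1_r, psum_shift; field; exact Hc.
      * intros j _; unfold o.
        replace (/ 2 - RN (S j)) with (- (RN j + / 2)) by (rewrite RN_S; field).
        rewrite Hpar; replace (/ 2 + RN (S j)) with (RN (S j) + / 2) by ring.
        field; split; apply Cpow_nz, RN_half_neq_0.
    + replace (F / c) with (/ c * (F - c / (/ 2) ^ e) + o O).
      * apply Ccvg_plus; [apply Ccvg_scal, Hlim | apply Ccvg_const].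
      * unfold o, RN; simpl (INR 0); rewrite Cplus_0_l; field; split; [exact Hc|].
        apply Cpow_nz; rewrite <- RtoC_inv by lra; intros E; apply RtoC_inj in E; lra. }
pose proof (Cabs_zsum e He) as Hz; pose proof (CSeries_cvg _ Hz) as Hcz; fold (zsum e) in Hcz.
assert (H2 : (2 : C) <> 0) by (intros E; apply RtoC_inj in E; lra).
assert (E2 : zsum e = / 2 ^ e * CSeries o + / 2 ^ e * zsum e).
{ apply (Ccvg_unique (fun n => psum (fun n => / RN (S n) ^ e) (2 * n))).
  - intros eps Heps; destruct (Hcz eps Heps) as [N HN]; exists N; intros n Hn; apply HN; lia.
  - apply (Ccvg_ext (fun n => / 2 ^ e * psum o n + / 2 ^ e * psum (fun n => / RN (S n) ^ e) n)).
    + intros n; rewrite psum_double, <- !psum_scal; f_equal; apply psum_ext; intros j _.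
      * unfold o; rewrite RN_S, RN_double.
        replace (2 * RN j + 1) with (2 * (RN j + / 2)) by (field; exact H2).
        rewrite Cpow_mult_l; field; split; apply Cpow_nz; auto using RN_half_neq_0.
      * replace (S (S (2 * j))) with (2 * S j)%nat by lia.
        rewrite RN_double, Cpow_mult_l; field; split; apply Cpow_nz; auto using RN_S_neq_0.
    + apply Ccvg_plus; apply Ccvg_scal; assumption. }
assert (E3 : (2 ^ e - 1) * zsum e = CSeries o).
{ assert (E : 2 ^ e * zsum e = CSeries o + zsum e).
  { transitivity ((2 ^ e * / 2 ^ e) * (CSeries o + zsum e)).
    - rewrite E2 at 1; ring.
    - rewrite Cinv_r by (apply Cpow_nz, H2); ring. }
  replace ((2 ^ e - 1) * zsum e) with (2 ^ e * zsum e - zsum e) by ring; rewrite E; ring. }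
replace (zsum e) with ((2 ^ e - 1) * zsum e / (2 ^ e - 1)) by (field; exact H2e).
rewrite E3, <- E1; field; auto.
Qed.

Lemma qpar_half' : qpar (/ 2) = - (1).
Proof. rewrite <- RtoC_inv by lra; exact qpar_half. Qed.

Lemma vz_half : vz (/ 2) = - / RtoC 4.
Proof. unfold vz, vrat; rewrite qpar_half'; field; intros E; apply RtoC_inj in E; lra. Qed.

Lemma zsum_2 : zsum 2 = - twopii ^ 2 / RtoC 24.
Proof.
rewrite (zsum_eval 2 (vz (/ 2)) (/ twopii ^ 2)).
- rewrite vz_half; field; apply twopii_neq_0.
- lia.
- intros E; apply (Cpow_nz twopii 2 twopii_neq_0).
  replace (twopii ^ 2) with (/ (/ twopii ^ 2)) by (field; apply twopii_neq_0).
  rewrite E; apply Cinv_0.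
- replace (2 ^ 2 - 1) with (RtoC 3) by ring; intros E; apply RtoC_inj in E; lra.
- intros x; ring.
- exact (vz_partial_fractions _ off_integers_half).
Qed.

Lemma zsum_4 : zsum 4 = twopii ^ 4 / RtoC 1440.
Proof.
rewrite (zsum_eval 4 (fz (/ 2)) (RtoC 6 / twopii ^ 4)).
- unfold fz; rewrite vz_half; field; apply twopii_neq_0.
- lia.
- intros E; apply (Cpow_nz twopii 4 twopii_neq_0).
  replace (twopii ^ 4) with (RtoC 6 / (RtoC 6 / twopii ^ 4)).
  + rewrite E; unfold Cdiv; rewrite Cinv_0; ring.
  + field; apply twopii_neq_0.
- replace (2 ^ 4 - 1) with (RtoC 15) by ring; intros E; apply RtoC_inj in E; lra.
- intros x; ring.
- exact (fz_partial_fractions _ off_integers_half).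
Qed.

Lemma Ccvg_psum_div (c : C) (a b : nat -> C) (l : C) : c <> 0 ->
  Ccvg (psum (fun j => c / a j + c / b j)) l ->
  Ccvg (psum (fun j => / a j + / b j)) (/ c * l).
Proof.
intros Hc H; apply (Ccvg_ext (fun n => / c * psum (fun j => c / a j + c / b j) n)).
- intros n; rewrite <- psum_scal; apply psum_ext; intros j _.
  transitivity ((/ c * c) * (/ a j + / b j)); [unfold Cdiv; ring|].
  rewrite Cinv_l by exact Hc; ring.
- now apply Ccvg_scal.
Qed.

Lemma vz_sum (z : C) : off_integers z ->
  Ccvg (psum (fun j => / (z + RN (S j)) ^ 2 + / (z - RN (S j)) ^ 2))
    (twopii ^ 2 * vz z - / z ^ 2).
Proof.
intros Hz; pose proof (off_integers_neq_0 z Hz); pose proof twopii_neq_0.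
replace (twopii ^ 2 * vz z - / z ^ 2)
  with (/ (/ twopii ^ 2) * (vz z - / twopii ^ 2 / z ^ 2)) by (field; auto).
apply (Ccvg_psum_div (/ twopii ^ 2)); [|now apply vz_partial_fractions].
intros E; apply (Cpow_nz twopii 2 twopii_neq_0).
replace (twopii ^ 2) with (/ (/ twopii ^ 2)) by (field; auto); rewrite E; apply Cinv_0.
Qed.

Lemma cz_sum (z : C) : off_integers z ->
  Ccvg (psum (fun j => / (z + RN (S j)) + / (z - RN (S j))))
    (twopii / 2 * cz z - / z).
Proof.
intros Hz; pose proof (off_integers_neq_0 z Hz); pose proof twopii_neq_0.
replace (twopii / 2 * cz z - / z)
  with (/ (2 / twopii) * (cz z - 2 / twopii / z ^ 1)).
2:{ rewrite Cpow_1_r; field; auto. }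
apply (Ccvg_psum_div (2 / twopii)).
- intros E; apply twopii_neq_0.
  replace twopii with (2 / (2 / twopii)).
  + rewrite E; unfold Cdiv; rewrite Cinv_0; ring.
  + field; auto.
- apply (Ccvg_ext (psum (fun j => 2 / twopii / (z + RN (S j)) ^ 1
             + 2 / twopii / (z - RN (S j)) ^ 1))); [|now apply cz_partial_fractions].
  intros n; apply psum_ext; intros; now rewrite !Cpow_1_r.
Qed.

Lemma fz_sum (z : C) : off_integers z ->
  Ccvg (psum (fun j => / (z + RN (S j)) ^ 4 + / (z - RN (S j)) ^ 4))
    (twopii ^ 4 / RtoC 6 * fz z - / z ^ 4).
Proof.
intros Hz; pose proof (off_integers_neq_0 z Hz); pose proof twopii_neq_0.
assert (H6 : RtoC 6 <> 0) by (intros E; apply RtoC_inj in E; lra).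
replace (twopii ^ 4 / RtoC 6 * fz z - / z ^ 4)
  with (/ (RtoC 6 / twopii ^ 4) * (fz z - RtoC 6 / twopii ^ 4 / z ^ 4)) by (field; auto).
apply (Ccvg_psum_div (RtoC 6 / twopii ^ 4)); [|now apply fz_partial_fractions].
intros E; apply (Cpow_nz twopii 4 twopii_neq_0).
replace (twopii ^ 4) with (RtoC 6 / (RtoC 6 / twopii ^ 4)) by (field; auto).
rewrite E; unfold Cdiv; rewrite Cinv_0; ring.
Qed.

Lemma upper_neq_0 (t : C) : upper t -> t <> 0.
Proof. intros H E; unfold upper in H; rewrite E in H; simpl in H; lra. Qed.

Lemma upper_S (t : C) : upper t -> upper (- / t).
Proof.
intros H; unfold upper in *; destruct t as [x y]; simpl in *.
apply Ropp_lt_cancel; rewrite Ropp_involutive, Ropp_0.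
unfold Rdiv; assert (0 < / (x * (x * 1) + y * (y * 1)))%R by (apply Rinv_0_lt_compat; nra); nra.
Qed.

Lemma upper_scal (s : R) (t : C) : (0 < s)%R -> upper t -> upper (RtoC s * t).
Proof. unfold upper; destruct t; unfold RtoC; simpl; intros; nra. Qed.

Lemma upper_RN (n : nat) (t : C) : upper t -> upper (RN (S n) * t).
Proof. apply upper_scal, lt_0_INR; lia. Qed.

Section Inversion.
Context (t : C).
Hypothesis t_upper : upper t.

Let K : R := (Im t ^ 2 / Cmod t)%R.

Lemma lattice_K_pos : (0 < K)%R.
Proof using t_upper.
unfold K; apply Rdiv_lt_0_compat; [apply pow_lt; exact t_upper|].
apply Cmod_gt_0, upper_neq_0, t_upper.
Qed.

Lemma lattice_lower (m : nat) (s : R) :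
  (K * INR m * Rabs s <= Cmod (RN m * t + RtoC s) ^ 2)%R.
Proof using t_upper.
assert (Ht : (0 < Cmod t)%R) by (apply Cmod_gt_0, upper_neq_0, t_upper).
assert (H1 : (INR m * Im t <= Cmod (RN m * t + RtoC s))%R).
{ eapply Rle_trans; [|apply im_le_Cmod].
  assert (E : Im (RN m * t + RtoC s) = (INR m * Im t)%R)
    by (unfold RN, RtoC; destruct t; simpl; ring).
  rewrite E; apply Rle_abs. }
assert (H2 : (Rabs s * Im t <= Cmod (RN m * t + RtoC s) * Cmod t)%R).
{ rewrite <- (Cmod_conj t), <- Cmod_mult.
  eapply Rle_trans; [|apply im_le_Cmod].
  assert (E : Im ((RN m * t + RtoC s) * Cconj t) = (- (s * Im t))%R)
    by (unfold RN, RtoC; destruct t; simpl; ring).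
  unfold upper in t_upper.
  rewrite E, Rabs_Ropp, Rabs_mult, (Rabs_pos_eq (Im t)); lra. }
unfold K; pose proof (pos_INR m); pose proof (Rabs_pos s); unfold upper in t_upper.
apply (Rmult_le_reg_r (Cmod t)); [exact Ht|].
replace (Im t ^ 2 / Cmod t * INR m * Rabs s * Cmod t)%R
  with ((INR m * Im t) * (Rabs s * Im t))%R by (field; lra).
replace (Cmod (RN m * t + RtoC s) ^ 2 * Cmod t)%R
  with (Cmod (RN m * t + RtoC s) * (Cmod (RN m * t + RtoC s) * Cmod t))%R by ring.
apply Rmult_le_compat; auto; apply Rmult_le_pos; lra.
Qed.

Lemma lattice_neq_0 (m : nat) (s : R) : (s <> 0)%R -> RN (S m) * t + RtoC s <> 0.
Proof using t_upper.
intros Hs E; pose proof (lattice_lower (S m) s) as H; rewrite E, Cmod_0 in H.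
pose proof lattice_K_pos; apply Rabs_pos_lt in Hs.
assert (0 < INR (S m))%R by (apply lt_0_INR; lia).
assert (0 < K * INR (S m) * Rabs s)%R by (apply Rmult_lt_0_compat; nra).
rewrite pow_i in H by lia; lra.
Qed.

Let inv_sq (n : nat) : R := (/ INR (S n) ^ 2)%R.

Lemma inv_sq_pos (n : nat) : (0 <= inv_sq n)%R.
Proof. apply Rlt_le, Rinv_0_lt_compat, pow_lt, lt_0_INR; lia. Qed.

Lemma vrat_vz (u : C) (n : nat) : vrat (qpar u ^ S n) = vz (RN (S n) * u).
Proof. unfold vz, RN; now rewrite qpar_scal. Qed.

Definition quad4 (m n : nat) : C :=
  / (RN (S m) * t + RN (S n)) ^ 4 + / (RN (S m) * t - RN (S n)) ^ 4.

Lemma quad4_bound (m n : nat) :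
  (Cmod (quad4 m n) <= 2 * / K ^ 2 * inv_sq m * inv_sq n)%R.
Proof using t_upper.
pose proof lattice_K_pos as HK.
assert (Hm : (0 < INR (S m))%R) by (apply lt_0_INR; lia).
assert (Hn : (0 < INR (S n))%R) by (apply lt_0_INR; lia).
assert (H : forall s : R, Rabs s = INR (S n) ->
  (Cmod (/ (RN (S m) * t + RtoC s) ^ 4) <= / K ^ 2 * inv_sq m * inv_sq n)%R).
{ intros s Hs.
  assert (Hs0 : (s <> 0)%R) by (intros E; rewrite E, Rabs_R0 in Hs; lra).
  pose proof (lattice_lower (S m) s) as Hl; rewrite Hs in Hl.
  rewrite Cmod_inv, Cmod_pow by (apply Cpow_nz; now apply lattice_neq_0).
  replace (/ K ^ 2 * inv_sq m * inv_sq n)%R with (/ (K * INR (S m) * INR (S n)) ^ 2)%R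
    by (unfold inv_sq; field; repeat split; lra).
  assert (Hp : (0 < K * INR (S m) * INR (S n))%R) by (apply Rmult_lt_0_compat; nra).
  apply Rinv_le_contravar; [apply pow_lt; exact Hp|].
  replace (Cmod (RN (S m) * t + RtoC s) ^ 4)%R
    with ((Cmod (RN (S m) * t + RtoC s) ^ 2) ^ 2)%R by ring.
  apply pow_incr; lra. }
unfold quad4; eapply Rle_trans; [apply Cmod_triangle|].
assert (H1 := H (INR (S n)) ltac:(apply Rabs_pos_eq; lra)).
assert (H2 := H (- INR (S n))%R ltac:(rewrite Rabs_Ropp; apply Rabs_pos_eq; lra)).
rewrite RtoC_opp in H2; unfold Cminus, RN in *; lra.
Qed.

Lemma quad4_row (m : nat) :
  CSeries (quad4 m) = twopii ^ 4 / RtoC 6 * fz (RN (S m) * t) - / t ^ 4 * / RN (S m) ^ 4.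
Proof using t_upper.
apply CSeries_of_cvg.
replace (/ t ^ 4 * / RN (S m) ^ 4) with (/ (RN (S m) * t) ^ 4)
  by (field; auto using upper_neq_0, RN_S_neq_0).
exact (fz_sum (RN (S m) * t) (off_integers_upper _ (upper_RN m t t_upper))).
Qed.

Lemma lattice_flip_plus (m n : nat) :
  RN (S m) * t + RN (S n) = - t * (RN (S n) * - / t - RN (S m)).
Proof using t_upper. field; apply upper_neq_0, t_upper. Qed.

Lemma lattice_flip_minus (m n : nat) :
  RN (S m) * t - RN (S n) = t * (RN (S n) * - / t + RN (S m)).
Proof using t_upper. field; apply upper_neq_0, t_upper. Qed.

Lemma off_flip (n : nat) : off_integers (RN (S n) * - / t).
Proof using t_upper. apply off_integers_upper, upper_RN, upper_S, t_upper. Qed.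

Lemma quad4_col (n : nat) :
  CSeries (fun m => quad4 m n) =
  / t ^ 4 * (twopii ^ 4 / RtoC 6 * fz (RN (S n) * - / t)) - / RN (S n) ^ 4.
Proof using t_upper.
pose proof (upper_neq_0 t t_upper) as Ht; pose proof (off_flip n) as Ho.
apply CSeries_of_cvg.
apply (Ccvg_ext (fun M => / t ^ 4 * psum (fun m => / (RN (S n) * - / t + RN (S m)) ^ 4
   + / (RN (S n) * - / t - RN (S m)) ^ 4) M)).
{ intros M; rewrite <- psum_scal; apply psum_ext; intros m _; unfold quad4.
  rewrite lattice_flip_plus, lattice_flip_minus.
  assert (H1 := off_integers_neq_0 _ (off_integers_plus _ (S m) Ho)).
  assert (H2 := off_integers_neq_0 _ (off_integers_minus _ (S m) Ho)).
  set (A := RN (S n) * - / t + RN (S m)) in *; set (B := RN (S n) * - / t - RN (S m)) in *.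
  field; auto. }
replace (/ t ^ 4 * (twopii ^ 4 / RtoC 6 * fz (RN (S n) * - / t)) - / RN (S n) ^ 4)
  with (/ t ^ 4 * (twopii ^ 4 / RtoC 6 * fz (RN (S n) * - / t) - / (RN (S n) * - / t) ^ 4)).
- apply Ccvg_scal, fz_sum, Ho.
- pose proof (RN_S_neq_0 n); field; auto.
Qed.

Lemma ex_series_inv_sq_scal (a : R) : ex_series (fun m => (a * inv_sq m)%R).
Proof using. apply ex_series_scal_R, ex_series_inv_sq. Qed.

Lemma E4_S : E4 (- / t) = t ^ 4 * E4 t.
Proof using t_upper.
pose proof (upper_neq_0 t t_upper) as Ht; pose proof (upper_S t t_upper) as Hs.
pose proof (CSeries_fubini quad4 (fun m => (2 * / K ^ 2 * inv_sq m)%R) inv_sq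
  quad4_bound inv_sq_pos (ex_series_inv_sq_scal _) ex_series_inv_sq) as E.
rewrite (CSeries_ext _ _ quad4_row), (CSeries_ext _ _ quad4_col) in E.
destruct (E4_lambert t t_upper) as [C1 E1]; destruct (E4_lambert _ Hs) as [C2 E2'].
assert (L1 : forall n, vrat (qpar t ^ S n) + RtoC 6 * vrat (qpar t ^ S n) ^ 2
  = fz (RN (S n) * t)) by (intros; unfold fz; now rewrite vrat_vz).
assert (L2 : forall n, vrat (qpar (- / t) ^ S n) + RtoC 6 * vrat (qpar (- / t) ^ S n) ^ 2
  = fz (RN (S n) * - / t)) by (intros; unfold fz; now rewrite vrat_vz).
pose proof (Cabs_ext _ _ L1 C1) as C1'; pose proof (Cabs_ext _ _ L2 C2) as C2'.
rewrite (CSeries_ext _ _ L1) in E1; rewrite (CSeries_ext _ _ L2) in E2'.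
pose proof (Cabs_zsum 4 ltac:(lia)) as Cz.
rewrite !CSeries_minus in E; auto using Cabs_scal.
rewrite !CSeries_scal in E; auto using Cabs_scal.
fold (zsum 4) in E; rewrite zsum_4 in E.
set (S1 := CSeries (fun m => fz (RN (S m) * t))) in *.
set (S2 := CSeries (fun m => fz (RN (S m) * - / t))) in *.
rewrite E1, E2'; pose proof twopii_neq_0 as Hp.
assert (H6 : RtoC 6 <> 0) by (intros E0; apply RtoC_inj in E0; lra).
assert (H1440 : RtoC 1440 <> 0) by (intros E0; apply RtoC_inj in E0; lra).
assert (E5 : S2 = t ^ 4 * S1 + (t ^ 4 - 1) / RtoC 240).
{ replace S2 with (RtoC 6 / twopii ^ 4 * t ^ 4 *
    ((/ t ^ 4 * (twopii ^ 4 / RtoC 6 * S2) - twopii ^ 4 / RtoC 1440) + twopii ^ 4 / RtoC 1440))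
    by (field; auto).
  rewrite <- E; field; auto. }
rewrite E5; field.
Qed.

Definition ri (w : C) : C := / w ^ 2 - / (w ^ 2 - (/ 2) ^ 2).

Definition quad2 (m n : nat) : C :=
  ri (RN (S m) * t + RN (S n)) + ri (RN (S m) * t - RN (S n)).

Lemma two_neq_0 : (2 : C) <> 0.
Proof. intros E; apply RtoC_inj in E; lra. Qed.

Lemma quad2_bound (m n : nat) :
  (Cmod (quad2 m n) <= 2 * / K ^ 2 * inv_sq m * inv_sq n)%R.
Proof using t_upper.
pose proof lattice_K_pos as HK.
assert (Hm : (0 < INR (S m))%R) by (apply lt_0_INR; lia).
assert (Hn : (1 <= INR (S n))%R) by (rewrite S_INR; pose proof (pos_INR n); lra).
assert (H : forall s : R, Rabs s = INR (S n) ->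
  (Cmod (ri (RN (S m) * t + RtoC s)) <= / K ^ 2 * inv_sq m * inv_sq n)%R).
{ intros s Hs.
  assert (Hsx : forall x : R, Rabs x = (/ 2)%R -> (INR (S n) / 2 <= Rabs (s + x))%R).
  { intros x Hx; pose proof (Rabs_triang_inv s (- x)) as H; rewrite Rabs_Ropp, Hs, Hx in H.
    replace (s - - x)%R with (s + x)%R in H by ring; lra. }
  assert (Hp2 : Rabs (/ 2) = (/ 2)%R) by (apply Rabs_pos_eq; lra).
  assert (Hm2 : Rabs (- / 2) = (/ 2)%R) by (rewrite Rabs_Ropp; exact Hp2).
  pose proof (Hsx _ Hp2) as Sp; pose proof (Hsx _ Hm2) as Sm.
  assert (N0 : RN (S m) * t + RtoC s <> 0).
  { apply lattice_neq_0; intros E; rewrite E, Rabs_R0 in Hs; lra. }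
  assert (Np : RN (S m) * t + RtoC (s + / 2) <> 0).
  { apply lattice_neq_0; intros E; rewrite E, Rabs_R0 in Sp; lra. }
  assert (Nm : RN (S m) * t + RtoC (s + - / 2) <> 0).
  { apply lattice_neq_0; intros E; rewrite E, Rabs_R0 in Sm; lra. }
  pose proof (lattice_lower (S m) s) as L0; rewrite Hs in L0.
  pose proof (lattice_lower (S m) (s + / 2)) as Lp.
  pose proof (lattice_lower (S m) (s + - / 2)) as Lm.
  set (w := RN (S m) * t + RtoC s) in *.
  assert (Ep : RN (S m) * t + RtoC (s + / 2) = w + / 2)
    by (unfold w; rewrite RtoC_plus, RtoC_inv by lra; ring).
  assert (Em : RN (S m) * t + RtoC (s + - / 2) = w - / 2)
    by (unfold w; rewrite RtoC_plus, RtoC_opp, RtoC_inv by lra; ring).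
  rewrite Ep in Np, Lp; rewrite Em in Nm, Lm.
  assert (Er : ri w = - (/ 2) ^ 2 * / (w ^ 2 * ((w + / 2) * (w - / 2)))).
  { unfold ri; replace (w ^ 2 - (/ 2) ^ 2) with ((w + / 2) * (w - / 2)) by ring.
    set (a := w + / 2) in *; set (b := w - / 2) in *.
    transitivity ((a * b - w ^ 2) * / (w ^ 2 * (a * b))); [field; auto|].
    f_equal; unfold a, b; ring. }
  set (P := (K * INR (S m) * INR (S n))%R) in *.
  assert (HP : (0 < P)%R) by (unfold P; apply Rmult_lt_0_compat; nra).
  assert (Lp' : (P / 2 <= Cmod (w + / 2) ^ 2)%R).
  { eapply Rle_trans; [|exact Lp]; unfold P.
    replace (K * INR (S m) * INR (S n) / 2)%R with (K * INR (S m) * (INR (S n) / 2))%R by field.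
    apply Rmult_le_compat_l; [nra | exact Sp]. }
  assert (Lm' : (P / 2 <= Cmod (w - / 2) ^ 2)%R).
  { eapply Rle_trans; [|exact Lm]; unfold P.
    replace (K * INR (S m) * INR (S n) / 2)%R with (K * INR (S m) * (INR (S n) / 2))%R by field.
    apply Rmult_le_compat_l; [nra | exact Sm]. }
  assert (Lpm : (P / 2 <= Cmod (w + / 2) * Cmod (w - / 2))%R).
  { apply Rsqr_incr_0_var; [|apply Rmult_le_pos; apply Cmod_ge_0].
    rewrite !Rsqr_pow2, Rpow_mult_distr; simpl (2) in *.
    replace ((P / 2) ^ 2)%R with (P / 2 * (P / 2))%R by ring.
    apply Rmult_le_compat; lra. }
  assert (N2 : w ^ 2 * ((w + / 2) * (w - / 2)) <> 0)
    by (apply Cmult_neq_0; [now apply Cpow_nz | now apply Cmult_neq_0]).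
  rewrite Er, Cmod_mult, Cmod_opp, Cmod_pow, Cmod_inv, Cmod_inv by auto using two_neq_0.
  rewrite Cmod_mult, Cmod_pow, Cmod_mult, (Cmod_RtoC_pos 2) by lra.
  replace (/ K ^ 2 * inv_sq m * inv_sq n)%R with (/ (P * P))%R
    by (unfold P, inv_sq; field; repeat split; lra).
  assert (HD : (P * (P / 2) <= Cmod w ^ 2 * (Cmod (w + / 2) * Cmod (w - / 2)))%R)
    by (apply Rmult_le_compat; lra).
  assert (HD0 : (0 < P * (P / 2))%R) by nra.
  assert (HI : (/ (Cmod w ^ 2 * (Cmod (w + / 2) * Cmod (w - / 2))) <= / (P * (P / 2)))%R)
    by (apply Rinv_le_contravar; lra).
  replace (/ (P * (P / 2)))%R with (2 * / (P * P))%R in HI by (field; lra).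
  assert (0 < / (P * P))%R by (apply Rinv_0_lt_compat; nra); nra. }
unfold quad2; eapply Rle_trans; [apply Cmod_triangle|].
assert (H1 := H (INR (S n)) ltac:(apply Rabs_pos_eq; lra)).
assert (H2 := H (- INR (S n))%R ltac:(rewrite Rabs_Ropp; apply Rabs_pos_eq; lra)).
rewrite RtoC_opp in H2; unfold Cminus, RN in *; lra.
Qed.

Lemma inv_RN_cvg (a : C) : Ccvg (fun N => / (a + RN N)) 0.
Proof using.
intros eps He.
set (N := S (Z.to_nat (up (Cmod a + 1 + 2 / eps)))).
assert (Hep : (0 < 2 / eps)%R) by (apply Rdiv_lt_0_compat; lra).
assert (HN : (Cmod a + 1 + 2 / eps <= INR N)%R).
{ unfold N; rewrite S_INR, INR_IZR_INZ, Z2Nat.id.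
  - destruct (archimed (Cmod a + 1 + 2 / eps)); lra.
  - apply le_IZR; destruct (archimed (Cmod a + 1 + 2 / eps)); pose proof (Cmod_ge_0 a); lra. }
exists N; intros n Hn; apply le_INR in Hn.
assert (H : (2 / eps <= Cmod (a + RN n))%R).
{ pose proof (Cmod_triangle_rev (RN n) (- a)) as H.
  replace (RN n - - a) with (a + RN n) in H by ring.
  rewrite Cmod_opp in H; unfold RN at 1 in H; rewrite Cmod_RtoC_pos in H by apply pos_INR; lra. }
replace (/ (a + RN n) - 0) with (/ (a + RN n)) by ring.
rewrite Cmod_inv by (apply Cmod_gt_0; lra).
assert (H2 : (/ Cmod (a + RN n) <= / (2 / eps))%R) by (apply Rinv_le_contravar; lra).
replace (/ (2 / eps))%R with (eps / 2)%R in H2 by (field; lra); lra.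
Qed.

Lemma ri_split (w : C) : w + / 2 <> 0 -> w - / 2 <> 0 ->
  / (w ^ 2 - (/ 2) ^ 2) = / (w - / 2) - / (w + / 2).
Proof using.
intros Hp Hm; replace (w ^ 2 - (/ 2) ^ 2) with ((w - / 2) * (w + / 2)) by ring.
set (a := w - / 2) in *; assert (E : w + / 2 = a + 1) by (unfold a; field).
rewrite E in *; field; auto.
Qed.

Lemma lattice_half_neq_0 (m n : nat) :
  RN (S m) * t + RN n + / 2 <> 0 /\ RN (S m) * t - RN n - / 2 <> 0.
Proof using t_upper.
pose proof (pos_INR n) as Hn; split.
- replace (RN (S m) * t + RN n + / 2) with (RN (S m) * t + RtoC (INR n + / 2))
    by (rewrite RtoC_plus, RtoC_inv by lra; unfold RN; ring).
  apply lattice_neq_0; lra.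
- replace (RN (S m) * t - RN n - / 2) with (RN (S m) * t + RtoC (- (INR n + / 2)))
    by (rewrite RtoC_opp, RtoC_plus, RtoC_inv by lra; unfold RN; ring).
  apply lattice_neq_0; lra.
Qed.

Lemma half_S (w : C) (n : nat) :
  w + RN (S n) - / 2 = w + RN n + / 2 /\ w - RN (S n) + / 2 = w - RN n - / 2.
Proof using. rewrite RN_S; split; field. Qed.

Lemma quad2_row (m : nat) :
  CSeries (quad2 m) =
  twopii ^ 2 * vz (RN (S m) * t) - / t ^ 2 * / RN (S m) ^ 2
   - (/ (RN (S m) * t + / 2) - / (RN (S m) * t - / 2)).
Proof using t_upper.
apply CSeries_of_cvg; set (w := RN (S m) * t).
apply (Ccvg_ext (fun N => psum (fun n => / (w + RN (S n)) ^ 2 + / (w - RN (S n)) ^ 2) N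
  - (/ (w + / 2) - / (w - / 2) - / (w + / 2 + RN N) + - / (- (w - / 2) + RN N)))).
{ induction n as [|n IH].
  - unfold RN; simpl; rewrite !Cplus_0_r.
    destruct (lattice_half_neq_0 m 0) as [Hp Hm]; fold w in Hp, Hm.
    replace (w - RN 0 - / 2) with (w - / 2) in Hm by (unfold RN; simpl (INR 0); ring).
    replace (w + RN 0 + / 2) with (w + / 2) in Hp by (unfold RN; simpl (INR 0); ring).
    set (a := w - / 2) in *; set (b := w + / 2) in *; field; auto.
  - rewrite !psum_S, <- IH; unfold quad2, ri; fold w.
    destruct (lattice_half_neq_0 m n) as [Hp Hm], (lattice_half_neq_0 m (S n)) as [Hp' Hm'].
    fold w in Hp, Hm, Hp', Hm'.
    destruct (half_S w n) as [E1 E2'].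
    rewrite !ri_split; try (rewrite E1 || rewrite E2'); auto.
    rewrite ?E1, ?E2'.
    replace (w + / 2 + RN n) with (w + RN n + / 2) by ring.
    replace (w + / 2 + RN (S n)) with (w + RN (S n) + / 2) by ring.
    replace (- (w - / 2) + RN n) with (- (w - RN n - / 2)) by ring.
    replace (- (w - / 2) + RN (S n)) with (- (w - RN (S n) - / 2)) by ring.
    set (a := w + RN n + / 2) in *; set (b := w - RN n - / 2) in *.
    set (a' := w + RN (S n) + / 2) in *; set (b' := w - RN (S n) - / 2) in *.
    replace (/ - b') with (- / b') by (field; auto).
    replace (/ - b) with (- / b) by (field; auto); ring. }
replace (twopii ^ 2 * vz w - / t ^ 2 * / RN (S m) ^ 2 - (/ (w + / 2) - / (w - / 2)))
  with (twopii ^ 2 * vz w - / w ^ 2 - (/ (w + / 2) - / (w - / 2) - 0 + - (1) * 0)).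
- apply Ccvg_minus; [exact (vz_sum w (off_integers_upper _ (upper_RN m t t_upper)))|].
  apply Ccvg_plus; [apply Ccvg_minus; [apply Ccvg_const | apply inv_RN_cvg]|].
  apply (Ccvg_ext (fun N => - (1) * / (- (w - / 2) + RN N))); [intros; ring|].
  apply Ccvg_scal, inv_RN_cvg.
- replace (/ w ^ 2) with (/ t ^ 2 * / RN (S m) ^ 2); [ring|].
  unfold w; field; auto using upper_neq_0, RN_S_neq_0.
Qed.

Definition kk (a : C) : C := / t * (twopii / 2 * cz (a * - / t) - / (a * - / t)).

Lemma kk_sum (a : R) : (0 < a)%R ->
  Ccvg (psum (fun m => / (RN (S m) * t + RtoC a) - / (RN (S m) * t - RtoC a))) (- kk (RtoC a)).
Proof using t_upper.
intros Ha; pose proof (upper_neq_0 t t_upper) as Ht.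
set (z := RtoC a * - / t).
assert (Ho : off_integers z) by (apply off_integers_upper, upper_scal, upper_S; assumption).
apply (Ccvg_ext (fun M => - / t * psum (fun m => / (z + RN (S m)) + / (z - RN (S m))) M)).
{ intros M; rewrite <- psum_scal; apply psum_ext; intros m _.
  replace (RN (S m) * t + RtoC a) with (- t * (z - RN (S m))) by (unfold z; field; exact Ht).
  replace (RN (S m) * t - RtoC a) with (t * (z + RN (S m))) by (unfold z; field; exact Ht).
  assert (H1 := off_integers_neq_0 _ (off_integers_plus _ (S m) Ho)).
  assert (H2 := off_integers_neq_0 _ (off_integers_minus _ (S m) Ho)).
  set (A := z + RN (S m)) in *; set (B := z - RN (S m)) in *; field; auto. }
replace (- kk (RtoC a)) with (- / t * (twopii / 2 * cz z - / z)) by (unfold kk; fold z; ring).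
apply Ccvg_scal, cz_sum, Ho.
Qed.

Lemma quad2_col (n : nat) :
  CSeries (fun m => quad2 m n) =
  / t ^ 2 * (twopii ^ 2 * vz (RN (S n) * - / t)) - / RN (S n) ^ 2
   + (kk (RN n + / 2) - kk (RN (S n) + / 2)).
Proof using t_upper.
pose proof (upper_neq_0 t t_upper) as Ht; pose proof (off_flip n) as Ho.
apply CSeries_of_cvg; set (z := RN (S n) * - / t) in *.
assert (Ea : RN n + / 2 = RtoC (INR n + / 2)) by (rewrite RtoC_plus, RtoC_inv by lra; reflexivity).
assert (Eb : RN (S n) + / 2 = RtoC (INR (S n) + / 2))
  by (rewrite RtoC_plus, RtoC_inv by lra; reflexivity).
rewrite Ea, Eb.
set (P1 := fun m => / (RN (S m) * t + RtoC (INR n + / 2))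
                    - / (RN (S m) * t - RtoC (INR n + / 2))).
set (P2 := fun m => / (RN (S m) * t + RtoC (INR (S n) + / 2))
                    - / (RN (S m) * t - RtoC (INR (S n) + / 2))).
apply (Ccvg_ext (fun M => / t ^ 2 * psum (fun m => / (z + RN (S m)) ^ 2 + / (z - RN (S m)) ^ 2) M
  - (psum P1 M - psum P2 M))).
{ induction n0 as [|m IH]; [simpl; ring|].
  rewrite !psum_S, <- IH; unfold quad2, ri.
  destruct (lattice_half_neq_0 m n) as [Hp Hm], (lattice_half_neq_0 m (S n)) as [Hp' Hm'].
  destruct (half_S (RN (S m) * t) n) as [E1 E2'].
  rewrite !ri_split; try (rewrite E1 || rewrite E2'); auto.
    rewrite ?E1, ?E2'.
  unfold P1, P2; rewrite <- Ea, <- Eb.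
  replace (RN (S m) * t - (RN n + / 2)) with (RN (S m) * t - RN n - / 2) by ring.
  replace (RN (S m) * t - (RN (S n) + / 2)) with (RN (S m) * t - RN (S n) - / 2) by ring.
  rewrite !Cplus_assoc.
  replace (/ (RN (S m) * t + RN (S n)) ^ 2) with (/ t ^ 2 * / (z - RN (S m)) ^ 2).
  2:{ rewrite lattice_flip_plus; fold z.
      assert (H2 := off_integers_neq_0 _ (off_integers_minus _ (S m) Ho)).
      set (B := z - RN (S m)) in *; field; auto. }
  replace (/ (RN (S m) * t - RN (S n)) ^ 2) with (/ t ^ 2 * / (z + RN (S m)) ^ 2).
  2:{ rewrite lattice_flip_minus; fold z.
      assert (H1 := off_integers_neq_0 _ (off_integers_plus _ (S m) Ho)).
      set (A := z + RN (S m)) in *; field; auto. }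
  ring. }
replace (/ t ^ 2 * (twopii ^ 2 * vz z) - / RN (S n) ^ 2 +
   (kk (RtoC (INR n + / 2)) - kk (RtoC (INR (S n) + / 2))))
  with (/ t ^ 2 * (twopii ^ 2 * vz z - / z ^ 2) -
   (- kk (RtoC (INR n + / 2)) - - kk (RtoC (INR (S n) + / 2)))).
- apply Ccvg_minus; [apply Ccvg_scal, vz_sum, Ho|].
  apply Ccvg_minus; apply kk_sum; pose proof (pos_INR n); pose proof (pos_INR (S n)); lra.
- replace (/ RN (S n) ^ 2) with (/ t ^ 2 * / z ^ 2); [ring|].
  unfold z; field; auto using RN_S_neq_0.
Qed.

Lemma kk_limit : Ccvg (fun N => kk (RN N + / 2)) (- / t * (twopii / 2)).
Proof using t_upper.
pose proof (upper_neq_0 t t_upper) as Ht; pose proof (upper_S t t_upper) as Hs.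
set (s := - / t) in *.
assert (Hs0 : s <> 0) by now apply upper_neq_0.
assert (Hq : Ccvg (fun N => qpar ((RN N + / 2) * s)) 0).
{ apply (Ccvg_ext (fun N => qpar (/ 2 * s) * qpar s ^ N)).
  - intros N; rewrite <- qpar_scal, <- qpar_plus; f_equal; unfold RN; ring.
  - replace (RtoC 0) with (qpar (/ 2 * s) * 0) by ring; apply Ccvg_scal.
    apply (Ccvg_0_le _ (fun N => (Cmod (qpar s) ^ N)%R)).
    + intros N; rewrite Cmod_pow; lra.
    + apply is_lim_seq_geom; rewrite Rabs_pos_eq by apply Cmod_ge_0; now apply qpar_lt_1. }
unfold kk; fold s.
replace (s * (twopii / 2)) with (/ t * (twopii / 2 * ((0 + 1) * / (0 - 1)) - / s * 0)).
2:{ unfold s; field; auto. }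
apply (Ccvg_scal (/ t)), Ccvg_minus.
- apply Ccvg_scal; unfold cz, Cdiv; apply Ccvg_mult.
  + apply Ccvg_plus; [exact Hq | apply Ccvg_const].
  + apply Ccvg_inv; [|apply Ccvg_minus; [exact Hq | apply Ccvg_const]].
    intros E; apply C1_nz; replace (RtoC 1) with (- (0 - 1)) by ring; rewrite E; ring.
- apply (Ccvg_ext (fun N => / s * / (/ 2 + RN N))); [|apply Ccvg_scal, inv_RN_cvg].
  intros N; pose proof (RN_half_neq_0 N) as Hn.
  replace (/ 2 + RN N) with (RN N + / 2) by ring; set (a := RN N + / 2) in *; field; auto.
Qed.

Lemma E2_S : E2 (- / t) = t ^ 2 * E2 t + RtoC 12 * t / twopii.
Proof using t_upper.
pose proof (upper_neq_0 t t_upper) as Ht; pose proof (upper_S t t_upper) as Hs.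
pose proof (CSeries_fubini quad2 (fun m => (2 * / K ^ 2 * inv_sq m)%R) inv_sq
  quad2_bound inv_sq_pos (ex_series_inv_sq_scal _) ex_series_inv_sq) as E.
rewrite (CSeries_ext _ _ quad2_row), (CSeries_ext _ _ quad2_col) in E.
destruct (E2_lambert t t_upper) as [C1 E1]; destruct (E2_lambert _ Hs) as [C2 E2'].
assert (L1 : forall n, vrat (qpar t ^ S n) = vz (RN (S n) * t)) by (intros; apply vrat_vz).
assert (L2 : forall n, vrat (qpar (- / t) ^ S n) = vz (RN (S n) * - / t))
  by (intros; apply vrat_vz).
pose proof (CSeries_cvg _ (Cabs_ext _ _ L1 C1)) as C1'.
pose proof (CSeries_cvg _ (Cabs_ext _ _ L2 C2)) as C2'.
rewrite (CSeries_ext _ _ L1) in E1; rewrite (CSeries_ext _ _ L2) in E2'.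
pose proof (CSeries_cvg _ (Cabs_zsum 2 ltac:(lia))) as Cz; fold (zsum 2) in Cz.
rewrite zsum_2 in Cz.
set (S1 := CSeries (fun m => vz (RN (S m) * t))) in *.
set (S2 := CSeries (fun m => vz (RN (S m) * - / t))) in *.
set (Z := - twopii ^ 2 / RtoC 24) in *.
assert (R1 : CSeries (fun m => twopii ^ 2 * vz (RN (S m) * t) - / t ^ 2 * / RN (S m) ^ 2 -
   (/ (RN (S m) * t + / 2) - / (RN (S m) * t - / 2))) =
   twopii ^ 2 * S1 - / t ^ 2 * Z - - kk (/ 2)).
{ apply CSeries_of_cvg.
  apply (Ccvg_ext (fun M => twopii ^ 2 * psum (fun m => vz (RN (S m) * t)) M
    - / t ^ 2 * psum (fun m => / RN (S m) ^ 2) M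
    - psum (fun m => / (RN (S m) * t + / 2) - / (RN (S m) * t - / 2)) M)).
  { induction n as [|m IH]; [simpl; ring | rewrite !psum_S, <- IH; ring]. }
  apply Ccvg_minus; [apply Ccvg_minus; apply Ccvg_scal; assumption|].
  pose proof (kk_sum (/ 2) ltac:(lra)) as H; rewrite RtoC_inv in H by lra; exact H. }
assert (R2 : CSeries (fun n => / t ^ 2 * (twopii ^ 2 * vz (RN (S n) * - / t)) - / RN (S n) ^ 2
   + (kk (RN n + / 2) - kk (RN (S n) + / 2))) =
   / t ^ 2 * (twopii ^ 2 * S2) - Z + (kk (/ 2) - - / t * (twopii / 2))).
{ apply CSeries_of_cvg.
  apply (Ccvg_ext (fun M => / t ^ 2 * (twopii ^ 2 * psum (fun m => vz (RN (S m) * - / t)) M)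
    - psum (fun m => / RN (S m) ^ 2) M + (kk (/ 2) - kk (RN M + / 2)))).
  { induction n as [|m IH].
    - simpl psum; replace (RN 0 + / 2) with (/ 2) by (unfold RN; simpl (INR 0); ring); ring.
    - rewrite !psum_S, <- IH; ring. }
  apply Ccvg_plus; [apply Ccvg_minus; [do 2 apply Ccvg_scal; assumption | assumption]|].
  apply Ccvg_minus; [apply Ccvg_const | exact kk_limit]. }
rewrite R1, R2 in E; rewrite E1, E2'; pose proof twopii_neq_0 as Hp.
assert (E5 : S2 = t ^ 2 * S1 + (1 - t ^ 2) / RtoC 24 - t / (2 * twopii)).
{ replace S2 with (t ^ 2 / twopii ^ 2 *
   ((/ t ^ 2 * (twopii ^ 2 * S2) - Z + (kk (/ 2) - - / t * (twopii / 2)))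
     + Z - kk (/ 2) - / t * (twopii / 2))) by (field; auto).
  rewrite <- E; unfold Z; field; auto. }
rewrite E5; field; exact Hp.
Qed.

End Inversion.

(** * The modular group *)

Definition RZ (n : Z) : C := RtoC (IZR n).

Lemma RZ_plus (a b : Z) : RZ (a + b) = RZ a + RZ b.
Proof. unfold RZ; now rewrite plus_IZR, RtoC_plus. Qed.

Lemma RZ_mult (a b : Z) : RZ (a * b) = RZ a * RZ b.
Proof. unfold RZ; now rewrite mult_IZR, RtoC_mult. Qed.

Lemma RZ_opp (a : Z) : RZ (- a) = - RZ a.
Proof. unfold RZ; now rewrite opp_IZR, RtoC_opp. Qed.

Lemma RZ_det (g : SL2Z) : RZ (ma g) * RZ (md g) - RZ (mb g) * RZ (mc g) = 1.
Proof.
rewrite <- !RZ_mult; unfold Cminus; rewrite <- RZ_opp, <- RZ_plus.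
replace (ma g * md g + - (mb g * mc g))%Z with 1%Z; [reflexivity | rewrite <- (mdet g); ring].
Qed.

Lemma autf_RZ (g : SL2Z) (t : C) : autf g t = RZ (mc g) * t + RZ (md g).
Proof. reflexivity. Qed.

Lemma act_RZ (g : SL2Z) (t : C) : act g t = (RZ (ma g) * t + RZ (mb g)) / autf g t.
Proof. reflexivity. Qed.

Lemma bottom_row_neq_0 (g : SL2Z) : mc g <> 0%Z \/ md g <> 0%Z.
Proof.
destruct (Z.eq_dec (mc g) 0) as [Ec | Ec]; [|now left].
destruct (Z.eq_dec (md g) 0) as [Ed | Ed]; [|now right].
pose proof (mdet g) as H; rewrite Ec, Ed in H; lia.
Qed.

Lemma IZR_abs_ge_1 (n : Z) : n <> 0%Z -> (1 <= Rabs (IZR n))%R.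
Proof. intros H; rewrite <- abs_IZR; apply IZR_le; lia. Qed.

Lemma autf_lower (g : SL2Z) (t : C) : upper t ->
  (Rmin 1 (Im t) <= Cmod (autf g t))%R.
Proof.
intros Ht; unfold upper in Ht; destruct (Z.eq_dec (mc g) 0) as [Ec | Ec].
- eapply Rle_trans; [apply Rmin_l|].
  destruct (bottom_row_neq_0 g) as [H | H]; [contradiction|].
  eapply Rle_trans; [apply (IZR_abs_ge_1 _ H)|].
  rewrite autf_RZ, Ec; unfold RZ; rewrite Cmult_0_l, Cplus_0_l, Cmod_R; lra.
- eapply Rle_trans; [apply Rmin_r|].
  eapply Rle_trans; [|apply im_le_Cmod].
  assert (E : Im (autf g t) = (IZR (mc g) * Im t)%R)
    by (unfold autf, RtoC; destruct t; simpl; ring).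
  rewrite E, Rabs_mult, (Rabs_pos_eq (Im t)) by lra.
  pose proof (IZR_abs_ge_1 _ Ec); nra.
Qed.

Lemma autf_neq_0 (g : SL2Z) (t : C) : upper t -> autf g t <> 0.
Proof.
intros Ht; pose proof (autf_lower g t Ht) as H; apply Cmod_gt_0.
assert (0 < Rmin 1 (Im t))%R by (apply Rmin_glb_lt; [lra | exact Ht]); lra.
Qed.

Lemma Im_act (g : SL2Z) (t : C) : upper t ->
  Im (act g t) = (Im t / Cmod (autf g t) ^ 2)%R.
Proof.
intros Ht; pose proof (autf_neq_0 g t Ht) as Hn; apply Cmod_gt_0 in Hn.
assert (Hn2 : (0 < Cmod (autf g t) ^ 2)%R) by (apply pow_lt; lra).
rewrite Cmod2_alt in *; revert Hn2; unfold act, autf, RtoC; destruct t as [x y]; simpl.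
intros Hn2.
assert (Hd : (IZR (ma g) * IZR (md g) - IZR (mb g) * IZR (mc g) = 1)%R).
{ rewrite <- !mult_IZR, <- minus_IZR, mdet; reflexivity. }
match goal with |- _ = (y / ?d)%R => set (D := d) in * end.
unfold Cinv; simpl; fold D.
replace (_ + _)%R with ((IZR (ma g) * IZR (md g) - IZR (mb g) * IZR (mc g)) * y / D)%R;
  [rewrite Hd; unfold Rdiv; ring|].
unfold Rdiv; ring.
Qed.

Lemma upper_act (g : SL2Z) (t : C) : upper t -> upper (act g t).
Proof.
intros Ht; unfold upper; rewrite Im_act by exact Ht.
apply Rdiv_lt_0_compat; [exact Ht | apply pow_lt, Cmod_gt_0, autf_neq_0, Ht].
Qed.

Lemma autf_mul (g h : SL2Z) (t : C) : upper t ->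
  autf (SL2Z_mul g h) t = autf g (act h t) * autf h t.
Proof.
intros Ht; pose proof (autf_neq_0 h t Ht) as Hn.
rewrite (autf_RZ g), act_RZ, autf_RZ; simpl.
rewrite !RZ_plus, !RZ_mult; rewrite (autf_RZ h) in *; field; exact Hn.
Qed.

Lemma act_mul (g h : SL2Z) (t : C) : upper t ->
  act (SL2Z_mul g h) t = act g (act h t).
Proof.
intros Ht; pose proof (autf_neq_0 h t Ht) as Hn.
pose proof (autf_neq_0 g _ (upper_act h t Ht)) as Hg.
rewrite (act_RZ (SL2Z_mul g h)), autf_mul, (act_RZ g) by exact Ht; simpl.
rewrite !RZ_plus, !RZ_mult; set (w := autf g (act h t)) in *.
rewrite (act_RZ h); rewrite (autf_RZ h) in *; field; auto.
Qed.

Definition MT (n : Z) : SL2Z := mkSL2Z 1 n 0 1 ltac:(ring).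
Definition MS : SL2Z := mkSL2Z 0 (-1) 1 0 ltac:(ring).
Definition M1 : SL2Z := mkSL2Z 1 0 0 1 ltac:(ring).

Lemma SL2Z_inv_det (g : SL2Z) : (md g * ma g - (- mb g) * (- mc g) = 1)%Z.
Proof. rewrite <- (mdet g); ring. Qed.

Definition SL2Z_inv (g : SL2Z) : SL2Z :=
  mkSL2Z (md g) (- mb g) (- mc g) (ma g) (SL2Z_inv_det g).

Lemma act_MT (n : Z) (t : C) : act (MT n) t = t + RZ n.
Proof.
rewrite act_RZ, autf_RZ; simpl; unfold RZ; field.
Qed.

Lemma autf_MT (n : Z) (t : C) : autf (MT n) t = 1.
Proof. rewrite autf_RZ; simpl; unfold RZ; ring. Qed.

Lemma autf_MS (t : C) : autf MS t = t.
Proof. rewrite autf_RZ; simpl; unfold RZ; ring. Qed.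

Lemma act_MS (t : C) : act MS t = - / t.
Proof. rewrite act_RZ, autf_MS; simpl; unfold RZ, Cdiv; ring. Qed.

Lemma act_inv (g : SL2Z) (t : C) : upper t -> act (SL2Z_inv g) (act g t) = t.
Proof.
intros Ht; rewrite <- act_mul by exact Ht.
rewrite act_RZ, autf_RZ; simpl; rewrite !RZ_plus, !RZ_mult, !RZ_opp.
pose proof (RZ_det g) as Hd.
replace (RZ (md g) * RZ (ma g) + - RZ (mb g) * RZ (mc g)) with (RtoC 1)
  by (rewrite <- Hd; ring).
replace (- RZ (mc g) * RZ (mb g) + RZ (ma g) * RZ (md g)) with (RtoC 1)
  by (rewrite <- Hd; ring).
replace (RZ (md g) * RZ (mb g) + - RZ (mb g) * RZ (md g)) with (RtoC 0) by ring.
replace (- RZ (mc g) * RZ (ma g) + RZ (ma g) * RZ (mc g)) with (RtoC 0) by ring.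
field.
Qed.

Lemma SL2Z_descent (P : SL2Z -> Prop) :
  (forall g, mc g = 0%Z -> P g) ->
  (forall g, P (SL2Z_mul MS g) -> P g) ->
  (forall g n, P (SL2Z_mul (MT n) g) -> P g) ->
  forall g, P g.
Proof.
intros H0 HS HT.
assert (H : forall N g, (Z.abs (mc g) < Z.of_nat N)%Z -> P g).
{ induction N as [|N IH]; intros g Hg; [lia|].
  destruct (Z.eq_dec (mc g) 0) as [E | E]; [now apply H0|].
  apply (HT g (- (ma g / mc g))%Z), HS, IH.
  assert (Em : mc (SL2Z_mul MS (SL2Z_mul (MT (- (ma g / mc g))) g)) = (ma g mod mc g)%Z).
  { rewrite Z.mod_eq by exact E.
    change ((1 * (1 * ma g + - (ma g / mc g) * mc g) + 0 * (0 * ma g + 1 * mc g))%Z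
      = (ma g - mc g * (ma g / mc g))%Z); ring. }
  rewrite Em; pose proof (Z.mod_bound_or (ma g) (mc g) E); lia. }
intros g; apply (H (S (Z.to_nat (Z.abs (mc g))))); lia.
Qed.

Lemma unimodular_triangular (g : SL2Z) : mc g = 0%Z ->
  (ma g = 1 /\ md g = 1)%Z \/ (ma g = -1 /\ md g = -1)%Z.
Proof.
intros E; pose proof (mdet g) as H; rewrite E in H.
assert (H1 : (ma g * md g = 1)%Z) by lia.
apply Z.eq_mul_1 in H1 as H2; destruct H2 as [H2 | H2]; rewrite H2 in *; lia.
Qed.

Lemma translation_iter (F : C -> C) (G : C -> Prop) (a : C) :
  G 1 -> (forall x y, G x -> G y -> G (x * y)) -> (forall x, G x -> G (/ x)) ->
  (forall x, G x -> x <> 0) -> G a ->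
  (forall t, upper t -> F (t + 1) = a * F t) ->
  forall n : Z, exists k, G k /\ forall t, upper t -> F (t + RZ n) = k * F t.
Proof.
intros G1 GM GV G0 Ga HF.
assert (Hup : forall (t : C) (s : R), upper t -> upper (t + RtoC s))
  by (intros t s; unfold upper, RtoC; destruct t; simpl; lra).
assert (Hpos : forall n : nat, exists k, G k /\
  forall t, upper t -> F (t + RZ (Z.of_nat n)) = k * F t).
{ induction n as [|n [k [Gk Hk]]].
  - exists 1; split; [exact G1|]; intros t _; unfold RZ; simpl; rewrite Cplus_0_r; ring.
  - exists (a * k); split; [now apply GM|]; intros t Ht.
    rewrite Nat2Z.inj_succ, <- Z.add_1_r, RZ_plus, Cplus_assoc.
    change (RZ 1) with (RtoC 1); rewrite HF by now apply Hup.
    rewrite Hk by exact Ht; ring. }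
intros n; destruct (Z_le_gt_dec 0 n) as [Hn | Hn].
- destruct (Hpos (Z.to_nat n)) as [k Hk]; rewrite Z2Nat.id in Hk by exact Hn; eauto.
- destruct (Hpos (Z.to_nat (- n))) as [k [Gk Hk]]; rewrite Z2Nat.id in Hk by lia.
  exists (/ k); split; [now apply GV|]; intros t Ht.
  pose proof (Hk (t + RZ n) (Hup t _ Ht)) as H.
  replace (t + RZ n + RZ (- n)) with t in H by (rewrite RZ_opp; ring).
  rewrite H; field; now apply G0.
Qed.

Lemma weight_transformation (F : C -> C) (G : C -> Prop) (k : nat) (a b : C) :
  G 1 -> (forall x y, G x -> G y -> G (x * y)) -> (forall x, G x -> G (/ x)) ->
  (forall x, G x -> x <> 0) -> G a -> G b ->
  (forall t, upper t -> F (t + 1) = a * F t) ->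
  (forall t, upper t -> F (- / t) = b * t ^ (2 * k) * F t) ->
  forall g, exists c, G c /\
    forall t, upper t -> F (act g t) = c * autf g t ^ (2 * k) * F t.
Proof.
intros G1 GM GV G0 Ga Gb HT HS.
pose proof (translation_iter F G a G1 GM GV G0 Ga HT) as HTn.
apply SL2Z_descent.
- intros g Hc; destruct (unimodular_triangular g Hc) as [[Ea Ed] | [Ea Ed]].
  + destruct (HTn (mb g)) as [c [Gc Hn]]; exists c; split; [exact Gc|]; intros t Ht.
    rewrite act_RZ, autf_RZ, Hc, Ea, Ed.
    replace (RZ 0 * t + RZ 1) with (RtoC 1) by (unfold RZ; ring).
    replace ((RZ 1 * t + RZ (mb g)) / 1) with (t + RZ (mb g))
      by (change (RZ 1) with (RtoC 1); field).
    rewrite Hn, Cpow_1_l by exact Ht; ring.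
  + destruct (HTn (- mb g)%Z) as [c [Gc Hn]]; exists c; split; [exact Gc|]; intros t Ht.
    rewrite act_RZ, autf_RZ, Hc, Ea, Ed.
    replace (RZ 0 * t + RZ (-1)) with (- RtoC 1)
      by (change (RZ (-1)) with (RtoC (-(1))); change (RZ 0) with (RtoC 0); rewrite RtoC_opp; ring).
    replace ((RZ (-1) * t + RZ (mb g)) / - (1)) with (t + RZ (- mb g)).
    2:{ rewrite RZ_opp; change (RZ (-1)) with (RtoC (-(1))); rewrite RtoC_opp; field. }
    rewrite Hn, Cpow_mult_r by exact Ht.
    replace ((- (1)) ^ 2) with (RtoC 1) by ring; rewrite Cpow_1_l; ring.
- intros g [c [Gc Hc]]; exists (/ b * c); split; [apply GM; auto|]; intros t Ht.
  specialize (Hc t Ht); rewrite act_mul, autf_mul, act_MS, autf_MS in Hc by exact Ht.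
  pose proof (upper_act g t Ht) as Hg.
  rewrite HS, Cpow_mult_l in Hc by exact Hg.
  pose proof (Cpow_nz _ (2 * k) (upper_neq_0 _ Hg)) as Hz.
  set (w := act g t ^ (2 * k)) in *; set (j := autf g t ^ (2 * k)) in *.
  replace (F (act g t)) with (/ (b * w) * (b * w * F (act g t))) by (field; auto).
  rewrite Hc; field; auto.
- intros g n [c [Gc Hc]]; destruct (HTn n) as [d [Gd Hd]].
  exists (/ d * c); split; [apply GM; auto|]; intros t Ht.
  specialize (Hc t Ht); rewrite act_mul, autf_mul, act_MT, autf_MT in Hc by exact Ht.
  pose proof (upper_act g t Ht) as Hg.
  rewrite Hd, Cmult_1_l in Hc by exact Hg.
  replace (F (act g t)) with (/ d * (d * F (act g t))) by (field; auto).
  rewrite Hc; ring.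
Qed.

Lemma weight_invariance (F : C -> C) (k : nat) :
  (forall t, upper t -> F (t + 1) = F t) ->
  (forall t, upper t -> F (- / t) = t ^ (2 * k) * F t) ->
  forall g t, upper t -> F (act g t) = autf g t ^ (2 * k) * F t.
Proof.
intros HT HS g t Ht.
destruct (weight_transformation F (fun x => x = 1) k 1 1) with (g := g) as [c [Ec Hc]]; auto.
- intros x y -> ->; ring.
- intros x ->; field.
- intros x ->; apply C1_nz.
- intros u Hu; rewrite HT by exact Hu; ring.
- intros u Hu; rewrite HS by exact Hu; ring.
- rewrite Hc, Ec by exact Ht; ring.
Qed.

Lemma exists_nearest_integer (x : R) : exists n : Z, (- / 2 <= x + IZR n <= / 2)%R.
Proof.
exists (- up (x - / 2))%Z; rewrite opp_IZR; destruct (archimed (x - / 2)); lra.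
Qed.

(* Instead of a maximum of [Im (act g t)] over the orbit, a value above 3/4 of the
   supremum is enough: inversion would multiply it by more than 4/3 if
   [Cmod < sqrt 3 / 2]. *)
Lemma fundamental_reduction (t : C) : upper t ->
  exists g, (Rabs (Re (act g t)) <= / 2)%R /\ (/ 2 <= Im (act g t))%R.
Proof.
intros Ht.
set (E := fun y => exists g, y = Im (act g t)).
set (mu := Rmin 1 (Im t)).
assert (Hmu : (0 < mu)%R) by (apply Rmin_glb_lt; [lra | exact Ht]).
destruct (completeness E) as [sg [Hub Hlub]].
{ exists (Im t / mu ^ 2)%R; intros y [g ->]; rewrite Im_act by exact Ht.
  pose proof (autf_lower g t Ht) as Hl; fold mu in Hl; unfold upper in Ht.
  apply Rmult_le_compat_l; [lra|].
  apply Rinv_le_contravar; [apply pow_lt; lra | apply pow_incr; lra]. }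
{ exists (Im (act M1 t)); now exists M1. }
assert (Hsg : (0 < sg)%R).
{ apply Rlt_le_trans with (Im (act M1 t)); [exact (upper_act M1 t Ht) | apply Hub; now exists M1]. }
assert (Hg : exists g, (3 / 4 * sg < Im (act g t))%R).
{ apply NNPP; intros Hn; assert (sg <= 3 / 4 * sg)%R; [|lra].
  apply Hlub; intros y [g ->]; apply Rnot_lt_le; intros Hlt; apply Hn; now exists g. }
destruct Hg as [g Hg].
destruct (exists_nearest_integer (Re (act g t))) as [n Hn].
exists (SL2Z_mul (MT n) g); rewrite act_mul, act_MT by exact Ht.
pose proof (upper_act g t Ht) as Hup.
set (w := act g t + RZ n).
assert (Hre : Re w = (Re (act g t) + IZR n)%R)
  by (unfold w, RZ, RtoC; destruct (act g t); simpl; ring).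
assert (Him : Im w = Im (act g t)) by (unfold w, RZ, RtoC; destruct (act g t); simpl; ring).
assert (Hw : upper w) by (unfold upper; rewrite Him; exact Hup).
assert (Hs : (Im (act MS w) <= sg)%R).
{ apply Hub; exists (SL2Z_mul MS (SL2Z_mul (MT n) g)).
  now rewrite !act_mul, act_MT by (auto using upper_act). }
rewrite Im_act, autf_MS in Hs by exact Hw.
assert (Hc0 : (0 < Cmod w)%R) by (apply Cmod_gt_0, upper_neq_0, Hw).
assert (Hc : (0 < Cmod w ^ 2)%R) by (apply pow_lt, Hc0).
assert (Hm : (3 / 4 <= Cmod w ^ 2)%R).
{ apply (Rmult_le_compat_r (Cmod w ^ 2)) in Hs; [|lra].
  replace (Im w / Cmod w ^ 2 * Cmod w ^ 2)%R with (Im w) in Hs by (field; lra).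
  rewrite Him in Hs; nra. }
rewrite Cmod2_alt in Hm; unfold upper in Hw; split.
- rewrite Hre; apply Rabs_le; lra.
- rewrite Hre in Hm; nra.
Qed.

(** * Sequential compactness *)

Lemma bounded_real_subseq (u : nat -> R) (a b : R) :
  (forall n, (a <= u n <= b)%R) ->
  exists (p : nat -> nat) (l : R), (forall n, (n <= p n)%nat) /\
    is_lim_seq (fun n => u (p n)) l.
Proof.
intros Hu.
destruct (Bolzano_Weierstrass u (fun c => (a <= c <= b)%R) (compact_P3 a b) Hu) as [l Hl].
assert (H : forall n : nat, exists p, (n <= p)%nat /\ (Rabs (u p - l) < / (INR n + 1))%R).
{ intros n.
  assert (Hp : (0 < / (INR n + 1))%R) by (apply Rinv_0_lt_compat; pose proof (pos_INR n); lra).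
  destruct (Hl (disc l (mkposreal _ Hp)) n) as [p [H1 H2]].
  - exists (mkposreal _ Hp); unfold included; auto.
  - exists p; split; [exact H1 | exact H2]. }
exists (fun n => proj1_sig (constructive_indefinite_description _ (H n))), l; split.
- intros n; destruct (constructive_indefinite_description _ (H n)) as [p [H1 H2]]; exact H1.
- apply is_lim_seq_spec; intros eps.
  destruct (archimed_cor1 eps (cond_pos eps)) as [N [HN HN0]].
  exists N; intros n Hn.
  destruct (constructive_indefinite_description _ (H n)) as [p [H1 H2]]; simpl.
  eapply Rlt_trans; [exact H2|]; eapply Rle_lt_trans; [|exact HN].
  apply Rinv_le_contravar; [apply lt_0_INR; exact HN0|].
  apply le_INR in Hn; lra.
Qed.

Lemma is_lim_seq_reindex (u : nat -> R) (l : R) (p : nat -> nat) :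
  (forall n, (n <= p n)%nat) -> is_lim_seq u l -> is_lim_seq (fun n => u (p n)) l.
Proof.
intros Hp H; apply is_lim_seq_spec in H; apply is_lim_seq_spec; intros eps.
destruct (H eps) as [N HN]; exists N; intros n Hn; apply HN; specialize (Hp n); lia.
Qed.

Lemma Ccvg_reindex (u : nat -> C) (l : C) (p : nat -> nat) :
  (forall n, (n <= p n)%nat) -> Ccvg u l -> Ccvg (fun n => u (p n)) l.
Proof.
intros Hp H eps He; destruct (H eps He) as [N HN]; exists N; intros n Hn.
apply HN; specialize (Hp n); lia.
Qed.

Lemma bounded_complex_subseq (u : nat -> C) (a b c d : R) :
  (forall n, (a <= Re (u n) <= b)%R /\ (c <= Im (u n) <= d)%R) ->
  exists (p : nat -> nat) (l : C), (forall n, (n <= p n)%nat) /\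
    Ccvg (fun n => u (p n)) l /\ (a <= Re l <= b)%R /\ (c <= Im l <= d)%R.
Proof.
intros Hu.
destruct (bounded_real_subseq (fun n => Re (u n)) a b (fun n => proj1 (Hu n)))
  as [p [x [Hp Hx]]].
destruct (bounded_real_subseq (fun n => Im (u (p n))) c d (fun n => proj2 (Hu (p n))))
  as [r [y [Hr Hy]]].
exists (fun n => p (r n)), (x, y).
assert (Hx' : is_lim_seq (fun n => Re (u (p (r n)))) x)
  by (apply (is_lim_seq_reindex (fun n => Re (u (p n)))); assumption).
repeat split.
- intros n; specialize (Hr n); specialize (Hp (r n)); lia.
- now apply is_lim_seq_Re.
- apply (is_lim_seq_le (fun _ => a) (fun n => Re (u (p (r n)))) a x);
    [intros; apply Hu | apply is_lim_seq_const | exact Hx'].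
- apply (is_lim_seq_le (fun n => Re (u (p (r n)))) (fun _ => b) x b);
    [intros; apply Hu | exact Hx' | apply is_lim_seq_const].
- apply (is_lim_seq_le (fun _ => c) (fun n => Im (u (p (r n)))) c y);
    [intros; apply Hu | apply is_lim_seq_const | exact Hy].
- apply (is_lim_seq_le (fun n => Im (u (p (r n)))) (fun _ => d) y d);
    [intros; apply Hu | exact Hy | apply is_lim_seq_const].
Qed.

(** * The discriminant and the ring of modular forms *)

Lemma derive_0_const_upper (F : C -> C) :
  (forall u, upper u -> is_Cderive F u 0) ->
  forall z w, upper z -> upper w -> F z = F w.
Proof.
intros H z w Hz Hw.
assert (H0 : (Cmod (F z - F w) <= 0 * Cmod (z - w))%R).
{ apply (mean_value_ineq F (fun _ => RtoC 0)); intros s Hs; split; [|rewrite Cmod_0; lra].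
  apply H; unfold upper in *.
  replace (Im (w + RtoC s * (z - w))) with ((1 - s) * Im w + s * Im z)%R
    by (unfold RtoC; destruct z, w; simpl; ring).
  destruct (Req_dec s 0) as [E | E]; [subst s; lra|].
  assert (0 < s * Im z)%R by (apply Rmult_lt_0_compat; lra).
  assert (0 <= (1 - s) * Im w)%R by (apply Rmult_le_pos; lra); lra. }
rewrite Rmult_0_l in H0; pose proof (Cmod_ge_0 (F z - F w)).
assert (E : F z - F w = 0) by (apply Cmod_eq_0; lra).
replace (F z) with (F z - F w + F w) by ring; rewrite E; ring.
Qed.

Lemma upper_plus_1 (t : C) : upper t -> upper (t + 1).
Proof. unfold upper, RtoC; destruct t; simpl; lra. Qed.

Lemma QS_plus_1 (a : nat -> C) (t : C) : QS a (t + 1) = QS a t.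
Proof. unfold QS; now rewrite qpar_plus_1. Qed.

Lemma E2_plus_1 (t : C) : E2 (t + 1) = E2 t.
Proof. apply QS_plus_1. Qed.

Lemma E4_plus_1 (t : C) : upper t -> E4 (t + 1) = E4 t.
Proof. intros H; rewrite !E4_QS; [apply QS_plus_1 | exact H | now apply upper_plus_1]. Qed.

Lemma eta_plus_1 (t : C) : upper t -> eta (t + 1) = Cexp (twopii / RtoC 24) * eta t.
Proof.
intros H; rewrite !eta_exp by auto using upper_plus_1.
unfold eta_log; rewrite QS_plus_1, <- Cexp_plus; f_equal; ring.
Qed.

Lemma is_Cderive_S (t : C) : upper t -> is_Cderive (fun u => - / u) t (/ t ^ 2).
Proof.
intros Ht; pose proof (upper_neq_0 t Ht) as Hz.
replace (/ t ^ 2) with (- (1) * (- (1) / t ^ 2)) by (field; exact Hz).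
apply (is_Cderive_ext (fun u => - (1) * / u)); [intros; ring|].
apply is_Cderive_scal, (is_Cderive_inv (fun u => u)); [exact Hz | apply is_Cderive_id].
Qed.

Lemma near_upper (t : C) (P : C -> Prop) : upper t -> (forall u, upper u -> P u) -> near t P.
Proof. intros Ht H; exact (near_imp t upper P H (Copen_upper t Ht)). Qed.

Lemma derivative_inversion (f df : C -> C) (k : nat) :
  (forall t, upper t -> is_Cderive f t (twopii * df t)) ->
  (forall t, upper t -> f (- / t) = t ^ k * f t) ->
  forall t, upper t ->
  df (- / t) = t ^ 2 * (t ^ k * df t + RN k * t ^ pred k * f t / twopii).
Proof.
intros Hd HS t Ht; pose proof (upper_neq_0 t Ht) as Hz; pose proof twopii_neq_0 as Hp.
pose proof (is_Cderive_comp f (fun u => - / u) t _ _ (Hd _ (upper_S t Ht)) (is_Cderive_S t Ht)) as H1.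
pose proof (is_Cderive_mult _ _ t _ _
  (is_Cderive_pow (fun u => u) t _ k (is_Cderive_id t)) (Hd t Ht)) as H2.
cbv beta in H1, H2.
assert (E : / t ^ 2 * (twopii * df (- / t)) =
   RtoC (INR k) * t ^ pred k * 1 * f t + t ^ k * (twopii * df t)).
{ apply (is_Cderive_unique (fun u => f (- / u)) t); [exact H1|].
  apply (is_Cderive_ext_near (fun u => u ^ k * f u)); [|exact H2].
  apply near_upper; [exact Ht|]; intros u Hu; symmetry; now apply HS. }
replace (df (- / t)) with (t ^ 2 / twopii * (/ t ^ 2 * (twopii * df (- / t))))
  by (field; auto).
rewrite E; unfold RN; field; exact Hp.
Qed.

Definition dE2 : C -> C := QS (ncoef e2_coef).
Definition dE4 : C -> C := QS (ncoef e4_coef).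
Definition ddE4 : C -> C := QS (ncoef (ncoef e4_coef)).
(* One of Ramanujan's equations, taken as definition: the q-expansion of E6 is not needed. *)
Definition E6 (t : C) : C := E2 t * E4 t - RtoC 3 * dE4 t.
Definition dE6 (t : C) : C := dE2 t * E4 t + E2 t * dE4 t - RtoC 3 * ddE4 t.

Lemma is_Cderive_E2 (t : C) : upper t -> is_Cderive E2 t (twopii * dE2 t).
Proof. apply is_Cderive_QS, subexp_e2. Qed.

Lemma is_Cderive_E4 (t : C) : upper t -> is_Cderive E4 t (twopii * dE4 t).
Proof.
intros Ht; apply (is_Cderive_ext_near (QS e4_coef)).
- apply near_upper; [exact Ht|]; intros u Hu; symmetry; now apply E4_QS.
- apply is_Cderive_QS; [exact subexp_e4 | exact Ht].
Qed.

Lemma is_Cderive_dE4 (t : C) : upper t -> is_Cderive dE4 t (twopii * ddE4 t).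
Proof. apply is_Cderive_QS, subexp_ncoef, subexp_e4. Qed.

Lemma is_Cderive_E6 (t : C) : upper t -> is_Cderive E6 t (twopii * dE6 t).
Proof.
intros Ht; unfold E6, dE6.
replace (twopii * (dE2 t * E4 t + E2 t * dE4 t - RtoC 3 * ddE4 t))
  with (twopii * dE2 t * E4 t + E2 t * (twopii * dE4 t) - RtoC 3 * (twopii * ddE4 t)) by ring.
apply is_Cderive_minus.
- apply is_Cderive_mult; [now apply is_Cderive_E2 | now apply is_Cderive_E4].
- now apply is_Cderive_scal, is_Cderive_dE4.
Qed.

Lemma dE2_S (t : C) : upper t ->
  dE2 (- / t) = t ^ 4 * dE2 t + 2 * t ^ 3 * E2 t / twopii + RtoC 12 * t ^ 2 / twopii ^ 2.
Proof.
intros Ht; pose proof (upper_neq_0 t Ht) as Hz; pose proof twopii_neq_0 as Hp.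
pose proof (is_Cderive_comp E2 (fun u => - / u) t _ _
  (is_Cderive_E2 _ (upper_S t Ht)) (is_Cderive_S t Ht)) as H1.
pose proof (is_Cderive_plus _ _ t _ _
  (is_Cderive_mult _ _ t _ _ (is_Cderive_pow (fun u => u) t _ 2 (is_Cderive_id t))
    (is_Cderive_E2 t Ht))
  (is_Cderive_scal (RtoC 12 / twopii) _ t _ (is_Cderive_id t))) as H2.
cbv beta in H1, H2.
match type of H2 with is_Cderive _ _ ?d =>
  assert (E : / t ^ 2 * (twopii * dE2 (- / t)) = d) end.
{ apply (is_Cderive_unique (fun u => E2 (- / u)) t); [exact H1|].
  eapply is_Cderive_ext_near; [|exact H2].
  apply near_upper; [exact Ht|]; intros u Hu; rewrite (E2_S u Hu); field; exact Hp. }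
replace (dE2 (- / t)) with (t ^ 2 / twopii * (/ t ^ 2 * (twopii * dE2 (- / t))))
  by (field; auto).
rewrite E; simpl (INR 2); simpl pred; rewrite RtoC_plus; field; exact Hp.
Qed.

Lemma dE4_S (t : C) : upper t ->
  dE4 (- / t) = t ^ 6 * dE4 t + RtoC 4 * t ^ 5 * E4 t / twopii.
Proof.
intros Ht; rewrite (derivative_inversion E4 dE4 4 is_Cderive_E4 E4_S t Ht).
unfold RN; replace (INR 4) with 4%R by (simpl; ring); simpl pred; field; apply twopii_neq_0.
Qed.

Lemma E6_S (t : C) : upper t -> E6 (- / t) = t ^ 6 * E6 t.
Proof.
intros Ht; unfold E6; rewrite E2_S, E4_S, dE4_S by exact Ht; field; apply twopii_neq_0.
Qed.

Lemma dE6_S (t : C) : upper t ->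
  dE6 (- / t) = t ^ 8 * dE6 t + RtoC 6 * t ^ 7 * E6 t / twopii.
Proof.
intros Ht; rewrite (derivative_inversion E6 dE6 6 is_Cderive_E6 E6_S t Ht).
unfold RN; replace (INR 6) with 6%R by (simpl; ring); simpl pred; field; apply twopii_neq_0.
Qed.

Lemma E6_plus_1 (t : C) : upper t -> E6 (t + 1) = E6 t.
Proof. intros Ht; unfold E6; now rewrite E2_plus_1, E4_plus_1, (QS_plus_1 (ncoef e4_coef)). Qed.

Lemma dE6_plus_1 (t : C) : upper t -> dE6 (t + 1) = dE6 t.
Proof.
intros Ht; unfold dE6, dE2, dE4, ddE4; rewrite E2_plus_1, E4_plus_1 by exact Ht.
now rewrite !QS_plus_1.
Qed.

Lemma upper_Ci : upper Ci.
Proof. unfold upper; simpl; lra. Qed.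

Lemma Ci_sq : Ci ^ 2 = - (1).
Proof. unfold Ci, RtoC, Copp; simpl; unfold Cmult; simpl; f_equal; ring. Qed.

Lemma S_Ci : - / Ci = Ci.
Proof.
assert (H : Ci <> 0) by (apply upper_neq_0, upper_Ci).
replace (- / Ci) with (- (1) * / Ci) by ring; rewrite <- Ci_sq; field; exact H.
Qed.

Lemma eta4_S (t : C) : upper t -> eta (- / t) ^ 4 = - t ^ 2 * eta t ^ 4.
Proof.
intros Ht.
set (R := fun u => eta (- / u) ^ 4 / (u ^ 2 * eta u ^ 4)).
assert (Hden : forall u, upper u -> u ^ 2 * eta u ^ 4 <> 0).
{ intros u Hu; apply Cmult_neq_0; apply Cpow_nz; [now apply upper_neq_0 | now apply eta_neq_0]. }
assert (HR : R t = R Ci).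
{ apply derive_0_const_upper; [|exact Ht | exact upper_Ci]; intros u Hu.
  pose proof (upper_neq_0 u Hu) as Hz; pose proof (eta_neq_0 u Hu) as He.
  pose proof (eta_neq_0 _ (upper_S u Hu)) as Hes; pose proof twopii_neq_0 as Hp.
  pose proof (is_Cderive_pow _ u _ 4 (is_Cderive_comp eta (fun u => - / u) u _ _
    (is_Cderive_eta _ (upper_S u Hu)) (is_Cderive_S u Hu))) as H1.
  pose proof (is_Cderive_mult _ _ u _ _ (is_Cderive_pow (fun u => u) u _ 2 (is_Cderive_id u))
    (is_Cderive_pow _ u _ 4 (is_Cderive_eta u Hu))) as H2.
  pose proof (is_Cderive_div _ _ u _ _ (Hden u Hu) H1 H2) as H.
  cbv beta in H.
  match type of H with is_Cderive _ _ ?d => replace d with (RtoC 0) in H end; [exact H|].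
  rewrite (E2_S u Hu); simpl pred.
  replace (INR 4) with 4%R by (simpl; ring); replace (INR 2) with 2%R by (simpl; ring).
  set (es := eta (- / u)) in *; set (e := eta u) in *; field; auto. }
unfold R in HR; rewrite S_Ci, Ci_sq in HR.
pose proof (Cpow_nz _ 4 (eta_neq_0 Ci upper_Ci)) as Hi.
replace (eta (- / t) ^ 4) with (eta (- / t) ^ 4 / (t ^ 2 * eta t ^ 4) * (t ^ 2 * eta t ^ 4)).
- rewrite HR; field; exact (eta_neq_0 Ci upper_Ci).
- field; split; [now apply eta_neq_0 | now apply upper_neq_0].
Qed.

Lemma Delta_neq_0 (t : C) : upper t -> Delta t <> 0.
Proof. intros Ht; apply Cpow_nz, eta_neq_0, Ht. Qed.

Lemma eta20_S (t : C) : upper t -> eta (- / t) ^ 20 = - (1) * t ^ (2 * 5) * eta t ^ 20.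
Proof.
intros Ht; replace (eta (- / t) ^ 20) with ((eta (- / t) ^ 4) ^ 5) by ring.
rewrite eta4_S by exact Ht; simpl (2 * 5)%nat; ring.
Qed.

Lemma Delta_S (t : C) : upper t -> Delta (- / t) = t ^ 12 * Delta t.
Proof.
intros Ht; unfold Delta; replace (eta (- / t) ^ 24) with ((eta (- / t) ^ 4) ^ 6) by ring.
rewrite eta4_S by exact Ht; ring.
Qed.

Lemma Delta_exp (t : C) : upper t -> Delta t = qpar t * Cexp (RtoC 24 * QS logeta_coef t).
Proof.
intros Ht; unfold Delta; rewrite eta_exp, Cexp_pow by exact Ht.
unfold qpar; rewrite <- Cexp_plus; f_equal; unfold eta_log.
replace (INR 24) with 24%R by (simpl; ring); fold twopii; field.
Qed.

Lemma Delta_plus_1 (t : C) : upper t -> Delta (t + 1) = Delta t.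
Proof.
intros Ht; rewrite !Delta_exp by auto using upper_plus_1.
now rewrite qpar_plus_1, QS_plus_1.
Qed.

Lemma is_Cderive_Delta (t : C) : upper t -> is_Cderive Delta t (twopii * E2 t * Delta t).
Proof.
intros Ht; unfold Delta.
pose proof (is_Cderive_pow eta t _ 24 (is_Cderive_eta t Ht)) as H; simpl pred in H.
replace (INR 24) with 24%R in H by (simpl; ring).
replace (twopii * E2 t * eta t ^ 24)
  with (RtoC 24 * eta t ^ 23 * (twopii / RtoC 24 * E2 t * eta t)); [exact H | field].
Qed.

Lemma smooth_exp_ode (U : C -> Prop) (HU : Copen U) (f g : C -> C) :
  (forall u, U u -> is_Cderive f u (g u * f u)) -> (forall n, smooth U n g) ->
  forall n, smooth U n f.
Proof.
intros Hd Hg n; induction n as [|n IH].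
- intros u Hu; exact (is_Cderive_cont _ _ _ (Hd u Hu)).
- exists (fun u => g u * f u); split; [exact Hd | apply smooth_mult; auto].
Qed.

Lemma smooth_E2 (n : nat) : smooth upper n E2.
Proof. apply smooth_QS, subexp_e2. Qed.

Lemma smooth_E4 (n : nat) : smooth upper n E4.
Proof.
apply (smooth_ext upper Copen_upper n (QS e4_coef)).
- intros u Hu; symmetry; now apply E4_QS.
- apply smooth_QS, subexp_e4.
Qed.

Lemma smooth_eta (n : nat) : smooth upper n eta.
Proof.
apply (smooth_exp_ode upper Copen_upper eta (fun u => twopii / RtoC 24 * E2 u)).
- exact is_Cderive_eta.
- intros m; apply (smooth_scal upper Copen_upper), smooth_E2.
Qed.

Lemma smooth_Delta (n : nat) : smooth upper n Delta.
Proof. apply (smooth_pow upper Copen_upper n 24), smooth_eta. Qed.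

Lemma smooth_dE2 (n : nat) : smooth upper n dE2.
Proof. apply smooth_QS, subexp_ncoef, subexp_e2. Qed.

Lemma smooth_dE4 (n : nat) : smooth upper n dE4.
Proof. apply smooth_QS, subexp_ncoef, subexp_e4. Qed.

Lemma smooth_ddE4 (n : nat) : smooth upper n ddE4.
Proof. apply smooth_QS, subexp_ncoef, subexp_ncoef, subexp_e4. Qed.

Lemma smooth_E6 (n : nat) : smooth upper n E6.
Proof.
apply (smooth_minus upper Copen_upper).
- apply (smooth_mult upper Copen_upper); [apply smooth_E2 | apply smooth_E4].
- apply (smooth_scal upper Copen_upper), smooth_dE4.
Qed.

Lemma smooth_dE6 (n : nat) : smooth upper n dE6.
Proof.
apply (smooth_minus upper Copen_upper).
- apply (smooth_plus upper Copen_upper); apply (smooth_mult upper Copen_upper);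
    auto using smooth_E2, smooth_E4, smooth_dE2, smooth_dE4.
- apply (smooth_scal upper Copen_upper), smooth_ddE4.
Qed.

(** * Behaviour at the cusp *)

Definition high (t : C) : Prop := (/ 2 <= Im t)%R.

Lemma high_upper (t : C) : high t -> upper t.
Proof. unfold high, upper; lra. Qed.

Lemma qpar_high (t : C) : high t -> (Cmod (qpar t) <= exp (- PI))%R.
Proof.
unfold high; intros H; rewrite qpar_Cmod; pose proof PI_pos.
destruct (Req_dec (2 * PI * Im t) PI) as [E | E]; [rewrite E; lra|].
apply Rlt_le, exp_increasing; nra.
Qed.

Lemma exp_mPI_lt_1 : (0 < exp (- PI) < 1)%R.
Proof.
split; [apply exp_pos|]; rewrite <- exp_0; apply exp_increasing; pose proof PI_pos; lra.
Qed.

Definition cusp2 (f : C -> C) (c0 c1 : C) : Prop :=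
  exists M : R, forall t, high t ->
    (Cmod (f t - c0 - c1 * qpar t) <= M * Cmod (qpar t) ^ 2)%R.

Lemma PS_bounded_high (a : nat -> C) : subexp a ->
  exists M : R, forall t, high t -> (Cmod (QS a t) <= M)%R.
Proof.
intros Ha; pose proof exp_mPI_lt_1 as He.
exists (Series (fun n => (Cmod (a n) * exp (- PI) ^ n)%R)); intros t Ht.
unfold QS, PS; apply CSeries_Cmod_le; [|apply subexp_summable; [exact Ha | lra]].
intros n; rewrite Cmod_mult, Cmod_pow; apply Rmult_le_compat_l; [apply Cmod_ge_0|].
apply pow_incr; split; [apply Cmod_ge_0 | now apply qpar_high].
Qed.

Lemma cusp2_QS (a : nat -> C) : subexp a -> cusp2 (QS a) (a O) (a 1%nat).
Proof.
intros Ha; pose proof (subexp_S _ Ha) as Ha1; pose proof (subexp_S _ Ha1) as Ha2.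
destruct (PS_bounded_high _ Ha2) as [M HM]; exists M; intros t Ht.
pose proof (qpar_lt_1 t (high_upper t Ht)) as Hq.
unfold QS; rewrite PS_incr, (PS_incr (fun n => a (S n))) by assumption.
match goal with |- (Cmod ?x <= _)%R =>
  replace x with (qpar t ^ 2 * QS (fun n => a (S (S n))) t) by (unfold QS; ring) end.
rewrite Cmod_mult, Cmod_pow, Rmult_comm; apply Rmult_le_compat_r; [apply pow2_ge_0 | auto].
Qed.

Lemma cusp2_ext (f g : C -> C) (c0 c1 : C) :
  (forall t, high t -> f t = g t) -> cusp2 f c0 c1 -> cusp2 g c0 c1.
Proof. intros E [M H]; exists M; intros t Ht; rewrite <- E; auto. Qed.

Lemma cusp2_plus (f g : C -> C) (a0 a1 b0 b1 : C) :
  cusp2 f a0 a1 -> cusp2 g b0 b1 -> cusp2 (fun t => f t + g t) (a0 + b0) (a1 + b1).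
Proof.
intros [M HM] [N HN]; exists (M + N)%R; intros t Ht.
replace (f t + g t - (a0 + b0) - (a1 + b1) * qpar t)
  with ((f t - a0 - a1 * qpar t) + (g t - b0 - b1 * qpar t)) by ring.
eapply Rle_trans; [apply Cmod_triangle|].
specialize (HM t Ht); specialize (HN t Ht); lra.
Qed.

Lemma cusp2_scal (k : C) (f : C -> C) (a0 a1 : C) :
  cusp2 f a0 a1 -> cusp2 (fun t => k * f t) (k * a0) (k * a1).
Proof.
intros [M HM]; exists (Cmod k * M)%R; intros t Ht.
replace (k * f t - k * a0 - k * a1 * qpar t) with (k * (f t - a0 - a1 * qpar t)) by ring.
rewrite Cmod_mult, Rmult_assoc; apply Rmult_le_compat_l; [apply Cmod_ge_0 | auto].
Qed.

Lemma cusp2_minus (f g : C -> C) (a0 a1 b0 b1 : C) :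
  cusp2 f a0 a1 -> cusp2 g b0 b1 -> cusp2 (fun t => f t - g t) (a0 - b0) (a1 - b1).
Proof.
intros Hf Hg; pose proof (cusp2_plus _ _ _ _ _ _ Hf (cusp2_scal (- (1)) _ _ _ Hg)) as H.
replace (a0 - b0) with (a0 + - (1) * b0) by ring.
replace (a1 - b1) with (a1 + - (1) * b1) by ring.
apply (cusp2_ext (fun t => f t + - (1) * g t)); [intros; ring | exact H].
Qed.

Lemma cusp2_bounded (f : C -> C) (a0 a1 : C) :
  cusp2 f a0 a1 -> exists B : R, forall t, high t -> (Cmod (f t) <= B)%R.
Proof.
intros [M HM]; exists (Rabs M + Cmod a0 + Cmod a1)%R; intros t Ht.
pose proof (qpar_high t Ht); pose proof exp_mPI_lt_1; pose proof (Cmod_ge_0 (qpar t)).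
replace (f t) with ((f t - a0 - a1 * qpar t) + (a0 + a1 * qpar t)) by ring.
eapply Rle_trans; [apply Cmod_triangle|].
pose proof (Cmod_triangle a0 (a1 * qpar t)) as H2; rewrite Cmod_mult in H2.
specialize (HM t Ht); pose proof (Rle_abs M); pose proof (Cmod_ge_0 a1).
assert (Cmod (qpar t) ^ 2 <= 1)%R by (simpl; nra).
assert (M * Cmod (qpar t) ^ 2 <= Rabs M)%R.
{ pose proof (Rabs_pos M); pose proof (pow2_ge_0 (Cmod (qpar t))); nra. }
nra.
Qed.

Lemma cusp2_mult (f g : C -> C) (a0 a1 b0 b1 : C) :
  cusp2 f a0 a1 -> cusp2 g b0 b1 ->
  cusp2 (fun t => f t * g t) (a0 * b0) (a0 * b1 + a1 * b0).
Proof.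
intros Hf Hg; destruct (cusp2_bounded _ _ _ Hg) as [B HB].
destruct Hf as [M HM], Hg as [N HN].
exists (Rabs M * Rabs B + (Cmod a0 + Cmod a1) * Rabs N + Cmod (a1 * b1))%R; intros t Ht.
set (q := qpar t).
assert (Hq1 : (Cmod q <= 1)%R).
{ pose proof (qpar_high t Ht); pose proof exp_mPI_lt_1; unfold q; lra. }
replace (f t * g t - a0 * b0 - (a0 * b1 + a1 * b0) * q)
  with ((f t - a0 - a1 * q) * g t + (a0 + a1 * q) * (g t - b0 - b1 * q) + a1 * b1 * q ^ 2)
  by ring.
eapply Rle_trans; [apply Cmod_triangle|].
eapply Rle_trans; [apply Rplus_le_compat_r, Cmod_triangle|].
rewrite !Cmod_mult, !Cmod_pow.
specialize (HM t Ht); specialize (HN t Ht); specialize (HB t Ht); fold q in HM, HN.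
pose proof (pow2_ge_0 (Cmod q)) as Hq2.
pose proof (Cmod_ge_0 (f t - a0 - a1 * q)); pose proof (Cmod_ge_0 (g t - b0 - b1 * q)).
pose proof (Cmod_ge_0 (g t)); pose proof (Cmod_ge_0 (a0 + a1 * q)).
pose proof (Cmod_triangle a0 (a1 * q)) as Ha; rewrite Cmod_mult in Ha.
pose proof (Cmod_ge_0 a1); pose proof (Cmod_ge_0 a0); pose proof (Cmod_ge_0 q).
assert (Ha' : (Cmod (a0 + a1 * q) <= Cmod a0 + Cmod a1)%R) by nra.
assert (T1 : (Cmod (f t - a0 - a1 * q) * Cmod (g t) <= Rabs M * Cmod q ^ 2 * Rabs B)%R).
{ apply Rmult_le_compat; auto.
  - eapply Rle_trans; [exact HM|]; apply Rmult_le_compat_r; [exact Hq2 | apply Rle_abs].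
  - eapply Rle_trans; [exact HB | apply Rle_abs]. }
assert (T2 : (Cmod (a0 + a1 * q) * Cmod (g t - b0 - b1 * q) <=
   (Cmod a0 + Cmod a1) * (Rabs N * Cmod q ^ 2))%R).
{ apply Rmult_le_compat; auto.
  eapply Rle_trans; [exact HN|]; apply Rmult_le_compat_r; [exact Hq2 | apply Rle_abs]. }
lra.
Qed.

Lemma sigma_1 (k : nat) : sigma k 1 = 1%nat.
Proof. unfold sigma; simpl; now rewrite Nat.pow_1_l. Qed.

Lemma cusp2_E2 : cusp2 E2 1 (- RtoC 24).
Proof.
replace (- RtoC 24) with (e2_coef 1); [exact (cusp2_QS _ subexp_e2)|].
unfold e2_coef; rewrite sigma_1, RtoC_opp; simpl (INR 1); ring.
Qed.

Lemma e4_coef_1 : e4_coef 1 = RtoC 240.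
Proof. unfold e4_coef; rewrite sigma_1; simpl (INR 1); ring. Qed.

Lemma cusp2_E4 : cusp2 E4 1 (RtoC 240).
Proof.
rewrite <- e4_coef_1; apply (cusp2_ext (QS e4_coef)); [|exact (cusp2_QS _ subexp_e4)].
intros t Ht; symmetry; apply E4_QS, high_upper, Ht.
Qed.

Lemma cusp2_ncoef (a : nat -> C) : subexp a -> cusp2 (QS (ncoef a)) 0 (a 1%nat).
Proof.
intros Ha; pose proof (cusp2_QS _ (subexp_ncoef a Ha)) as H.
unfold ncoef in H at 2 3; simpl (INR 0) in H; simpl (INR 1) in H.
rewrite Cmult_0_l, Cmult_1_l in H; exact H.
Qed.

Lemma cusp2_dE4 : cusp2 dE4 0 (RtoC 240).
Proof. rewrite <- e4_coef_1; apply cusp2_ncoef, subexp_e4. Qed.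

Lemma cusp2_E6 : cusp2 E6 1 (- RtoC 504).
Proof.
pose proof (cusp2_minus _ _ _ _ _ _ (cusp2_mult _ _ _ _ _ _ cusp2_E2 cusp2_E4)
  (cusp2_scal (RtoC 3) _ _ _ cusp2_dE4)) as H.
replace (RtoC 1) with (1 * 1 - RtoC 3 * 0) by ring.
replace (- RtoC 504) with (1 * RtoC 240 + - RtoC 24 * 1 - RtoC 3 * RtoC 240) by ring.
exact H.
Qed.

Lemma Delta_high_bounds : exists c M : R, (0 < c)%R /\ forall t, high t ->
  (c * Cmod (qpar t) <= Cmod (Delta t))%R /\
  (Cmod (Delta t - qpar t) <= M * Cmod (qpar t) ^ 2)%R.
Proof.
destruct (cusp2_QS _ subexp_logeta) as [M0 HM0].
destruct (PS_bounded_high _ subexp_logeta) as [B HB].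
set (B' := (24 * Rabs B)%R).
set (M1 := (24 * (Rabs M0 + Cmod (logeta_coef 1)))%R).
exists (exp (- B')), (exp B' * M1)%R; split; [apply exp_pos|]; intros t Ht.
pose proof (high_upper t Ht) as Hu; rewrite Delta_exp by exact Hu.
set (L := QS logeta_coef t); set (q := qpar t).
assert (HL : (Cmod (RtoC 24 * L) <= B')%R).
{ rewrite Cmod_mult, Cmod_RtoC_pos by lra; unfold B'.
  pose proof (HB t Ht); pose proof (Rle_abs B); fold L in H; lra. }
assert (HLq : (Cmod (RtoC 24 * L) <= M1 * Cmod q)%R).
{ rewrite Cmod_mult, Cmod_RtoC_pos by lra; unfold M1.
  pose proof (HM0 t Ht) as H; fold L q in H.
  assert (E0 : logeta_coef 0 = 0).
  { unfold logeta_coef; change (sigma 1 0) with O; simpl (INR 0).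
    unfold Rdiv; rewrite Rmult_0_l, Ropp_0; reflexivity. }
  rewrite E0 in H; replace (L - 0 - logeta_coef 1 * q) with (L - logeta_coef 1 * q) in H by ring.
  pose proof (Cmod_triangle (L - logeta_coef 1 * q) (logeta_coef 1 * q)) as H1.
  replace (L - logeta_coef 1 * q + logeta_coef 1 * q) with L in H1 by ring.
  rewrite Cmod_mult in H1.
  pose proof (qpar_high t Ht) as Hq; fold q in Hq; pose proof exp_mPI_lt_1.
  pose proof (Cmod_ge_0 q); pose proof (Rle_abs M0); pose proof (Rabs_pos M0).
  assert (M0 * Cmod q ^ 2 <= Rabs M0 * Cmod q)%R.
  { apply Rle_trans with (Rabs M0 * Cmod q ^ 2)%R.
    - apply Rmult_le_compat_r; [apply pow2_ge_0 | lra].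
    - apply Rmult_le_compat_l; [lra | simpl; nra]. }
  lra. }
split.
- rewrite Cmod_mult, (Rmult_comm (Cmod q)); apply Rmult_le_compat_r; [apply Cmod_ge_0|].
  rewrite Cmod_Cexp.
  pose proof (re_le_Cmod (RtoC 24 * L)) as H; apply Rabs_le_between in H.
  destruct (Req_dec (- B') (Re (RtoC 24 * L))) as [E | E]; [rewrite E; lra|].
  apply Rlt_le, exp_increasing; lra.
- replace (q * Cexp (RtoC 24 * L) - q) with (q * (Cexp (RtoC 24 * L) - 1)) by ring.
  rewrite Cmod_mult.
  assert (H : (Cmod (Cexp (RtoC 24 * L) - 1) <= exp B' * Cmod (RtoC 24 * L))%R).
  { pose proof (mean_value_ineq Cexp Cexp 0 (RtoC 24 * L) (exp B')) as H.
    rewrite Cexp_0 in H; replace (RtoC 24 * L - 0) with (RtoC 24 * L) in H by ring; apply H.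
    intros s Hs; split; [apply is_Cderive_Cexp|]; rewrite Cmod_Cexp.
    assert (Hle : (Re (0 + RtoC s * (RtoC 24 * L)) <= B')%R).
    { rewrite Cplus_0_l; eapply Rle_trans; [apply Rle_abs|].
      eapply Rle_trans; [apply re_le_Cmod|]; rewrite (Cmod_mult (RtoC s)), Cmod_RtoC_pos by lra.
      pose proof (Cmod_ge_0 (RtoC 24 * L)); nra. }
    destruct (Req_dec (Re (0 + RtoC s * (RtoC 24 * L))) B') as [E | E]; [rewrite E; lra|].
    apply Rlt_le, exp_increasing; lra. }
  pose proof (exp_pos B'); pose proof (Cmod_ge_0 q).
  apply Rle_trans with (Cmod q * (exp B' * (M1 * Cmod q)))%R; [|apply Req_le; simpl; ring].
  apply Rmult_le_compat_l; [assumption|].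
  eapply Rle_trans; [exact H|]; apply Rmult_le_compat_l; lra.
Qed.

(** * Forms of negative weight vanish *)

(* A maximum of [|g|^2 / y^k] is impossible for [k >= 1] because its logarithm is strictly
   subharmonic; only the mean over the four points [t1 +- d], [t1 +- i d] is used. *)
Lemma no_interior_maximum (g : C -> C) (k : nat) (t1 : C) :
  (1 <= k)%nat -> smooth upper 2 g -> upper t1 -> g t1 <> 0 ->
  ~ (forall t, upper t ->
       (Cmod (g t) ^ 2 * Im t1 ^ k <= Cmod (g t1) ^ 2 * Im t ^ k)%R).
Proof.
intros Hk Hg Ht1 Hg1 Hmax.
destruct (smooth_peano upper Copen_upper 2 g t1 Ht1 Hg) as [c Hc].
set (y := Im t1) in *; assert (Hy : (0 < y)%R) by exact Ht1.
set (g1 := g t1) in *.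
assert (Hgp : (0 < Cmod g1)%R) by now apply Cmod_gt_0.
assert (Ec0 : c O = g1).
{ destruct (Hc 1%R Rlt_0_1) as [d [Hd H]]; specialize (H t1).
  replace (t1 - t1) with (RtoC 0) in H by ring; rewrite Cmod_0 in H; specialize (H Hd).
  simpl in H; pose proof (Cmod_ge_0 (g t1 - (0 + c 0%nat * 1 + c 1%nat * (0 * 1) + c 2%nat * (0 * (0 * 1))))) as Hp.
  assert (E : g t1 - (0 + c 0%nat * 1 + c 1%nat * (0 * 1) + c 2%nat * (0 * (0 * 1))) = 0)
    by (apply Cmod_eq_0; lra).
  fold g1 in E; replace (c O) with (g1 - (g1 - c O)) by ring.
  replace (g1 - c O) with (g1 - (0 + c 0%nat * 1 + c 1%nat * (0 * 1) + c 2%nat * (0 * (0 * 1)))) by ring.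
  rewrite E; ring. }
set (al := c 1%nat / g1); set (be := c 2%nat / g1).
set (eps := (/ (512 * y ^ 2))%R).
assert (Hy2 : (0 < y ^ 2)%R) by (apply pow_lt; lra).
assert (Heps : (0 < eps)%R) by (apply Rinv_0_lt_compat; lra).
destruct (Hc (eps * Cmod g1)%R) as [r [Hr Hpe]]; [nra|].
set (U := 2 * be - al ^ 2).
set (A := (2 * Cmod be ^ 2 + Cmod U ^ 2 + Cmod be ^ 4)%R).
assert (HA : (0 <= A)%R).
{ unfold A; pose proof (pow2_ge_0 (Cmod be)); pose proof (pow2_ge_0 (Cmod U)).
  assert (0 <= Cmod be ^ 4)%R by (apply pow_le, Cmod_ge_0); lra. }
set (B := (Cmod al + Cmod be + eps + 1)%R).
assert (HB : (1 < B)%R) by (unfold B; pose proof (Cmod_ge_0 al); pose proof (Cmod_ge_0 be); lra).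
assert (Hd : exists d : R, (0 < d)%R /\ (d < r)%R /\ (d <= 1)%R /\ (d * B <= 1)%R /\ (d < y)%R /\
   (A * d ^ 2 <= / (8 * y ^ 2))%R).
{ set (e1 := (/ (8 * y ^ 2))%R); assert (He1 : (0 < e1)%R) by (apply Rinv_0_lt_compat; lra).
  set (m := Rmin (r / 2) (Rmin (/ B) (Rmin (y / 2) (e1 / (A + 1))))).
  assert (HBi : (0 < / B)%R) by (apply Rinv_0_lt_compat; lra).
  assert (He1A : (0 < e1 / (A + 1))%R) by (apply Rdiv_lt_0_compat; lra).
  assert (Hm : (0 < m)%R) by (repeat apply Rmin_glb_lt; lra).
  assert (M1 : (m <= r / 2)%R) by apply Rmin_l.
  assert (M2 : (m <= / B)%R) by (eapply Rle_trans; [apply Rmin_r | apply Rmin_l]).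
  assert (M3 : (m <= y / 2)%R)
    by (eapply Rle_trans; [apply Rmin_r|]; eapply Rle_trans; [apply Rmin_r | apply Rmin_l]).
  assert (M4 : (m <= e1 / (A + 1))%R)
    by (eapply Rle_trans; [apply Rmin_r|]; eapply Rle_trans; [apply Rmin_r | apply Rmin_r]).
  assert (HBi1 : (/ B <= 1)%R) by (rewrite <- Rinv_1; apply Rinv_le_contravar; lra).
  exists m; repeat split; try lra.
  - apply (Rmult_le_compat_r B) in M2; [|lra]; rewrite Rinv_l in M2; lra.
  - apply (Rmult_le_compat_r (A + 1)) in M4; [|lra].
    replace (e1 / (A + 1) * (A + 1))%R with e1 in M4 by (field; lra).
    assert (m ^ 2 <= m)%R by (simpl; nra); nra. }
destruct Hd as [d [Hd0 [Hdr [Hd1 [HdB [Hdy HdA]]]]]].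
set (a := fun s : C => 1 + al * s + be * s ^ 2).
set (b := fun s : C => g (t1 + s) / g1).
assert (Hab : forall s, Cmod s = d -> (Cmod (b s - a s) <= eps * d ^ 2)%R).
{ intros s Hs; specialize (Hpe (t1 + s)); replace (t1 + s - t1) with s in Hpe by ring.
  rewrite Hs in Hpe; specialize (Hpe Hdr); simpl psum in Hpe.
  rewrite Ec0 in Hpe.
  replace (b s - a s) with ((g (t1 + s) - (0 + g1 * 1 + c 1%nat * (s * 1) + c 2%nat * (s * (s * 1)))) / g1)
    by (unfold a, b, al, be; field; exact Hg1).
  rewrite Cmod_div by exact Hg1; apply (Rmult_le_reg_r (Cmod g1)); [exact Hgp|].
  unfold Rdiv; rewrite Rmult_assoc, Rinv_l, Rmult_1_r by lra; lra. }
assert (Ha2 : forall s, Cmod s = d -> (Cmod (a s) <= 2)%R /\ (Cmod (b s) <= 2)%R).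
{ intros s Hs.
  assert (H1 : (Cmod (a s) <= 1 + Cmod al * d + Cmod be * d)%R).
  { unfold a; eapply Rle_trans; [apply Cmod_triangle|].
    eapply Rle_trans; [apply Rplus_le_compat_r, Cmod_triangle|].
    rewrite !Cmod_mult, Cmod_pow, Hs, Cmod_1; pose proof (Cmod_ge_0 be).
    assert (d ^ 2 <= d)%R by (simpl; nra); nra. }
  pose proof (Hab s Hs) as H2.
  assert (H3 : (Cmod (b s) <= Cmod (a s) + eps * d ^ 2)%R).
  { replace (b s) with (a s + (b s - a s)) by ring.
    eapply Rle_trans; [apply Cmod_triangle | lra]. }
  assert (d ^ 2 <= d)%R by (simpl; nra).
  assert (eps * d ^ 2 <= eps * d)%R by nra.
  unfold B in HdB; pose proof (Cmod_ge_0 al); pose proof (Cmod_ge_0 be); split; nra. }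
set (s1 := RtoC d); set (s2 := - RtoC d); set (s3 := Ci * RtoC d); set (s4 := - (Ci * RtoC d)).
assert (Hs1 : Cmod s1 = d) by (apply Cmod_RtoC_pos; lra).
assert (Hs2 : Cmod s2 = d) by (unfold s2; rewrite Cmod_opp; exact Hs1).
assert (Hs3 : Cmod s3 = d) by (unfold s3; rewrite Cmod_mult, Cmod_Ci, Rmult_1_l; exact Hs1).
assert (Hs4 : Cmod s4 = d) by (unfold s4; rewrite Cmod_opp; exact Hs3).
set (E := (eps * d ^ 2)%R).
assert (HE : (0 <= E)%R) by (unfold E; pose proof (pow2_ge_0 d); nra).
assert (Hmul : forall x x' z z' (m m' e e' : R),
  (Cmod (x - x') <= e)%R -> (Cmod (z - z') <= e')%R -> (Cmod x <= m)%R -> (Cmod z' <= m')%R ->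
  (Cmod (x * z - x' * z') <= m * e' + m' * e)%R).
{ intros x x' z z' m m' e e' H1 H2 H3 H4.
  replace (x * z - x' * z') with (x * (z - z') + z' * (x - x')) by ring.
  eapply Rle_trans; [apply Cmod_triangle|]; rewrite !Cmod_mult.
  apply Rplus_le_compat; apply Rmult_le_compat; auto using Cmod_ge_0. }
pose proof (Ha2 s1 Hs1) as [A1 B1]; pose proof (Ha2 s2 Hs2) as [A2 B2].
pose proof (Ha2 s3 Hs3) as [A3 B3]; pose proof (Ha2 s4 Hs4) as [A4 B4].
pose proof (Hab s1 Hs1) as D1; pose proof (Hab s2 Hs2) as D2.
pose proof (Hab s3 Hs3) as D3; pose proof (Hab s4 Hs4) as D4; fold E in D1, D2, D3, D4.
pose proof (Hmul _ _ _ _ _ _ _ _ D1 D2 B1 A2) as D12.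
pose proof (Hmul _ _ _ _ _ _ _ _ D3 D4 B3 A4) as D34.
assert (B12 : (Cmod (b s1 * b s2) <= 4)%R).
{ rewrite Cmod_mult; pose proof (Cmod_ge_0 (b s1)); pose proof (Cmod_ge_0 (b s2)); nra. }
assert (A34 : (Cmod (a s3 * a s4) <= 4)%R).
{ rewrite Cmod_mult; pose proof (Cmod_ge_0 (a s3)); pose proof (Cmod_ge_0 (a s4)); nra. }
pose proof (Hmul _ _ _ _ _ _ _ _ D12 D34 B12 A34) as DD.
assert (EA : a s1 * a s2 * (a s3 * a s4) =
   1 + RtoC d ^ 4 * (2 * be ^ 2 - U ^ 2 + be ^ 4 * RtoC d ^ 4)).
{ unfold a, s1, s2, s3, s4, U.
  transitivity ((1 + (2 * be - al ^ 2) * RtoC d ^ 2 + be ^ 2 * RtoC d ^ 4) *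
    ((1 + be * (Ci ^ 2) * RtoC d ^ 2) ^ 2 - al ^ 2 * (Ci ^ 2) * RtoC d ^ 2)); [ring|].
  rewrite Ci_sq; ring. }
assert (HEA : (1 - A * d ^ 4 <= Cmod (a s1 * a s2 * (a s3 * a s4)))%R).
{ rewrite EA; set (X := RtoC d ^ 4 * (2 * be ^ 2 - U ^ 2 + be ^ 4 * RtoC d ^ 4)).
  assert (HX : (Cmod X <= A * d ^ 4)%R).
  { assert (Hdm : Cmod (RtoC d) = d) by exact Hs1.
    unfold X; rewrite Cmod_mult, Cmod_pow, Hdm, Rmult_comm.
    apply Rmult_le_compat_r; [apply pow_le; lra|].
    eapply Rle_trans; [apply Cmod_triangle|].
    eapply Rle_trans; [apply Rplus_le_compat_r, Cmod_sub_triangle|].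
    rewrite !Cmod_mult, !Cmod_pow, Hdm, (Cmod_RtoC_pos 2) by lra.
    assert (d ^ 4 <= 1)%R by (rewrite <- (pow1 4); apply pow_incr; lra).
    assert (0 <= Cmod be ^ 4)%R by (apply pow_le, Cmod_ge_0); unfold A; nra. }
  pose proof (Cmod_triangle_rev 1 (- X)) as H; rewrite Cmod_opp, Cmod_1 in H.
  replace (1 - - X) with (1 + X) in H by ring; lra. }
assert (Hlow : (1 - A * d ^ 4 - 32 * E <= Cmod (b s1 * b s2 * (b s3 * b s4)))%R).
{ pose proof (Cmod_triangle_rev (a s1 * a s2 * (a s3 * a s4))
    (a s1 * a s2 * (a s3 * a s4) - b s1 * b s2 * (b s3 * b s4))) as H.
  replace (a s1 * a s2 * (a s3 * a s4) -
    (a s1 * a s2 * (a s3 * a s4) - b s1 * b s2 * (b s3 * b s4)))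
    with (b s1 * b s2 * (b s3 * b s4)) in H by ring.
  rewrite (Cmod_minus_sym (a s1 * a s2 * (a s3 * a s4))) in H; lra. }
assert (Hbk : forall s, (Cmod s = d) -> (Cmod (b s) ^ 2 <= ((y + Im s) / y) ^ k)%R).
{ intros s Hs; pose proof (im_le_Cmod s) as Him; rewrite Hs in Him; apply Rabs_le_between in Him.
  assert (Hup : upper (t1 + s)).
  { unfold upper; replace (Im (t1 + s)) with (y + Im s)%R
      by (unfold y; destruct t1, s; reflexivity); lra. }
  pose proof (Hmax _ Hup) as H.
  replace (Im (t1 + s)) with (y + Im s)%R in H by (unfold y; destruct t1, s; reflexivity).
  unfold b; rewrite Cmod_div by exact Hg1; unfold Rdiv; rewrite !Rpow_mult_distr, !pow_inv.
  assert (Hyk : (0 < y ^ k)%R) by (apply pow_lt; lra).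
  assert (Hg2 : (0 < Cmod g1 ^ 2)%R) by (apply pow_lt; lra).
  apply (Rmult_le_reg_r (Cmod g1 ^ 2 * y ^ k)); [nra|].
  replace (Cmod (g (t1 + s)%C) ^ 2 * / Cmod g1 ^ 2 * (Cmod g1 ^ 2 * y ^ k))%R
    with (Cmod (g (t1 + s)%C) ^ 2 * y ^ k)%R by (field; lra).
  replace ((y + Im s) ^ k * / y ^ k * (Cmod g1 ^ 2 * y ^ k))%R
    with (Cmod g1 ^ 2 * (y + Im s) ^ k)%R by (field; lra); exact H. }
pose proof (Hbk s1 Hs1) as K1; pose proof (Hbk s2 Hs2) as K2.
pose proof (Hbk s3 Hs3) as K3; pose proof (Hbk s4 Hs4) as K4.
replace (Im s1) with 0%R in K1 by reflexivity.
replace (Im s2) with 0%R in K2 by (unfold s2, RtoC; simpl; ring).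
replace (Im s3) with d in K3 by (unfold s3, RtoC, Ci; simpl; ring).
replace (Im s4) with (- d)%R in K4 by (unfold s4, RtoC, Ci; simpl; ring).
replace ((y + 0) / y)%R with 1%R in K1, K2 by (field; lra); rewrite pow1 in K1, K2.
set (w := (d ^ 2 / y ^ 2)%R).
assert (Hw : (0 < w < 1)%R).
{ unfold w; split; [apply Rdiv_lt_0_compat; [apply pow_lt; lra | lra]|].
  apply (Rmult_lt_reg_r (y ^ 2)); [lra|]; unfold Rdiv; rewrite Rmult_assoc, Rinv_l; nra. }
assert (K34 : (Cmod (b s3) ^ 2 * Cmod (b s4) ^ 2 <= 1 - w)%R).
{ apply Rle_trans with (((y + d) / y) ^ k * ((y + - d) / y) ^ k)%R.
  - apply Rmult_le_compat; auto using pow2_ge_0.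
  - rewrite <- Rpow_mult_distr.
    replace ((y + d) / y * ((y + - d) / y))%R with (1 - w)%R by (unfold w; field; lra).
    rewrite <- (pow_1 (1 - w)) at 2; apply pow_le_1_antitone; [lra | exact Hk]. }
assert (Hup : (Cmod (b s1 * b s2 * (b s3 * b s4)) ^ 2 <= 1 - w)%R).
{ rewrite !Cmod_mult, !Rpow_mult_distr.
  pose proof (pow2_ge_0 (Cmod (b s1))); pose proof (pow2_ge_0 (Cmod (b s2))).
  assert (Cmod (b s1) ^ 2 * Cmod (b s2) ^ 2 <= 1)%R by nra.
  assert (0 <= Cmod (b s3) ^ 2 * Cmod (b s4) ^ 2)%R
    by (apply Rmult_le_pos; apply pow2_ge_0).
  assert (0 <= Cmod (b s1) ^ 2 * Cmod (b s2) ^ 2)%R by (apply Rmult_le_pos; assumption); nra. }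
assert (Hsmall : (A * d ^ 4 + 32 * E <= w / 4)%R).
{ assert (F1 : (A * d ^ 4 <= d ^ 2 * / (8 * y ^ 2))%R).
  { replace (A * d ^ 4)%R with (d ^ 2 * (A * d ^ 2))%R by ring.
    apply Rmult_le_compat_l; [apply pow2_ge_0 | exact HdA]. }
  replace (d ^ 2 * / (8 * y ^ 2))%R with (w / 8)%R in F1 by (unfold w; field; lra).
  assert (F2 : (32 * E = w / 16)%R) by (unfold E, eps, w; field; lra); lra. }
set (P := Cmod (b s1 * b s2 * (b s3 * b s4))) in *.
assert (0 <= P)%R by apply Cmod_ge_0.
assert (Hq : (1 - w / 4 <= P)%R) by lra; nra.
Qed.

Lemma negative_weight_vanishes (g : C -> C) (k : nat) (M : R) :
  (1 <= k)%nat -> smooth upper 2 g ->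
  (forall t, upper t -> g (t + 1) = g t) ->
  (forall t, upper t -> g t = t ^ (2 * k) * g (- / t)) ->
  (forall t, high t -> (Cmod (g t) <= M)%R) ->
  forall t, upper t -> g t = 0.
Proof.
intros Hk Hg HT HS HM t0 Ht0; apply NNPP; intros Hn.
set (phi := fun t => (Cmod (g t) ^ 2 / Im t ^ (2 * k))%R).
assert (Hphi : forall h t, upper t -> phi (act h t) = phi t).
{ intros h t Ht.
  destruct (weight_transformation (fun t => / g t) (fun x => x = 1) k 1 1) with (g := h)
    as [c [Ec Hc]]; auto.
  - intros x y -> ->; ring.
  - intros x ->; field.
  - intros x ->; apply C1_nz.
  - intros u Hu; rewrite HT by exact Hu; ring.
  - intros u Hu; rewrite (HS u Hu); pose proof (Cpow_nz _ (2 * k) (upper_neq_0 u Hu)) as Hz.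
    destruct (classic (g (- / u) = 0)) as [E | E].
    + rewrite E, Cmult_0_r, Cinv_0; ring.
    + field; auto.
  - specialize (Hc t Ht); rewrite Ec, Cmult_1_l in Hc.
    pose proof (autf_neq_0 h t Ht) as Hj.
    assert (E : g t = autf h t ^ (2 * k) * g (act h t)).
    { destruct (classic (g (act h t) = 0)) as [E | E].
      - rewrite E, Cinv_0 in Hc; rewrite E, Cmult_0_r.
        destruct (Cmult_integral _ _ (eq_sym Hc)) as [E1 | E1];
          [exfalso; exact (Cpow_nz _ _ Hj E1)|].
        apply NNPP; intros Hgt; apply C1_nz.
        rewrite <- (Cinv_r (g t) Hgt), E1; ring.
      - assert (Hgt : g t <> 0).
        { intros E0; rewrite E0, Cinv_0, Cmult_0_r in Hc; apply C1_nz.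
          rewrite <- (Cinv_r _ E), Hc; ring. }
        pose proof (Cpow_nz _ (2 * k) Hj) as Hjk.
        set (J0 := autf h t ^ (2 * k)) in *.
        transitivity (J0 * / (J0 * / g t)); [field; auto|].
        rewrite <- Hc; field; exact E. }
    unfold phi; rewrite E, Im_act, Cmod_mult, Cmod_pow by exact Ht.
    apply Cmod_gt_0 in Hj; unfold upper in Ht.
    unfold Rdiv; rewrite !Rpow_mult_distr, !pow_inv, <- !pow_mult.
    replace (2 * k * 2)%nat with (2 * (2 * k))%nat by lia.
    assert (0 < Cmod (autf h t) ^ (2 * (2 * k)))%R by (apply pow_lt; lra).
    assert (0 < Im t ^ (2 * k))%R by (apply pow_lt; lra); field; lra. }
assert (Hp0 : (0 < phi t0)%R).
{ apply Rdiv_lt_0_compat; apply pow_lt; [now apply Cmod_gt_0 | exact Ht0]. }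
set (Y := (M ^ 2 / phi t0 + 1)%R).
assert (HY : (1 <= Y)%R).
{ unfold Y; assert (0 <= M ^ 2 / phi t0)%R; [|lra].
  apply Rmult_le_pos; [apply pow2_ge_0 | apply Rlt_le, Rinv_0_lt_compat, Hp0]. }
assert (HM2 : forall t, high t -> (Cmod (g t) ^ 2 <= M ^ 2)%R).
{ intros t Ht; apply pow_incr; split; [apply Cmod_ge_0 | auto]. }
assert (Hhigh : forall t, (Y <= Im t)%R -> (phi t < phi t0)%R).
{ intros t Ht; assert (Hht : high t) by (unfold high; lra).
  specialize (HM2 t Hht).
  assert (H1 : (Im t <= Im t ^ (2 * k))%R).
  { rewrite <- (pow_1 (Im t)) at 1; apply Rle_pow; [lra | lia]. }
  apply (Rmult_lt_reg_r (Im t ^ (2 * k))); [lra|].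
  unfold phi at 1, Rdiv; rewrite Rmult_assoc, Rinv_l, Rmult_1_r by lra.
  apply Rle_lt_trans with (M ^ 2)%R; [exact HM2|].
  apply Rlt_le_trans with (phi t0 * Y)%R; [|apply Rmult_le_compat_l; lra].
  unfold Y; rewrite Rmult_plus_distr_l.
  replace (phi t0 * (M ^ 2 / phi t0))%R with (M ^ 2)%R by (field; lra); lra. }
set (box := fun t : C => (- / 2 <= Re t <= / 2)%R /\ (/ 2 <= Im t <= Y)%R).
assert (Hred : forall t, upper t -> exists u, phi u = phi t /\
   ((/ 2 <= Im u)%R /\ (- / 2 <= Re u <= / 2)%R)).
{ intros t Ht; destruct (fundamental_reduction t Ht) as [h [H1 H2]].
  exists (act h t); split; [now apply Hphi|]; apply Rabs_le_between in H1; lra. }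
assert (Hmaxbox : exists t1, box t1 /\ forall t, box t -> (phi t <= phi t1)%R).
{ set (S := fun v : R => exists t, box t /\ v = phi t).
  assert (Hboxb : forall t, box t -> (phi t <= M ^ 2 * 2 ^ (2 * k))%R).
  { intros t [_ [Hy _]]; unfold phi, Rdiv; apply Rmult_le_compat; auto using pow2_ge_0.
    - apply Rlt_le, Rinv_0_lt_compat, pow_lt; lra.
    - rewrite <- pow_inv; apply pow_incr.
      split; [apply Rlt_le, Rinv_0_lt_compat; lra|].
      replace 2%R with (/ / 2)%R by (field); apply Rinv_le_contravar; lra. }
  destruct (Hred t0 Ht0) as [u0 [E0 [Hu0 Hu0']]].
  assert (Hbu0 : box u0).
  { split; [exact Hu0'|]; split; [exact Hu0|].
    apply Rnot_lt_le; intros Hlt; specialize (Hhigh u0 ltac:(lra)); lra. }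
  destruct (completeness S) as [sg [Hub Hlub]].
  { exists (M ^ 2 * 2 ^ (2 * k))%R; intros v [t [Hb ->]]; auto. }
  { exists (phi u0), u0; auto. }
  assert (Hseq : forall n : nat, exists t, box t /\ (sg - / (INR n + 1) < phi t)%R).
  { intros n; apply NNPP; intros Hno.
    assert (Hp : (0 < / (INR n + 1))%R) by (apply Rinv_0_lt_compat; pose proof (pos_INR n); lra).
    assert (sg <= sg - / (INR n + 1))%R; [|lra].
    apply Hlub; intros v [t [Hb ->]]; apply Rnot_lt_le; intros Hlt; apply Hno; eauto. }
  set (u := fun n => proj1_sig (constructive_indefinite_description _ (Hseq n))).
  assert (Hu : forall n, box (u n) /\ (sg - / (INR n + 1) < phi (u n))%R).
  { intros n; unfold u; destruct (constructive_indefinite_description _ (Hseq n)); assumption. }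
  destruct (bounded_complex_subseq u _ _ _ _ (fun n => proj1 (Hu n))) as [p [l [Hp [Hl [Hl1 Hl2]]]]].
  exists l; split; [split; assumption|].
  assert (Hlu : upper l) by (unfold upper; lra).
  assert (Hphil : is_lim_seq (fun n => phi (u (p n))) (phi l)).
  { assert (Hgl : Ccvg (fun n => g (u (p n))) (g l)).
    { apply (Ccvg_comp g); [|exact Hl].
      exact (smooth_le upper Copen_upper 0 _ (smooth_le upper Copen_upper 1 _ Hg) l Hlu). }
    assert (Hmod : is_lim_seq (fun n => Cmod (g (u (p n)))) (Cmod (g l))).
    { apply is_lim_seq_spec; intros eps; destruct (Hgl eps (cond_pos eps)) as [N HN].
      exists N; intros n Hnn; specialize (HN n Hnn).
      pose proof (Cmod_triangle_rev (g (u (p n))) (g l)).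
      pose proof (Cmod_triangle_rev (g l) (g (u (p n)))) as H'.
      rewrite Cmod_minus_sym in H'; apply Rabs_def1; lra. }
    assert (Hpow : forall (v : nat -> R) (x : R) (m : nat), is_lim_seq v x ->
       is_lim_seq (fun n => (v n ^ m)%R) (x ^ m)%R).
    { intros v x m Hv; induction m as [|m IH]; [apply is_lim_seq_const|].
      simpl; now apply (is_lim_seq_mult' v (fun n => (v n ^ m)%R)). }
    unfold phi; apply (is_lim_seq_div' (fun n => (Cmod (g (u (p n))) ^ 2)%R)
      (fun n => (Im (u (p n)) ^ (2 * k))%R)).
    - now apply Hpow.
    - apply Hpow; exact (Ccvg_Im _ _ Hl).
    - apply pow_nonzero; unfold upper in Hlu; lra. }
  assert (Hsgl : (sg <= phi l)%R).
  { assert (Hlim : is_lim_seq (fun n => (sg - / (INR n + 1))%R) sg).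
    { replace (Finite sg) with (Finite (sg - 0)) by (f_equal; ring).
      apply is_lim_seq_minus'; [apply is_lim_seq_const|].
      apply (is_lim_seq_ext (fun n => (/ INR (Datatypes.S n))%R)); [intros; now rewrite S_INR|].
      apply (is_lim_seq_incr_1 (fun n => (/ INR n)%R)).
      replace (Finite 0) with (Rbar_inv p_infty) by reflexivity.
      apply is_lim_seq_inv; [apply is_lim_seq_INR | discriminate]. }
    apply (is_lim_seq_le (fun n => (sg - / (INR (p n) + 1))%R) (fun n => phi (u (p n))) sg (phi l)).
    - intros n; apply Rlt_le, Hu.
    - exact (is_lim_seq_reindex (fun n => (sg - / (INR n + 1))%R) sg p Hp Hlim).
    - exact Hphil. }
  intros t Hb; apply Rle_trans with sg; [apply Hub; exists t; auto | exact Hsgl]. }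
destruct Hmaxbox as [t1 [[Hb1 Hb2] Hmax]].
assert (Ht1 : upper t1) by (unfold upper; lra).
assert (Hglob : forall t, upper t -> (phi t <= phi t1)%R).
{ assert (H0 : (phi t0 <= phi t1)%R).
  { destruct (Hred t0 Ht0) as [u [E [H1 H2]]]; rewrite <- E; apply Hmax.
    split; [exact H2|]; split; [exact H1|].
    apply Rnot_lt_le; intros Hlt; specialize (Hhigh u ltac:(lra)); lra. }
  intros t Ht; destruct (Hred t Ht) as [u [E [H1 H2]]]; rewrite <- E.
  destruct (Rle_lt_dec (Im u) Y) as [H3 | H3].
  - apply Hmax; split; auto.
  - specialize (Hhigh u ltac:(lra)); lra. }
apply (no_interior_maximum g (2 * k) t1); [lia | exact Hg | exact Ht1 | |].
- intros E; specialize (Hglob t0 Ht0); unfold phi in Hglob at 2.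
  rewrite E, Cmod_0 in Hglob; unfold Rdiv in Hglob; rewrite pow_i, Rmult_0_l in Hglob by lia; lra.
- intros t Ht; specialize (Hglob t Ht); unfold phi in Hglob; unfold upper in Ht, Ht1.
  assert (P1 : (0 < Im t ^ (2 * k))%R) by (apply pow_lt; lra).
  assert (P2 : (0 < Im t1 ^ (2 * k))%R) by (apply pow_lt; lra).
  apply (Rmult_le_compat_r (Im t ^ (2 * k) * Im t1 ^ (2 * k))) in Hglob; [|nra].
  replace (Cmod (g t) ^ 2 / Im t ^ (2 * k) * (Im t ^ (2 * k) * Im t1 ^ (2 * k)))%R
    with (Cmod (g t) ^ 2 * Im t1 ^ (2 * k))%R in Hglob by (field; lra).
  replace (Cmod (g t1) ^ 2 / Im t1 ^ (2 * k) * (Im t ^ (2 * k) * Im t1 ^ (2 * k)))%R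
    with (Cmod (g t1) ^ 2 * Im t ^ (2 * k))%R in Hglob by (field; lra).
  exact Hglob.
Qed.

(** * Ramanujan's differential equations and the function [J] *)

Lemma cusp_form_vanishes (F : C -> C) (k w : nat) (c1 : C) :
  (1 <= k)%nat -> (w + 2 * k = 12)%nat -> (forall n, smooth upper n F) ->
  (forall t, upper t -> F (t + 1) = F t) ->
  (forall t, upper t -> F (- / t) = t ^ w * F t) ->
  cusp2 F 0 c1 -> forall t, upper t -> F t = 0.
Proof.
intros Hk Hw Hs HT HS [M HM] t Ht.
destruct Delta_high_bounds as [c [M' [Hc HD]]].
assert (H0 : F t / Delta t = 0).
{ apply (negative_weight_vanishes (fun t => F t / Delta t) k ((Cmod c1 + Rabs M) / c) Hk).
  - apply (smooth_mult upper Copen_upper); [apply Hs|].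
    apply (smooth_inv upper Copen_upper); [exact Delta_neq_0 | apply smooth_Delta].
  - intros u Hu; now rewrite HT, Delta_plus_1.
  - intros u Hu; rewrite HS, Delta_S by exact Hu.
    rewrite <- Hw, Cpow_add_r.
    pose proof (upper_neq_0 u Hu) as Hz; pose proof (Delta_neq_0 u Hu) as Hd.
    pose proof (Cpow_nz _ w Hz); pose proof (Cpow_nz _ (2 * k) Hz).
    set (A := u ^ w) in *; set (B := u ^ (2 * k)) in *; field; auto.
  - intros u Hu; pose proof (high_upper u Hu) as Hup.
    rewrite Cmod_div by now apply Delta_neq_0.
    destruct (HD u Hu) as [H1 _]; specialize (HM u Hu).
    assert (Hq : (0 < Cmod (qpar u))%R) by apply Cmod_gt_0, qpar_neq_0.
    assert (Hq1 : (Cmod (qpar u) <= 1)%R) by (apply Rlt_le, qpar_lt_1, Hup).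
    assert (HF : (Cmod (F u) <= (Cmod c1 + Rabs M) * Cmod (qpar u))%R).
    { replace (F u) with ((F u - 0 - c1 * qpar u) + c1 * qpar u) by ring.
      eapply Rle_trans; [apply Cmod_triangle|]; rewrite Cmod_mult.
      assert (M * Cmod (qpar u) ^ 2 <= Rabs M * Cmod (qpar u))%R.
      { apply Rle_trans with (Rabs M * Cmod (qpar u) ^ 2)%R.
        - apply Rmult_le_compat_r; [apply pow2_ge_0 | apply Rle_abs].
        - apply Rmult_le_compat_l; [apply Rabs_pos | simpl; nra]. }
      lra. }
    assert (HDp : (0 < Cmod (Delta u))%R) by now apply Cmod_gt_0, Delta_neq_0.
    apply (Rmult_le_reg_r (Cmod (Delta u))); [exact HDp|].
    unfold Rdiv at 1; rewrite Rmult_assoc, Rinv_l, Rmult_1_r by lra.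
    eapply Rle_trans; [exact HF|].
    replace ((Cmod c1 + Rabs M) / c * Cmod (Delta u))%R
      with ((Cmod c1 + Rabs M) * (/ c * Cmod (Delta u)))%R by (unfold Rdiv; ring).
    apply Rmult_le_compat_l; [pose proof (Cmod_ge_0 c1); pose proof (Rabs_pos M); lra|].
    apply (Rmult_le_reg_l c); [exact Hc|]; rewrite <- Rmult_assoc, Rinv_r by lra; lra.
  - exact Ht. }
pose proof (Delta_neq_0 t Ht) as Hd.
replace (F t) with (F t / Delta t * Delta t) by (field; exact Hd); rewrite H0; ring.
Qed.

Lemma ramanujan_E2 (t : C) : upper t -> RtoC 12 * dE2 t = E2 t ^ 2 - E4 t.
Proof.
intros Ht.
assert (H : E2 t * E2 t - RtoC 12 * dE2 t - E4 t = 0).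
{ apply (cusp_form_vanishes (fun t => E2 t * E2 t - RtoC 12 * dE2 t - E4 t) 4 4
    ((1 * - RtoC 24 + - RtoC 24 * 1) - RtoC 12 * e2_coef 1 - RtoC 240)).
  - lia.
  - lia.
  - intros n; apply (smooth_minus upper Copen_upper);
      [apply (smooth_minus upper Copen_upper)|apply smooth_E4].
    + apply (smooth_mult upper Copen_upper); apply smooth_E2.
    + apply (smooth_scal upper Copen_upper), smooth_dE2.
  - intros u Hu; unfold dE2; now rewrite E2_plus_1, E4_plus_1, QS_plus_1.
  - intros u Hu; rewrite E2_S, dE2_S, E4_S by exact Hu; field; apply twopii_neq_0.
  - assert (E : RtoC 0 = 1 * 1 - RtoC 12 * 0 - 1) by ring; rewrite E at 1.
    apply cusp2_minus; [apply cusp2_minus|exact cusp2_E4].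
    + apply cusp2_mult; exact cusp2_E2.
    + apply cusp2_scal, cusp2_ncoef, subexp_e2.
  - exact Ht. }
replace (RtoC 12 * dE2 t) with
  (E2 t ^ 2 - E4 t - (E2 t * E2 t - RtoC 12 * dE2 t - E4 t)) by ring.
rewrite H; ring.
Qed.

Lemma ramanujan_E4 (t : C) : RtoC 3 * dE4 t = E2 t * E4 t - E6 t.
Proof. unfold E6; ring. Qed.

Lemma ramanujan_E6 (t : C) : upper t -> 2 * dE6 t = E2 t * E6 t - E4 t ^ 2.
Proof.
intros Ht.
assert (H : 2 * dE6 t - E2 t * E6 t + E4 t * E4 t = 0).
{ eapply (cusp_form_vanishes (fun t => 2 * dE6 t - E2 t * E6 t + E4 t * E4 t) 2 8).
  - lia.
  - lia.
  - intros n; apply (smooth_plus upper Copen_upper);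
      [apply (smooth_minus upper Copen_upper)|].
    + apply (smooth_scal upper Copen_upper), smooth_dE6.
    + apply (smooth_mult upper Copen_upper); [apply smooth_E2 | apply smooth_E6].
    + apply (smooth_mult upper Copen_upper); apply smooth_E4.
  - intros u Hu; now rewrite dE6_plus_1, E6_plus_1, E2_plus_1, E4_plus_1.
  - intros u Hu; rewrite E2_S, dE6_S, E6_S, E4_S by exact Hu; field; apply twopii_neq_0.
  - assert (E : RtoC 0 = 2 * (0 * 1 + 1 * 0 - RtoC 3 * 0) - 1 * 1 + 1 * 1) by ring.
    rewrite E at 1.
    apply cusp2_plus; [apply cusp2_minus|].
    + apply cusp2_scal; unfold dE6; apply cusp2_minus; [apply cusp2_plus|].
      * apply cusp2_mult; [apply cusp2_ncoef, subexp_e2 | exact cusp2_E4].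
      * apply cusp2_mult; [exact cusp2_E2 | exact cusp2_dE4].
      * apply cusp2_scal; unfold ddE4; apply cusp2_ncoef, subexp_ncoef, subexp_e4.
    + apply cusp2_mult; [exact cusp2_E2 | exact cusp2_E6].
    + apply cusp2_mult; exact cusp2_E4.
  - exact Ht. }
replace (2 * dE6 t) with
  (E2 t * E6 t - E4 t ^ 2 + (2 * dE6 t - E2 t * E6 t + E4 t * E4 t)) by ring.
rewrite H; ring.
Qed.

Lemma high_qpar_small (d : R) : (0 < d)%R ->
  exists Y : R, (1 <= Y)%R /\ forall t, (Y <= Im t)%R -> (Cmod (qpar t) < d)%R.
Proof.
intros Hd; pose proof PI_pos as HP; exists (/ d + 1)%R.
assert (Hi : (0 < / d)%R) by (apply Rinv_0_lt_compat; lra).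
split; [lra|]; intros t Ht; rewrite qpar_Cmod, exp_Ropp.
assert (H2 : (2 * 3 / 2 <= PI)%R) by (pose proof PI2_3_2; lra).
assert (H1 : (/ d < exp (2 * PI * Im t))%R).
{ pose proof (exp_ineq1_le (2 * PI * Im t)); nra. }
rewrite <- (Rinv_inv d); apply Rinv_lt_contravar; [|exact H1].
apply Rmult_lt_0_compat; [exact Hi | apply exp_pos].
Qed.

Lemma discriminant (t : C) : upper t -> E4 t ^ 3 - E6 t ^ 2 = RtoC 1728 * Delta t.
Proof.
intros Ht.
set (W := fun u => (E4 u ^ 3 - E6 u ^ 2) / Delta u).
assert (HW : forall u v, upper u -> upper v -> W u = W v).
{ apply derive_0_const_upper; intros u Hu.
  pose proof (Delta_neq_0 u Hu) as Hd.
  pose proof (is_Cderive_div _ _ u _ _ Hd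
    (is_Cderive_minus _ _ u _ _ (is_Cderive_pow _ u _ 3 (is_Cderive_E4 u Hu))
       (is_Cderive_pow _ u _ 2 (is_Cderive_E6 u Hu))) (is_Cderive_Delta u Hu)) as H.
  cbv beta in H.
  match type of H with is_Cderive _ _ ?d => replace d with (RtoC 0) in H end; [exact H|].
  pose proof (ramanujan_E4 u) as R4; pose proof (ramanujan_E6 u Hu) as R6.
  replace (INR 3) with 3%R by (simpl; ring); replace (INR 2) with 2%R by (simpl; ring).
  simpl pred.
  replace (RtoC 3 * E4 u ^ 2 * (twopii * dE4 u) - RtoC 2 * E6 u ^ 1 * (twopii * dE6 u))
    with (twopii * (E4 u ^ 2 * (RtoC 3 * dE4 u) - E6 u * (2 * dE6 u))) by ring.
  rewrite R4, R6; field; exact Hd. }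
set (K := W t).
assert (HK : forall u, upper u -> E4 u ^ 3 - E6 u ^ 2 = K * Delta u).
{ intros u Hu; unfold K; rewrite (HW t u Ht Hu); unfold W; field; now apply Delta_neq_0. }
rewrite HK by exact Ht; f_equal.
assert (Hcusp : cusp2 (fun u => E4 u * E4 u * E4 u - E6 u * E6 u) 0 (RtoC 1728)).
{ replace (RtoC 0) with (1 * 1 * 1 - 1 * 1) by ring.
  replace (RtoC 1728) with ((1 * 1 * RtoC 240 + (1 * RtoC 240 + RtoC 240 * 1) * 1)
    - (1 * - RtoC 504 + - RtoC 504 * 1)) by ring.
  apply cusp2_minus; [apply cusp2_mult; [apply cusp2_mult|]; exact cusp2_E4|].
  apply cusp2_mult; exact cusp2_E6. }
destruct Hcusp as [M HM]; destruct Delta_high_bounds as [c [M' [_ HD]]].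
apply NNPP; intros Hne.
assert (Hp : (0 < Cmod (RtoC 1728 - K))%R)
  by (apply Cmod_gt_0, Cminus_neq_0; intros E; apply Hne; now symmetry).
set (B := (Rabs M + Cmod K * Rabs M' + 1)%R).
assert (HB : (0 < B)%R).
{ unfold B; pose proof (Rabs_pos M); pose proof (Cmod_ge_0 K); pose proof (Rabs_pos M'); nra. }
destruct (high_qpar_small (Cmod (RtoC 1728 - K) / B)) as [Y [HY Hq]];
  [apply Rdiv_lt_0_compat; assumption|].
set (u := RtoC Y * Ci).
assert (HIm : Im u = Y) by (unfold u, RtoC, Ci; simpl; ring).
assert (Hh : high u) by (unfold high; rewrite HIm; lra).
specialize (Hq u ltac:(lra)); specialize (HM u Hh); destruct (HD u Hh) as [_ HDu].
replace (E4 u * E4 u * E4 u - E6 u * E6 u) with (E4 u ^ 3 - E6 u ^ 2) in HM by ring.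
rewrite (HK u (high_upper u Hh)) in HM.
set (q := qpar u) in *.
assert (Hq0 : (0 < Cmod q)%R) by apply Cmod_gt_0, qpar_neq_0.
assert (H : (Cmod ((RtoC 1728 - K) * q) <= (Rabs M + Cmod K * Rabs M') * Cmod q ^ 2)%R).
{ replace ((RtoC 1728 - K) * q)
    with (K * (Delta u - q) - (K * Delta u - 0 - RtoC 1728 * q)) by ring.
  eapply Rle_trans; [apply Cmod_sub_triangle|]; rewrite Cmod_mult.
  pose proof (pow2_ge_0 (Cmod q)); pose proof (Rle_abs M); pose proof (Rle_abs M').
  pose proof (Cmod_ge_0 K).
  assert (Cmod K * Cmod (Delta u - q) <= Cmod K * (Rabs M' * Cmod q ^ 2))%R.
  { apply Rmult_le_compat_l; [assumption|]; nra. }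
  assert (M * Cmod q ^ 2 <= Rabs M * Cmod q ^ 2)%R by nra; lra. }
rewrite Cmod_mult in H.
assert (H2 : (Cmod (RtoC 1728 - K) <= (Rabs M + Cmod K * Rabs M') * Cmod q)%R).
{ apply (Rmult_le_reg_r (Cmod q)); [exact Hq0|]; simpl in H; lra. }
apply (Rmult_lt_compat_r B) in Hq; [|exact HB].
replace (Cmod (RtoC 1728 - K) / B * B)%R with (Cmod (RtoC 1728 - K)) in Hq by (field; lra).
unfold B in Hq; nra.
Qed.

Lemma C1728_neq_0 : RtoC 1728 <> 0.
Proof. intros E; apply RtoC_inj in E; lra. Qed.

Lemma E4_E6_no_common_zero (t : C) : upper t -> E4 t = 0 -> E6 t <> 0.
Proof.
intros Ht E E'; pose proof (discriminant t Ht) as H; rewrite E, E' in H.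
apply (Cmult_neq_0 _ _ C1728_neq_0 (Delta_neq_0 t Ht)); rewrite <- H; ring.
Qed.

Lemma J_minus_1 (t : C) : upper t -> J t - 1 = E6 t ^ 2 / (RtoC 1728 * Delta t).
Proof.
intros Ht; pose proof (Delta_neq_0 t Ht); unfold J.
replace (E6 t ^ 2) with (E4 t ^ 3 - (E4 t ^ 3 - E6 t ^ 2)) by ring.
rewrite discriminant by exact Ht; field; assumption.
Qed.

Lemma is_Cderive_J (t : C) : upper t ->
  is_Cderive J t (- twopii * E4 t ^ 2 * E6 t / (RtoC 1728 * Delta t)).
Proof.
intros Ht; pose proof (Delta_neq_0 t Ht) as Hd.
pose proof (is_Cderive_div _ _ t _ _ (Cmult_neq_0 _ _ C1728_neq_0 Hd)
  (is_Cderive_pow _ t _ 3 (is_Cderive_E4 t Ht))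
  (is_Cderive_scal (RtoC 1728) _ t _ (is_Cderive_Delta t Ht))) as H.
cbv beta in H.
match type of H with is_Cderive _ _ ?d =>
  replace d with (- twopii * E4 t ^ 2 * E6 t / (RtoC 1728 * Delta t)) in H end; [exact H|].
replace (E6 t) with (E2 t * E4 t - RtoC 3 * dE4 t) by reflexivity.
replace (INR 3) with 3%R by (simpl; ring); simpl pred; field; exact Hd.
Qed.

Lemma smooth_J (n : nat) : smooth upper n J.
Proof.
apply (smooth_mult upper Copen_upper); [apply (smooth_pow upper Copen_upper n 3), smooth_E4|].
apply (smooth_inv upper Copen_upper).
- intros u Hu; exact (Cmult_neq_0 _ _ C1728_neq_0 (Delta_neq_0 u Hu)).
- apply (smooth_scal upper Copen_upper), smooth_Delta.
Qed.

Lemma E4_act (g : SL2Z) (t : C) : upper t -> E4 (act g t) = autf g t ^ 4 * E4 t.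
Proof. exact (weight_invariance E4 2 E4_plus_1 E4_S g t). Qed.

Lemma E6_act (g : SL2Z) (t : C) : upper t -> E6 (act g t) = autf g t ^ 6 * E6 t.
Proof. exact (weight_invariance E6 3 E6_plus_1 E6_S g t). Qed.

Lemma Delta_act (g : SL2Z) (t : C) : upper t -> Delta (act g t) = autf g t ^ 12 * Delta t.
Proof. exact (weight_invariance Delta 6 Delta_plus_1 Delta_S g t). Qed.

Lemma J_act (g : SL2Z) (t : C) : upper t -> J (act g t) = J t.
Proof.
intros Ht; unfold J; rewrite E4_act, Delta_act by exact Ht.
pose proof (autf_neq_0 g t Ht); pose proof (Delta_neq_0 t Ht); field; auto.
Qed.

Lemma E6_Ci : E6 Ci = 0.
Proof.
pose proof (E6_S Ci upper_Ci) as H; rewrite S_Ci in H.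
replace (Ci ^ 6) with ((Ci ^ 2) ^ 3) in H by ring; rewrite Ci_sq in H.
replace (E6 Ci) with ((E6 Ci - (- (1)) ^ 3 * E6 Ci) / 2) by field.
rewrite <- H; field.
Qed.

Lemma rho_eq : rho = ((- / 2)%R, (sqrt 3 / 2)%R).
Proof.
unfold rho; rewrite Cexp_imag.
replace (2 * PI / 3)%R with (2 * (PI / 3))%R by field.
rewrite cos_2a, sin_2a, cos_PI3, sin_PI3.
assert (H : (sqrt 3 * sqrt 3 = 3)%R) by (apply sqrt_sqrt; lra).
f_equal; [|field].
replace (1 / 2 * (1 / 2) - sqrt 3 / 2 * (sqrt 3 / 2))%R
  with (1 / 4 - sqrt 3 * sqrt 3 / 4)%R by field; rewrite H; field.
Qed.

Lemma upper_rho : upper rho.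
Proof.
rewrite rho_eq; unfold upper; simpl; assert (0 < sqrt 3)%R by (apply sqrt_lt_R0; lra); lra.
Qed.

Lemma rho_poly : rho ^ 2 + rho + 1 = 0.
Proof.
rewrite rho_eq; assert (H : (sqrt 3 * sqrt 3 = 3)%R) by (apply sqrt_sqrt; lra).
unfold Cpow, Cmult, Cplus, RtoC; simpl; f_equal; [|field].
field_simplify; replace (sqrt 3 ^ 2)%R with 3%R by (simpl; lra); field.
Qed.

Lemma E4_rho : E4 rho = 0.
Proof.
pose proof upper_rho as Hu; pose proof (upper_neq_0 rho Hu) as Hz.
assert (Es : - / rho = rho + 1).
{ replace (rho + 1) with (- rho ^ 2 + (rho ^ 2 + rho + 1)) by ring; rewrite rho_poly.
  assert (E3 : rho ^ 3 = 1).
  { replace (rho ^ 3) with (1 + (rho - 1) * (rho ^ 2 + rho + 1)) by ring; rewrite rho_poly; ring. }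
  replace (/ rho) with (rho ^ 3 / rho) by (rewrite E3; field; exact Hz); field; exact Hz. }
pose proof (E4_S rho Hu) as H; rewrite Es, E4_plus_1 in H by exact Hu.
assert (E4' : rho ^ 4 = rho).
{ replace (rho ^ 4) with (rho + rho * (rho - 1) * (rho ^ 2 + rho + 1)) by ring.
  rewrite rho_poly; ring. }
rewrite E4' in H.
destruct (Cmult_integral (rho - 1) (E4 rho)) as [E | E]; [|exfalso|exact E].
- replace ((rho - 1) * E4 rho) with (rho * E4 rho - E4 rho) by ring; rewrite <- H; ring.
- assert (E1 : rho = 1) by (replace rho with (rho - 1 + 1) by ring; rewrite E; ring).
  unfold upper in Hu; rewrite E1 in Hu; simpl in Hu; lra.
Qed.

(** * Injectivity of [J] on the quotient *)

Definition equiv (t w : C) : Prop := exists g, t = act g w.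

Lemma equiv_sym (t w : C) : upper w -> equiv t w -> equiv w t.
Proof. intros Hw [g ->]; exists (SL2Z_inv g); symmetry; now apply act_inv. Qed.

Lemma equiv_trans (t u w : C) : upper w -> equiv t u -> equiv u w -> equiv t w.
Proof. intros Hw [g ->] [h ->]; exists (SL2Z_mul g h); symmetry; now apply act_mul. Qed.

Lemma equiv_J (t w : C) : upper w -> equiv t w -> J t = J w.
Proof. intros Hw [g ->]; now apply J_act. Qed.

Lemma bounded_int_subseq (u : nat -> Z) (B : R) :
  (forall n, (Rabs (IZR (u n)) <= B)%R) ->
  exists (p : nat -> nat) (v : Z), (forall n, (n <= p n)%nat) /\ forall n, u (p n) = v.
Proof.
intros Hu.
destruct (bounded_real_subseq (fun n => IZR (u n)) (- B) B) as [p [l [Hp Hl]]].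
{ intros n; apply Rabs_le_between, Hu. }
apply is_lim_seq_spec in Hl.
destruct (Hl (mkposreal (/ 2) ltac:(lra))) as [N HN]; simpl in HN.
exists (fun n => p (N + n)%nat), (u (p N)); split.
- intros n; specialize (Hp (N + n)%nat); lia.
- intros n; pose proof (HN N (le_n N)) as H1; pose proof (HN (N + n)%nat ltac:(lia)) as H2.
  apply Rabs_lt_between in H1; apply Rabs_lt_between in H2.
  assert (H3 : (-1 < IZR (u (p (N + n)%nat) - u (p N)) < 1)%R) by (rewrite minus_IZR; lra).
  destruct H3 as [H3 H4]; apply lt_IZR in H3; apply lt_IZR in H4; lia.
Qed.

Lemma linear_form_entries (a b : Z) (w : C) (B D y0 : R) :
  (0 < y0)%R -> (y0 <= Im w)%R -> (Cmod w <= D)%R -> (Cmod (RZ a * w + RZ b) <= B)%R ->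
  (Rabs (IZR a) <= B / y0)%R /\ (Rabs (IZR b) <= B + B / y0 * D)%R.
Proof.
intros Hy Hw HD HB.
assert (Ha : (Rabs (IZR a) * Im w <= B)%R).
{ eapply Rle_trans; [|exact HB]; eapply Rle_trans; [|apply im_le_Cmod].
  assert (E : Im (RZ a * w + RZ b) = (IZR a * Im w)%R)
    by (unfold RZ, RtoC; destruct w; simpl; ring).
  rewrite E, Rabs_mult, (Rabs_pos_eq (Im w)); lra. }
assert (Ha' : (Rabs (IZR a) <= B / y0)%R).
{ apply (Rmult_le_reg_r y0); [exact Hy|]; unfold Rdiv; rewrite Rmult_assoc, Rinv_l, Rmult_1_r by lra.
  pose proof (Rabs_pos (IZR a)); nra. }
split; [exact Ha'|].
rewrite <- Cmod_R; fold (RZ b).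
replace (RZ b) with ((RZ a * w + RZ b) - RZ a * w) by ring.
eapply Rle_trans; [apply Cmod_sub_triangle|]; rewrite Cmod_mult.
unfold RZ at 3; rewrite Cmod_R.
apply Rplus_le_compat; [exact HB|].
apply Rmult_le_compat; auto using Rabs_pos, Cmod_ge_0.
Qed.

Lemma equiv_closed (t w : nat -> C) (t0 w0 : C) :
  upper t0 -> upper w0 -> (forall n, upper (w n)) ->
  Ccvg t t0 -> Ccvg w w0 -> (forall n, equiv (t n) (w n)) -> equiv t0 w0.
Proof.
intros Ht0 Hw0 Hw Ht Hcw Heq; unfold upper in Ht0, Hw0.
destruct (Ht (Im t0 / 2)%R ltac:(lra)) as [N1 HN1].
destruct (Hcw (Im w0 / 2)%R ltac:(lra)) as [N2 HN2].
set (N := (N1 + N2)%nat).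
set (Dt := (Cmod t0 + Im t0)%R); set (Dw := (Cmod w0 + Im w0)%R).
assert (Bt : forall n, (N <= n)%nat -> (Im t0 / 2 <= Im (t n))%R /\ (Cmod (t n) <= Dt)%R).
{ intros n Hn; specialize (HN1 n ltac:(lia)).
  pose proof (im_le_Cmod (t n - t0)) as H; rewrite Im_minus in H.
  assert (H' : (Rabs (Im (t n) - Im t0) < Im t0 / 2)%R) by lra.
  apply Rabs_lt_between in H'; pose proof (Cmod_triangle_rev (t n) t0); unfold Dt; lra. }
assert (Bw : forall n, (N <= n)%nat -> (Im w0 / 2 <= Im (w n))%R /\ (Cmod (w n) <= Dw)%R).
{ intros n Hn; specialize (HN2 n ltac:(lia)).
  pose proof (im_le_Cmod (w n - w0)) as H; rewrite Im_minus in H.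
  assert (H' : (Rabs (Im (w n) - Im w0) < Im w0 / 2)%R) by lra.
  apply Rabs_lt_between in H'; pose proof (Cmod_triangle_rev (w n) w0); unfold Dw; lra. }
set (g := fun n => proj1_sig (constructive_indefinite_description _ (Heq (N + n)%nat))).
assert (Hg : forall n, t (N + n)%nat = act (g n) (w (N + n)%nat)).
{ intros n; unfold g; destruct (constructive_indefinite_description _ (Heq (N + n)%nat)); assumption. }
set (Bj := (Dw / (Im t0 / 2) + 1)%R).
assert (Hj : forall n, (Cmod (autf (g n) (w (N + n)%nat)) <= Bj)%R).
{ intros n; destruct (Bt (N + n)%nat ltac:(lia)) as [T1 _].
  destruct (Bw (N + n)%nat ltac:(lia)) as [_ W2].
  pose proof (Im_act (g n) _ (Hw (N + n)%nat)) as E; rewrite <- Hg in E.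
  pose proof (autf_neq_0 (g n) _ (Hw (N + n)%nat)) as Hn; apply Cmod_gt_0 in Hn.
  set (j := Cmod (autf (g n) (w (N + n)%nat))) in *.
  assert (E2 : (Im (t (N + n)%nat) * j ^ 2 = Im (w (N + n)%nat))%R) by (rewrite E; field; lra).
  assert (Hle : (Im (w (N + n)%nat) <= Dw)%R).
  { eapply Rle_trans; [apply Rle_abs|]; eapply Rle_trans; [apply im_le_Cmod | exact W2]. }
  assert (Hj2 : (j ^ 2 <= Dw / (Im t0 / 2))%R).
  { apply (Rmult_le_reg_r (Im t0 / 2)); [lra|].
    replace (Dw / (Im t0 / 2) * (Im t0 / 2))%R with Dw by (field; lra).
    pose proof (pow2_ge_0 j); nra. }
  unfold Bj; nra. }
set (Ba := (Dt * Bj)%R).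
assert (Hnum : forall n, (Cmod (RZ (ma (g n)) * w (N + n)%nat + RZ (mb (g n))) <= Ba)%R).
{ intros n; destruct (Bt (N + n)%nat ltac:(lia)) as [_ T2].
  pose proof (autf_neq_0 (g n) _ (Hw (N + n)%nat)) as Hn.
  replace (RZ (ma (g n)) * w (N + n)%nat + RZ (mb (g n)))
    with (t (N + n)%nat * autf (g n) (w (N + n)%nat))
    by (rewrite Hg, act_RZ; field; exact Hn).
  rewrite Cmod_mult; apply Rmult_le_compat; auto using Cmod_ge_0. }
assert (Hy0 : (0 < Im w0 / 2)%R) by lra.
assert (Hab : forall n, (Rabs (IZR (ma (g n))) <= Ba / (Im w0 / 2))%R /\
   (Rabs (IZR (mb (g n))) <= Ba + Ba / (Im w0 / 2) * Dw)%R).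
{ intros n; destruct (Bw (N + n)%nat ltac:(lia)).
  apply (linear_form_entries _ _ (w (N + n)%nat)); auto. }
assert (Hcd : forall n, (Rabs (IZR (mc (g n))) <= Bj / (Im w0 / 2))%R /\
   (Rabs (IZR (md (g n))) <= Bj + Bj / (Im w0 / 2) * Dw)%R).
{ intros n; destruct (Bw (N + n)%nat ltac:(lia)).
  apply (linear_form_entries _ _ (w (N + n)%nat)); auto; apply Hj. }
destruct (bounded_int_subseq (fun n => ma (g n)) _ (fun n => proj1 (Hab n))) as [p1 [a [P1 Ea]]].
destruct (bounded_int_subseq (fun n => mb (g (p1 n))) _ (fun n => proj2 (Hab (p1 n))))
  as [p2 [b [P2 Eb]]].
destruct (bounded_int_subseq (fun n => mc (g (p1 (p2 n)))) _ (fun n => proj1 (Hcd (p1 (p2 n)))))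
  as [p3 [c [P3 Ec]]].
destruct (bounded_int_subseq (fun n => md (g (p1 (p2 (p3 n))))) _
  (fun n => proj2 (Hcd (p1 (p2 (p3 n)))))) as [p4 [d [P4 Ed]]].
set (p := fun n => p1 (p2 (p3 (p4 n)))).
assert (Hp : forall n, (n <= p n)%nat).
{ intros n; unfold p; specialize (P4 n); specialize (P3 (p4 n)); specialize (P2 (p3 (p4 n)));
    specialize (P1 (p2 (p3 (p4 n)))); lia. }
set (h := g (p 0%nat)).
assert (Hact : forall n, act (g (p n)) (w (N + p n)%nat) = act h (w (N + p n)%nat)).
{ intros n; rewrite !act_RZ, !autf_RZ; unfold h, p.
  now rewrite !Ea, !Eb, !Ec, !Ed. }
exists h; apply (Ccvg_unique (fun n => t (N + p n)%nat)).
- apply (Ccvg_reindex t t0 (fun n => (N + p n)%nat)); [|exact Ht].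
  intros n; specialize (Hp n); lia.
- apply (Ccvg_ext (fun n => act h (w (N + p n)%nat))).
  { intros n; rewrite Hg; symmetry; apply Hact. }
  assert (Hww : Ccvg (fun n => w (N + p n)%nat) w0).
  { apply (Ccvg_reindex w w0 (fun n => (N + p n)%nat)); [|exact Hcw].
    intros n; specialize (Hp n); lia. }
  assert (Hlin : forall x y : Z, Ccvg (fun n => RZ x * w (N + p n)%nat + RZ y) (RZ x * w0 + RZ y)).
  { intros x y; apply Ccvg_plus; [now apply Ccvg_scal | apply Ccvg_const]. }
  unfold act, Cdiv; apply Ccvg_mult; [apply Hlin|].
  apply Ccvg_inv; [now apply autf_neq_0 | apply Hlin].
Qed.

Lemma locally_surjective_seq (F dF : C -> C) (z : C) (c : nat -> C) :
  near z (fun u => is_Cderive F u (dF u)) -> Ccont dF z -> dF z <> 0 -> Ccvg c (F z) ->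
  exists u, Ccvg u z /\ exists N, forall n, (N <= n)%nat -> F (u n) = c n.
Proof.
intros HF Hc Hz Hcv; pose proof Hz as Hl; apply Cmod_gt_0 in Hl.
destruct (strict_derive F dF z HF Hc (Cmod (dF z) / 2)) as [r [Hr Hs]]; [lra|].
destruct (locally_surjective F dF z HF Hc Hz r Hr) as [d [Hd Hsurj]].
destruct (Hcv d Hd) as [N HN].
assert (H : forall n, exists u, (N <= n)%nat -> (Cmod (u - z) < r)%R /\ F u = c n).
{ intros n; destruct (le_dec N n) as [Hn | Hn].
  - destruct (Hsurj (c n) (HN n Hn)) as [u Hu]; exists u; auto.
  - exists z; lia. }
exists (fun n => proj1_sig (constructive_indefinite_description _ (H n))).
assert (Hu : forall n, (N <= n)%nat ->
  (Cmod (proj1_sig (constructive_indefinite_description _ (H n)) - z) < r)%R /\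
  F (proj1_sig (constructive_indefinite_description _ (H n))) = c n).
{ intros n; destruct (constructive_indefinite_description _ (H n)) as [u Hu]; exact Hu. }
split; [|exists N; intros n Hn; apply Hu, Hn].
intros eps He.
destruct (Hcv (eps * (Cmod (dF z) / 2))%R) as [N' HN']; [nra|].
exists (N + N')%nat; intros n Hn; destruct (Hu n ltac:(lia)) as [H1 H2].
set (u := proj1_sig (constructive_indefinite_description _ (H n))) in *.
assert (Hzz : (Cmod (z - z) < r)%R)
  by (replace (z - z) with (RtoC 0) by ring; rewrite Cmod_0; exact Hr).
specialize (Hs u z H1 Hzz); rewrite H2 in Hs.
specialize (HN' n ltac:(lia)).
pose proof (Cmod_triangle_rev ((u - z) * dF z) (c n - F z)) as H3.
rewrite (Cmod_minus_sym ((u - z) * dF z)), Cmod_mult in H3.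
apply (Rmult_lt_reg_r (Cmod (dF z) / 2)); [lra|].
pose proof (Cmod_ge_0 (u - z)); lra.
Qed.

Definition step (j : nat) : R := (/ INR (S j) ^ 6)%R.

Lemma step_pos (j : nat) : (0 < step j)%R.
Proof. apply Rinv_0_lt_compat, pow_lt, lt_0_INR; lia. Qed.

Lemma inv_RN_S_cvg : Ccvg (fun j => / RN (S j)) 0.
Proof.
apply (Ccvg_ext (fun j => / (1 + RN j))); [intros j; rewrite RN_S; f_equal; ring|].
apply inv_RN_cvg.
Qed.

Lemma step_eq (j : nat) : RtoC (step j) = (/ RN (S j)) ^ 6.
Proof.
unfold step, RN; rewrite RtoC_inv, RtoC_pow, Cpow_inv; [reflexivity | |].
- apply RN_S_neq_0.
- apply pow_nonzero, not_0_INR; lia.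
Qed.

Lemma smooth_strict (F : C -> C) (t : C) : upper t -> (forall n, smooth upper n F) ->
  exists dF, (forall u, upper u -> is_Cderive F u (dF u)) /\
    near t (fun u => is_Cderive F u (dF u)) /\ Ccont dF t.
Proof.
intros Ht HF; destruct (smooth_all_derive upper Copen_upper F HF) as [dF [Hd Hs]].
exists dF; split; [exact Hd|]; split; [now apply near_upper | exact (Hs O t Ht)].
Qed.

(* At a zero of [E4] (of [E6]) the function [J] is a cube (square plus 1) of a locally
   invertible function, and the chosen increments have explicit roots. *)
Lemma J_lift (t : C) : upper t ->
  exists u, Ccvg u t /\ exists N, forall j, (N <= j)%nat -> J (u j) = J t + Ci * RtoC (step j).
Proof.
intros Ht; pose proof (Delta_neq_0 t Ht) as Hd; pose proof (eta_neq_0 t Ht) as He.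
pose proof twopii_neq_0 as Hp; pose proof inv_RN_S_cvg as Hinv.
assert (Hpow : forall m, (1 <= m)%nat -> Ccvg (fun j => (/ RN (S j)) ^ m) 0).
{ intros m Hm; destruct m as [|m]; [lia|]; clear Hm; induction m as [|m IH].
  - apply (Ccvg_ext (fun j => / RN (S j))); [intros; now rewrite Cpow_1_r | exact Hinv].
  - apply (Ccvg_ext (fun j => / RN (S j) * (/ RN (S j)) ^ S m)); [intros; now rewrite (Cpow_S _ (S m))|].
    replace (RtoC 0) with (0 * 0) by ring; now apply Ccvg_mult. }
assert (Hup : forall u, Ccvg u t -> exists N, forall j, (N <= j)%nat -> upper (u j)).
{ intros u Hu; destruct (Copen_upper t Ht) as [r [Hr Hb]]; destruct (Hu r Hr) as [N HN].
  exists N; auto. }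
destruct (classic (E4 t = 0)) as [E4z | E4z].
- set (F := fun u => E4 u * / eta u ^ 8).
  assert (HF : forall n, smooth upper n F).
  { intros n; apply (smooth_mult upper Copen_upper); [apply smooth_E4|].
    apply (smooth_inv upper Copen_upper); [intros; now apply Cpow_nz, eta_neq_0|].
    apply (smooth_pow upper Copen_upper), smooth_eta. }
  destruct (smooth_strict F t Ht HF) as [dF [HdF [Hn Hc]]].
  assert (HdFt : dF t <> 0).
  { assert (E : dF t = twopii * dE4 t * / eta t ^ 8 + E4 t *
        (- (RtoC (INR 8) * eta t ^ pred 8 * (twopii / RtoC 24 * E2 t * eta t)) / (eta t ^ 8) ^ 2)).
    { apply (is_Cderive_unique F t); [now apply HdF|].
      apply (is_Cderive_mult E4 (fun u => / eta u ^ 8)); [now apply is_Cderive_E4|].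
      apply (is_Cderive_inv (fun u => eta u ^ 8)); [now apply Cpow_nz|].
      apply (is_Cderive_pow eta); now apply is_Cderive_eta. }
    rewrite E4z in E.
    intros E0; apply (E4_E6_no_common_zero t Ht E4z).
    pose proof (ramanujan_E4 t) as R; rewrite E4z in R.
    replace (E6 t) with (- (RtoC 3 * dE4 t)) by (rewrite R; ring).
    replace (dE4 t) with (dF t * eta t ^ 8 / twopii) by (rewrite E; field; auto).
    rewrite E0; field; exact Hp. }
  assert (EF0 : F t = 0) by (unfold F; rewrite E4z; ring).
  set (c := fun j => - Ci * RtoC 12 * (/ RN (S j)) ^ 2).
  assert (Hcv : Ccvg c (F t)).
  { rewrite EF0; replace (RtoC 0) with (- Ci * RtoC 12 * 0) by ring; unfold c.
    apply (Ccvg_scal (- Ci * RtoC 12)), Hpow; lia. }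
  destruct (locally_surjective_seq F dF t c Hn Hc HdFt Hcv) as [u [Hu [N HN]]].
  destruct (Hup u Hu) as [N' HN'].
  exists u; split; [exact Hu|]; exists (N + N')%nat; intros j Hj.
  specialize (HN j ltac:(lia)); specialize (HN' j ltac:(lia)).
  pose proof (eta_neq_0 _ HN') as Hej.
  assert (EJ : J (u j) = F (u j) ^ 3 / RtoC 1728) by (unfold J, F, Delta; field; exact Hej).
  rewrite EJ, HN; unfold J at 1; rewrite E4z, step_eq; unfold c.
  replace ((- Ci * RtoC 12 * (/ RN (S j)) ^ 2) ^ 3)
    with (- Ci * (Ci ^ 2) * RtoC 1728 * (/ RN (S j)) ^ 6) by ring.
  rewrite Ci_sq; field; auto using RN_S_neq_0.
- destruct (classic (E6 t = 0)) as [E6z | E6z].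
  + set (F := fun u => E6 u * / eta u ^ 12).
    assert (HF : forall n, smooth upper n F).
    { intros n; apply (smooth_mult upper Copen_upper); [apply smooth_E6|].
      apply (smooth_inv upper Copen_upper); [intros; now apply Cpow_nz, eta_neq_0|].
      apply (smooth_pow upper Copen_upper), smooth_eta. }
    destruct (smooth_strict F t Ht HF) as [dF [HdF [Hn Hc]]].
    assert (HdFt : dF t <> 0).
    { assert (E : dF t = twopii * dE6 t * / eta t ^ 12 + E6 t *
          (- (RtoC (INR 12) * eta t ^ pred 12 * (twopii / RtoC 24 * E2 t * eta t)) / (eta t ^ 12) ^ 2)).
      { apply (is_Cderive_unique F t); [now apply HdF|].
        apply (is_Cderive_mult E6 (fun u => / eta u ^ 12)); [now apply is_Cderive_E6|].
        apply (is_Cderive_inv (fun u => eta u ^ 12)); [now apply Cpow_nz|].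
        apply (is_Cderive_pow eta); now apply is_Cderive_eta. }
      rewrite E6z in E.
      intros E0; apply (Cpow_nz _ 2 E4z).
      pose proof (ramanujan_E6 t Ht) as R; rewrite E6z in R.
      replace (E4 t ^ 2) with (- (2 * dE6 t)) by (rewrite R; ring).
      replace (dE6 t) with (dF t * eta t ^ 12 / twopii) by (rewrite E; field; auto).
      rewrite E0; field; exact Hp. }
    assert (EF0 : F t = 0) by (unfold F; rewrite E6z; ring).
    set (c := fun j => (1 + Ci) * RtoC (sqrt 864) * (/ RN (S j)) ^ 3).
    assert (Hcv : Ccvg c (F t)).
    { rewrite EF0; replace (RtoC 0) with ((1 + Ci) * RtoC (sqrt 864) * 0) by ring; unfold c.
      apply (Ccvg_scal ((1 + Ci) * RtoC (sqrt 864))), Hpow; lia. }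
    destruct (locally_surjective_seq F dF t c Hn Hc HdFt Hcv) as [u [Hu [N HN]]].
    destruct (Hup u Hu) as [N' HN'].
    exists u; split; [exact Hu|]; exists (N + N')%nat; intros j Hj.
    specialize (HN j ltac:(lia)); specialize (HN' j ltac:(lia)).
    pose proof (eta_neq_0 _ HN') as Hej.
    assert (EJ : J (u j) = 1 + F (u j) ^ 2 / RtoC 1728).
    { replace (J (u j)) with (1 + (J (u j) - 1)) by ring; rewrite J_minus_1 by exact HN'.
      unfold F, Delta; field; exact Hej. }
    assert (EJ1 : J t = 1).
    { replace (J t) with (1 + (J t - 1)) by ring; rewrite J_minus_1, E6z by exact Ht.
      field; exact Hd. }
    rewrite EJ, HN, EJ1, step_eq; unfold c.
    replace (((1 + Ci) * RtoC (sqrt 864) * (/ RN (S j)) ^ 3) ^ 2)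
      with ((1 + 2 * Ci + Ci ^ 2) * (RtoC (sqrt 864) * RtoC (sqrt 864)) * (/ RN (S j)) ^ 6) by ring.
    rewrite Ci_sq, <- RtoC_mult, sqrt_sqrt by lra.
    field; apply RN_S_neq_0.
  + destruct (smooth_strict J t Ht smooth_J) as [dF [HdF [Hn Hc]]].
    assert (HdFt : dF t <> 0).
    { rewrite (is_Cderive_unique J t _ _ (HdF t Ht) (is_Cderive_J t Ht)).
      intros E; apply (Cmult_neq_0 _ _ (Cmult_neq_0 _ _ Hp (Cpow_nz _ 2 E4z)) E6z).
      pose proof C1728_neq_0 as H17.
      replace (twopii * E4 t ^ 2 * E6 t)
        with (- (- twopii * E4 t ^ 2 * E6 t / (RtoC 1728 * Delta t)) * (RtoC 1728 * Delta t))
        by (field; exact Hd).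
      rewrite E; ring. }
    apply (locally_surjective_seq J dF t _ Hn Hc HdFt).
    assert (H : Ccvg (fun j => J t + Ci * (/ RN (S j)) ^ 6) (J t + Ci * 0)).
    { apply Ccvg_plus; [apply Ccvg_const | apply Ccvg_scal, Hpow; lia]. }
    replace (J t + Ci * 0) with (J t) in H by ring.
    revert H; apply Ccvg_ext; intros j; now rewrite step_eq.
Qed.

Lemma qpar_eq_1 (z : C) : qpar z = 1 -> exists n : Z, z = RZ n.
Proof.
intros H; pose proof PI_pos as HP; destruct z as [x y].
assert (Hy : (y = 0)%R).
{ pose proof (qpar_Cmod (x, y)) as E; rewrite H, Cmod_1 in E; simpl in E.
  rewrite <- exp_0 in E; apply exp_inv in E; nra. }
subst y; destruct (exists_nearest_integer x) as [n Hn].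
assert (Hq : qpar (RtoC (x + IZR n)) = 1).
{ assert (E : qpar (RtoC (x + IZR n) + - RZ n + RZ n) = 1).
  { replace (RtoC (x + IZR n) + - RZ n + RZ n) with (RtoC (x + IZR n)) by ring.
    assert (Hz : forall m : Z, qpar (RZ m) = 1).
    { intros m; destruct (Z_le_gt_dec 0 m) as [Hm | Hm].
      - rewrite <- (Z2Nat.id m Hm); unfold RZ; rewrite <- INR_IZR_INZ.
        pose proof (qpar_RN 0 (Z.to_nat m)) as E; rewrite Cplus_0_l, qpar_0 in E; exact E.
      - assert (Em : RZ m = 0 - RN (Z.to_nat (- m))).
        { unfold RN; rewrite INR_IZR_INZ, Z2Nat.id by lia.
          fold (RZ (- m)); rewrite RZ_opp; ring. }
        rewrite Em, qpar_RN_minus; exact qpar_0. }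
    rewrite RtoC_plus, qpar_plus; fold (RZ n); rewrite Hz.
    change (RtoC x) with ((x, 0%R) : C); rewrite H; ring. }
  replace (RtoC (x + IZR n) + - RZ n + RZ n) with (RtoC (x + IZR n)) in E by ring; exact E. }
set (f := (x + IZR n)%R) in *.
assert (Hs : sin (PI * f) = 0%R).
{ unfold qpar in Hq; replace (RtoC (2 * PI) * Ci * RtoC f) with (RtoC (2 * (PI * f)) * Ci) in Hq
    by (rewrite !RtoC_mult; ring).
  rewrite Cexp_imag in Hq; injection Hq as Hc _.
  rewrite cos_2a_sin in Hc; nra. }
assert (Hf : f = 0%R).
{ destruct (Rtotal_order f 0) as [Hf | [Hf | Hf]]; [|exact Hf|].
  - exfalso; assert (0 < sin (- (PI * f)))%R by (apply sin_gt_0; nra).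
    rewrite sin_neg in H0; lra.
  - exfalso; assert (0 < sin (PI * f))%R by (apply sin_gt_0; nra); lra. }
exists (- n)%Z; unfold RZ; rewrite opp_IZR; unfold RtoC; f_equal; unfold f in Hf; lra.
Qed.

Lemma qpar_inj (t w : C) : qpar t = qpar w -> exists n : Z, t = w + RZ n.
Proof.
intros H; destruct (qpar_eq_1 (t - w)) as [n Hn].
- unfold Cminus; rewrite qpar_plus, H, <- qpar_plus.
  replace (w + - w) with (RtoC 0) by ring; exact qpar_0.
- exists n; rewrite <- Hn; ring.
Qed.

Definition invJ_q (q : C) : C :=
  RtoC 1728 * q * Cexp (RtoC 24 * PS logeta_coef q) / PS e4_coef q ^ 3.

Definition e4_disk (q : C) : Prop := disk q /\ PS e4_coef q <> 0.

Lemma PS_cont (a : nat -> C) (q : C) : subexp a -> disk q -> Ccont (PS a) q.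
Proof. intros Ha Hq; exact (is_Cderive_cont _ _ _ (is_Cderive_PS a q Ha Hq)). Qed.

Lemma Copen_e4_disk : Copen e4_disk.
Proof.
intros q [H1 H2]; apply near_and; [now apply Copen_disk|].
apply Ccont_neq; [|exact H2]; apply PS_cont; [exact subexp_e4 | exact H1].
Qed.

Lemma smooth_sub (U V : C -> Prop) (n : nat) : forall f : C -> C,
  (forall z, V z -> U z) -> smooth U n f -> smooth V n f.
Proof.
induction n as [|n IH]; intros f H Hf.
- intros u Hu; apply Hf; auto.
- destruct Hf as [df [Hd Hs]]; exists df; split; auto.
Qed.

Lemma smooth_Cexp_PS (a : nat -> C) (k : C) (n : nat) : subexp a ->
  smooth disk n (fun q => Cexp (k * PS a q)).
Proof.
intros Ha; apply (smooth_exp_ode disk Copen_disk _ (fun q => k * PS (dcoef a) q)).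
- intros q Hq; apply (is_Cderive_comp Cexp (fun q => k * PS a q)); [apply is_Cderive_Cexp|].
  apply is_Cderive_scal; now apply is_Cderive_PS.
- intros m; apply (smooth_scal disk Copen_disk), smooth_PS, subexp_dcoef, Ha.
Qed.

Lemma smooth_invJ_q (n : nat) : smooth e4_disk n invJ_q.
Proof.
assert (Hsub : forall z, e4_disk z -> disk z) by (intros z H; apply H).
apply (smooth_mult e4_disk Copen_e4_disk); [apply (smooth_mult e4_disk Copen_e4_disk)|].
- apply (smooth_scal e4_disk Copen_e4_disk), smooth_id, Copen_e4_disk.
- apply (smooth_sub disk e4_disk n _ Hsub), smooth_Cexp_PS, subexp_logeta.
- apply (smooth_inv e4_disk Copen_e4_disk).
  + intros u Hu; apply Cpow_nz, Hu.
  + apply (smooth_pow e4_disk Copen_e4_disk), (smooth_sub disk e4_disk n _ Hsub), smooth_PS, subexp_e4.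
Qed.

Lemma e4_disk_0 : e4_disk 0.
Proof. split; [exact disk_0|]; rewrite PS_at_0 by exact subexp_e4; apply C1_nz. Qed.

Lemma invJ_q_locally_injective : exists d : R, (0 < d)%R /\
  forall u v, (Cmod u < d)%R -> (Cmod v < d)%R -> invJ_q u = invJ_q v -> u = v.
Proof.
destruct (smooth_all_derive e4_disk Copen_e4_disk invJ_q smooth_invJ_q) as [df [Hd Hs]].
assert (E : df 0 = RtoC 1728).
{ set (H := fun q => RtoC 1728 * Cexp (RtoC 24 * PS logeta_coef q) * / PS e4_coef q ^ 3).
  assert (HH : smooth e4_disk 1 H).
  { assert (Hsub : forall z, e4_disk z -> disk z) by (intros z Hz; apply Hz).
    apply (smooth_mult e4_disk Copen_e4_disk).
    - apply (smooth_scal e4_disk Copen_e4_disk), (smooth_sub disk e4_disk 1 _ Hsub).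
      apply smooth_Cexp_PS, subexp_logeta.
    - apply (smooth_inv e4_disk Copen_e4_disk).
      + intros u Hu; apply Cpow_nz, Hu.
      + apply (smooth_pow e4_disk Copen_e4_disk), (smooth_sub disk e4_disk 1 _ Hsub), smooth_PS, subexp_e4. }
  destruct HH as [dH [HdH _]].
  assert (H0 : H 0 = RtoC 1728).
  { unfold H; rewrite !PS_at_0 by (exact subexp_logeta || exact subexp_e4).
    unfold logeta_coef; change (sigma 1 0) with O; simpl (INR 0).
    unfold Rdiv; rewrite Rmult_0_l, Ropp_0, Cmult_0_r, Cexp_0; simpl e4_coef; field. }
  transitivity (1 * H 0 + 0 * dH 0); [|rewrite H0; ring].
  apply (is_Cderive_unique invJ_q 0); [apply Hd, e4_disk_0|].
  apply (is_Cderive_ext (fun q => q * H q)).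
  - intros q; unfold invJ_q, H, Cdiv; ring.
  - apply (is_Cderive_mult (fun q => q)); [apply is_Cderive_id | apply HdH, e4_disk_0]. }
destruct (locally_injective invJ_q df 0) as [d [Hd0 Hinj]].
- exact (near_imp _ _ _ Hd (Copen_e4_disk 0 e4_disk_0)).
- exact (Hs O 0 e4_disk_0).
- rewrite E; exact C1728_neq_0.
- exists d; split; [exact Hd0|]; intros u v Hu Hv; apply Hinj.
  + now replace (u - 0) with u by ring.
  + now replace (v - 0) with v by ring.
Qed.

Lemma invJ_q_spec (t : C) : upper t -> invJ_q (qpar t) = / J t.
Proof.
intros Ht; unfold invJ_q, J; rewrite E4_QS, Delta_exp by exact Ht; unfold QS.
pose proof (qpar_neq_0 t) as Hq; pose proof (Cexp_neq_0 (RtoC 24 * PS logeta_coef (qpar t))) as He.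
set (e := Cexp (RtoC 24 * PS logeta_coef (qpar t))) in *; set (q := qpar t) in *.
destruct (classic (PS e4_coef q = 0)) as [E | E].
- rewrite E; unfold Cdiv; replace (0 ^ 3) with (RtoC 0) by ring.
  rewrite Cinv_0, Cmult_0_l, Cinv_0; ring.
- field; auto.
Qed.

Lemma equiv_fundamental (t : C) : upper t -> exists u, equiv u t /\ upper u /\
  (Rabs (Re u) <= / 2)%R /\ high u.
Proof.
intros Ht; destruct (fundamental_reduction t Ht) as [g [H1 H2]].
exists (act g t); split; [now exists g|]; split; [now apply upper_act|]; split; assumption.
Qed.

Lemma Im_of_J_large (Y : R) : exists M : R, forall t, high t ->
  (M < Cmod (J t))%R -> (Y < Im t)%R.
Proof.
destruct Delta_high_bounds as [c [M' [Hc HD]]].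
destruct (cusp2_bounded _ _ _ cusp2_E4) as [B HB].
set (e := exp (- (2 * PI * Y))); assert (He : (0 < e)%R) by apply exp_pos.
exists (Rabs B ^ 3 / (1728 * (c * e)))%R; intros t Ht HJ.
apply Rnot_le_lt; intros HY; apply (Rlt_not_le _ _ HJ).
pose proof (high_upper t Ht) as Hu; destruct (HD t Ht) as [H1 _]; specialize (HB t Ht).
assert (Hq : (e <= Cmod (qpar t))%R).
{ rewrite qpar_Cmod; unfold e; pose proof PI_pos.
  destruct (Req_dec Y (Im t)) as [E | E]; [rewrite E; lra|].
  apply Rlt_le, exp_increasing; nra. }
pose proof (Delta_neq_0 t Hu) as Hd.
unfold J; rewrite Cmod_div by (apply Cmult_neq_0; [exact C1728_neq_0 | exact Hd]).
rewrite Cmod_mult, Cmod_pow, Cmod_RtoC_pos by lra; unfold Rdiv.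
assert (HDl : (c * e <= Cmod (Delta t))%R) by nra.
apply Rmult_le_compat.
- apply pow_le, Cmod_ge_0.
- apply Rlt_le, Rinv_0_lt_compat; nra.
- apply pow_incr; split; [apply Cmod_ge_0|]; eapply Rle_trans; [exact HB | apply Rle_abs].
- apply Rinv_le_contravar; nra.
Qed.

Lemma J_injective_large : exists M : R, forall t w, upper t -> upper w ->
  (M < Cmod (J t))%R -> J t = J w -> equiv t w.
Proof.
destruct invJ_q_locally_injective as [d [Hd Hinj]].
destruct (high_qpar_small d Hd) as [Y [_ HY]].
destruct (Im_of_J_large Y) as [M HM]; exists M; intros t w Ht Hw HJ E.
destruct (equiv_fundamental t Ht) as [t' [Et [Ht' [_ Hht]]]].
destruct (equiv_fundamental w Hw) as [w' [Ew [Hw' [_ Hhw]]]].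
pose proof (equiv_J _ _ Ht Et) as Jt; pose proof (equiv_J _ _ Hw Ew) as Jw.
assert (Hqt : (Cmod (qpar t') < d)%R) by (apply HY, Rlt_le, HM; [exact Hht | rewrite Jt; exact HJ]).
assert (Hqw : (Cmod (qpar w') < d)%R)
  by (apply HY, Rlt_le, HM; [exact Hhw | rewrite Jw, <- E; exact HJ]).
destruct (qpar_inj t' w') as [n Hn].
{ apply Hinj; auto; rewrite !invJ_q_spec by assumption; now rewrite Jt, Jw, E. }
apply (equiv_trans t t' w Hw); [now apply equiv_sym|].
apply (equiv_trans t' w' w Hw); [|exact Ew].
exists (MT n); now rewrite act_MT.
Qed.

(* [J t = J w = x + i s] with [t], [w] inequivalent; for [s > 0] the value avoids the
   critical values 0 and 1. *)
Definition bad (x s : R) : Prop := exists t w, upper t /\ upper w /\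
  J t = RtoC x + Ci * RtoC s /\ J w = RtoC x + Ci * RtoC s /\ ~ equiv t w.

Lemma bad_bounded (x : R) : exists M : R, forall s, bad x s -> (s <= M)%R.
Proof.
destruct J_injective_large as [M HM]; exists (Rabs M); intros s [t [w [Ht [Hw [Jt [Jw Hn]]]]]].
apply Rnot_lt_le; intros Hlt; apply Hn, HM; auto; [|now rewrite Jt, Jw].
rewrite Jt; eapply Rlt_le_trans; [|apply im_le_Cmod].
assert (E : Im (RtoC x + Ci * RtoC s) = s) by (unfold RtoC, Ci; simpl; ring).
rewrite E; pose proof (Rle_abs M); pose proof (Rle_abs s); lra.
Qed.

Lemma bad_open (x s : R) : bad x s -> exists s', (s < s')%R /\ bad x s'.
Proof.
intros [t [w [Ht [Hw [Jt [Jw Hn]]]]]].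
destruct (J_lift t Ht) as [u [Hu [N1 HN1]]]; destruct (J_lift w Hw) as [v [Hv [N2 HN2]]].
destruct (Copen_upper t Ht) as [r1 [Hr1 Hb1]]; destruct (Hu r1 Hr1) as [N3 HN3].
destruct (Copen_upper w Hw) as [r2 [Hr2 Hb2]]; destruct (Hv r2 Hr2) as [N4 HN4].
apply NNPP; intros Hno; apply Hn.
set (N := (N1 + N2 + N3 + N4)%nat).
apply (equiv_closed (fun j => u (j + N)%nat) (fun j => v (j + N)%nat)); auto.
- intros j; apply Hb2, HN4; lia.
- now apply Ccvg_shift.
- now apply Ccvg_shift.
- intros j; apply NNPP; intros Hne; apply Hno.
  exists (s + step (j + N))%R; split; [pose proof (step_pos (j + N)); lra|].
  exists (u (j + N)%nat), (v (j + N)%nat); repeat split; auto.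
  + apply Hb1, HN3; lia.
  + apply Hb2, HN4; lia.
  + rewrite HN1 by lia; rewrite Jt, RtoC_plus; ring.
  + rewrite HN2 by lia; rewrite Jw, RtoC_plus; ring.
Qed.

Lemma J_derivative_neq_0 (t : C) (x s : R) : upper t -> (0 < s)%R ->
  J t = RtoC x + Ci * RtoC s -> - twopii * E4 t ^ 2 * E6 t / (RtoC 1728 * Delta t) <> 0.
Proof.
intros Ht Hs HJ; pose proof (Delta_neq_0 t Ht) as Hd.
assert (Him : Im (J t) = s) by (rewrite HJ; unfold RtoC, Ci; simpl; ring).
assert (H4 : E4 t <> 0).
{ intros E; assert (EJ : J t = 0) by (unfold J; rewrite E; field; exact Hd).
  rewrite EJ in Him; simpl in Him; lra. }
assert (H6 : E6 t <> 0).
{ intros E; pose proof (J_minus_1 t Ht) as EJ; rewrite E in EJ.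
  assert (EJ1 : J t = 1).
  { replace (J t) with (J t - 1 + 1) by ring; rewrite EJ; field; exact Hd. }
  rewrite EJ1 in Him; simpl in Him; lra. }
intros E; apply (Cmult_neq_0 _ _ (Cmult_neq_0 _ _ twopii_neq_0 (Cpow_nz _ 2 H4)) H6).
replace (twopii * E4 t ^ 2 * E6 t)
  with (- (- twopii * E4 t ^ 2 * E6 t / (RtoC 1728 * Delta t)) * (RtoC 1728 * Delta t))
  by (field; exact Hd).
rewrite E; ring.
Qed.

Lemma J_large_of_Im (M : R) : exists Y : R, forall t, (Y < Im t)%R -> (M < Cmod (J t))%R.
Proof.
destruct cusp2_E4 as [K HK]; destruct Delta_high_bounds as [c [M' [_ HD]]].
set (A := (240 + Rabs K)%R); set (B := (1728 * (1 + Rabs M'))%R).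
assert (HA : (0 < A)%R) by (unfold A; pose proof (Rabs_pos K); lra).
assert (HB : (0 < B)%R) by (unfold B; pose proof (Rabs_pos M'); lra).
set (d := Rmin (/ (2 * A)) (/ (8 * B * (Rabs M + 1)))).
assert (HM1 : (0 < Rabs M + 1)%R) by (pose proof (Rabs_pos M); lra).
assert (HBM : (0 < 8 * B * (Rabs M + 1))%R) by (apply Rmult_lt_0_compat; lra).
assert (Hd : (0 < d)%R) by (apply Rmin_glb_lt; apply Rinv_0_lt_compat; lra).
destruct (high_qpar_small d Hd) as [Y [HY1 HY]]; exists Y; intros t Ht.
assert (Hh : high t) by (unfold high; lra); pose proof (high_upper t Hh) as Hu.
specialize (HY t ltac:(lra)); specialize (HK t Hh); destruct (HD t Hh) as [_ HDt].
set (q := Cmod (qpar t)) in *.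
assert (Hq0 : (0 < q)%R) by apply Cmod_gt_0, qpar_neq_0.
assert (Hq1 : (q < 1)%R) by exact (qpar_lt_1 t Hu).
assert (D1 : (d <= / (2 * A))%R) by apply Rmin_l.
assert (D2 : (d <= / (8 * B * (Rabs M + 1)))%R) by apply Rmin_r.
assert (Hq2 : (q ^ 2 <= q)%R) by (simpl; nra).
assert (HE : (/ 2 <= Cmod (E4 t))%R).
{ pose proof (Cmod_triangle_rev 1 (- (E4 t - 1))) as H.
  replace (1 - - (E4 t - 1)) with (E4 t) in H by ring; rewrite Cmod_1, Cmod_opp in H.
  assert (H2 : (Cmod (E4 t - 1) <= A * q)%R).
  { replace (E4 t - 1) with ((E4 t - 1 - RtoC 240 * qpar t) + RtoC 240 * qpar t) by ring.
    eapply Rle_trans; [apply Cmod_triangle|]; rewrite Cmod_mult, Cmod_RtoC_pos by lra; fold q.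
    unfold A; pose proof (Rle_abs K); pose proof (Rabs_pos K).
    assert (K * q ^ 2 <= Rabs K * q)%R by nra; lra. }
  assert (A * q <= / 2)%R; [|lra].
  apply Rle_trans with (A * / (2 * A))%R; [apply Rmult_le_compat_l; lra|].
  apply Req_le; field; lra. }
assert (HDl : (1728 * Cmod (Delta t) <= B * q)%R).
{ replace (Delta t) with ((Delta t - qpar t) + qpar t) by ring.
  pose proof (Cmod_triangle (Delta t - qpar t) (qpar t)) as H; fold q in H.
  unfold B; pose proof (Rle_abs M'); pose proof (Rabs_pos M').
  assert (M' * q ^ 2 <= Rabs M' * q)%R by nra; lra. }
pose proof (Delta_neq_0 t Hu) as Hdn; assert (HDp : (0 < Cmod (Delta t))%R) by now apply Cmod_gt_0.
unfold J; rewrite Cmod_div by (apply Cmult_neq_0; [exact C1728_neq_0 | exact Hdn]).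
rewrite Cmod_mult, Cmod_pow, Cmod_RtoC_pos by lra.
apply (Rmult_lt_reg_r (1728 * Cmod (Delta t))); [lra|].
unfold Rdiv; rewrite Rmult_assoc, Rinv_l, Rmult_1_r by lra.
apply Rlt_le_trans with (/ 8)%R.
- apply Rle_lt_trans with (Rabs M * (B * q))%R.
  { pose proof (Rle_abs M); pose proof (Rabs_pos M).
    apply Rle_trans with (Rabs M * (1728 * Cmod (Delta t)))%R; [apply Rmult_le_compat_r; lra|].
    apply Rmult_le_compat_l; lra. }
  apply Rlt_le_trans with ((Rabs M + 1) * (B * d))%R; [pose proof (Rabs_pos M); nra|].
  apply Rle_trans with ((Rabs M + 1) * (B * / (8 * B * (Rabs M + 1))))%R.
  + apply Rmult_le_compat_l; [lra|]; apply Rmult_le_compat_l; lra.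
  + apply Req_le; field; lra.
- replace (/ 8)%R with ((/ 2) ^ 3)%R by field; apply pow_incr; lra.
Qed.

Lemma bad_closed (x s : R) (sk : nat -> R) : (0 < s)%R -> (forall k, (0 < sk k)%R) ->
  (forall k, bad x (sk k)) -> is_lim_seq sk s -> bad x s.
Proof.
intros Hs Hsk Hbad Hlim.
assert (Hsel : forall k, exists p : C * C, (Rabs (Re (fst p)) <= / 2)%R /\ high (fst p) /\
  (Rabs (Re (snd p)) <= / 2)%R /\ high (snd p) /\
  J (fst p) = RtoC x + Ci * RtoC (sk k) /\ J (snd p) = RtoC x + Ci * RtoC (sk k) /\
  ~ equiv (fst p) (snd p)).
{ intros k; destruct (Hbad k) as [t [w [Ht [Hw [Jt [Jw Hn]]]]]].
  destruct (equiv_fundamental t Ht) as [t' [Et [Ht' [Hrt Hht]]]].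
  destruct (equiv_fundamental w Hw) as [w' [Ew [Hw' [Hrw Hhw]]]].
  exists (t', w'); cbn [fst snd]; repeat split; auto.
  - now rewrite (equiv_J _ _ Ht Et).
  - now rewrite (equiv_J _ _ Hw Ew).
  - intros He; apply Hn.
    apply (equiv_trans t t' w Hw); [now apply equiv_sym|].
    now apply (equiv_trans t' w' w Hw). }
set (pr := fun k => proj1_sig (constructive_indefinite_description _ (Hsel k))).
assert (Hpr : forall k, (Rabs (Re (fst (pr k))) <= / 2)%R /\ high (fst (pr k)) /\
  (Rabs (Re (snd (pr k))) <= / 2)%R /\ high (snd (pr k)) /\
  J (fst (pr k)) = RtoC x + Ci * RtoC (sk k) /\ J (snd (pr k)) = RtoC x + Ci * RtoC (sk k) /\
  ~ equiv (fst (pr k)) (snd (pr k))).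
{ intros k; unfold pr; destruct (constructive_indefinite_description _ (Hsel k)); assumption. }
clearbody pr.
destruct (bad_bounded x) as [Ms HMs].
destruct (J_large_of_Im (Rabs x + Rabs Ms)) as [Y HY].
assert (HJb : forall k, (Cmod (RtoC x + Ci * RtoC (sk k)) <= Rabs x + Rabs Ms)%R).
{ intros k; eapply Rle_trans; [apply Cmod_triangle|].
  rewrite Cmod_mult, Cmod_Ci, !Cmod_R, Rmult_1_l.
  specialize (Hsk k); specialize (HMs _ (Hbad k)).
  rewrite (Rabs_pos_eq (sk k)) by lra; pose proof (Rle_abs Ms); lra. }
assert (Hbox : forall u k, high u -> J u = RtoC x + Ci * RtoC (sk k) ->
  (Rabs (Re u) <= / 2)%R -> (- / 2 <= Re u <= / 2)%R /\ (/ 2 <= Im u <= Y)%R).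
{ intros u k Hu HJ Hr; split; [now apply Rabs_le_between|]; split; [exact Hu|].
  apply Rnot_lt_le; intros Hlt; apply HY in Hlt; rewrite HJ in Hlt; specialize (HJb k); lra. }
destruct (bounded_complex_subseq (fun k => fst (pr k)) (- / 2) (/ 2) (/ 2) Y)
  as [p [t [Hp [Ht [_ Htu]]]]].
{ intros k; destruct (Hpr k) as [H1 [H2 [_ [_ [H5 _]]]]]; exact (Hbox _ k H2 H5 H1). }
destruct (bounded_complex_subseq (fun k => snd (pr (p k))) (- / 2) (/ 2) (/ 2) Y)
  as [r [w [Hr [Hw [_ Hwu]]]]].
{ intros k; destruct (Hpr (p k)) as [_ [_ [H3 [H4 [_ [H6 _]]]]]]; exact (Hbox _ (p k) H4 H6 H3). }
assert (Htup : upper t) by (unfold upper; lra); assert (Hwup : upper w) by (unfold upper; lra).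
assert (Ht' : Ccvg (fun k => fst (pr (p (r k)))) t)
  by exact (Ccvg_reindex (fun k => fst (pr (p k))) t r Hr Ht).
assert (Hcs : Ccvg (fun k => RtoC x + Ci * RtoC (sk (p (r k)))) (RtoC x + Ci * RtoC s)).
{ apply Ccvg_plus; [apply Ccvg_const|]; apply Ccvg_scal.
  intros eps He; apply is_lim_seq_spec in Hlim; destruct (Hlim (mkposreal eps He)) as [N HN].
  exists N; intros k Hk; rewrite <- RtoC_minus, Cmod_R; apply HN.
  specialize (Hr k); specialize (Hp (r k)); lia. }
assert (HJlim : forall (u : nat -> C) (l : C), upper l -> Ccvg u l ->
  (forall k, J (u k) = RtoC x + Ci * RtoC (sk (p (r k)))) -> J l = RtoC x + Ci * RtoC s).
{ intros u l Hl Hul HJu; apply (Ccvg_unique (fun k => J (u k))).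
  - apply (Ccvg_comp J); [exact (smooth_J 0 l Hl) | exact Hul].
  - revert Hcs; apply Ccvg_ext; intros k; symmetry; apply HJu. }
assert (HJt : J t = RtoC x + Ci * RtoC s).
{ apply (HJlim (fun k => fst (pr (p (r k)))) t Htup Ht'); intros k.
  destruct (Hpr (p (r k))) as [_ [_ [_ [_ [H5 _]]]]]; exact H5. }
assert (HJw : J w = RtoC x + Ci * RtoC s).
{ apply (HJlim (fun k => snd (pr (p (r k)))) w Hwup Hw); intros k.
  destruct (Hpr (p (r k))) as [_ [_ [_ [_ [_ [H6 _]]]]]]; exact H6. }
exists t, w; repeat split; auto.
intros [g Hg].
destruct (smooth_strict J t Htup smooth_J) as [dJ [HdJ [Hn Hc]]].
destruct (locally_injective J dJ t Hn Hc) as [d [Hd Hinj]].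
{ rewrite (is_Cderive_unique J t _ _ (HdJ t Htup) (is_Cderive_J t Htup)).
  exact (J_derivative_neq_0 t x s Htup Hs HJt). }
assert (Hgw : Ccvg (fun k => act g (snd (pr (p (r k))))) t).
{ rewrite Hg; unfold act, Cdiv; apply Ccvg_mult.
  - apply Ccvg_plus; [now apply Ccvg_scal | apply Ccvg_const].
  - apply Ccvg_inv; [now apply autf_neq_0|].
    apply Ccvg_plus; [now apply Ccvg_scal | apply Ccvg_const]. }
destruct (Ht' d Hd) as [N1 HN1]; destruct (Hgw d Hd) as [N2 HN2].
destruct (Hpr (p (r (N1 + N2)%nat))) as [_ [_ [_ [H4 [H5 [H6 Hne]]]]]].
apply Hne; exists g; apply Hinj.
- apply HN1; lia.
- apply HN2; lia.
- rewrite J_act by exact (high_upper _ H4); now rewrite H5, H6.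
Qed.

Lemma J_injective_real (t w : C) (x : R) : upper t -> upper w ->
  J t = RtoC x -> J w = RtoC x -> equiv t w.
Proof.
intros Ht Hw Jt Jw; apply NNPP; intros Hn.
assert (H0 : bad x 0).
{ exists t, w; repeat split; auto; [rewrite Jt | rewrite Jw]; ring. }
destruct (bad_open x 0 H0) as [s1 [Hs1 Hb1]].
destruct (bad_bounded x) as [M HM].
destruct (completeness (bad x)) as [s [Hub Hlub]]; [exists M; exact HM | now exists s1|].
assert (Hs : (s1 <= s)%R) by (apply Hub, Hb1).
assert (Hseq : forall k : nat, exists v, bad x v /\ (s - s1 * / (INR k + 2) < v)%R).
{ intros k; apply NNPP; intros Hno.
  assert (Hp : (0 < s1 * / (INR k + 2))%R).
  { apply Rmult_lt_0_compat; [exact Hs1|]; apply Rinv_0_lt_compat; pose proof (pos_INR k); lra. }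
  assert (s <= s - s1 * / (INR k + 2))%R; [|lra].
  apply Hlub; intros v Hv; apply Rnot_lt_le; intros Hlt; apply Hno; eauto. }
set (sk := fun k => proj1_sig (constructive_indefinite_description _ (Hseq k))).
assert (Hsk : forall k, bad x (sk k) /\ (s - s1 * / (INR k + 2) < sk k)%R).
{ intros k; unfold sk; destruct (constructive_indefinite_description _ (Hseq k)); assumption. }
clearbody sk.
assert (Hlim : is_lim_seq sk s).
{ apply (is_lim_seq_le_le (fun k => (s - s1 * / (INR k + 2))%R) _ (fun _ => s)).
  - intros k; destruct (Hsk k) as [H1 H2]; apply Hub in H1; lra.
  - replace (Finite s) with (Finite (s - s1 * 0)) by (f_equal; ring).
    apply is_lim_seq_minus'; [apply is_lim_seq_const|].
    apply (is_lim_seq_mult' (fun _ => s1) (fun k => (/ (INR k + 2))%R));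
      [apply is_lim_seq_const|].
    apply (is_lim_seq_ext (fun k => (/ INR (S (S k)))%R)).
    { intros k; rewrite !S_INR; f_equal; ring. }
    apply (is_lim_seq_incr_1 (fun k => (/ INR (S k))%R)).
    apply (is_lim_seq_incr_1 (fun k => (/ INR k)%R)).
    replace (Finite 0) with (Rbar_inv p_infty) by reflexivity.
    apply is_lim_seq_inv; [apply is_lim_seq_INR | discriminate].
  - apply is_lim_seq_const. }
assert (Hpos : forall k, (0 < sk k)%R).
{ intros k; destruct (Hsk k) as [_ H]; pose proof (pos_INR k).
  assert (/ (INR k + 2) <= / 2)%R by (apply Rinv_le_contravar; lra); nra. }
destruct (bad_open x s) as [s' [Hs' Hb']].
- apply (bad_closed x s sk); [lra | exact Hpos | intros; apply Hsk | exact Hlim].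
- apply Hub in Hb'; lra.
Qed.

(** * The algebraic system *)

Definition offd (A : nat -> nat -> C) (n : nat) : C :=
  psum (fun i => psum (fun k => if Nat.eqb k i then 0 else A i k) n) n.

Lemma psum_swap (B : nat -> nat -> C) (n m : nat) :
  psum (fun i => psum (B i) m) n = psum (fun k => psum (fun i => B i k) n) m.
Proof.
induction n as [|n IH]; simpl.
- now rewrite psum_0.
- now rewrite IH, <- psum_plus.
Qed.

Lemma offd_swap (A : nat -> nat -> C) (n : nat) : offd (fun i k => A k i) n = offd A n.
Proof.
unfold offd.
rewrite (psum_swap (fun i k => if Nat.eqb k i then 0 else A k i)).
apply psum_ext; intros i _; apply psum_ext; intros k _; now rewrite Nat.eqb_sym.
Qed.

Lemma offd_plus (A B : nat -> nat -> C) (n : nat) :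
  offd (fun i k => A i k + B i k) n = offd A n + offd B n.
Proof.
unfold offd; rewrite <- psum_plus; apply psum_ext; intros i _.
rewrite <- psum_plus; apply psum_ext; intros k _; destruct (Nat.eqb k i); ring.
Qed.

Lemma offd_ext (A B : nat -> nat -> C) (n : nat) :
  (forall i k, (i < n)%nat -> (k < n)%nat -> i <> k -> A i k = B i k) -> offd A n = offd B n.
Proof.
intros H; unfold offd; apply psum_ext; intros i Hi; apply psum_ext; intros k Hk.
destruct (Nat.eqb_spec k i); auto.
Qed.

Lemma offd_row (a : nat -> C) (A : nat -> nat -> C) (n : nat) :
  offd (fun i k => a i * A i k) n =
  psum (fun i => a i * psum (fun k => if Nat.eqb k i then 0 else A i k) n) n.
Proof.
unfold offd; apply psum_ext; intros i _; rewrite <- psum_scal; apply psum_ext; intros k _.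
destruct (Nat.eqb k i); ring.
Qed.

Lemma psum_indicator (a : nat -> C) (i n : nat) : (i < n)%nat ->
  psum (fun k => if Nat.eqb k i then a k else 0) n = a i.
Proof.
intros Hi.
assert (H : forall m, psum (fun k => if Nat.eqb k i then a k else 0) m =
  if (i <? m)%nat then a i else 0).
{ induction m as [|m IH]; [reflexivity|]; rewrite psum_S, IH.
  destruct (Nat.eqb_spec m i) as [E | E]; destruct (Nat.ltb_spec i m);
    destruct (Nat.ltb_spec i (S m)); try lia; try (subst m); ring. }
rewrite H; destruct (Nat.ltb_spec i n); [reflexivity | lia].
Qed.

Lemma psum_1 (n : nat) : psum (fun _ => RtoC 1) n = RN n.
Proof.
induction n as [|n IH]; [reflexivity | rewrite psum_S, IH, RN_S; reflexivity].
Qed.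

Lemma psum_square (s : nat -> C) (n : nat) :
  psum s n ^ 2 = psum (fun i => s i ^ 2) n + offd (fun i k => s i * s k) n.
Proof.
replace (psum s n ^ 2) with (psum s n * psum s n) by ring.
unfold offd; rewrite <- psum_plus, <- psum_scal; apply psum_ext; intros i Hi.
rewrite Cmult_comm, <- psum_scal.
rewrite <- (psum_indicator (fun _ => s i ^ 2) i n Hi), <- psum_plus.
apply psum_ext; intros k _; destruct (Nat.eqb_spec k i) as [-> | E]; ring.
Qed.

Lemma offd_one (n : nat) : offd (fun _ _ => RtoC 1) n = RN n * (RN n - 1).
Proof.
pose proof (psum_square (fun _ => RtoC 1) n) as H; rewrite psum_1 in H.
rewrite (psum_ext (fun _ => 1 ^ 2) (fun _ => RtoC 1)), psum_1 in H by (intros; ring).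
rewrite (offd_ext (fun _ _ => RtoC 1) (fun _ _ => 1 * 1)) by (intros; ring).
replace (RN n * (RN n - 1)) with (RN n ^ 2 - RN n) by ring; rewrite H; ring.
Qed.

Lemma psum_linear (c0 c1 c2 c3 c4 c5 : C) (a b c d e : nat -> C) (n : nat) :
  psum (fun i => c0 + c1 * a i + c2 * b i + c3 * c i + c4 * d i + c5 * e i) n =
  c0 * RN n + c1 * psum a n + c2 * psum b n + c3 * psum c n + c4 * psum d n + c5 * psum e n.
Proof.
induction n as [|n IH]; [unfold RN; simpl; ring | rewrite !psum_S, IH, RN_S; ring].
Qed.

Section Stieltjes.
Context (n : nat) (X : nat -> C) (j : C).
Hypothesis X_dist : forall i k, (i < n)%nat -> (k < n)%nat -> i <> k -> X i <> X k.
Hypothesis X_0 : forall i, (i < n)%nat -> X i <> 0.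
Hypothesis X_1 : forall i, (i < n)%nat -> X i <> 1.
Hypothesis X_sys : forall i, (i < n)%nat ->
  psum (fun k => if Nat.eqb k i then 0 else / (X i - X k)) n
  = - (RtoC 8 / X i + RtoC 9 / (X i - 1)) / RtoC 12.
Hypothesis j_X : forall i, (i < n)%nat -> j <> X i.
Hypothesis j_1 : j <> 1.

Let ee (i : nat) : C := - (RtoC 8 / X i + RtoC 9 / (X i - 1)) / RtoC 12.
Let s (i : nat) : C := j / (j - X i).
Let nu (i : nat) : C := - (RtoC 17 / RtoC 6) - RtoC 3 / 2 / (X i - 1).

Lemma stieltjes_count : RN n * (RN n - 1) = psum nu n.
Proof using X_dist X_0 X_1 X_sys.
rewrite <- offd_one.
rewrite (offd_ext _ (fun i k => X i * / (X i - X k) + X k * / (X k - X i))).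
2:{ intros i k Hi Hk Hik; pose proof (Cminus_neq_0 _ _ (X_dist i k Hi Hk Hik)) as H1.
    assert (H2 : X k - X i <> 0) by (apply Cminus_neq_0, X_dist; auto).
    field; auto. }
rewrite offd_plus, (offd_swap (fun i k => X i * / (X i - X k))), (offd_row X (fun i k => / (X i - X k))).
rewrite <- psum_plus; apply psum_ext; intros i Hi; rewrite X_sys by exact Hi.
pose proof (X_0 i Hi); pose proof (Cminus_neq_0 _ _ (X_1 i Hi)); unfold nu; field; auto.
Qed.

Lemma stieltjes_square :
  psum s n ^ 2 = psum (fun i => s i ^ 2) n + psum nu n
    + 2 * psum (fun i => X i ^ 2 * ee i / (j - X i)) n.
Proof using X_dist X_0 X_1 X_sys j_X.
rewrite psum_square, <- stieltjes_count, <- offd_one.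
rewrite (offd_ext (fun i k => s i * s k)
  (fun i k => (1 / 2 + X i ^ 2 / (j - X i) * / (X i - X k))
            + (1 / 2 + X k ^ 2 / (j - X k) * / (X k - X i)))).
2:{ intros i k Hi Hk Hik; pose proof (Cminus_neq_0 _ _ (X_dist i k Hi Hk Hik)) as H1.
    assert (H2 : X k - X i <> 0) by (apply Cminus_neq_0, X_dist; auto).
    pose proof (Cminus_neq_0 _ _ (j_X i Hi)); pose proof (Cminus_neq_0 _ _ (j_X k Hk)).
    unfold s; field; auto. }
rewrite offd_plus, (offd_swap (fun i k => 1 / 2 + X i ^ 2 / (j - X i) * / (X i - X k))).
rewrite offd_plus, (offd_row (fun i => X i ^ 2 / (j - X i)) (fun i k => / (X i - X k))).
rewrite (psum_ext (fun i => X i ^ 2 / (j - X i) * _) (fun i => X i ^ 2 * ee i / (j - X i))).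
2:{ intros i Hi; rewrite X_sys by exact Hi; unfold ee, Cdiv; ring. }
rewrite (offd_ext (fun _ _ => RtoC 1) (fun _ _ => 1 / 2 + 1 / 2)) by (intros; field).
rewrite (offd_plus (fun _ _ => 1 / 2)); ring.
Qed.

Lemma stieltjes_identity :
  let u := j / (j - 1) in
  let g := 2 / RtoC 3 + u + 2 * psum (fun i => j / (j - X i)) n in
  let dg := - / (j - 1) ^ 2 - 2 * psum (fun i => X i / (j - X i) ^ 2) n in
  u * (- (1 / RtoC 72) - g / 2 + (RtoC 12 * RN n + RtoC 11) ^ 2 / RtoC 72)
    + g / RtoC 3 - j * dg - g ^ 2 / 2 = 0.
Proof using X_dist X_0 X_1 X_sys j_X j_1.
intros u g dg; fold s in g.
pose proof (Cminus_neq_0 _ _ j_1) as Hj1.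
set (S1 := psum s n) in *; set (S2 := psum (fun i => X i / (j - X i) ^ 2) n) in *.
set (Q := psum (fun i => s i ^ 2) n); set (V := psum nu n).
set (W := psum (fun i => X i ^ 2 * ee i / (j - X i)) n).
pose proof stieltjes_square as HS; fold S1 Q V W in HS.
pose proof stieltjes_count as HV; fold V in HV.
set (a := 2 / RtoC 3 + u).
set (T := fun i => u * (RtoC 11 / RtoC 3 + 2)
  + (- u + 2 / RtoC 3 - 2 * a) * s i + (2 * j) * (X i / (j - X i) ^ 2)
  + (- (2)) * s i ^ 2 + (2 * u - 2) * nu i + (- RtoC 4) * (X i ^ 2 * ee i / (j - X i))).
assert (HT : psum T n = 0).
{ rewrite (psum_ext T (fun _ => RtoC 0)); [apply psum_0|]; intros i Hi.
  pose proof (X_0 i Hi); pose proof (Cminus_neq_0 _ _ (X_1 i Hi)).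
  pose proof (Cminus_neq_0 _ _ (j_X i Hi)).
  unfold T, a, u, s, nu, ee; field; auto. }
unfold T in HT; rewrite psum_linear in HT; fold S1 S2 Q V W in HT.
transitivity (u * (- (1 / RtoC 72) - a / 2 + RtoC 121 / RtoC 72) + a / RtoC 3
   + j / (j - 1) ^ 2 - a ^ 2 / 2
   + (u * (RtoC 11 / RtoC 3 + 2) * RN n + (- u + 2 / RtoC 3 - 2 * a) * S1 + 2 * j * S2
      + (- (2)) * Q + (2 * u - 2) * V + (- RtoC 4) * W)
   + 2 * u * (RN n * (RN n - 1) - V) - 2 * (S1 ^ 2 - (Q + V + 2 * W))).
- unfold g, dg; fold a; field; exact Hj1.
- rewrite HT, HS, HV; unfold a, u; field; exact Hj1.
Qed.

End Stieltjes.

Lemma Rsum_psum (p : nat -> bool) (F : nat -> R) (n : nat) :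
  RtoC (Rsum (filter p (seq 0 n)) F) = psum (fun k => if p k then RtoC (F k) else 0) n.
Proof.
induction n as [|n IH]; [reflexivity|].
rewrite seq_S, filter_app, psum_S, <- IH; unfold Rsum.
rewrite map_app, fold_right_app; simpl; destruct (p n); simpl.
- generalize (map F (filter p (seq 0 n))); intros l; rewrite <- RtoC_plus; f_equal.
  induction l as [|y l IHl]; simpl; [ring | rewrite IHl; ring].
- now rewrite Cplus_0_r.
Qed.

Lemma Rsum_pos (l : list nat) (F : nat -> R) :
  (forall k, In k l -> (0 < F k)%R) -> (exists k, In k l) -> (0 < Rsum l F)%R.
Proof.
unfold Rsum; intros H [k Hk].
assert (H0 : forall l', (forall k, In k l' -> (0 < F k)%R) -> (0 <= fold_right Rplus 0 (map F l'))%R).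
{ induction l' as [|a l' IH]; simpl; intros Hl'; [lra|].
  assert (0 < F a)%R by auto; assert (0 <= fold_right Rplus 0 (map F l'))%R by auto; lra. }
destruct l as [|a l]; [destruct Hk|]; simpl.
assert (0 < F a)%R by auto with datatypes.
assert (0 <= fold_right Rplus 0 (map F l))%R by auto with datatypes; lra.
Qed.

Lemma Rsum_neg (l : list nat) (F : nat -> R) :
  (forall k, In k l -> (F k < 0)%R) -> (exists k, In k l) -> (Rsum l F < 0)%R.
Proof.
intros H Hk.
assert (H0 := Rsum_pos l (fun k => (- F k)%R) ltac:(intros k Hin; specialize (H k Hin); lra) Hk).
assert (E : Rsum l (fun k => (- F k)%R) = (- Rsum l F)%R); [|lra].
unfold Rsum; clear; induction l as [|a l IH]; simpl; [ring | rewrite IH; ring].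
Qed.

Lemma argmax_exists (x : nat -> R) (n : nat) : (0 < n)%nat ->
  exists m, (m < n)%nat /\ forall k, (k < n)%nat -> (x k <= x m)%R.
Proof.
induction n as [|n IH]; [lia|]; intros _; destruct n as [|n].
- exists O; split; [lia|]; intros k Hk; replace k with O by lia; lra.
- destruct IH as [m [Hm H]]; [lia|].
  destruct (Rle_lt_dec (x (S n)) (x m)) as [Hle | Hlt].
  + exists m; split; [lia|]; intros k Hk.
    destruct (Nat.eq_dec k (S n)) as [-> | Hne]; [exact Hle | apply H; lia].
  + exists (S n); split; [lia|]; intros k Hk.
    destruct (Nat.eq_dec k (S n)) as [-> | Hne]; [lra|].
    specialize (H k ltac:(lia)); lra.
Qed.

Lemma filter_neq_In (n i k : nat) :
  In k (filter (fun j => negb (Nat.eqb j i)) (seq 0 n)) <-> (k < n)%nat /\ k <> i.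
Proof.
rewrite filter_In, in_seq, Bool.negb_true_iff, Nat.eqb_neq; lia.
Qed.

Lemma E_system_plus_small (n : nat) (x : nat -> R) :
  (forall i, (i < n)%nat -> (0 < x i < 1)%R) -> E_system 8 9 12 n x -> (n <= 1)%nat.
Proof.
intros Hb [Hd [_ Hs]]; apply Nat.nlt_ge; intros Hn.
destruct (argmax_exists x n ltac:(lia)) as [M [HM HMmax]].
destruct (argmax_exists (fun k => (- x k)%R) n ltac:(lia)) as [m [Hm Hmmin]].
assert (Hother : forall i, (i < n)%nat -> exists k, In k (filter (fun j => negb (Nat.eqb j i)) (seq 0 n))).
{ intros i Hi; destruct (Nat.eq_dec i 0) as [E | E].
  - exists 1%nat; apply filter_neq_In; lia.
  - exists 0%nat; apply filter_neq_In; lia. }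
assert (HsM : (Rsum (filter (fun j => negb (Nat.eqb j M)) (seq 0 n)) (fun j => 12 / (x j - x M)) < 0)%R).
{ apply Rsum_neg; [|now apply Hother]; intros k Hk; apply filter_neq_In in Hk.
  pose proof (HMmax k ltac:(lia)); pose proof (Hd k M ltac:(lia) HM ltac:(lia)).
  assert (0 < 12 / (x M - x k))%R by (apply Rdiv_lt_0_compat; lra).
  replace (12 / (x k - x M))%R with (- (12 / (x M - x k)))%R by (field; lra); lra. }
assert (Hsm : (0 < Rsum (filter (fun j => negb (Nat.eqb j m)) (seq 0 n)) (fun j => 12 / (x j - x m)))%R).
{ apply Rsum_pos; [|now apply Hother]; intros k Hk; apply filter_neq_In in Hk.
  pose proof (Hmmin k ltac:(lia)); pose proof (Hd k m ltac:(lia) Hm ltac:(lia)).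
  apply Rdiv_lt_0_compat; lra. }
pose proof (Hs M HM) as EM; pose proof (Hs m Hm) as Em.
pose proof (Hb M HM) as BM; pose proof (Hb m Hm) as Bm; pose proof (HMmax m Hm) as Hle.
assert (H1 : (0 < 8 / x M + 9 / (x M - 1))%R) by lra.
assert (H2 : (8 / x m + 9 / (x m - 1) < 0)%R) by lra.
assert (F1 : (x M < 8 / 17)%R).
{ replace (8 / x M + 9 / (x M - 1))%R with ((8 - 17 * x M) / (x M * (1 - x M)))%R in H1 by (field; lra).
  apply Rnot_le_lt; intros Hc; apply (Rlt_not_le _ _ H1).
  assert (0 < x M * (1 - x M))%R by (apply Rmult_lt_0_compat; lra).
  assert (0 <= (17 * x M - 8) / (x M * (1 - x M)))%R
    by (apply Rmult_le_pos; [lra | apply Rlt_le, Rinv_0_lt_compat; lra]).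
  replace ((8 - 17 * x M) / (x M * (1 - x M)))%R
    with (- ((17 * x M - 8) / (x M * (1 - x M))))%R by (field; lra); lra. }
assert (F2 : (8 / 17 < x m)%R).
{ replace (8 / x m + 9 / (x m - 1))%R with (- ((17 * x m - 8) / (x m * (1 - x m))))%R in H2
    by (field; lra).
  apply Rnot_le_lt; intros Hc.
  assert (0 < x m * (1 - x m))%R by (apply Rmult_lt_0_compat; lra).
  assert (0 <= (8 - 17 * x m) / (x m * (1 - x m)))%R
    by (apply Rmult_le_pos; [lra | apply Rlt_le, Rinv_0_lt_compat; lra]).
  replace ((17 * x m - 8) / (x m * (1 - x m)))%R
    with (- ((8 - 17 * x m) / (x m * (1 - x m))))%R in H2 by (field; lra); lra. }
lra.
Qed.

Lemma E_8_9_12_residues (n : nat) (x : nat -> R) :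
  (forall i, (i < n)%nat -> (0 < x i < 1)%R) -> E_8_9_12 n x ->
  (forall i k, (i < n)%nat -> (k < n)%nat -> i <> k -> x i <> x k) /\
  forall i, (i < n)%nat ->
    psum (fun k => if Nat.eqb k i then 0 else / (RtoC (x i) - RtoC (x k))) n
    = - (RtoC 8 / RtoC (x i) + RtoC 9 / (RtoC (x i) - 1)) / RtoC 12.
Proof.
intros Hb Hsys.
assert (H : E_system 8 9 (-12) n x).
{ destruct Hsys as [H | H]; [|exact H].
  pose proof (E_system_plus_small n x Hb H) as Hn; destruct H as [Hd [H01 Hs]].
  split; [exact Hd|]; split; [exact H01|]; intros i Hi; rewrite <- (Hs i Hi).
  assert (n = 1 /\ i = 0)%nat as [-> ->] by lia; reflexivity. }
destruct H as [Hd [H01 Hs]]; split; [exact Hd|]; intros i Hi.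
specialize (Hs i Hi); specialize (Hb i Hi).
pose proof (Rsum_psum (fun j => negb (Nat.eqb j i)) (fun j => (-12 / (x j - x i))%R) n) as E.
assert (E2 : RtoC (Rsum (filter (fun j => negb (Nat.eqb j i)) (seq 0 n)) (fun j => (-12 / (x j - x i))%R))
  = RtoC 12 * psum (fun k => if Nat.eqb k i then 0 else / (RtoC (x i) - RtoC (x k))) n).
{ rewrite E, <- psum_scal; apply psum_ext; intros k Hk.
  destruct (Nat.eqb_spec k i) as [Ek | Ek]; cbn [negb]; [ring|].
  pose proof (Hd k i Hk Hi Ek) as Hne; pose proof (Hd i k Hi Hk (not_eq_sym Ek)) as Hne'.
  replace (-12 / (x k - x i))%R with (12 * / (x i - x k))%R by (field; lra).
  rewrite RtoC_mult, RtoC_inv, RtoC_minus by lra; reflexivity. }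
set (Sg := psum (fun k => if Nat.eqb k i then 0 else / (RtoC (x i) - RtoC (x k))) n) in *.
assert (E3 : RtoC (8 / x i + 9 / (x i - 1)) + RtoC 12 * Sg = 0)
  by (rewrite <- E2, <- RtoC_plus, Hs; reflexivity).
rewrite RtoC_plus in E3; unfold Rdiv in E3; rewrite !RtoC_mult, !RtoC_inv, RtoC_minus in E3 by lra.
replace Sg with ((RtoC 8 * / RtoC (x i) + RtoC 9 * / (RtoC (x i) - RtoC 1) + RtoC 12 * Sg
  - (RtoC 8 * / RtoC (x i) + RtoC 9 * / (RtoC (x i) - RtoC 1))) / RtoC 12).
- rewrite E3; unfold Cdiv; ring.
- assert (H1 : RtoC (x i) <> 0) by (intros E0; apply RtoC_inj in E0; lra).
  assert (H2 : RtoC (x i) - 1 <> 0) by (apply Cminus_neq_0; intros E0; apply RtoC_inj in E0; lra).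
  field; auto.
Qed.

(** * Double poles *)

Lemma Cinv_neq_0 (a : C) : a <> 0 -> / a <> 0.
Proof.
intros Ha E; apply C1_nz; rewrite <- (Cinv_r a Ha), E; ring.
Qed.

Fixpoint hadamard (n : nat) (f : C -> C) (z : C) : Prop :=
  match n with
  | O => Ccont f z
  | S k => exists g, (forall u, f u = f z + (u - z) * g u) /\ hadamard k g z
  end.

Lemma quotient_derive (f g : C -> C) (z : C) :
  (forall u, f u = f z + (u - z) * g u) -> Ccont g z -> is_Cderive f z (g z).
Proof.
intros E H; apply is_Cderive_eps; intros eps He; destruct (H eps He) as [d [Hd Hg]].
exists d; split; [exact Hd|]; intros u Hu; rewrite (E u).
replace (f z + (u - z) * g u - f z - (u - z) * g z) with ((g u - g z) * (u - z)) by ring.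
rewrite Cmod_mult; apply Rmult_le_compat_r; [apply Cmod_ge_0 | apply Rlt_le, Hg, Hu].
Qed.

Lemma hadamard_le (n : nat) : forall f z, hadamard (S n) f z -> hadamard n f z.
Proof.
induction n as [|n IH]; intros f z [g [E Hg]].
- exact (is_Cderive_cont _ _ _ (quotient_derive f g z E Hg)).
- exists g; auto.
Qed.

Lemma hadamard_cont (n : nat) (f : C -> C) (z : C) : hadamard n f z -> Ccont f z.
Proof. induction n as [|n IH]; [auto | intros H; apply IH, hadamard_le, H]. Qed.

Lemma hadamard_scal (n : nat) (c : C) : forall f z, hadamard n f z -> hadamard n (fun u => c * f u) z.
Proof.
induction n as [|n IH]; intros f z.
- intros H; apply Ccont_mult; [|exact H]; exact (is_Cderive_cont _ _ _ (is_Cderive_const c z)).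
- intros [g [E Hg]]; exists (fun u => c * g u); split; [|auto]; intros u; rewrite (E u); ring.
Qed.

Lemma hadamard_plus (n : nat) : forall f g z, hadamard n f z -> hadamard n g z ->
  hadamard n (fun u => f u + g u) z.
Proof.
induction n as [|n IH]; intros f g z.
- apply Ccont_plus.
- intros [f1 [Ef Hf]] [g1 [Eg Hg]]; exists (fun u => f1 u + g1 u); split; [|auto].
  intros u; rewrite (Ef u), (Eg u); ring.
Qed.

Lemma hadamard_mult (n : nat) : forall f g z, hadamard n f z -> hadamard n g z ->
  hadamard n (fun u => f u * g u) z.
Proof.
induction n as [|n IH]; intros f g z.
- apply Ccont_mult.
- intros Hf Hg; pose proof (hadamard_le _ _ _ Hg) as Hg'.
  destruct Hf as [f1 [Ef Hf]], Hg as [g1 [Eg Hg]].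
  exists (fun u => f1 u * g u + f z * g1 u); split.
  + intros u; rewrite (Ef u).
    replace (f z * g z) with (f z * (g u - (u - z) * g1 u)) by (rewrite (Eg u); ring); ring.
  + apply hadamard_plus; [now apply IH | now apply hadamard_scal].
Qed.

Lemma peano_value (n : nat) (f : C -> C) (z : C) (c : nat -> C) : peano n f z c -> c O = f z.
Proof.
intros H; symmetry; apply NNPP; intros Hne.
assert (Hp : (0 < Cmod (f z - c O))%R) by (apply Cmod_gt_0, Cminus_neq_0, Hne).
destruct (H (Cmod (f z - c O) / 2)%R ltac:(lra)) as [d [Hd Hf]].
specialize (Hf z); rewrite psum_at_center in Hf.
replace (z - z) with (RtoC 0) in Hf by ring; rewrite Cmod_0 in Hf; specialize (Hf Hd).
assert (H01 : (0 <= 0 ^ n <= 1)%R) by (destruct n; simpl; lra).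
nra.
Qed.

Lemma peano_quotient (n : nat) (f : C -> C) (z : C) (c : nat -> C) : peano (S n) f z c ->
  exists g, (forall u, f u = f z + (u - z) * g u) /\ g z = c 1%nat /\ peano n g z (fun k => c (S k)).
Proof.
intros H; pose proof (peano_value _ _ _ _ H) as E0.
exists (fun u => if Ceq_dec u z then c 1%nat else (f u - f z) / (u - z)); split; [|split].
- intros u; destruct (Ceq_dec u z) as [-> | E]; [ring|]; apply Cminus_neq_0 in E; field; exact E.
- destruct (Ceq_dec z z); [reflexivity | congruence].
- intros eps He; destruct (H eps He) as [d [Hd Hf]]; exists d; split; [exact Hd|].
  intros u Hu; destruct (Ceq_dec u z) as [-> | E].
  + rewrite psum_at_center; replace (c 1%nat - c 1%nat) with (RtoC 0) by ring.
    rewrite Cmod_0; apply Rmult_le_pos; [lra | apply pow_le, Cmod_ge_0].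
  + apply Cminus_neq_0 in E; pose proof (proj1 (Cmod_gt_0 _) E) as Hp.
    apply Rmult_le_reg_r with (Cmod (u - z)); [exact Hp|].
    rewrite <- Cmod_mult, Rmult_assoc, (Rmult_comm (_ ^ n)); specialize (Hf u Hu).
    rewrite psum_shift, E0 in Hf.
    rewrite (psum_ext (fun k => c (S k) * (u - z) ^ S k)
      (fun k => (u - z) * (c (S k) * (u - z) ^ k))), psum_scal in Hf by (intros; simpl; ring).
    replace (((f u - f z) / (u - z) - psum (fun k => c (S k) * (u - z) ^ k) (S n)) * (u - z))
      with (f u - (f z * (u - z) ^ 0 + (u - z) * psum (fun k => c (S k) * (u - z) ^ k) (S n)));
      [exact Hf | simpl; field; exact E].
Qed.

Lemma peano_hadamard (n : nat) : forall f z c, peano n f z c -> hadamard n f z.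
Proof.
induction n as [|n IH]; intros f z c H.
- pose proof (peano_value _ _ _ _ H) as E0; intros eps He.
  destruct (H (eps / 2)%R ltac:(lra)) as [d [Hd Hf]]; exists d; split; [exact Hd|].
  intros u Hu; specialize (Hf u Hu); rewrite <- E0; simpl in Hf.
  replace (f u - (0 + c O * 1)) with (f u - c O) in Hf by ring; lra.
- destruct (peano_quotient n f z c H) as [g [E [_ Hg]]]; exists g; split; [exact E|].
  exact (IH _ _ _ Hg).
Qed.

Lemma holomorphic_quotient (f g : C -> C) (z : C) : holomorphic_at f z ->
  (forall u, f u = f z + (u - z) * g u) -> hadamard 1 g z -> holomorphic_at g z.
Proof.
intros [r [Hr Hf]] E [g1 [E1 H1]]; exists r; split; [exact Hr|]; intros u Hu.
destruct (Ceq_dec u z) as [-> | Hne].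
- exists (g1 z); now apply quotient_derive.
- destruct (Hf u Hu) as [l Hl]; pose proof (Cminus_neq_0 _ _ Hne) as Hs.
  assert (Hm : is_Cderive (fun v => f v - f z) u (l - 0))
    by (apply is_Cderive_minus; [exact Hl | apply is_Cderive_const]).
  assert (Hi : is_Cderive (fun v => v - z) u (1 - 0))
    by (apply is_Cderive_minus; [apply is_Cderive_id | apply is_Cderive_const]).
  eexists; eapply is_Cderive_ext_near; [|exact (is_Cderive_div _ _ u _ _ Hs Hm Hi)].
  apply (near_imp u (fun v => v <> z)); [|apply Ccont_neq; [apply Ccont_id | exact Hne]].
  intros v Hv; apply Cminus_neq_0 in Hv; rewrite (E v); field; exact Hv.
Qed.

Lemma holomorphic_smooth (U : C -> Prop) (f : C -> C) (z : C) :
  Copen U -> U z -> smooth U 1 f -> holomorphic_at f z.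
Proof.
intros HU Hz [df [Hd _]]; apply (near_imp z U); [|now apply HU].
intros u Hu; exists (df u); auto.
Qed.

Lemma holomorphic_mult (f g : C -> C) (z : C) : holomorphic_at f z -> holomorphic_at g z ->
  holomorphic_at (fun u => f u * g u) z.
Proof.
intros Hf Hg; eapply near_imp; [|exact (near_and _ _ _ Hf Hg)].
intros u [[a Ha] [b Hb]]; eexists; apply is_Cderive_mult; eassumption.
Qed.

Lemma holomorphic_inv (f : C -> C) (z : C) : f z <> 0 -> holomorphic_at f z ->
  holomorphic_at (fun u => / f u) z.
Proof.
intros Hz Hf.
assert (Hc : Ccont f z) by (destruct (near_self _ _ Hf) as [l Hl]; exact (is_Cderive_cont _ _ _ Hl)).
eapply near_imp; [|exact (near_and _ _ _ Hf (Ccont_neq f z 0 Hc Hz))].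
intros u [[a Ha] Hu]; eexists; apply is_Cderive_inv; eassumption.
Qed.

(* Near z, D = s Y with s = u - z, and the Laurent expansion of N / D^2 starts
   with A / s^2, A = N z / Y z ^ 2; the condition on second derivatives says
   that N - A Y^2 vanishes to order 2. *)
Lemma double_pole (U : C -> Prop) (N D N1 D1 D2 : C -> C) (z : C) :
  Copen U -> U z -> (forall n, smooth U n N) -> (forall n, smooth U n D) ->
  (forall u, U u -> is_Cderive N u (N1 u)) ->
  (forall u, U u -> is_Cderive D u (D1 u)) ->
  (forall u, U u -> is_Cderive D1 u (D2 u)) -> (forall n, smooth U n D2) ->
  N z <> 0 -> D z = 0 -> D1 z <> 0 -> N z * D2 z = N1 z * D1 z ->
  pole_of_order 2 (fun u => N u / D u ^ 2) z /\ is_residue (fun u => N u / D u ^ 2) z 0.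
Proof.
intros HU Hz SN SD HN HD HD1 SD2 Nz Dz D1z Hres.
destruct (smooth_peano U HU 2 D2 z Hz (SD2 2%nat)) as [c Hc].
pose proof (peano_antider 2 D1 D2 z c (near_imp z U _ HD1 (HU z Hz)) Hc) as Hp1.
pose proof (peano_antider 3 D D1 z _ (near_imp z U _ HD (HU z Hz)) Hp1) as Hp.
pose proof (peano_value _ _ _ _ Hc) as Ec.
destruct (peano_quotient 3 _ _ _ Hp) as [Y [EY [Yz HpY]]].
destruct (peano_quotient 2 _ _ _ HpY) as [Y1 [EY1 [Y1z HpY1]]].
assert (EYz : Y z = D1 z) by (rewrite Yz; simpl; field).
assert (EY1z : Y1 z = D2 z / 2)
  by (rewrite Y1z, <- Ec; simpl; replace (1 + 1)%R with 2%R by ring; field).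
assert (HhY : hadamard 3 Y z) by exact (peano_hadamard _ _ _ _ HpY).
assert (HY : holomorphic_at Y z).
{ apply (holomorphic_quotient D Y z); [apply (holomorphic_smooth U); auto | exact EY|].
  do 2 apply hadamard_le; exact HhY. }
assert (HNh : holomorphic_at N z) by (apply (holomorphic_smooth U); auto).
assert (Yz0 : Y z <> 0) by (rewrite EYz; exact D1z).
assert (HYc : Ccont Y z) by exact (hadamard_cont _ _ _ HhY).
assert (Hoff : near z (fun u => u <> z -> N u / D u ^ 2 = (N u * / (Y u * Y u)) / (u - z) ^ 2)).
{ apply (near_imp z (fun u => Y u <> 0)); [|now apply Ccont_neq].
  intros u Hu Hne; apply Cminus_neq_0 in Hne; rewrite (EY u), Dz; field; auto. }
assert (HG : holomorphic_at (fun u => N u * / (Y u * Y u)) z).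
{ apply holomorphic_mult; [exact HNh|]; apply (holomorphic_inv (fun u => Y u * Y u)).
  - now apply Cmult_neq_0.
  - now apply holomorphic_mult. }
split.
- split; [lia|]; exists (fun u => N u * / (Y u * Y u)); split; [exact HG|]; split; [|exact Hoff].
  apply Cmult_neq_0; [exact Nz|]; now apply Cinv_neq_0, Cmult_neq_0.
- set (A := N z / (Y z * Y z)).
  set (M := fun u => N u + (- A) * (Y u * Y u)).
  assert (HhN : hadamard 3 N z).
  { destruct (smooth_peano U HU 3 N z Hz (SN 3%nat)) as [cn Hcn]; exact (peano_hadamard _ _ _ _ Hcn). }
  assert (HhM : hadamard 3 M z)
    by (apply hadamard_plus; [exact HhN | apply hadamard_scal, hadamard_mult; exact HhY]).
  assert (HMh : holomorphic_at M z).
  { eapply near_imp; [|exact (near_and _ _ _ HNh HY)]; intros u [[a Ha] [b Hb]]; eexists.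
    apply is_Cderive_plus; [exact Ha | apply is_Cderive_scal, is_Cderive_mult; exact Hb]. }
  assert (Mz : M z = 0) by (unfold M, A; field; exact Yz0).
  destruct HhM as [M1 [EM HhM1]].
  assert (M1z : M1 z = 0).
  { pose proof (quotient_derive M M1 z EM (hadamard_cont _ _ _ HhM1)) as H1.
    assert (HYd : is_Cderive Y z (Y1 z))
      by (apply quotient_derive; [exact EY1 | exact (hadamard_cont 2 _ _ (peano_hadamard _ _ _ _ HpY1))]).
    assert (H2 : is_Cderive M z (N1 z + (- A) * (Y1 z * Y z + Y z * Y1 z))).
    { apply is_Cderive_plus; [now apply HN|]; apply is_Cderive_scal; now apply is_Cderive_mult. }
    rewrite (is_Cderive_unique _ _ _ _ H1 H2), EY1z; unfold A; rewrite EYz.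
    replace (N1 z) with (N1 z * D1 z / D1 z) by (field; exact D1z); rewrite <- Hres; field; exact D1z. }
  pose proof (holomorphic_quotient M M1 z HMh EM (hadamard_le _ _ _ HhM1)) as HM1h.
  destruct HhM1 as [M2 [EM1 HhM2]].
  pose proof (holomorphic_quotient M1 M2 z HM1h EM1 HhM2) as HM2h.
  exists 1%nat, (fun k => if Nat.eqb k 2 then A else 0), (fun u => M2 u * / (Y u * Y u)).
  split; [|split; [|reflexivity]].
  + apply holomorphic_mult; [exact HM2h|]; apply (holomorphic_inv (fun u => Y u * Y u)).
    * now apply Cmult_neq_0.
    * now apply holomorphic_mult.
  + apply (near_imp z (fun u => (u <> z -> N u / D u ^ 2 = (N u * / (Y u * Y u)) / (u - z) ^ 2)
        /\ Y u <> 0)); [|apply near_and; [exact Hoff | now apply Ccont_neq]].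
    intros u [Hu HYu] Hne; rewrite (Hu Hne); apply Cminus_neq_0 in Hne.
    assert (EN : N u = (u - z) * ((u - z) * M2 u) + A * (Y u * Y u)).
    { replace (N u) with (M u + A * (Y u * Y u)) by (unfold M; ring).
      rewrite (EM u), (EM1 u), Mz, M1z; ring. }
    rewrite EN; unfold Csum; simpl; field; auto.
Qed.

(** * The form f_n as a quotient N / D^2 *)

Section Form.
Context (n : nat) (x : nat -> R).
Hypothesis x_bounds : forall i, (i < n)%nat -> (0 < x i < 1)%R.
Hypothesis x_sol : E_8_9_12 n x.

Let X (i : nat) : C := RtoC (x i).

Definition Jprod (m : nat) (t : C) : C := Cprod (seq 0 m) (fun i => J t - RtoC (x i)).
Definition Dform (t : C) : C := E4 t * E6 t * Jprod n t.
Definition Nform (t : C) : C := RtoC 1728 * eta t ^ 44.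
Definition nu_form (t : C) : C := twopii * RtoC (11 / 6) * E2 t.

Lemma Cprod_seq_S (F : nat -> C) (m : nat) : Cprod (seq 0 (S m)) F = Cprod (seq 0 m) F * F m.
Proof.
unfold Cprod; rewrite seq_S, map_app, fold_right_app; simpl.
induction (map F (seq 0 m)) as [|a l IH]; simpl; [ring | rewrite IH; ring].
Qed.

Lemma Cprod_pow (F : nat -> C) (k m : nat) :
  Cprod (seq 0 m) (fun i => F i ^ k) = Cprod (seq 0 m) F ^ k.
Proof.
induction m as [|m IH]; [unfold Cprod; simpl; now rewrite Cpow_1_l|].
rewrite !Cprod_seq_S, IH, Cpow_mult_l; reflexivity.
Qed.

Lemma Jprod_S (m : nat) (t : C) : Jprod (S m) t = Jprod m t * (J t - X m).
Proof. exact (Cprod_seq_S (fun i => J t - RtoC (x i)) m). Qed.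

Lemma Jprod_zero (m : nat) (t : C) : Jprod m t = 0 <-> exists i, (i < m)%nat /\ J t = X i.
Proof.
induction m as [|m IH].
- split; [intros E; exfalso; exact (C1_nz E) | intros [i [Hi _]]; lia].
- rewrite Jprod_S; split.
  + intros E; destruct (Cmult_integral _ _ E) as [E' | E'].
    * destruct (proj1 IH E') as [i [Hi Ei]]; exists i; split; [lia | exact Ei].
    * exists m; split; [lia|]; replace (J t) with (J t - X m + X m) by ring; rewrite E'; ring.
  + intros [i [Hi Ei]]; destruct (Nat.eq_dec i m) as [-> | Hne]; [rewrite Ei; ring|].
    rewrite (proj2 IH); [ring|]; exists i; split; [lia | exact Ei].
Qed.

Lemma smooth_Jprod (m k : nat) : smooth upper k (Jprod m).
Proof.
induction m as [|m IH]; [apply (smooth_const upper Copen_upper k 1)|].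
apply (smooth_ext upper Copen_upper k (fun t => Jprod m t * (J t - X m))).
- intros u _; symmetry; apply Jprod_S.
- apply (smooth_mult upper Copen_upper); [exact IH|].
  apply (smooth_minus upper Copen_upper); [apply smooth_J | apply (smooth_const upper Copen_upper)].
Qed.

Lemma smooth_Dform (k : nat) : smooth upper k Dform.
Proof.
apply (smooth_mult upper Copen_upper); [|apply smooth_Jprod].
apply (smooth_mult upper Copen_upper); [apply smooth_E4 | apply smooth_E6].
Qed.

Lemma smooth_Nform (k : nat) : smooth upper k Nform.
Proof. apply (smooth_scal upper Copen_upper), (smooth_pow upper Copen_upper), smooth_eta. Qed.

Lemma Nform_neq_0 (t : C) : upper t -> Nform t <> 0.
Proof. intros Ht; apply Cmult_neq_0; [exact C1728_neq_0 | now apply Cpow_nz, eta_neq_0]. Qed.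

Lemma is_Cderive_Nform (t : C) : upper t -> is_Cderive Nform t (nu_form t * Nform t).
Proof.
intros Ht.
pose proof (is_Cderive_scal (RtoC 1728) _ t _ (is_Cderive_pow eta t _ 44 (is_Cderive_eta t Ht))) as H.
cbv beta in H; simpl pred in H.
replace (INR 44) with 44%R in H by (simpl; ring).
unfold nu_form, Nform.
match type of H with is_Cderive _ _ ?d =>
  replace (twopii * RtoC (11 / 6) * E2 t * (RtoC 1728 * eta t ^ 44)) with d; [exact H|] end.
replace (eta t ^ 44) with (eta t * eta t ^ 43) by reflexivity.
unfold Rdiv; rewrite RtoC_mult, RtoC_inv by lra; field.
Qed.

Lemma f_form_quotient (t : C) : upper t -> f_form n x t = Nform t / Dform t ^ 2.
Proof.
intros Ht; unfold f_form; rewrite Cprod_pow; fold (Jprod n t).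
rewrite J_minus_1 by exact Ht; unfold Dform, Nform, Delta.
pose proof (eta_neq_0 t Ht) as He.
destruct (classic (E4 t * E6 t * Jprod n t = 0)) as [E | E].
- rewrite E; unfold Cdiv.
  replace (E4 t ^ 2 * (E6 t ^ 2 * / (RtoC 1728 * eta t ^ 24)) * Jprod n t ^ 2)
    with ((E4 t * E6 t * Jprod n t) ^ 2 * / (RtoC 1728 * eta t ^ 24)) by ring.
  rewrite E; replace (0 ^ 2 * / (RtoC 1728 * eta t ^ 24)) with (RtoC 0) by ring.
  replace (0 ^ 2) with (RtoC 0) by ring; rewrite Cinv_0; ring.
- pose proof (Cmult_neq_0_r _ _ E) as HP; pose proof (Cmult_neq_0_l _ _ E) as H46.
  pose proof (Cmult_neq_0_l _ _ H46) as H4; pose proof (Cmult_neq_0_r _ _ H46) as H6.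
  pose proof C1728_neq_0; field; auto.
Qed.

Lemma f_form_neq_0 (t : C) : upper t -> Dform t <> 0 -> f_form n x t <> 0.
Proof.
intros Ht HD; rewrite f_form_quotient by exact Ht; unfold Cdiv.
apply Cmult_neq_0; [now apply Nform_neq_0 | now apply Cinv_neq_0, Cpow_nz].
Qed.

Lemma Dform_off (t : C) : upper t -> Dform t <> 0 -> near t (fun u => upper u /\ Dform u <> 0).
Proof.
intros Ht HD; apply near_and; [now apply Copen_upper|].
apply Ccont_neq; [exact (smooth_Dform 0 t Ht) | exact HD].
Qed.

Lemma x_distinct (i k : nat) : (i < n)%nat -> (k < n)%nat -> i <> k -> X i <> X k.
Proof.
intros Hi Hk Hik E; apply RtoC_inj in E; revert E.
exact (proj1 (E_8_9_12_residues n x x_bounds x_sol) i k Hi Hk Hik).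
Qed.

Lemma X_neq_0 (i : nat) : (i < n)%nat -> X i <> 0.
Proof. intros Hi E; apply RtoC_inj in E; pose proof (x_bounds i Hi); lra. Qed.

Lemma X_neq_1 (i : nat) : (i < n)%nat -> X i <> 1.
Proof. intros Hi E; apply RtoC_inj in E; pose proof (x_bounds i Hi); lra. Qed.

Lemma J_zero_E4 (t : C) : E4 t = 0 -> J t = 0.
Proof. intros E; unfold J; rewrite E; unfold Cdiv; ring. Qed.

Lemma J_one_E6 (t : C) : upper t -> E6 t = 0 -> J t = 1.
Proof.
intros Ht E; replace (J t) with (J t - 1 + 1) by ring.
rewrite J_minus_1, E by exact Ht; unfold Cdiv; ring.
Qed.

Lemma Jprod_simple_zero (m : nat) (t : C) : (m <= n)%nat -> upper t ->
  exists p, is_Cderive (Jprod m) t p /\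
    (Jprod m t = 0 -> E4 t <> 0 -> E6 t <> 0 -> p <> 0).
Proof.
intros Hm Ht; set (j1 := - twopii * E4 t ^ 2 * E6 t / (RtoC 1728 * Delta t)).
induction m as [|m IH].
- exists 0; split; [exact (is_Cderive_const 1 t) | intros E; exfalso; exact (C1_nz E)].
- destruct IH as [p [Hp Hz]]; [lia|].
  assert (HJ : is_Cderive (fun u => J u - X m) t (j1 - 0))
    by (apply is_Cderive_minus; [now apply is_Cderive_J | apply is_Cderive_const]).
  exists (p * (J t - X m) + Jprod m t * (j1 - 0)); split.
  + apply (is_Cderive_ext (fun u => Jprod m u * (J u - X m))); [intros; symmetry; apply Jprod_S|].
    exact (is_Cderive_mult _ _ t _ _ Hp HJ).
  + rewrite Jprod_S; intros E H4 H6.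
    destruct (classic (Jprod m t = 0)) as [E0 | E0].
    * rewrite E0, Cmult_0_l, Cplus_0_r; apply Cmult_neq_0; [now apply Hz|].
      destruct (proj1 (Jprod_zero m t) E0) as [i [Hi Ei]]; rewrite Ei.
      apply Cminus_neq_0, x_distinct; lia.
    * destruct (Cmult_integral _ _ E) as [E1 | E1]; [contradiction|].
      rewrite E1; replace (p * 0 + Jprod m t * (j1 - 0)) with (Jprod m t * j1) by ring.
      apply Cmult_neq_0; [exact E0|]; unfold j1, Cdiv.
      pose proof (Cmult_neq_0 _ _ C1728_neq_0 (Delta_neq_0 t Ht)).
      apply Cmult_neq_0; [|now apply Cinv_neq_0].
      apply Cmult_neq_0; [|exact H6]; apply Cmult_neq_0; [|now apply Cpow_nz].
      intros E2; apply twopii_neq_0; replace twopii with (- - twopii) by ring; rewrite E2; ring.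
Qed.

Lemma Dform_derive (t p : C) : upper t -> is_Cderive (Jprod n) t p ->
  is_Cderive Dform t ((twopii * dE4 t * E6 t + E4 t * (twopii * dE6 t)) * Jprod n t
    + E4 t * E6 t * p).
Proof.
intros Ht Hp.
exact (is_Cderive_mult _ _ t _ _
  (is_Cderive_mult _ _ t _ _ (is_Cderive_E4 t Ht) (is_Cderive_E6 t Ht)) Hp).
Qed.

Lemma Dform_simple_zero (t l : C) : upper t -> is_Cderive Dform t l -> Dform t = 0 -> l <> 0.
Proof.
intros Ht Hl E.
destruct (Jprod_simple_zero n t (le_n n) Ht) as [p [Hp Hz]].
rewrite (is_Cderive_unique _ _ _ _ Hl (Dform_derive t p Ht Hp)).
pose proof (ramanujan_E4 t) as R4; pose proof (ramanujan_E6 t Ht) as R6.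
assert (HJ0 : forall i, (i < n)%nat -> J t = X i -> E4 t <> 0 /\ E6 t <> 0).
{ intros i Hi EJ; split; intros E'.
  - apply (X_neq_0 i Hi); rewrite <- EJ; now apply J_zero_E4.
  - apply (X_neq_1 i Hi); rewrite <- EJ; now apply J_one_E6. }
destruct (classic (Jprod n t = 0)) as [EP | EP].
- rewrite EP; destruct (proj1 (Jprod_zero n t) EP) as [i [Hi EJ]].
  destruct (HJ0 i Hi EJ) as [H4 H6].
  rewrite Cmult_0_r, Cplus_0_l; auto using Cmult_neq_0.
- destruct (Cmult_integral _ _ E) as [E46 | E0]; [|contradiction].
  destruct (Cmult_integral _ _ E46) as [E4z | E6z].
  + pose proof (E4_E6_no_common_zero t Ht E4z) as H6.
    assert (Hd : dE4 t <> 0).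
    { intros Ed; apply H6; replace (E6 t) with (E2 t * E4 t - RtoC 3 * dE4 t) by (rewrite R4; ring).
      rewrite Ed, E4z; ring. }
    rewrite E4z; replace ((twopii * dE4 t * E6 t + 0 * (twopii * dE6 t)) * Jprod n t + 0 * E6 t * p)
      with (twopii * dE4 t * E6 t * Jprod n t) by ring.
    exact (Cmult_neq_0 _ _ (Cmult_neq_0 _ _ (Cmult_neq_0 _ _ twopii_neq_0 Hd) H6) EP).
  + assert (H4 : E4 t <> 0) by (intros E'; exact (E4_E6_no_common_zero t Ht E' E6z)).
    assert (Hd : dE6 t <> 0).
    { intros Ed; apply (Cpow_nz _ 2 H4).
      replace (E4 t ^ 2) with (E2 t * E6 t - 2 * dE6 t) by (rewrite R6; ring).
      rewrite Ed, E6z; ring. }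
    rewrite E6z; replace ((twopii * dE4 t * 0 + E4 t * (twopii * dE6 t)) * Jprod n t + E4 t * 0 * p)
      with (E4 t * twopii * dE6 t * Jprod n t) by ring.
    exact (Cmult_neq_0 _ _ (Cmult_neq_0 _ _ (Cmult_neq_0 _ _ H4 twopii_neq_0) Hd) EP).
Qed.

Lemma Dform_zero_pole_locus (w : nat -> C) (t : C) :
  (forall i, (i < n)%nat -> upper (w i)) -> (forall i, (i < n)%nat -> J (w i) = RtoC (x i)) ->
  upper t -> (Dform t = 0 <-> pole_locus n w t).
Proof.
intros Hw HJ Ht; split.
- intros E; destruct (Cmult_integral _ _ E) as [E46 | EP];
    [destruct (Cmult_integral _ _ E46) as [E' | E']|].
  + right; left; apply (J_injective_real t rho 0); auto using upper_rho, J_zero_E4, E4_rho.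
  + left; apply (J_injective_real t Ci 1); auto using upper_Ci, J_one_E6, E6_Ci.
  + right; right; destruct (proj1 (Jprod_zero n t) EP) as [i [Hi EJ]]; exists i; split; [exact Hi|].
    apply (J_injective_real t (w i) (x i)); auto.
- unfold Dform; intros [[g ->] | [[g ->] | [i [Hi [g ->]]]]].
  + rewrite (E6_act g Ci upper_Ci), E6_Ci; ring.
  + rewrite (E4_act g rho upper_rho), E4_rho; ring.
  + rewrite (proj2 (Jprod_zero n (act g (w i)))); [ring|].
    exists i; split; [exact Hi|]; rewrite J_act by auto; auto.
Qed.

End Form.

(** * The Schwarzian derivative *)

Section Schwarzian.
Context (n : nat) (x : nat -> R).
Hypothesis x_bounds : forall i, (i < n)%nat -> (0 < x i < 1)%R.
Hypothesis x_sol : E_8_9_12 n x.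

Let X (i : nat) : C := RtoC (x i).

Definition gsum (j : C) : C :=
  2 / RtoC 3 + j / (j - 1) + 2 * psum (fun i => j / (j - RtoC (x i))) n.
Definition dgsum (j : C) : C :=
  - / (j - 1) ^ 2 - 2 * psum (fun i => RtoC (x i) / (j - RtoC (x i)) ^ 2) n.
Definition phi_form (t : C) : C := E2 t / RtoC 6 + E6 t / E4 t * gsum (J t).
Definition Phi_form (t : C) : C := twopii * phi_form t.

Lemma is_Cderive_psum (F dF : nat -> C -> C) (m : nat) (z : C) :
  (forall i, (i < m)%nat -> is_Cderive (F i) z (dF i z)) ->
  is_Cderive (fun u => psum (fun i => F i u) m) z (psum (fun i => dF i z) m).
Proof.
induction m as [|m IH]; intros H; [exact (is_Cderive_const 0 z)|].
apply (is_Cderive_plus (fun u => psum (fun i => F i u) m) (F m)); [apply IH; auto | apply H; lia].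
Qed.

Lemma is_Cderive_moebius (a j : C) : j <> a -> is_Cderive (fun u => u / (u - a)) j (- a / (j - a) ^ 2).
Proof.
intros Hj; apply Cminus_neq_0 in Hj.
pose proof (is_Cderive_div _ _ j _ _ Hj (is_Cderive_id j)
  (is_Cderive_minus _ _ j _ _ (is_Cderive_id j) (is_Cderive_const a j))) as H.
cbv beta in H; match type of H with is_Cderive _ _ ?d => replace (- a / (j - a) ^ 2) with d; [exact H|] end.
field; exact Hj.
Qed.

Lemma is_Cderive_gsum (j : C) : j <> 1 -> (forall i, (i < n)%nat -> j <> X i) ->
  is_Cderive gsum j (dgsum j).
Proof.
intros H1 HX.
pose proof (is_Cderive_psum (fun i u => u / (u - X i)) (fun i u => - X i / (u - X i) ^ 2) n j
  (fun i Hi => is_Cderive_moebius (X i) j (HX i Hi))) as H2.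
pose proof (is_Cderive_plus _ _ j _ _
  (is_Cderive_plus _ _ j _ _ (is_Cderive_const (2 / RtoC 3) j) (is_Cderive_moebius 1 j H1))
  (is_Cderive_scal 2 _ j _ H2)) as H.
cbv beta in H; unfold dgsum.
match type of H with is_Cderive _ _ ?d => match goal with |- is_Cderive _ _ ?e =>
  replace e with d; [exact H|] end end.
rewrite (psum_ext (fun i => - X i / (j - X i) ^ 2) (fun i => - (1) * (RtoC (x i) / (j - RtoC (x i)) ^ 2)))
  by (intros; unfold X, Cdiv; ring).
rewrite psum_scal; unfold Cdiv; ring.
Qed.

Lemma Dform_neq_0_factors (t : C) : upper t -> Dform n x t <> 0 ->
  E4 t <> 0 /\ E6 t <> 0 /\ J t <> 1 /\ (forall i, (i < n)%nat -> J t <> X i).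
Proof.
intros Ht HD.
pose proof (Cmult_neq_0_r _ _ HD) as HP; pose proof (Cmult_neq_0_l _ _ HD) as H46.
pose proof (Cmult_neq_0_l _ _ H46) as H4; pose proof (Cmult_neq_0_r _ _ H46) as H6.
split; [exact H4|]; split; [exact H6|]; split.
- intros E; assert (E0 : J t - 1 = 0) by (rewrite E; ring).
  rewrite J_minus_1 in E0 by exact Ht; revert E0; unfold Cdiv; apply Cmult_neq_0.
  + now apply Cpow_nz.
  + apply Cinv_neq_0, Cmult_neq_0; [exact C1728_neq_0 | now apply Delta_neq_0].
- intros i Hi E; apply HP; refine (proj2 (Jprod_zero x n t) (ex_intro _ i (conj Hi E))).
Qed.

Lemma J_ratio (t : C) : upper t -> E4 t <> 0 -> E6 t <> 0 -> J t <> 1 ->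
  E4 t = (E6 t / E4 t) ^ 2 * (J t / (J t - 1)).
Proof.
intros Ht H4 H6 HJ; rewrite J_minus_1 by exact Ht; unfold J.
pose proof C1728_neq_0; pose proof (Delta_neq_0 t Ht); field; auto.
Qed.

Lemma dJ_ratio (t : C) : upper t -> E4 t <> 0 ->
  - twopii * E4 t ^ 2 * E6 t / (RtoC 1728 * Delta t) = - twopii * J t * (E6 t / E4 t).
Proof.
intros Ht H4; unfold J; pose proof C1728_neq_0; pose proof (Delta_neq_0 t Ht); field; auto.
Qed.

Lemma Jprod_log_derive (m : nat) (t : C) : upper t -> (forall i, (i < m)%nat -> J t <> X i) ->
  is_Cderive (Jprod x m) t (- twopii * E4 t ^ 2 * E6 t / (RtoC 1728 * Delta t)
     * Jprod x m t * psum (fun i => / (J t - X i)) m).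
Proof.
intros Ht; set (j1 := - twopii * E4 t ^ 2 * E6 t / (RtoC 1728 * Delta t)).
induction m as [|m IH]; intros HX.
- replace (j1 * _ * _) with (RtoC 0) by (simpl; ring); exact (is_Cderive_const 1 t).
- assert (HJ : is_Cderive (fun u => J u - X m) t (j1 - 0))
    by (apply is_Cderive_minus; [now apply is_Cderive_J | apply is_Cderive_const]).
  apply (is_Cderive_ext (fun u => Jprod x m u * (J u - X m))); [intros; symmetry; apply Jprod_S|].
  pose proof (is_Cderive_mult _ _ t _ _ (IH ltac:(auto)) HJ) as H; cbv beta in H.
  match type of H with is_Cderive _ _ ?d => match goal with |- is_Cderive _ _ ?e =>
    replace e with d; [exact H|] end end.
  rewrite Jprod_S, psum_S; fold (X m); pose proof (Cminus_neq_0 _ _ (HX m ltac:(lia))); field; auto.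
Qed.

Lemma log_derivative (t d : C) : upper t -> Dform n x t <> 0 -> is_Cderive (Dform n x) t d ->
  nu_form t - 2 * d / Dform n x t = Phi_form t.
Proof.
intros Ht HD Hd.
destruct (Dform_neq_0_factors t Ht HD) as [H4 [H6 [HJ1 HX]]].
pose proof (Cmult_neq_0_r _ _ HD) as HP.
rewrite (is_Cderive_unique _ _ _ _ Hd
  (Dform_derive n x t _ Ht (Jprod_log_derive n t Ht HX))).
rewrite dJ_ratio by assumption; unfold Dform, nu_form, Phi_form, phi_form, gsum.
pose proof (ramanujan_E4 t) as R4; pose proof (ramanujan_E6 t Ht) as R6.
replace (dE4 t) with ((E2 t * E4 t - E6 t) / RtoC 3) by (rewrite <- R4; field).
replace (dE6 t) with ((E2 t * E6 t - E4 t ^ 2) / 2) by (rewrite <- R6; field).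
rewrite (psum_ext (fun i => J t / (J t - RtoC (x i))) (fun i => J t * / (J t - X i))), psum_scal
  by reflexivity.
pose proof (J_ratio t Ht H4 H6 HJ1) as EJ.
set (S := psum (fun i => / (J t - X i)) n); set (P := Jprod x n t) in *; set (u := J t / (J t - 1)) in *.
assert (Eu : u = E4 t ^ 3 / E6 t ^ 2).
{ transitivity (E4 t * (E4 t / E6 t) ^ 2); [rewrite EJ at 1 | idtac]; field; auto. }
rewrite Eu.
unfold Rdiv; rewrite RtoC_mult, RtoC_inv by lra; field; auto.
Qed.

Lemma is_Cderive_Phi (t : C) : upper t -> Dform n x t <> 0 ->
  is_Cderive Phi_form t (Phi_form t ^ 2 / 2
    - twopii ^ 2 * ((RtoC 12 * RN n + RtoC 11) ^ 2 / RtoC 72 * E4 t)).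
Proof.
intros Ht HD.
destruct (Dform_neq_0_factors t Ht HD) as [H4 [H6 [HJ1 HX]]].
pose proof (is_Cderive_comp gsum J t _ _ (is_Cderive_gsum _ HJ1 HX) (is_Cderive_J t Ht)) as Hg.
rewrite dJ_ratio in Hg by assumption.
assert (C6 : RtoC 6 <> 0) by (intros E; apply RtoC_inj in E; lra).
pose proof (is_Cderive_scal twopii _ t _ (is_Cderive_plus _ _ t _ _
  (is_Cderive_div E2 (fun _ => RtoC 6) t _ _ C6
     (is_Cderive_E2 t Ht) (is_Cderive_const (RtoC 6) t))
  (is_Cderive_mult _ _ t _ _
    (is_Cderive_div _ _ t _ _ H4 (is_Cderive_E6 t Ht) (is_Cderive_E4 t Ht)) Hg))) as H.
cbv beta in H.
match type of H with is_Cderive _ _ ?d => match goal with |- is_Cderive _ _ ?e =>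
  replace e with d; [exact H|] end end.
clear H Hg; unfold Phi_form, phi_form.
pose proof (ramanujan_E2 t Ht) as R2; pose proof (ramanujan_E4 t) as R4.
pose proof (ramanujan_E6 t Ht) as R6.
pose proof (J_ratio t Ht H4 H6 HJ1) as EJ.
destruct (E_8_9_12_residues n x x_bounds x_sol) as [_ Hsys].
assert (ID : J t / (J t - 1) * (- (1 / RtoC 72) - gsum (J t) / 2
    + (RtoC 12 * RN n + RtoC 11) ^ 2 / RtoC 72)
  + gsum (J t) / RtoC 3 - J t * dgsum (J t) - gsum (J t) ^ 2 / 2 = 0)
  by exact (stieltjes_identity n X (J t) (x_distinct n x x_bounds x_sol)
    (X_neq_0 n x x_bounds) (X_neq_1 n x x_bounds) Hsys HX HJ1).
replace (dE2 t) with ((E2 t ^ 2 - E4 t) / RtoC 12) by (rewrite <- R2; field).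
replace (dE4 t) with ((E2 t * E4 t - E6 t) / RtoC 3) by (rewrite <- R4; field).
replace (dE6 t) with ((E2 t * E6 t - E4 t ^ 2) / 2) by (rewrite <- R6; field).
set (g := gsum (J t)) in *; set (dg := dgsum (J t)) in *; set (u := J t / (J t - 1)) in *.
set (y := E6 t / E4 t) in *.
set (K := (RtoC 12 * RN n + RtoC 11) ^ 2 / RtoC 72) in *.
transitivity (twopii ^ 2 * ((E2 t / RtoC 6 + y * g) ^ 2 / 2 - K * E4 t
  + (E4 t * (- (1 / RtoC 72) - g / 2 + K) + y ^ 2 * (g / RtoC 3 - J t * dg - g ^ 2 / 2)))).
- unfold y; field; auto.
- replace (E4 t * (- (1 / RtoC 72) - g / 2 + K)) with (y ^ 2 * (u * (- (1 / RtoC 72) - g / 2 + K)))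
    by (rewrite EJ; ring).
  replace (y ^ 2 * (u * (- (1 / RtoC 72) - g / 2 + K)) + y ^ 2 * (g / RtoC 3 - J t * dg - g ^ 2 / 2))
    with (y ^ 2 * (u * (- (1 / RtoC 72) - g / 2 + K) + g / RtoC 3 - J t * dg - g ^ 2 / 2)) by ring.
  rewrite ID; field.
Qed.

Lemma is_Cderive_f_form (t : C) : upper t -> Dform n x t <> 0 ->
  is_Cderive (f_form n x) t (f_form n x t * Phi_form t).
Proof.
intros Ht HD; destruct (smooth_Dform n x 1) as [D1 [HD1 _]].
rewrite <- (log_derivative t (D1 t) Ht HD (HD1 t Ht)).
apply (is_Cderive_ext_near (fun u => Nform u / Dform n x u ^ 2)).
- apply (near_imp t upper); [intros u Hu; symmetry; now apply f_form_quotient | now apply Copen_upper].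
- pose proof (is_Cderive_div _ _ t _ _ (Cpow_nz _ 2 HD) (is_Cderive_Nform t Ht)
    (is_Cderive_pow _ t _ 2 (HD1 t Ht))) as H; cbv beta in H.
  match type of H with is_Cderive _ _ ?d => match goal with |- is_Cderive _ _ ?e =>
    replace e with d; [exact H|] end end.
  rewrite f_form_quotient by exact Ht; simpl pred; replace (INR 2) with 2%R by (simpl; ring).
  field; exact HD.
Qed.

Lemma f_form_holomorphic (t : C) : upper t -> Dform n x t <> 0 -> holomorphic_at (f_form n x) t.
Proof.
intros Ht HD; apply (near_imp t (fun u => upper u /\ Dform n x u <> 0)); [|now apply Dform_off].
intros u [Hu HDu]; eexists; now apply is_Cderive_f_form.
Qed.

Lemma schwarzian_primitive (h : C -> C) (t : C) : is_primitive_on_H (f_form n x) h ->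
  upper t -> Dform n x t <> 0 ->
  is_schwarzian h t (RtoC (2 * PI ^ 2 * ((12 * INR n + 11) ^ 2 / 6 ^ 2)) * E4 t).
Proof.
intros [_ Hh] Ht HD; pose proof (Dform_off n x t Ht HD) as Hoff.
pose proof (f_form_neq_0 n x t Ht HD) as Hf.
exists (f_form n x), (fun u => f_form n x u * Phi_form u),
  (Phi_form t ^ 2 / 2 - twopii ^ 2 * ((RtoC 12 * RN n + RtoC 11) ^ 2 / RtoC 72 * E4 t)).
split; [|split; [|split; [exact Hf | split]]].
- apply (near_imp t _ _ (fun u H => Hh u (proj1 H) (f_form_holomorphic u (proj1 H) (proj2 H))) Hoff).
- exact (near_imp t _ _ (fun u H => is_Cderive_f_form u (proj1 H) (proj2 H)) Hoff).
- apply (is_Cderive_ext_near Phi_form); [|now apply is_Cderive_Phi].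
  apply (near_imp t _ _) with (2 := Hoff); intros u [Hu HDu].
  pose proof (f_form_neq_0 n x u Hu HDu); field; auto.
- assert (Ew : twopii ^ 2 = - RtoC (4 * PI ^ 2)).
  { unfold twopii, Cpow, Cmult, Copp, RtoC, Ci; simpl; f_equal; ring. }
  rewrite Ew; unfold RN.
  replace (2 * PI ^ 2 * ((12 * INR n + 11) ^ 2 / 6 ^ 2))%R
    with (4 * PI ^ 2 * ((12 * INR n + 11) ^ 2 * / 72))%R by field.
  rewrite RtoC_mult, (RtoC_mult (_ ^ 2)), RtoC_inv, (RtoC_pow (12 * INR n + 11)), RtoC_plus,
    !RtoC_mult by lra.
  unfold Cdiv; field; auto.
Qed.

Lemma f_form_double_pole (t : C) : upper t -> Dform n x t = 0 ->
  pole_of_order 2 (f_form n x) t /\ is_residue (f_form n x) t 0.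
Proof.
intros Ht ED.
destruct (smooth_all_derive upper Copen_upper (Dform n x) (smooth_Dform n x)) as [D1 [HD1 SD1]].
destruct (smooth_all_derive upper Copen_upper D1 SD1) as [D2 [HD2 SD2]].
pose proof (Dform_simple_zero n x x_bounds x_sol t _ Ht (HD1 t Ht) ED) as D1t.
set (nu := nu_form); set (K := (RtoC 12 * RN n + RtoC 11) ^ 2 / RtoC 72).
set (R := fun u => 2 * (D2 u - nu u * D1 u)
   - Dform n x u * (twopii * RtoC (11 / 6) * (twopii * dE2 u) - nu u ^ 2 / 2 + twopii ^ 2 * (K * E4 u))).
assert (HR0 : forall u, upper u -> Dform n x u <> 0 -> R u = 0).
{ intros u Hu HDu.
  assert (Hnu : is_Cderive nu u (twopii * RtoC (11 / 6) * (twopii * dE2 u)))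
    by (apply is_Cderive_scal; now apply is_Cderive_E2).
  assert (HP : is_Cderive Phi_form u (twopii * RtoC (11 / 6) * (twopii * dE2 u)
     - 2 * ((D2 u * Dform n x u - D1 u * D1 u) / Dform n x u ^ 2))).
  { apply (is_Cderive_ext_near (fun v => nu v - 2 * (D1 v / Dform n x v))).
    - apply (near_imp u _ _) with (2 := Dform_off n x u Hu HDu); intros v [Hv HDv].
      rewrite <- (log_derivative v (D1 v) Hv HDv (HD1 v Hv)); unfold nu, Cdiv; ring.
    - apply is_Cderive_minus; [exact Hnu|]; apply is_Cderive_scal, is_Cderive_div; auto. }
  pose proof (is_Cderive_unique _ _ _ _ HP (is_Cderive_Phi u Hu HDu)) as E.
  rewrite <- (log_derivative u (D1 u) Hu HDu (HD1 u Hu)) in E; fold nu in E; fold K in E.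
  unfold R; set (nd := twopii * RtoC (11 / 6) * (twopii * dE2 u)) in *.
  transitivity (- Dform n x u * (nd - 2 * ((D2 u * Dform n x u - D1 u * D1 u) / Dform n x u ^ 2)
    - ((nu u - 2 * D1 u / Dform n x u) ^ 2 / 2 - twopii ^ 2 * (K * E4 u)))).
  - field; exact HDu.
  - rewrite E; ring. }
assert (HRc : smooth upper 0 R).
{ assert (Snu : smooth upper 0 nu) by (apply (smooth_scal upper Copen_upper), smooth_E2).
  apply (smooth_minus upper Copen_upper).
  - apply (smooth_scal upper Copen_upper), (smooth_minus upper Copen_upper); [apply SD2|].
    apply (smooth_mult upper Copen_upper); [exact Snu | apply SD1].
  - apply (smooth_mult upper Copen_upper); [apply smooth_Dform|].
    apply (smooth_plus upper Copen_upper).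
    + apply (smooth_minus upper Copen_upper).
      * do 2 apply (smooth_scal upper Copen_upper); apply smooth_dE2.
      * apply (smooth_ext upper Copen_upper 0 (fun u => / 2 * nu u ^ 2)); [intros; unfold Cdiv; ring|].
        apply (smooth_scal upper Copen_upper), (smooth_pow upper Copen_upper); exact Snu.
    + do 2 apply (smooth_scal upper Copen_upper); apply smooth_E4. }
assert (HRt : R t = 0).
{ apply NNPP; intros HRt.
  destruct (locally_injective (Dform n x) D1 t (near_imp t upper _ HD1 (Copen_upper t Ht))
    (SD1 O t Ht) D1t) as [d [Hd Hinj]].
  destruct (near_and _ _ _ (Copen_upper t Ht) (Ccont_neq R t 0 (HRc t Ht) HRt)) as [r [Hr Hn]].
  set (e := (Rmin d r / 2)%R).
  assert (He : (0 < e < d /\ e < r)%R).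
  { unfold e; pose proof (Rmin_l d r); pose proof (Rmin_r d r).
    assert (0 < Rmin d r)%R by now apply Rmin_glb_lt. lra. }
  assert (Hm : Cmod (t + RtoC e - t) = e).
  { replace (t + RtoC e - t) with (RtoC e) by ring; rewrite Cmod_R, Rabs_pos_eq; lra. }
  destruct (Hn (t + RtoC e)) as [Hu HRu]; [rewrite Hm; lra|].
  apply HRu, HR0; [exact Hu|]; intros E0.
  assert (Et : t + RtoC e = t).
  { apply Hinj; [rewrite Hm; lra | | now rewrite E0, ED].
    replace (t - t) with (RtoC 0) by ring; rewrite Cmod_0; lra. }
  rewrite Et in Hm; replace (t - t) with (RtoC 0) in Hm by ring; rewrite Cmod_0 in Hm; lra. }
assert (Hres : Nform t * D2 t = nu_form t * Nform t * D1 t).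
{ unfold R in HRt; rewrite ED in HRt; fold nu.
  replace (D2 t) with ((2 * (D2 t - nu t * D1 t) - 0 *
    (twopii * RtoC (11 / 6) * (twopii * dE2 t) - nu t ^ 2 / 2 + twopii ^ 2 * (K * E4 t))) / 2
    + nu t * D1 t) by field.
  rewrite HRt; unfold Cdiv; ring. }
destruct (double_pole upper Nform (Dform n x) (fun u => nu_form u * Nform u) D1 D2 t
  Copen_upper Ht smooth_Nform (smooth_Dform n x) is_Cderive_Nform HD1 HD2 SD2
  (Nform_neq_0 t Ht) ED D1t Hres) as [[_ [G [HG [Gt HGn]]]] [m [c [G2 [HG2 [Hn2 Hc]]]]]].
split.
- split; [lia|]; exists G; split; [exact HG|]; split; [exact Gt|].
  eapply near_imp; [|exact (near_and _ _ _ (Copen_upper t Ht) HGn)]; cbv beta.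
  intros u [Hu H] Hne; rewrite f_form_quotient by exact Hu; auto.
- exists m, c, G2; split; [exact HG2|]; split; [|exact Hc].
  eapply near_imp; [|exact (near_and _ _ _ (Copen_upper t Ht) Hn2)]; cbv beta.
  intros u [Hu H] Hne; rewrite f_form_quotient by exact Hu; auto.
Qed.

End Schwarzian.

(** * Modularity *)

Definition chi20 (g : SL2Z) : C := eta (act g Ci) ^ 20 / (autf g Ci ^ 10 * eta Ci ^ 20).

Lemma eta20_act (g : SL2Z) :
  chi20 g <> 0 /\ forall t, upper t -> eta (act g t) ^ 20 = chi20 g * autf g t ^ 10 * eta t ^ 20.
Proof.
destruct (weight_transformation (fun t => eta t ^ 20) (fun c => c <> 0) 5
  (Cexp (twopii / RtoC 24) ^ 20) (- (1))) with (g := g) as [c [Hc H]].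
- apply C1_nz.
- apply Cmult_neq_0.
- apply Cinv_neq_0.
- auto.
- apply Cpow_nz, Cexp_neq_0.
- intros E; apply C1_nz; replace (RtoC 1) with (- - (1)) by ring; rewrite E; ring.
- intros t Ht; rewrite eta_plus_1 by exact Ht; apply Cpow_mult_l.
- intros t Ht; apply (eta20_S t Ht).
- simpl (2 * 5)%nat in H.
  assert (E : chi20 g = c); [|rewrite E; auto].
  unfold chi20; rewrite (H Ci upper_Ci).
  pose proof (autf_neq_0 g Ci upper_Ci) as Ha; pose proof (eta_neq_0 Ci upper_Ci) as He.
  field; split; auto.
Qed.

Lemma is_character_chi20 : is_character chi20.
Proof.
split; [intros g; apply eta20_act|]; intros g h.
destruct (eta20_act g) as [_ Hg]; destruct (eta20_act h) as [_ Hh].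
destruct (eta20_act (SL2Z_mul g h)) as [_ Hgh].
pose proof (eta_neq_0 Ci upper_Ci) as He.
pose proof (autf_neq_0 h Ci upper_Ci) as Ha; pose proof (upper_act h Ci upper_Ci) as Hu.
pose proof (autf_neq_0 g _ Hu) as Hb.
pose proof (Hgh Ci upper_Ci) as E.
rewrite act_mul, autf_mul, (Hg _ Hu), (Hh _ upper_Ci) in E by exact upper_Ci.
assert (HC : (autf g (act h Ci) * autf h Ci) ^ 10 * eta Ci ^ 20 <> 0)
  by (apply Cmult_neq_0; apply Cpow_nz; [now apply Cmult_neq_0 | exact He]).
replace (chi20 (SL2Z_mul g h)) with
  (chi20 (SL2Z_mul g h) * (autf g (act h Ci) * autf h Ci) ^ 10 * eta Ci ^ 20
   / ((autf g (act h Ci) * autf h Ci) ^ 10 * eta Ci ^ 20)) by (field; auto).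
rewrite <- E; field; auto.
Qed.

Lemma Cinv_mult (a b : C) : a <> 0 -> / (a * b) = / a * / b.
Proof.
intros Ha; destruct (classic (b = 0)) as [-> | Hb]; [|field; auto].
rewrite Cmult_0_r, Cinv_0; ring.
Qed.

Section Modular.
Context (n : nat) (x : nat -> R).

Lemma f_form_act (g : SL2Z) (t : C) : upper t ->
  f_form n x (act g t) = chi20 g * autf g t ^ 2 * f_form n x t.
Proof.
intros Ht; unfold f_form; destruct (eta20_act g) as [_ Hg].
rewrite E4_act, J_act, Hg by exact Ht.
pose proof (autf_neq_0 g t Ht) as Ha; set (a := autf g t) in *.
set (P := Cprod (seq 0 n) (fun i => (J t - RtoC (x i)) ^ 2)).
replace ((a ^ 4 * E4 t) ^ 2 * (J t - 1) * P) with (a ^ 8 * (E4 t ^ 2 * (J t - 1) * P)) by ring.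
unfold Cdiv; rewrite Cinv_mult by now apply Cpow_nz.
set (Q := / (E4 t ^ 2 * (J t - 1) * P)).
field; exact Ha.
Qed.

Definition cusp_delta (q : C) : C := q * Cexp (RtoC 24 * PS logeta_coef q).
Definition cusp_factor (i : nat) (q : C) : C :=
  PS e4_coef q ^ 3 - RtoC (x i) * (RtoC 1728 * cusp_delta q).
Definition cusp_den (q : C) : C :=
  PS e4_coef q ^ 2 * (PS e4_coef q ^ 3 - RtoC 1728 * cusp_delta q)
  * Cprod (seq 0 n) (fun i => cusp_factor i q) ^ 2.
Definition cusp_form (q : C) : C :=
  Cexp (RtoC 20 * PS logeta_coef q) * (RtoC 1728 * cusp_delta q) ^ S (n * 2) * / cusp_den q.

Lemma smooth_cusp_delta (k : nat) : smooth disk k cusp_delta.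
Proof.
apply (smooth_mult disk Copen_disk); [apply (smooth_id disk Copen_disk)|].
apply smooth_Cexp_PS, subexp_logeta.
Qed.

Lemma smooth_cusp_den (k : nat) : smooth disk k cusp_den.
Proof.
assert (HE : smooth disk k (PS e4_coef)) by (apply smooth_PS, subexp_e4).
assert (HD : smooth disk k (fun q => RtoC 1728 * cusp_delta q))
  by (apply (smooth_scal disk Copen_disk), smooth_cusp_delta).
apply (smooth_mult disk Copen_disk); [apply (smooth_mult disk Copen_disk)|].
- now apply (smooth_pow disk Copen_disk).
- apply (smooth_minus disk Copen_disk); [now apply (smooth_pow disk Copen_disk) | exact HD].
- apply (smooth_pow disk Copen_disk).
  induction n as [|m IH]; [apply (smooth_const disk Copen_disk k 1)|].
  apply (smooth_ext disk Copen_disk k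
    (fun q => Cprod (seq 0 m) (fun i => cusp_factor i q) * cusp_factor m q)).
  + intros q _; symmetry; apply (Cprod_seq_S (fun i => cusp_factor i q)).
  + apply (smooth_mult disk Copen_disk); [exact IH|].
    apply (smooth_minus disk Copen_disk); [now apply (smooth_pow disk Copen_disk)|].
    now apply (smooth_scal disk Copen_disk).
Qed.

Lemma cusp_den_0 : cusp_den 0 = 1.
Proof.
assert (E : PS e4_coef 0 = 1) by exact (PS_at_0 e4_coef subexp_e4).
assert (Ed : cusp_delta 0 = 0) by (unfold cusp_delta; ring).
assert (EP : Cprod (seq 0 n) (fun i => cusp_factor i 0) = 1).
{ induction n as [|m IH]; [reflexivity|].
  rewrite (Cprod_seq_S (fun i => cusp_factor i 0)), IH; unfold cusp_factor; rewrite E, Ed; ring. }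
unfold cusp_den; rewrite EP, E, Ed; ring.
Qed.

Lemma Cprod_scal (k : C) (F G : nat -> C) (m : nat) : (forall i, F i = k * G i) ->
  Cprod (seq 0 m) F = k ^ m * Cprod (seq 0 m) G.
Proof.
intros H; induction m as [|m IH]; [unfold Cprod; simpl; ring|].
rewrite !Cprod_seq_S, IH, H, Cpow_S; ring.
Qed.

Lemma f_form_cusp (t : C) : upper t -> cusp_den (qpar t) <> 0 ->
  f_form n x t = Cexp (RtoC (2 * PI / INR 6) * Ci * t) ^ 5 * cusp_form (qpar t).
Proof.
intros Ht HD; unfold f_form.
assert (E20 : eta t ^ 20 = Cexp (RtoC (2 * PI / INR 6) * Ci * t) ^ 5
    * Cexp (RtoC 20 * PS logeta_coef (qpar t))).
{ rewrite eta_exp, !Cexp_pow, <- Cexp_plus by exact Ht; f_equal.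
  replace (INR 20) with 20%R by (simpl; ring); replace (INR 5) with 5%R by (simpl; ring).
  replace (INR 6) with 6%R by (simpl; ring).
  unfold eta_log, QS, twopii, Rdiv; rewrite (RtoC_mult (2 * PI) (/ 6)), RtoC_inv by lra; field. }
assert (Ed : Delta t = cusp_delta (qpar t)) by exact (Delta_exp t Ht).
pose proof (Delta_neq_0 t Ht) as Hd; rewrite Ed in Hd.
rewrite E20, Cprod_pow; unfold cusp_form, cusp_den in *; unfold J; rewrite Ed, E4_QS by exact Ht; unfold QS.
set (E := PS e4_coef (qpar t)) in *; set (d := RtoC 1728 * cusp_delta (qpar t)) in *.
assert (Hd' : d <> 0) by (apply Cmult_neq_0; [exact C1728_neq_0 | exact Hd]).
rewrite (Cprod_scal (/ d) _ (fun i => cusp_factor i (qpar t)))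
  by (intros i; unfold cusp_factor; fold E d; field; exact Hd').
set (P := Cprod (seq 0 n) (fun i => cusp_factor i (qpar t))) in *.
rewrite (Cpow_S d (n * 2)), (Cpow_mult_r d n 2), (Cpow_inv d n) by exact Hd'.
pose proof (Cpow_nz d n Hd') as Hdn; set (dn := d ^ n) in *.
pose proof (Cmult_neq_0_l _ _ HD) as H1; pose proof (Cmult_neq_0_r _ _ HD) as HP.
pose proof (Cpow_neq_0_inv P 1 HP) as HP'.
pose proof (Cmult_neq_0_r _ _ H1) as H2; pose proof (Cpow_neq_0_inv _ 1 (Cmult_neq_0_l _ _ H1)) as H3.
field; auto.
Qed.

Lemma f_form_meromorphic_at_cusp : meromorphic_at_cusp (f_form n x).
Proof.
assert (Hd0 : cusp_den 0 <> 0) by (rewrite cusp_den_0; apply C1_nz).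
destruct (near_and 0 _ _ (Copen_disk 0 disk_0)
  (Ccont_neq cusp_den 0 0 (smooth_cusp_den 0 0 disk_0) Hd0)) as [r [Hr Hn]].
set (U := fun q => disk q /\ cusp_den q <> 0).
assert (HU : Copen U).
{ intros q [Hq Hdq]; apply near_and; [now apply Copen_disk|].
  apply Ccont_neq; [exact (smooth_cusp_den 0 q Hq) | exact Hdq]. }
assert (HUd : forall q, U q -> disk q) by (intros q H; apply H).
assert (HS : smooth U 1 cusp_form).
{ apply (smooth_mult U HU); [apply (smooth_mult U HU)|].
  - apply (smooth_sub disk U 1 _ HUd), smooth_Cexp_PS, subexp_logeta.
  - apply (smooth_pow U HU), (smooth_scal U HU), (smooth_sub disk U 1 _ HUd), smooth_cusp_delta.
  - apply (smooth_inv U HU); [intros q H; apply H|].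
    apply (smooth_sub disk U 1 _ HUd), smooth_cusp_den. }
destruct HS as [dF [HdF _]].
assert (Hsm : forall u, (Cmod u < Rmin 1 r)%R -> U (u ^ 6)).
{ intros u Hu; apply Hn; replace (u ^ 6 - 0) with (u ^ 6) by ring; rewrite Cmod_pow.
  pose proof (Rmin_l 1 r); pose proof (Rmin_r 1 r); pose proof (Cmod_ge_0 u).
  assert (H5 : (Cmod u ^ 5 <= 1)%R) by (rewrite <- (pow1 5); apply pow_incr; lra).
  replace (Cmod u ^ 6)%R with (Cmod u * Cmod u ^ 5)%R by (simpl; ring).
  assert (H6 : (0 <= Cmod u ^ 5)%R) by now apply pow_le.
  nra. }
exists 6%nat, 0%nat, (fun u => u ^ 5 * cusp_form (u ^ 6)), (Rmin 1 r).
split; [lia|]; split; [apply Rmin_glb_lt; lra|]; split.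
- intros u Hu; eexists.
  apply is_Cderive_mult; [apply (is_Cderive_pow (fun v => v)), is_Cderive_id|].
  apply (is_Cderive_comp cusp_form (fun v => v ^ 6)); [apply HdF; now apply Hsm|].
  apply (is_Cderive_pow (fun v => v)), is_Cderive_id.
- intros t Ht; cbv zeta; intros Hu.
  set (u := Cexp (RtoC (2 * PI / INR 6) * Ci * t)) in *.
  assert (Eq : u ^ 6 = qpar t).
  { unfold u, qpar; rewrite Cexp_pow; f_equal; replace (INR 6) with 6%R by (simpl; ring).
    unfold Rdiv; rewrite (RtoC_mult (2 * PI) (/ 6)), RtoC_inv by lra; field. }
  rewrite Eq, (f_form_cusp t Ht); [fold u; simpl; field|].
  rewrite <- Eq; now apply Hsm.
Qed.

End Modular.

Theorem theorem3p3 (n : nat) (x : nat -> R) (w : nat -> C)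
  (x_bounds : forall i : nat, (i < n)%nat -> (0 < x i < 1)%R)
  (x_sol : E_8_9_12 n x)
  (w_upper : forall i : nat, (i < n)%nat -> upper (w i))
  (w_J : forall i : nat, (i < n)%nat -> J (w i) = RtoC (x i)) :
  (exists chi : SL2Z -> C,
     is_character chi /\ meromorphic_modular_form 2 chi (f_form n x)) /\
  (forall t : C, upper t -> ~ pole_locus n w t ->
     holomorphic_at (f_form n x) t /\ f_form n x t <> RtoC 0) /\
  (forall t : C, upper t -> pole_locus n w t ->
     pole_of_order 2 (f_form n x) t /\ is_residue (f_form n x) t (RtoC 0)) /\
  (forall h : C -> C, is_primitive_on_H (f_form n x) h ->
     forall t : C, upper t -> ~ pole_locus n w t ->
       is_schwarzian h t
         (RtoC (2 * PI ^ 2 * ((12 * INR n + 11) ^ 2 / 6 ^ 2)) * E4 t)%C).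
Proof.
pose proof (fun t => Dform_zero_pole_locus n x w t w_upper w_J) as Hlocus.
split; [|split; [|split]].
- exists chi20; split; [exact is_character_chi20|]; split; [|split].
  + intros t Ht; destruct (classic (Dform n x t = 0)) as [E | HD].
    * destruct (f_form_double_pole n x x_bounds x_sol t Ht E) as [[_ [g [Hg [_ Hn]]]] _].
      exists 2%nat, g; auto.
    * exists 0%nat, (f_form n x); split; [now apply f_form_holomorphic|].
      exists 1%R; split; [lra|]; intros u _ _; simpl; field.
  + intros g t Ht _; now apply f_form_act.
  + apply f_form_meromorphic_at_cusp.
- intros t Ht Hp; rewrite <- (Hlocus t Ht) in Hp.
  exact (conj (f_form_holomorphic n x t Ht Hp) (f_form_neq_0 n x t Ht Hp)).
- intros t Ht Hp; apply f_form_double_pole; auto; now apply Hlocus.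
- intros h Hh t Ht Hp; rewrite <- (Hlocus t Ht) in Hp; exact (schwarzian_primitive n x x_bounds x_sol h t Hh Ht Hp).
Qed.
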